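(* Let $(X,\mathcal E,\Psi,\mathfrak F,\mathfrak P)$ be a generalized gradient system (as in the context) satisfying conditions (E0)–(E5) and ($\Psi$1)–($\Psi$4). Then for every $P_0\in\mathrm D$ there exists an EDI solution $P\in\mathrm{AC}([0,T];X)$ with $P(0)=P_0$.
   Context: Setting: $X$ is a separable reflexive Banach space with dual $X^*$, pairing $\langle\cdot,\cdot\rangle$, $T>0$. $\mathcal E:[0,T]\times X\to(-\infty,\infty]$ with $\{P:\mathcal E(t,P)<\infty\}=\mathrm D$ for all $t$ (fixed $\mathrm D\subset X$); $\mathcal G(P):=\inf_{t\in[0,T]}\mathcal E(t,P)$. For $P\in\mathrm D$, $\Psi_P:X\to[0,\infty)$ with Fenchel conjugate $\Psi_P^*(\Xi)=\sup_V(\langle\Xi,V\rangle-\Psi_P(V))$ and convex subdifferential $\partial\Psi_P$. $\mathfrak F:[0,T]\times\mathrm D\rightrightarrows X^*$ multivalued; $\mathfrak P:\mathrm{graph}(\mathfrak F)\to\mathbb R$. Conditions: (E0) $P\mapsto\mathcal E(t,P)$ is lower semicontinuous for every $t$; there is $C_0>0$ with $\mathcal E(t,P)\ge\mathcal G(P)\ge C_0$ for all $(t,P)\in[0,T]\times\mathrm D$; $\mathrm{graph}(\mathfrak F)$ is a Borel set in $[0,T]\times X\times X^*$. (E1) for every $t$, $P\mapsto\mathcal E(t,P)$ has compact sublevels in $X$. (E2) if $P_*\in X$, $\tau>0$, $t\in[0,T]$ and $\bar P$ minimizes $P\mapsto\mathcal E(t,P)+\tau\Psi_{P_*}((P-P_*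 )/\tau)$, then there is $\Xi\in\mathfrak F(t,\bar P)$ with $-\Xi\in\partial\Psi_{P_*}((\bar P-P_* )/\tau)$. (E3) there is $K_1>0$ with $|\mathcal E(t,P)-\mathcal E(s,P)|\le K_1\mathcal G(P)|t-s|$ for all $P\in\mathrm D$, $s,t\in[0,T]$. (E4) $\mathfrak P$ is Borel and there is $K_2>0$ such that for all $(t,P,\Xi)\in\mathrm{graph}(\mathfrak F)$: $\liminf_{h\downarrow0}\frac1h(\mathcal E(t+h,P)-\mathcal E(t,P))\le\mathfrak P(t,P,\Xi)\le\lim_{h\downarrow0}\frac1h(\mathcal E(t,P)-\mathcal E(t-h,P))\le K_2\mathcal G(P)$. (E5) for all $t\in[0,T]$ and sequences $P_n\to P$ in $X$, $\Xi_n\rightharpoonup\Xi$ weakly in $X^*$ with $\Xi_n\in\mathfrak F(t,P_n)$, $\mathcal E(t,P_n)\to\mathscr E$ and $\mathfrak P(t,P_n,\Xi_n)\to\mathscr P$ in $\mathbb R$, one has $\Xi\in\mathfrak F(t,P)$, $\mathscr P\le\mathfrak P(t,P,\Xi)$, $\mathscr E=\mathcal E(t,P)$. ($\Psi$1) for every $P\in\mathrm D$, $\Psi_P$ is lower semicontinuous, convex, with $\Psi_P(0)=0$. ($\Psi$2) for every $S>0$: $\lim_{\|V\|\to\infty}\frac1{\|V\|}\inf_{\mathcal G(P)\le S}\Psi_P(V)=\infty$ and $\lim_{\|\Xi\|_*\to\infty}\frac1{\|\Xi\|_*}\inf_{\mathcal G(P)\le S}\Psi^*_P(\Xi)=\infty$.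 ($\Psi$3) for every $S>0$: if $P_n\to P$ in $X$, $\mathcal G(P_n)\le S$, $V_n\rightharpoonup V$ in $X$, $\Xi_n\rightharpoonup\Xi$ in $X^*$, then $\liminf_n\Psi_{P_n}(V_n)\ge\Psi_P(V)$ and $\liminf_n\Psi^*_{P_n}(\Xi_n)\ge\Psi^*_P(\Xi)$. ($\Psi$4) for all $P\in\mathrm D$, $V\in X$ and $\Xi_1,\Xi_2\in\partial\Psi_P(V)$: $\Psi_P^*(\Xi_1)=\Psi_P^*(\Xi_2)$. EDI solution: $P\in\mathrm{AC}([0,T];X)$ such that there exist $\mathscr E\in\mathrm{BV}([0,T])$ with $\mathscr E(t)\ge\mathcal E(t,P(t))$ for all $t$ and $\mathscr E(s)=\mathcal E(s,P(s))$ for a.a. $s\in(0,T)$ and $s=0$, and $\Xi\in L^1(0,T;X^* )$ with $\Xi(t)\in\mathfrak F(t,P(t))$ for a.a. $t$, such that for all $0\le s\le t\le T$: $\mathscr E(t)+\int_s^t(\Psi_{P(r)}(\dot P(r))+\Psi^*_{P(r)}(-\Xi(r)))dr\le\mathscr E(s)+\int_s^t\mathfrak P(r,P(r),\Xi(r))dr$. *)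

(* Defs.v *)
From mathcomp Require Import all_boot all_order all_algebra.
From mathcomp Require Import all_classical all_reals all_analysis.
Set Implicit Arguments.
Unset Strict Implicit.
Unset Printing Implicit Defensive.
Import Order.TTheory GRing.Theory Num.Theory.
Import numFieldNormedType.Exports.
Local Open Scope classical_set_scope.
Local Open Scope ring_scope.

Section GGS.
Context {R : realType} {X : normedModType R}.

Definition is_dual (Xi : X -> R) : Prop :=
  (forall (a : R) (u v : X), Xi (a *: u + v) = a * Xi u + Xi v) /\ continuous Xi.

Definition dnorm (Xi : X -> R) : R :=
  sup [set x : R | exists2 V : X, `|V| <= 1 & x = `|Xi V|].

Definition is_bidual (phi : (X -> R) -> R) : Prop :=
  (forall (a : R) (Xi1 Xi2 : X -> R), is_dual Xi1 -> is_dual Xi2 ->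
     phi (fun V => a * Xi1 V + Xi2 V) = a * phi Xi1 + phi Xi2) /\
  (exists C : R, forall Xi, is_dual Xi -> `|phi Xi| <= C * dnorm Xi).

Definition reflexive_space : Prop :=
  forall phi, is_bidual phi ->
    exists V : X, forall Xi, is_dual Xi -> phi Xi = Xi V.

Definition separable_space : Prop :=
  exists u : nat -> X, closure (range u) = setT.

Definition weak_cvg (Vn : nat -> X) (V : X) : Prop :=
  forall Xi, is_dual Xi -> Xi (Vn n) @[n --> \oo] --> Xi V.

Definition weak_cvg_dual (Xin : nat -> X -> R) (Xi : X -> R) : Prop :=
  (forall n, is_dual (Xin n)) /\ is_dual Xi /\
  forall phi, is_bidual phi -> phi (Xin n) @[n --> \oo] --> phi Xi.

Definition convex_fun (f : X -> R) : Prop :=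
  forall (l : R) (V W : X), 0 <= l <= 1 ->
    f (l *: V + (1 - l) *: W) <= l * f V + (1 - l) * f W.

Definition fconj (f : X -> R) (Xi : X -> R) : \bar R :=
  ereal_sup [set ((Xi V - f V)%:E) | V in [set: X]].

Definition subdiff (f : X -> R) (V : X) (Xi : X -> R) : Prop :=
  is_dual Xi /\ forall W : X, f V + Xi (W - V) <= f W.

Definition ambient (T : R) : set (R * X * (X -> R)) :=
  [set z | `[0, T]%classic z.1.1 /\ is_dual z.2].

Definition pdist (z z' : R * X * (X -> R)) : R :=
  Num.max `|z.1.1 - z'.1.1|
    (Num.max `|z.1.2 - z'.1.2| (dnorm (fun V => z.2 V - z'.2 V))).

Definition rel_open (T : R) (U : set (R * X * (X -> R))) : Prop :=
  U `<=` ambient T /\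
  forall z, U z -> exists2 e : R, 0 < e &
    forall z', ambient T z' -> pdist z z' < e -> U z'.

Definition borel_set (T : R) (A : set (R * X * (X -> R))) : Prop :=
  <<s ambient T, rel_open T >> A.

Definition graphF (T : R) (D : set X) (F : R -> X -> set (X -> R))
  : set (R * X * (X -> R)) :=
  [set z | `[0, T]%classic z.1.1 /\ D z.1.2 /\ F z.1.1 z.1.2 z.2].

Definition Ginf (T : R) (E : R -> X -> \bar R) (P : X) : \bar R :=
  ereal_inf [set E t P | t in `[0, T]%classic].

Definition abs_cont (T : R) (P : R -> X) : Prop :=
  forall eps : R, 0 < eps -> exists2 delta : R, 0 < delta &
    forall (n : nat) (a b : 'I_n -> R),
      (forall i, 0 <= a i /\ a i <= b i /\ b i <= T) ->
      (forall i j, i != j -> b i <= a j \/ b j <= a i) ->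
      \sum_(i < n) (b i - a i) < delta ->
      \sum_(i < n) `|P (b i) - P (a i)| < eps.

Definition simple_dual_fun (T : R) (s : R -> X -> R) : Prop :=
  (forall r, is_dual (s r)) /\
  finite_set (s @` `[0, T]%classic) /\
  forall y, measurable (`[0, T]%classic `&` (s @^-1` [set y])).

Definition bochner_L1_dual (T : R) (Xi : R -> X -> R) : Prop :=
  (forall r, `[0, T]%classic r -> is_dual (Xi r)) /\
  (exists s : nat -> R -> X -> R, (forall n, simple_dual_fun T (s n)) /\
     {ae (@completed_lebesgue_measure R), forall r, `[0, T]%classic r ->
        dnorm (fun V => s n r V - Xi r V) @[n --> \oo] --> 0}) /\
  (@completed_lebesgue_measure R).-integrable `[0, T]%classic
     (fun r => (dnorm (Xi r))%:E).

End GGS.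

(* Main.v *)
(* Minimizing movements with step [tau = T/(n+1)], interpolated a la De Giorgi.
   Let [v] be the value of the incremental problem at an intermediate time and [w]
   the dissipation accumulated up to the last node. Up to a linear term, [v + w] is
   nonincreasing, and its derivative is a.e. at most [Pw - Psi*(-Xi)] for a force
   [Xi] given by (E2): the directional derivative of [Psi] produces a subgradient,
   and (Psi4) exchanges it for the one of (E2).

   Young measures are avoided. The monotone functions converge a.e., so that
   [cE = lim v]. The dissipation part follows pointwise: the limit [W] of [w]
   satisfies [xi (P t - P s) - c (t - s) <= W t - W s] as long as
   [Psi*_{P r}(xi) <= c] on [s, t], hence [Psi_P(P') <= W'] a.e. For the force part,
   Fatou's lemma bounds the derivatives of [v + w]; at almost every fixed time, weak
   compactness and (E5) along a subsequence that realizes the limit yield an admissible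
   force and the identity [cE = E(t, P t)]. These forces are then selected measurably:
   the set of admissible pairs (time, force) is analytic for the weak-* topology, and
   analytic sets have measurable projections by Choquet's capacitability theorem.

   The derivative of [P] exists a.e. because [P] is controlled by the monotone
   function [W]: Lebesgue's theorem on monotone functions gives weak derivatives, and
   Lebesgue points of [|P' - x|], for [x] in a dense set, give the strong one. *)
Require Import Defs.
From mathcomp Require Import all_boot all_order all_algebra.
From mathcomp Require Import all_classical all_reals all_analysis.
From mathcomp Require Import measurable_realfun.
From mathcomp Require Import lra ring zify.
From mathcomp Require finmap.
Set Implicit Arguments.
Unset Strict Implicit.
Unset Printing Implicit Defensive.
Import Order.TTheory GRing.Theory Num.Theory.
Import numFieldNormedType.Exports.
Local Open Scope classical_set_scope.
Local Open Scope ring_scope.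

(** * Hahn-Banach and the dual space *)

(** Two obstacles shape the proof. Limits are needed at every time at once, while (E5) and (Psi3)
    speak of sequences. An ultrafilter on the indices gives all limits simultaneously; when a
    sequence is required, countably many of them are realized along a true subsequence. That
    subsequence may depend on the time, so the discrete forces never have to be measurable: only the
    scalar bound [b] is. Next, (E0) and (E4) speak of Borel sets for the norm of the dual, whereas
    compactness is weak-*. A separable reflexive space has a separable dual, so a norm-open set is a
    countable union of balls; each ball is weak-* closed and its complement is a countable union of
    weak-* closed sets. Hence Borel sets are analytic together with their complements. The linear
    term comes from (E3): below an energy level the energy is Lipschitz in time. Superlinearity of
    [Psi] is used as [M * |V| <= Psi P V + C] with [M] arbitrary: a large [M] absorbs the jumps of
    [W], so that [P] is absolutely continuous although [W] need not be continuous. *)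

Section HahnBanach.
Context {R : realType} {V : lmodType R} (S : set V).
Hypothesis S_lin : forall (a : R) u v, S u -> S v -> S (a *: u + v).
Hypothesis S0 : S 0.

(** Homogeneity is asked only as an inequality, which infima preserve; equality follows by scaling
    back with [a^-1]. The subspace [S] is a predicate so that the same theorem serves on all of [X]
    and on the continuous functionals among the functions [X -> R]. *)
Definition sublinear_on (p : V -> R) :=
  (forall x y, S x -> S y -> p (x + y) <= p x + p y) /\
  (forall a x, 0 < a -> S x -> p (a *: x) <= a * p x).

Let SD u v : S u -> S v -> S (u + v).
Proof. by move=> Su Sv; have := @S_lin 1 _ _ Su Sv; rewrite scale1r. Qed.
Let SZ a u : S u -> S (a *: u).
Proof. by move=> Su; have := @S_lin a _ _ Su S0; rewrite addr0. Qed.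
Let SN u : S u -> S (- u).
Proof. by move=> Su; rewrite -scaleN1r; exact: SZ. Qed.

Lemma sublinear_onZ p a x : sublinear_on p -> 0 < a -> S x ->
  p (a *: x) = a * p x.
Proof.
move=> [_ pZ] a0 Sx; apply/eqP; rewrite eq_le pZ//=.
have := pZ a^-1 (a *: x); rewrite invr_gt0 => /(_ a0 (SZ a Sx)).
by rewrite scalerA mulVf ?gt_eqF// scale1r ler_pdivlMl.
Qed.

Lemma sublinear_on0 p : sublinear_on p -> p 0 = 0.
Proof.
move=> sp; have := @sublinear_onZ p 2 0 sp (ltr0n _ 2) S0.
rewrite scaler0 => h; lra.
Qed.

Lemma sublinear_onN p x : sublinear_on p -> S x -> - p (- x) <= p x.
Proof.
move=> sp Sx; have := sp.1 _ _ Sx (SN Sx).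
by rewrite subrr sublinear_on0// => h; lra.
Qed.

(** The classical modification of [p] that fixes the value at [y]: it stays below [p] and is at most
    [- p y] at [- y] (take [t = 1]), so a linear functional below it equals [p y] at [y]. *)
Definition tilt (p : V -> R) (y x : V) : R :=
  inf [set p (x + t *: y) - t * p y | t in [set t | 0 <= t]].

Lemma tilt_lb p x y : sublinear_on p -> S x -> S y ->
  lbound [set p (x + t *: y) - t * p y | t in [set t | 0 <= t]] (- p (- x)).
Proof.
move=> sp Sx Sy _ [t /= t0 <-].
have -> : t * p y = p (t *: y).
  move: t0; rewrite le_eqVlt => /predU1P[<-|t0]; last by rewrite sublinear_onZ.
  by rewrite scale0r mul0r sublinear_on0.
have := sp.1 _ _ (SD Sx (SZ t Sy)) (SN Sx).
by rewrite [_ + _ - _]addrC addKr => h; lra.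
Qed.

Lemma tilt_ub p x y t : sublinear_on p -> S x -> S y -> 0 <= t ->
  tilt p y x <= p (x + t *: y) - t * p y.
Proof.
by move=> sp Sx Sy t0; apply: ge_inf; [exists (- p (- x)); exact: tilt_lb|exists t].
Qed.

Lemma tilt_glb p x y c : (forall t, 0 <= t -> c <= p (x + t *: y) - t * p y) ->
  c <= tilt p y x.
Proof.
move=> h; apply: lb_le_inf; first by exists (p (x + 0 *: y) - 0 * p y); exists 0; rewrite /= ?lexx.
by move=> _ [t t0 <-]; exact: h.
Qed.

Lemma tilt_sublinear p y : sublinear_on p -> S y -> sublinear_on (tilt p y).
Proof.
move=> sp Sy; split.
- move=> x1 x2 Sx1 Sx2; rewrite -lerBlDr; apply: tilt_glb => t1 t10.
  rewrite lerBlDr -lerBlDl; apply: tilt_glb => t2 t20.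
  rewrite lerBlDl; apply: (le_trans (@tilt_ub p _ y (t1 + t2) sp _ Sy _)).
  + exact: SD.
  + exact: addr_ge0.
  + have -> : x1 + x2 + (t1 + t2) *: y = (x1 + t1 *: y) + (x2 + t2 *: y).
      by rewrite scalerDl addrACA.
    have := sp.1 _ _ (SD Sx1 (SZ t1 Sy)) (SD Sx2 (SZ t2 Sy)).
    by move=> h; rewrite mulrDl; lra.
- move=> a x a0 Sx; rewrite -ler_pdivrMl//; apply: tilt_glb => t t0.
  rewrite ler_pdivrMl//.
  apply: (le_trans (@tilt_ub p _ y (a * t) sp (SZ a Sx) Sy _)).
    by rewrite mulr_ge0// ltW.
  rewrite -scalerA -scalerDr sublinear_onZ//; last by apply: SD => //; exact: SZ.
  by rewrite mulrBr mulrA.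
Qed.

Lemma tilt_le p y x : sublinear_on p -> S y -> S x -> tilt p y x <= p x.
Proof.
move=> sp Sy Sx; have := @tilt_ub p x y 0 sp Sx Sy (lexx _).
by rewrite scale0r mul0r addr0 subr0.
Qed.

(* A minimal sublinear functional is linear: tilting it cannot decrease it. *)
Lemma minimal_sublinear_linear q : sublinear_on q ->
  (forall q', sublinear_on q' -> (forall x, S x -> q' x <= q x) ->
     forall x, S x -> q x <= q' x) ->
  forall a u v, S u -> S v -> q (a *: u + v) = a * q u + q v.
Proof.
move=> sq qmin.
have qN y : S y -> q (- y) = - q y.
  move=> Sy; apply/eqP; rewrite eq_le; apply/andP; split.
    have := qmin _ (tilt_sublinear sq Sy) (fun x => tilt_le sq Sy) _ (SN Sy).
    move=> /le_trans -> //.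
    have := @tilt_ub q (- y) y 1 sq (SN Sy) Sy ler01.
    by rewrite scale1r addNr sublinear_on0// mul1r sub0r.
  by have := sublinear_onN sq Sy; rewrite lerNl.
have qD x y : S x -> S y -> q (x + y) = q x + q y.
  move=> Sx Sy; apply/eqP; rewrite eq_le sq.1//=.
  have := sq.1 _ _ (SD Sx Sy) (SN Sy).
  by rewrite addrK qN// => h; lra.
have qZ a x : S x -> q (a *: x) = a * q x.
  move=> Sx; have [a0|a0|<-] := ltgtP 0 a.
  - exact: sublinear_onZ.
  - rewrite -[a in LHS]opprK scaleNr qN; last exact: SZ.
    by rewrite sublinear_onZ ?oppr_gt0// mulNr opprK.
  - by rewrite scale0r mul0r sublinear_on0.
by move=> a u v Su Sv; rewrite qD ?qZ//; exact: SZ.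
Qed.

(** Zorn's lemma on the sublinear functionals below [p], where larger means pointwise smaller. A
    nonempty chain is bounded by its pointwise infimum, which is finite because all members are at
    least [- p (- x)]; its subadditivity uses that two members are comparable. *)
Lemma exists_minimal_sublinear p : sublinear_on p ->
  exists q, [/\ sublinear_on q, (forall x, S x -> q x <= p x) &
   (forall q', sublinear_on q' -> (forall x, S x -> q' x <= q x) ->
     forall x, S x -> q x <= q' x)].
Proof.
move=> sp.
pose Q := {q : V -> R | sublinear_on q /\ forall x, S x -> q x <= p x}.
pose t0 : Q := exist _ p (conj sp (fun x _ => lexx (p x))).
pose Rel (a b : Q) := `[< forall x, S x -> sval b x <= sval a x >].
have Rel_refl t : Rel t t by apply/asboolP.
have Rel_trans r s t : Rel r s -> Rel s t -> Rel r t.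
  move=> /asboolP rs /asboolP st; apply/asboolP => x Sx.
  exact: le_trans (st _ Sx) (rs _ Sx).
have chain (A : set Q) : total_on A Rel -> exists t, forall s, A s -> Rel s t.
  move=> Atot; have [[a0 Aa0]|A0] := pselect (A !=set0); last first.
    by exists t0 => s As; exfalso; apply: A0; exists s.
  pose q x := inf [set sval a x | a in A].
  have lbq x : S x -> has_lbound [set sval a x | a in A].
    move=> Sx; exists (- p (- x)) => _ [a Aa <-].
    have := sublinear_onN (svalP a).1 Sx; have := (svalP a).2 _ (SN Sx).
    by move=> h1 h2; lra.
  have qle a x : A a -> S x -> q x <= sval a x.
    by move=> Aa Sx; apply: ge_inf; [exact: lbq|exists a].
  have qge c x : (forall a, A a -> c <= sval a x) -> c <= q x.
    move=> h; apply: lb_le_inf; first by exists (sval a0 x); exists a0.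
    by move=> _ [a Aa <-]; exact: h.
  have sq : sublinear_on q.
    split.
    - move=> x y Sx Sy; rewrite -lerBlDr; apply: (qge) => a Aa.
      rewrite lerBlDr -lerBlDl; apply: (qge) => b Ab; rewrite lerBlDl.
      have [/asboolP h|/asboolP h] := Atot _ _ Aa Ab.
      + apply: (le_trans (qle _ _ Ab (SD Sx Sy))).
        apply: (le_trans ((svalP b).1.1 _ _ Sx Sy)).
        by rewrite lerD2r; exact: h.
      + apply: (le_trans (qle _ _ Aa (SD Sx Sy))).
        apply: (le_trans ((svalP a).1.1 _ _ Sx Sy)).
        by rewrite lerD2l; exact: h.
    - move=> c x c0 Sx; rewrite -ler_pdivrMl//; apply: (qge) => a Aa.
      rewrite ler_pdivrMl//; apply: (le_trans (qle _ _ Aa (SZ c Sx))).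
      exact: (svalP a).1.2.
  have qp x : S x -> q x <= p x.
    by move=> Sx; apply: (le_trans (qle _ _ Aa0 Sx)); exact: (svalP a0).2.
  exists (exist _ q (conj sq qp)) => s As; apply/asboolP => x Sx /=.
  exact: qle.
have [q qmax] := ZL_preorder t0 Rel_refl Rel_trans chain.
exists (sval q); split; [exact: (svalP q).1|exact: (svalP q).2|].
move=> q' sq' q'q x Sx.
have q'p y : S y -> q' y <= p y.
  by move=> Sy; apply: (le_trans (q'q _ Sy)); exact: (svalP q).2.
have /asboolP := qmax (exist _ q' (conj sq' q'p)) (asboolT q'q).
by apply.
Qed.

(** Minimality gives linearity; starting from [tilt p v0] instead of [p] fixes the value at [v0]. *)
Lemma HahnBanach p v0 : sublinear_on p -> S v0 ->
  exists L : V -> R,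
    [/\ forall a u v, S u -> S v -> L (a *: u + v) = a * L u + L v,
        forall x, S x -> L x <= p x & L v0 = p v0].
Proof.
move=> sp Sv0; have st := tilt_sublinear sp Sv0.
have [q [sq qt qmin]] := exists_minimal_sublinear st.
have qlin := minimal_sublinear_linear sq qmin.
have qp x : S x -> q x <= p x.
  by move=> Sx; apply: (le_trans (qt _ Sx)); exact: tilt_le.
exists q; split => //.
apply/eqP; rewrite eq_le qp//=.
have := qt _ (SN Sv0); have := @tilt_ub p (- v0) v0 1 sp (SN Sv0) Sv0 ler01.
rewrite scale1r addNr sublinear_on0// mul1r sub0r => h1 h2.
have := qlin (-1) v0 0 Sv0 S0; rewrite addr0 scaleN1r sublinear_on0// => h3.
lra.
Qed.

End HahnBanach.

Section Dual.
Context {R : realType} {X : normedModType R}.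
Implicit Types (xi : X -> R) (u v : X).

Lemma dualD xi u v : is_dual xi -> xi (u + v) = xi u + xi v.
Proof. by move=> [h _]; have := h 1 u v; rewrite scale1r mul1r. Qed.

Lemma dual0 xi : is_dual xi -> xi 0 = 0.
Proof. by move=> h; have := dualD 0 0 h; rewrite addr0 => h2; lra. Qed.

Lemma dualZ xi a u : is_dual xi -> xi (a *: u) = a * xi u.
Proof. by move=> h; have := h.1 a u 0; rewrite !addr0 (dual0 h) addr0. Qed.

Lemma dualN xi u : is_dual xi -> xi (- u) = - xi u.
Proof. by move=> h; rewrite -scaleN1r dualZ// mulN1r. Qed.

Lemma dualB xi u v : is_dual xi -> xi (u - v) = xi u - xi v.
Proof. by move=> h; rewrite dualD// dualN. Qed.

(** A one-sided bound near the origin suffices: applied to [- u] it bounds the absolute value, and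
    linearity turns this into continuity everywhere. *)
Lemma linear_bounded_dual xi (r C : R) : 0 < r ->
  (forall (a : R) u v, xi (a *: u + v) = a * xi u + xi v) ->
  (forall u, `|u| < r -> xi u <= C) -> is_dual xi.
Proof.
move=> r0 lin bnd; split => // x.
have xi0 : xi 0 = 0 by have := lin 1 0 0; rewrite scale1r addr0 mul1r => h; lra.
have C0 : 0 <= C by rewrite -xi0; apply: bnd; rewrite normr0.
have Z a u : xi (a *: u) = a * xi u by have := lin a u 0; rewrite !addr0 xi0 addr0.
have D u v : xi (u - v) = xi u - xi v.
  by have := lin (-1) v u; rewrite scaleN1r addrC mulN1r addrC => ->; rewrite addrC.
have small e u : 0 < e -> `|u| < r * e -> `|xi u| <= C * e.
  move=> e0 ur.
  have key w : `|w| < r * e -> xi w <= C * e.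
    move=> wr; have := bnd (e^-1 *: w); rewrite normrZ gtr0_norm ?invr_gt0//.
    by rewrite ltr_pdivrMl// mulrC => /(_ wr); rewrite Z ler_pdivrMl// mulrC.
  rewrite ler_norml key// andbT lerNl -mulN1r -Z scaleN1r; apply: key.
  by rewrite normrN.
apply/cvgrPdist_le => /= e e0.
have Ce : 0 < e / (C + 1) by rewrite divr_gt0// ltr_wpDl.
near=> y; rewrite -D; apply: (le_trans (small _ _ Ce _)).
  near: y; have re : 0 < r * (e / (C + 1)) by exact: mulr_gt0.
  exact: (@cvgr_dist_lt _ _ _ _ _ id x cvg_id).
rewrite mulrCA ger_pMr// ler_pdivrMr ?ltr_wpDl//; lra.
Unshelve. all: by end_near. Qed.

Lemma dual_bounded xi : is_dual xi ->
  exists2 C : R, 0 <= C & forall u, `|xi u| <= C * `|u|.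
Proof.
move=> dxi.
have [d d0 dP] : exists2 d : R, 0 < d & forall w, `|w| < d -> `|xi w| < 1.
  have : xi x @[x --> (0 : X)] --> xi 0 by exact: dxi.2.
  rewrite (dual0 dxi) => /cvgrPdist_lt/(_ 1 ltr01).
  move=> /nbhs_ballP[/= d d0 dP]; exists d => // w wd.
  have := dP w; rewrite -ball_normE /= !sub0r !normrN; exact.
exists (2 / d) => [|u]; first by rewrite divr_ge0// ltW.
have [->|u0] := eqVneq u 0; first by rewrite (dual0 dxi) !normr0 mulr0.
have nu0 : 0 < `|u| by rewrite normr_gt0.
have c0 : 0 < d / (2 * `|u|) by rewrite divr_gt0 ?mulr_gt0.
have := dP ((d / (2 * `|u|)) *: u); rewrite normrZ (gtr0_norm c0) dualZ// [`|_ * xi _|]normrM (gtr0_norm c0).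
have -> : d / (2 * `|u|) * `|u| = d / 2 by field; rewrite gt_eqF.
have dd : d / 2 < d by lra.
move=> /(_ dd) h.
have {}h : `|xi u| < (d / (2 * `|u|))^-1.
  by rewrite -[ltRHS]mulr1 ltr_pdivlMl.
apply/ltW/(lt_le_trans h); rewrite le_eqVlt; apply/orP; left; apply/eqP.
by field; rewrite !gt_eqF.
Qed.

Lemma dual_norm_has_sup xi : is_dual xi ->
  has_sup [set x : R | exists2 V : X, `|V| <= 1 & x = `|xi V|].
Proof.
move=> dxi; have [C C0 CP] := dual_bounded dxi; split.
  by exists `|xi 0|; exists 0 => //; rewrite normr0.
exists C => _ [V V1 ->]; apply: (le_trans (CP V)).
by rewrite ler_piMr.
Qed.

Lemma dual_norm_ge0 xi : is_dual xi -> 0 <= dnorm xi.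
Proof.
move=> dxi; apply: (@le_trans _ _ `|xi 0|) => //.
apply: sup_upper_bound; first exact: dual_norm_has_sup.
by exists 0 => //; rewrite normr0.
Qed.

Lemma dual_le xi u : is_dual xi -> `|xi u| <= dnorm xi * `|u|.
Proof.
move=> dxi; have [->|u0] := eqVneq u 0; first by rewrite (dual0 dxi) !normr0 mulr0.
have nu0 : 0 < `|u| by rewrite normr_gt0.
rewrite -ler_pdivrMr//; apply: sup_upper_bound; first exact: dual_norm_has_sup.
exists (`|u|^-1 *: u); first by rewrite normrZ ger0_norm ?invr_ge0// mulVf ?gt_eqF.
by rewrite dualZ// normrM (@ger0_norm _ `|u|^-1) ?invr_ge0// mulrC.
Qed.

Lemma dual_norm_le xi (C : R) : 0 <= C -> (forall u, `|xi u| <= C * `|u|) ->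
  dnorm xi <= C.
Proof.
move=> C0 h; apply: sup_le_ub.
  by exists `|xi 0|; exists 0 => //; rewrite normr0.
by move=> _ [V V1 ->]; apply: (le_trans (h V)); rewrite ler_piMr.
Qed.

Lemma is_dual_comb (a : R) xi1 xi2 : is_dual xi1 -> is_dual xi2 ->
  is_dual (fun u => a * xi1 u + xi2 u).
Proof.
move=> [l1 c1] [l2 c2]; split => [b u v|].
  by rewrite l1 l2; ring.
move=> x; apply: (@cvgD _ R^o); last exact: c2.
by apply: cvgM; [exact: cvg_cst|exact: c1].
Qed.

Lemma is_dual_ext xi1 xi2 : is_dual xi1 -> xi1 =1 xi2 -> is_dual xi2.
Proof. by move=> h /funext <-. Qed.

Lemma is_dual0 : is_dual (fun _ : X => 0 : R).
Proof. by split => [a u v|x]; [rewrite mulr0 addr0|exact: cvg_cst]. Qed.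

Lemma is_dualZ (a : R) xi : is_dual xi -> is_dual (fun u => a * xi u).
Proof.
by move=> h; apply: (is_dual_ext (is_dual_comb a h is_dual0)) => u; rewrite addr0.
Qed.

Lemma is_dualN xi : is_dual xi -> is_dual (fun u => - xi u).
Proof.
by move=> h; apply: (is_dual_ext (is_dualZ (-1) h)) => u; rewrite mulN1r.
Qed.

Lemma is_dualD xi1 xi2 : is_dual xi1 -> is_dual xi2 ->
  is_dual (fun u => xi1 u + xi2 u).
Proof.
by move=> h1 h2; apply: (is_dual_ext (is_dual_comb 1 h1 h2)) => u; rewrite mul1r.
Qed.

Lemma is_dualB xi1 xi2 : is_dual xi1 -> is_dual xi2 ->
  is_dual (fun u => xi1 u - xi2 u).
Proof. by move=> h1 h2; exact: is_dualD h1 (is_dualN h2). Qed.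

Lemma dual_normD xi1 xi2 : is_dual xi1 -> is_dual xi2 ->
  dnorm (fun u => xi1 u + xi2 u) <= dnorm xi1 + dnorm xi2.
Proof.
move=> h1 h2; apply: dual_norm_le => [|u]; first by rewrite addr_ge0 ?dual_norm_ge0.
by rewrite mulrDl (le_trans (ler_normD _ _))// lerD// dual_le.
Qed.

Lemma dual_normZ_le (a : R) xi : is_dual xi ->
  dnorm (fun u => a * xi u) <= `|a| * dnorm xi.
Proof.
move=> h; apply: dual_norm_le => [|u]; first by rewrite mulr_ge0 ?dual_norm_ge0.
by rewrite normrM -mulrA ler_wpM2l// dual_le.
Qed.

Lemma dual_normN xi : is_dual xi -> dnorm (fun u => - xi u) = dnorm xi.
Proof.
move=> h; apply/eqP; rewrite eq_le; apply/andP; split; apply: dual_norm_le.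
- exact: dual_norm_ge0.
- by move=> u; rewrite normrN dual_le.
- exact/dual_norm_ge0/is_dualN.
- by move=> u; have := dual_le u (is_dualN h); rewrite normrN.
Qed.

Lemma dual_normBC xi1 xi2 : is_dual xi1 -> is_dual xi2 ->
  dnorm (fun u => xi1 u - xi2 u) = dnorm (fun u => xi2 u - xi1 u).
Proof.
move=> h1 h2; rewrite -dual_normN; last exact: is_dualB.
by congr dnorm; apply/funext => u; rewrite opprB.
Qed.

Lemma dual_norm_triangle xi2 xi1 xi3 : is_dual xi1 -> is_dual xi2 -> is_dual xi3 ->
  dnorm (fun u => xi1 u - xi3 u) <=
    dnorm (fun u => xi1 u - xi2 u) + dnorm (fun u => xi2 u - xi3 u).
Proof.
move=> h1 h2 h3; have -> : (fun u => xi1 u - xi3 u) =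
    (fun u => (xi1 u - xi2 u) + (xi2 u - xi3 u)).
  by apply/funext => u; rewrite addrA subrK.
exact: (dual_normD (is_dualB h1 h2) (is_dualB h2 h3)).
Qed.

Lemma dual_normBB xi : dnorm (fun u => xi u - xi u) = 0.
Proof.
apply/eqP; rewrite eq_le; apply/andP; split.
  by apply: dual_norm_le => // u; rewrite subrr normr0 mul0r.
have -> : (fun u => xi u - xi u) = (fun=> 0).
  by apply/funext => u; rewrite subrr.
exact: dual_norm_ge0 is_dual0.
Qed.

(** Hahn-Banach with the norm itself as sublinear majorant. *)
Lemma norming_functional u :
  exists xi, [/\ is_dual xi, dnorm xi <= 1 & xi u = `|u|].
Proof.
have sp : sublinear_on [set: X] (fun u : X => `|u| : R).
  split => [x y _ _|a x a0 _]; first exact: ler_normD.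
  by rewrite normrZ gtr0_norm.
have [//|//|//|L [Llin Lle Lu]] := @HahnBanach R X setT _ _ _ u sp _.
have dL : is_dual L.
  apply: (@linear_bounded_dual _ 1 1 ltr01) => [a x y|x x1]; first exact: Llin.
  by apply: (le_trans (Lle _ _)) => //; exact: ltW.
exists L; split => //; apply: dual_norm_le => // x; rewrite mul1r ler_norml Lle// andbT.
by rewrite lerNl -(dualN _ dL) -normrN; exact: Lle.
Qed.

(** * Separability of the dual of a separable reflexive space *)

Section Separability.
Variable z : nat -> X -> R.
Hypothesis dz : forall n, is_dual (z n).

(** Coding a combination by its list of coefficients makes the rational ones countable; the offset
    [n] keeps the recursion structural. *)
Fixpoint dual_comb (n : nat) (s : seq R) : X -> R :=
  if s is a :: s' then fun u => a * z n u + dual_comb n.+1 s' u else fun=> 0.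

Lemma is_dual_dual_comb n s : is_dual (dual_comb n s).
Proof.
elim: s n => [|a s IH] n /=; first exact: is_dual0.
exact: is_dual_comb (dz n) (IH n.+1).
Qed.

Lemma dual_combD n s1 s2 : exists s,
  forall u, dual_comb n s u = dual_comb n s1 u + dual_comb n s2 u.
Proof.
elim: s1 s2 n => [|a s1 IH] [|b s2] n /=.
- by exists [::] => u /=; rewrite addr0.
- by exists (b :: s2) => u /=; rewrite add0r.
- by exists (a :: s1) => u /=; rewrite addr0.
- by have [s sE] := IH s2 n.+1; exists (a + b :: s) => u /=; rewrite sE; ring.
Qed.

Lemma dual_combZ n (c : R) s u :
  dual_comb n [seq c * a | a <- s] u = c * dual_comb n s u.
Proof. by elim: s n => [|a s IH] n /=; rewrite ?mulr0// IH; ring. Qed.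

Lemma dual_comb_rat n s (e : R) : 0 < e -> exists q : seq rat,
  dnorm (fun u => dual_comb n s u - dual_comb n [seq ratr a | a <- q] u) < e.
Proof.
elim: s n e => [|a s IH] n e e0; first by exists [::]; rewrite /= dual_normBB.
have e2 : 0 < e / 2 by rewrite divr_gt0.
have [q qe] := IH n.+1 _ e2.
have zn0 : 0 < dnorm (z n) + 1 by rewrite ltr_wpDl// dual_norm_ge0.
have d0 : 0 < e / 2 / (dnorm (z n) + 1) by rewrite divr_gt0.
have [r rar] : exists r : rat, `|a - ratr r| < e / 2 / (dnorm (z n) + 1).
  have : a - e / 2 / (dnorm (z n) + 1) < a by rewrite gtrBl.
  move=> /rat_in_itvoo[r]; rewrite in_itv /= => /andP[r1 r2]; exists r.
  by rewrite gtr0_norm ?subr_gt0// ltrBlDr -ltrBlDl.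
exists (r :: q) => /=.
set f := (fun u => _).
have -> : f = (fun u => (a - ratr r) * z n u +
    (dual_comb n.+1 s u - dual_comb n.+1 [seq ratr a | a <- q] u)).
  by apply/funext => u; rewrite /f; ring.
apply: (le_lt_trans (dual_normD (is_dualZ _ (dz n))
  (is_dualB (is_dual_dual_comb _ _) (is_dual_dual_comb _ _)))).
have h := dual_normZ_le (a - ratr r) (dz n).
have h2 : `|a - ratr r| * dnorm (z n) <= e / 2.
  have : `|a - ratr r| * (dnorm (z n) + 1) <= e / 2.
    by rewrite -ler_pdivlMr// ltW.
  apply: le_trans; rewrite ler_wpM2l//; lra.
lra.
Qed.

Lemma mem_dual_comb n : exists s, forall u, dual_comb 0 s u = z n u.
Proof.
exists (rcons (nseq n 0) 1) => u.
rewrite -[in RHS](add0n n); elim: n 0%N => [|n IH] k /=.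
  by rewrite addn0 mul1r addr0.
by rewrite mul0r add0r IH addSnnS.
Qed.

(** If [xi] were at distance at least [e] from the span, Hahn-Banach applied to the distance [p]
    would give [L] with [L xi = p xi >= e] and [L <= p], hence bounded and zero on the span. By
    reflexivity [L] is the evaluation at some [v] annihilated by all [z n], so [v = 0] and
    [L xi = 0]. *)
Lemma dual_comb_dense : reflexive_space (X := X) ->
  (forall u, (forall n, z n u = 0) -> u = 0) ->
  forall xi (e : R), is_dual xi -> 0 < e ->
    exists s, dnorm (fun u => xi u - dual_comb 0 s u) < e.
Proof.
move=> Xrefl zsep xi e dxi e0; apply: contrapT => /forallNP far.
pose S : set (X -> R^o) := [set x | is_dual x].
pose p (x : X -> R^o) : R := inf [set dnorm (fun u => x u - dual_comb 0 s u) | s in setT].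
have plb x s : is_dual x -> p x <= dnorm (fun u => x u - dual_comb 0 s u).
  move=> dx; apply: ge_inf; last by exists s.
  by exists 0 => _ [s' _ <-]; exact/dual_norm_ge0/is_dualB/is_dual_dual_comb.
have pglb x c : (forall s, c <= dnorm (fun u => x u - dual_comb 0 s u)) -> c <= p x.
  move=> h; apply: lb_le_inf => [|_ [s _ <-]//].
  by exists (dnorm (fun u => x u - dual_comb 0 [::] u)); exists [::].
have S_lin (a : R) (x y : X -> R^o) : S x -> S y -> S (a *: x + y).
  by move=> dx dy; exact: is_dual_comb.
have S0 : S 0 by exact: is_dual0.
have sp : sublinear_on S p.
  split.
  - move=> x y dx dy; rewrite -lerBlDr; apply: (pglb) => s1.
    rewrite lerBlDr -lerBlDl; apply: (pglb) => s2; rewrite lerBlDl.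
    have [s sE] := dual_combD 0 s1 s2.
    apply: (le_trans (plb _ s (is_dualD dx dy))).
    have -> : (fun u : X => (x + y) u - dual_comb 0 s u) = (fun u =>
        (x u - dual_comb 0 s1 u) + (y u - dual_comb 0 s2 u)).
      apply/funext => u; rewrite sE (_ : (x + y) u = x u + y u)//; ring.
    by apply: dual_normD; apply: is_dualB => //; exact: is_dual_dual_comb.
  - move=> a x a0 dx; rewrite -ler_pdivrMl//; apply: (pglb) => s.
    rewrite ler_pdivrMl//.
    apply: (le_trans (plb (a *: x) [seq a * b | b <- s] (is_dualZ a dx))).
    have -> : (fun u : X => (a *: x) u - dual_comb 0 [seq a * b | b <- s] u) =
        (fun u => a * (x u - dual_comb 0 s u)).
      apply/funext => u; rewrite dual_combZ (_ : (a *: x) u = a * x u)//; ring.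
    apply: (le_trans (dual_normZ_le _ _)); last by rewrite gtr0_norm.
    by apply: is_dualB => //; exact: is_dual_dual_comb.
have pxi : e <= p xi by apply: pglb => s; rewrite leNgt; apply/negP; exact: far.
have [L [Llin Lle Lxi]] := HahnBanach S_lin S0 sp dxi.
have LN x : is_dual x -> L (- x) = - L x.
  move=> dx; have := Llin (-1) x 0 dx S0; rewrite addr0 scaleN1r => ->.
  have := Llin 1 0 0 S0 S0; rewrite scale1r addr0 mul1r => h.
  have -> : L 0 = 0 by lra.
  by rewrite addr0 mulN1r.
have pdn x : is_dual x -> p x <= dnorm x.
  move=> dx; apply: (le_trans (plb x [::] dx)).
  by rewrite (_ : (fun u => _) = x)//; apply/funext => u /=; rewrite subr0.
have bL : is_bidual L.
  split; first by move=> a x y dx dy; exact: Llin.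
  exists 1 => x dx; rewrite mul1r ler_norml; apply/andP; split.
    rewrite lerNl -LN//; apply: (le_trans (Lle _ (is_dualN dx))).
    by apply: (le_trans (pdn _ (is_dualN dx))); rewrite (dual_normN dx).
  by apply: (le_trans (Lle _ dx)); exact: pdn.
have [v vL] := Xrefl L bL.
have v0 : v = 0.
  apply: zsep => n; rewrite -vL//; have [s sE] := mem_dual_comb n.
  have Lz (c : R) : L (c *: (z n : X -> R^o)) <= 0.
    apply: (le_trans (Lle _ (is_dualZ c (dz n)))).
    apply: (le_trans (plb _ [seq c * a | a <- s] (is_dualZ c (dz n)))).
    rewrite (_ : (fun u => _) = (fun u => z n u - z n u)) ?dual_normBB//.
    by apply/funext => u; rewrite dual_combZ sE !subrr.
  apply/eqP; rewrite eq_le; apply/andP; split.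
    by have := Lz 1; rewrite scale1r.
  by have := Lz (-1); rewrite scaleN1r LN// oppr_le0.
have : L xi = 0 by rewrite vL// v0 dual0.
by rewrite Lxi => h; rewrite h leNgt e0 in pxi.
Qed.

End Separability.

Lemma separable_dense_seq : separable_space (X := X) ->
  exists w : nat -> X, forall u (e : R), 0 < e -> exists n, `|u - w n| < e.
Proof.
move=> [w wd]; exists w => u e e0.
have : closure (range w) u by rewrite wd.
move=> /(_ (ball u e) (nbhsx_ballx _ _ e0)) [_ [[n _ <-]]].
by rewrite -ball_normE; exists n.
Qed.

Lemma norming_sequence : separable_space (X := X) ->
  exists z : nat -> X -> R,
    [/\ forall n, is_dual (z n), forall n, dnorm (z n) <= 1 &
        forall u (e : R), 0 < e -> exists n, `|u| - e <= z n u].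
Proof.
move=> /separable_dense_seq [w wd].
have [z zP] := choice (fun n => norming_functional (w n)).
exists z; split => [n|n|u e e0]; [by have [] := zP n|by have [] := zP n|].
have e2 : 0 < e / 2 by rewrite divr_gt0.
have [n un] := wd u _ e2; exists n; have [dz z1 zw] := zP n.
have h1 : `|u| <= `|w n| + `|u - w n|.
  by rewrite -[in leLHS](subrK (w n) u) addrC; exact: ler_normD.
have h2 : `|z n (w n - u)| <= `|w n - u|.
  by apply: (le_trans (dual_le _ dz)); rewrite ler_piMl.
rewrite (distrC (w n)) in h2; move: h2; rewrite ler_norml dualB// zw => /andP[_ h2].
lra.
Qed.

Lemma dual_separable : separable_space (X := X) -> reflexive_space (X := X) ->
  exists y : nat -> X -> R, (forall n, is_dual (y n)) /\
    forall xi (e : R), is_dual xi -> 0 < e ->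
      exists n, dnorm (fun u => xi u - y n u) < e.
Proof.
move=> Xsep Xrefl; have [z [dz z1 znorm]] := norming_sequence Xsep.
have zsep u : (forall n, z n u = 0) -> u = 0.
  move=> zu; apply/eqP; rewrite -normr_eq0 eq_le normr_ge0 andbT leNgt.
  apply/negP => u0; have u2 : 0 < `|u| / 2 by rewrite divr_gt0.
  by have [n] := znorm u _ u2; rewrite zu => h; lra.
pose y n := dual_comb z 0 [seq ratr a | a <- odflt [::] (unpickle n : option (seq rat))].
exists y; split => [n|xi e dxi e0]; first exact: is_dual_dual_comb.
have e2 : 0 < e / 2 by rewrite divr_gt0.
have [s sE] := dual_comb_dense dz Xrefl zsep dxi e2.
have [q qE] := dual_comb_rat dz 0 s e2.
exists (pickle q); rewrite /y pickleK /=.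
apply: (le_lt_trans (@dual_norm_triangle (dual_comb z 0 s) _ _ dxi _ _)).
- exact: is_dual_dual_comb.
- exact: is_dual_dual_comb.
lra.
Qed.

End Dual.

(** * Subsequences extracted along an ultrafilter *)

Section LimitBounds.
Context {R : realType} {T : Type} (F : set_system T).

Lemma cvg_lim_le {FF : ProperFilter F} (u : T -> R) (l C : R) : u n @[n --> F] --> l ->
  (\forall n \near F, u n <= C) -> l <= C.
Proof.
move=> ul uC; rewrite leNgt; apply/negP => Cl.
have /filter_ex : F ([set n | u n <= C] `&` [set n | C < u n]).
  by apply: filterI => //; apply: (cvgr_gt _ ul).
by move=> [n [/= h1 h2]]; rewrite leNgt h2 in h1.
Qed.

Lemma cvg_lim_ge {FF : ProperFilter F} (u : T -> R) (l C : R) : u n @[n --> F] --> l ->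
  (\forall n \near F, C <= u n) -> C <= l.
Proof.
move=> ul uC; rewrite leNgt; apply/negP => Cl.
have /filter_ex : F ([set n | C <= u n] `&` [set n | u n < C]).
  by apply: filterI => //; apply: (cvgr_lt _ ul).
by move=> [n [/= h1 h2]]; rewrite leNgt h2 in h1.
Qed.

Lemma rcvgD {FF : ProperFilter F} (u v : T -> R) (a b : R) : u n @[n --> F] --> a -> v n @[n --> F] --> b ->
  (u n + v n) @[n --> F] --> a + b.
Proof. by move=> ua vb; apply: (@cvgD _ R^o). Qed.

Lemma rcvgN {FF : ProperFilter F} (u : T -> R) (a : R) : u n @[n --> F] --> a -> (- u n) @[n --> F] --> - a.
Proof. by move=> ua; apply: (@cvgN _ R^o). Qed.

Lemma rcvgB {FF : ProperFilter F} (u v : T -> R) (a b : R) : u n @[n --> F] --> a -> v n @[n --> F] --> b ->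
  (u n - v n) @[n --> F] --> a - b.
Proof. by move=> ua vb; exact: rcvgD ua (rcvgN vb). Qed.

Lemma rcvgZ {FF : ProperFilter F} (c : R) (u : T -> R) (a : R) : u n @[n --> F] --> a -> (c * u n) @[n --> F] --> c * a.
Proof. by move=> ua; apply: cvgM => //; exact: cvg_cst. Qed.

End LimitBounds.

Section Along.
Context (U : set_system nat) {UU : UltraFilter U}.
Hypothesis Uoo : forall k, U [set n | (k <= n)%N].

(** A property of subsequences that holds as soon as the subsequence eventually enters each of
    countably many sets of [U]. Such properties are stable under countable conjunction and are met
    by an actual strictly increasing subsequence. *)
Definition along (Q : (nat -> nat) -> Prop) : Prop :=
  exists A : nat -> set nat, (forall i, U (A i)) /\
    forall s : nat -> nat, (forall i, \forall n \near \oo, A i (s n)) -> Q s.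

Lemma along_near A : U A -> along (fun s => \forall n \near \oo, A (s n)).
Proof. by move=> UA; exists (fun=> A); split => // s /(_ 0%N). Qed.

Lemma along_sub (Q Q' : (nat -> nat) -> Prop) :
  (forall s, Q s -> Q' s) -> along Q -> along Q'.
Proof. by move=> QQ' [A [UA AQ]]; exists A; split => // s /AQ/QQ'. Qed.

Lemma along_forall (Q : nat -> (nat -> nat) -> Prop) :
  (forall i, along (Q i)) -> along (fun s => forall i, Q i s).
Proof.
move=> /choice[A AP].
exists (fun i => if unpickle i is Some (j, k) then A j k else setT).
split => [i|s h j].
  by case: unpickle => [[j k]|]; [exact: (AP j).1|exact: filterT].
apply: (AP j).2 => k; have := h (pickle (j, k)); rewrite pickleK; exact.
Qed.

Lemma along_and Q Q' : along Q -> along Q' -> along (fun s => Q s /\ Q' s).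
Proof.
move=> h1 h2; have := @along_forall (fun i => if i is 0%N then Q else Q') _.
move=> /(_ _)/(along_sub _); apply => [s h|[|i]//].
by split; [exact: (h 0%N)|exact: (h 1%N)].
Qed.

(** Diagonal extraction: the term of rank [n] is taken beyond its predecessor and in
    [A 0, ..., A n], a finite intersection that belongs to [U]. *)
Lemma along_subsequence Q : along Q ->
  exists s : nat -> nat, (forall n, (s n < s n.+1)%N) /\ Q s.
Proof.
move=> [A [UA AQ]].
have nonempty m n : exists k, (m < k)%N /\ forall i, (i <= n)%N -> A i k.
  have : U ([set k | (m.+1 <= k)%N] `&` \bigcap_(i in [set i | (i <= n)%N]) A i).
    apply: filterI => //; elim: n => [|n IH].
      apply: filterS (UA 0%N) => k Ak i /=; by rewrite leqn0 => /eqP ->.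
    apply: filterS (filterI (UA n.+1) IH) => k [Ak IHk] i /=.
    by rewrite leq_eqVlt => /predU1P[->//|]; exact: IHk.
  by move=> /filter_ex [k [mk Ak]]; exists k.
have [f fP] := choice (fun mn : nat * nat => nonempty mn.1 mn.2).
pose s := fix s n := if n is m.+1 then f (s m, m.+1) else f (0%N, 0%N).
exists s; split => [n|]; first by have [] := fP (s n, n.+1).
apply: AQ => i; exists i => //= n /= iin.
by case: n iin => [|n] iin /=; [have [_] := fP (0%N, 0%N)|have [_] := fP (s n, n.+1)]; exact.
Qed.

(** A cluster point of an ultrafilter is a limit: a neighbourhood whose preimage is not in [U] has a
    complement whose preimage is, which contradicts clustering. *)
Lemma ultra_compact {Z : topologicalType} (K : set Z) (u : nat -> Z) :
  compact K -> (forall n, K (u n)) -> exists2 l, K l & u n @[n --> U] --> l.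
Proof.
move=> cK Ku; have UK : (u @ U) K.
  by rewrite /fmap/=; apply: filterS (@filterT _ U _) => n _; exact: Ku.
have [l [Kl cl]] := cK (u @ U) _ UK.
exists l => // B lB; have [//|UnB] := in_ultra_setVsetC (u @^-1` B) UU.
by have [z []] := cl (~` B) B UnB lB.
Qed.

End Along.

Lemma exists_ultra_oo :
  exists2 U : set_system nat, UltraFilter U & forall k, U [set n | (k <= n)%N].
Proof.
have [U [UU oU]] := ultraFilterLemma (T := nat) (F := \oo) _.
by exists U => // k; apply: oU; exists k.
Qed.

Section AlongMetric.
Context {R : realType} (U : set_system nat) {UU : UltraFilter U}.

Lemma along_cvg {Z : pseudoMetricType R} (u : nat -> Z) (l : Z) :
  u n @[n --> U] --> l -> along U (fun s => u (s n) @[n --> \oo] --> l).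
Proof.
move=> ul; exists (fun k => [set n | ball l k.+1%:R^-1 (u n)]); split.
  by move=> k; apply: ul; apply: nbhsx_ballx; rewrite invr_gt0.
move=> s h; apply/cvg_ballP => e e0.
have [k ke] : exists k : nat, k.+1%:R^-1 < e.
  by have [k _ kP] := near_infty_natSinv_lt (PosNum e0); exists k; exact: (kP k (leqnn k)).
apply: filterS (h k) => n /=; exact/le_ball/ltW.
Qed.

Lemma ultra_bounded (u : nat -> R) (C : R) : (forall n, `|u n| <= C) ->
  exists2 l, `|l| <= C & u n @[n --> U] --> l.
Proof.
move=> uC; have [|l + ul] := ultra_compact (@segment_compact R (- C) C) (u := u).
  by move=> n /=; rewrite in_itv /= -ler_norml.
by rewrite /= in_itv /= -ler_norml => lC; exists l.
Qed.

End AlongMetric.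

(** * Weak and weak-* compactness *)

Section Weak.
Context {R : realType} {X : normedModType R} (U : set_system nat) {UU : UltraFilter U}.

(** Banach-Alaoglu along an ultrafilter: each scalar sequence [x n u] lies in a compact interval,
    and its limit is linear in [u] and inherits the bound. *)
Lemma weak_star_ultra (x : nat -> X -> R) (C : R) :
  (forall n, is_dual (x n)) -> (forall n, dnorm (x n) <= C) ->
  exists xi, [/\ is_dual xi, dnorm xi <= C & forall u, x n u @[n --> U] --> xi u].
Proof.
move=> dx xC; have C0 : 0 <= C by exact: le_trans (dual_norm_ge0 (dx 0%N)) (xC 0%N).
have xnC u n : `|x n u| <= C * `|u|.
  by apply: (le_trans (dual_le u (dx n))); rewrite ler_wpM2r.
have h u : exists l : R, `|l| <= C * `|u| /\ x n u @[n --> U] --> l.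
  by have [l] := ultra_bounded (xnC u); exists l.
have [xi xiP] := choice h.
exists xi; split => [||u]; last by have [] := xiP u.
- apply: (@linear_bounded_dual _ _ _ 1 C ltr01) => [a u v|u u1].
    apply: (@cvg_unique _ (@Rhausdorff R) (x n (a *: u + v) @[n --> U])).
      by have [] := xiP (a *: u + v).
    have -> : (fun n => x n (a *: u + v)) = (fun n => a * x n u + x n v).
      by apply/funext => n; rewrite (dx n).1.
    apply: (@cvgD _ R^o); last by have [] := xiP v.
    by apply: cvgM; [exact: cvg_cst|have [] := xiP u].
  apply: (le_trans (ler_norm _)); have [+ _] := xiP u.
  by move/le_trans; apply; rewrite ler_piMr// ltW.
- by apply: dual_norm_le => // u; have [] := xiP u.
Qed.

(** Only the limits at a dense sequence have to be realized; the uniform bound on the norms carries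
    the convergence to every [u]. *)
Lemma weak_star_along (x : nat -> X -> R) xi (C : R) :
  separable_space (X := X) ->
  (forall n, is_dual (x n)) -> (forall n, dnorm (x n) <= C) -> is_dual xi ->
  (forall u, x n u @[n --> U] --> xi u) ->
  along U (fun s => forall u, x (s n) u @[n --> \oo] --> xi u).
Proof.
move=> /separable_dense_seq [w wd] dx xC dxi xxi.
have C0 : 0 <= C by exact: le_trans (dual_norm_ge0 (dx 0%N)) (xC 0%N).
apply: along_sub (along_forall (fun i => along_cvg (xxi (w i)))) => s h u.
apply/cvgrPdist_lt => e e0.
have D0 : 0 < C + dnorm xi + 1 by rewrite ltr_wpDl// addr_ge0// dual_norm_ge0.
have [i ui] := wd u (e / 2 / (C + dnorm xi + 1)) (divr_gt0 (divr_gt0 e0 (ltr0n _ 2)) D0).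
have e2 : 0 < e / 2 by rewrite divr_gt0.
have := h i => /cvgrPdist_lt/(_ _ e2); apply: filterS => n hn.
have -> : xi u - x (s n) u =
    xi (u - w i) + (xi (w i) - x (s n) (w i)) - x (s n) (u - w i).
  by rewrite (dualB _ _ dxi) (dualB _ _ (dx _)); ring.
have h1 := dual_le (u - w i) dxi.
have h2 := dual_le (u - w i) (dx (s n)).
have h3 : dnorm (x (s n)) * `|u - w i| <= C * `|u - w i| by rewrite ler_wpM2r.
have h4 : (C + dnorm xi + 1) * `|u - w i| < e / 2 by rewrite mulrC -ltr_pdivlMr.
apply: (le_lt_trans (ler_normB _ _)).
have := ler_normD (xi (u - w i)) (xi (w i) - x (s n) (w i)).
have := normr_ge0 (u - w i).
move: h4; rewrite !mulrDl mul1r; lra.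
Qed.

(** The limits of [xi (v n)] define a bounded functional of [xi], which reflexivity represents by a
    vector. *)
Lemma weak_ultra (v : nat -> X) (C : R) : reflexive_space (X := X) ->
  (forall n, `|v n| <= C) ->
  exists V, forall xi, is_dual xi -> xi (v n) @[n --> U] --> xi V.
Proof.
move=> Xrefl vC.
(* The choice below runs over all functions [X -> R]; the value matters only on continuous
   functionals, the only ones that [is_bidual] constrains. *)
have h xi : exists l : R, is_dual xi -> `|l| <= C * dnorm xi /\ xi (v n) @[n --> U] --> l.
  have [dxi|ndxi] := pselect (is_dual xi); last by exists 0.
  have [|l l1 l2] := @ultra_bounded _ U _ (fun n => xi (v n)) (C * dnorm xi).
    move=> n; apply: (le_trans (dual_le _ dxi)); rewrite mulrC.
    by rewrite ler_wpM2r// dual_norm_ge0.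
  by exists l.
have [phi phiP] := choice h.
have [|V VP] := Xrefl phi.
  split; last by exists C => xi dxi; have [] := phiP _ dxi.
  move=> a x1 x2 d1 d2.
  apply: (@cvg_unique _ (@Rhausdorff R) ((fun u => a * x1 u + x2 u) (v n) @[n --> U])).
    by have [] := phiP _ (is_dual_comb a d1 d2).
  apply: (@cvgD _ R^o); last by have [] := phiP _ d2.
  by apply: cvgM; [exact: cvg_cst|have [] := phiP _ d1].
by exists V => xi dxi; rewrite -VP//; have [] := phiP _ dxi.
Qed.

Lemma weak_along (v : nat -> X) V (C : R) :
  separable_space (X := X) -> reflexive_space (X := X) ->
  (forall n, `|v n| <= C) ->
  (forall xi, is_dual xi -> xi (v n) @[n --> U] --> xi V) ->
  along U (fun s => weak_cvg (fun n => v (s n)) V).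
Proof.
move=> Xsep Xrefl vC vV.
have [y [dy yd]] := dual_separable Xsep Xrefl.
have C0 : 0 <= C by exact: le_trans (vC 0%N).
apply: along_sub (along_forall (fun i => along_cvg (vV _ (dy i)))) => s h xi dxi.
apply/cvgrPdist_lt => e e0.
have D0 : 0 < C + `|V| + 1 by rewrite ltr_wpDl// addr_ge0.
have [i ui] := yd xi (e / 2 / (C + `|V| + 1)) dxi (divr_gt0 (divr_gt0 e0 (ltr0n _ 2)) D0).
have e2 : 0 < e / 2 by rewrite divr_gt0.
have := h i => /cvgrPdist_lt/(_ _ e2); apply: filterS => n hn.
have dd := is_dualB dxi (dy i).
have -> : xi V - xi (v (s n)) =
    (xi V - y i V) + (y i V - y i (v (s n))) - (xi (v (s n)) - y i (v (s n))).
  by ring.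
have h1 := dual_le V dd.
have h2 := dual_le (v (s n)) dd.
set d := dnorm _ in h1 h2 ui.
have d0 : 0 <= d by exact: dual_norm_ge0.
have h3 : d * `|v (s n)| <= d * C by rewrite ler_wpM2l.
have h4 : d * (C + `|V| + 1) < e / 2 by rewrite -ltr_pdivlMr.
apply: (le_lt_trans (ler_normB _ _)).
have := ler_normD (xi V - y i V) (y i V - y i (v (s n))).
move: h4; rewrite !mulrDr mulr1; lra.
Qed.

Lemma weak_cvg_dualP (x : nat -> X -> R) xi : reflexive_space (X := X) ->
  (forall n, is_dual (x n)) -> is_dual xi ->
  (forall u, x n u @[n --> \oo] --> xi u) -> weak_cvg_dual x xi.
Proof.
move=> Xrefl dx dxi h; split => //; split => // phi /Xrefl[V VP].
by rewrite VP//; apply: cvg_trans (h V); apply: near_eq_cvg; near=> n; rewrite VP.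
Unshelve. all: by end_near. Qed.

Lemma weak_cvg_dual_cst (xi : X -> R) : is_dual xi -> weak_cvg_dual (fun=> xi) xi.
Proof. by move=> dxi; split => //; split => // phi _; exact: cvg_cst. Qed.

End Weak.

(** * Differentiability of monotone functions *)

Section MonotoneDerivative.
Context {R : realType}.
Notation mu := (@lebesgue_measure R).
Notation mus := ((wlength (@idfun R))^*)%mu.

(** Numbers that code no pair, or a nonpositive radius, are sent to the ball of center 0 and radius
    1, so that every index gives a genuine ball. *)
Definition rat_center (i : nat) : R :=
  if (unpickle i : option (rat * rat)) is Some (c, r) then
    if (0 < (ratr r : R)) then ratr c else 0 else 0.
Definition rat_radius (i : nat) : R :=
  if (unpickle i : option (rat * rat)) is Some (c, r) then
    if (0 < (ratr r : R)) then ratr r else 1 else 1.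
Notation cc := rat_center.
Notation rr := rat_radius.

Lemma rat_radius_gt0 i : 0 < rr i.
Proof. by rewrite /rr; case: unpickle => [[c r]|//]; case: ifP. Qed.

Definition cball i : set R := `[cc i - rr i, cc i + rr i]%classic.

Lemma rat_ballP (q r : rat) : 0 < (ratr r : R) ->
  exists i, cc i = ratr q /\ rr i = ratr r.
Proof. by move=> r0; exists (pickle (q, r)); rewrite /cc /rr pickleK r0. Qed.

Lemma lebesgue_measure_oo (a b : R) : a <= b ->
  mu (`]a, b[%classic : set R) = (b - a)%:E.
Proof.
move=> ab; have := lebesgue_measure_itv `]a, b[; move=> ->.
rewrite /= lte_fin; case: ltP => [_|h]; first by rewrite EFinB.
by rewrite (@le_anti _ _ a b) ?ab// subrr.
Qed.

Lemma lebesgue_measure_cc (a b : R) : a <= b ->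
  mu (`[a, b]%classic : set R) = (b - a)%:E.
Proof.
move=> ab; have := lebesgue_measure_itv `[a, b]; move=> ->.
rewrite /= lte_fin; case: ltP => [_|h]; first by rewrite EFinB.
by rewrite (@le_anti _ _ a b) ?ab// subrr.
Qed.

(** Induction on the family: removing one open interval from [O] lowers its measure by the length of
    that interval and leaves the others inside. *)
Lemma sum_disjoint_itv (s : seq nat) (a b : nat -> R) (O : set R) :
  measurable O -> uniq s -> (forall i, i \in s -> a i <= b i) ->
  (forall i, i \in s -> `]a i, b i[ `<=` O) ->
  (forall i j, i \in s -> j \in s -> i != j -> b i <= a j \/ b j <= a i) ->
  ((\sum_(i <- s) (b i - a i))%:E <= mu O)%E.
Proof.
elim: s O => [|i s IH] O mO /=.
  by move=> *; rewrite big_nil measure_ge0.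
move=> /andP[ins us] ab abO dis; rewrite big_cons.
have mI : measurable (`]a i, b i[%classic : set R) by exact: measurable_itv.
have h : ((\sum_(i <- s) (b i - a i))%:E <= mu (O `\` `]a i, b i[))%E.
  apply: IH => //.
  - exact: measurableD.
  - by move=> j js; apply: ab; rewrite inE js orbT.
  - move=> j js x jx; split; first by apply: (abO j) => //; rewrite inE js orbT.
    move: jx; rewrite /= !in_itv /= => /andP[jx xj] /andP[ix xi].
    have ij : i != j by apply: contraNneq ins => ->.
    have [||h|h] := dis i j _ _ ij; [by rewrite inE eqxx|by rewrite inE js orbT| |].
      by have := lt_le_trans xi h; rewrite ltNge (ltW jx).
    by have := lt_le_trans xj h; rewrite ltNge (ltW ix).
  - by move=> j k js ks; apply: dis; rewrite inE ?js ?ks orbT.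
rewrite (measureDI mu mO mI) EFinD addeC leeD//.
rewrite setIidr; last by apply: abO; rewrite inE eqxx.
have := ab i; rewrite inE eqxx => /(_ isT) /lebesgue_measure_oo abi.
rewrite -abi; exact: lexx.
Qed.

(** Vitali's covering theorem for rational balls. The disjointness it provides concerns the closed
    balls, whence the strict inequalities between end points. *)
Lemma vitali_rat (E : set R) (Pr : R -> R -> Prop) (e : R) : (mus E < +oo)%E ->
  (forall x d, E x -> 0 < d -> exists i, [/\ rr i < d, `|x - cc i| < rr i & Pr (cc i) (rr i)]) ->
  0 < e ->
  exists s : seq nat, [/\ uniq s, (forall i, i \in s -> Pr (cc i) (rr i)),
    (forall i j, i \in s -> j \in s -> i != j ->
       cc i + rr i < cc j - rr j \/ cc j + rr j < cc i - rr i) &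
    (mus (E `\` \big[setU/set0]_(i <- s) cball i) < e%:E)%E].
Proof.
move=> Efin Ecov e0.
pose B i : set R := ball (cc i) (rr i).
have rB i : (radius (B i))%:num = rr i by rewrite radius_ball_num// ltW// rat_radius_gt0.
have B0 i : 0 < (radius (B i))%:num by rewrite rB rat_radius_gt0.
have cB i : closure (B i) = cball i.
  by rewrite /B closure_ballE closed_ball_itv ?rat_radius_gt0.
pose F := [set i | Pr (cc i) (rr i)].
have cov : vitali_cover E B F.
  split; first by move=> i; exact: is_ball_ball.
  move=> x Ex d d0; have [i [id xi Pi]] := Ecov x d Ex d0.
  by exists i; rewrite rB; split => //; rewrite /B -ball_normE /ball_ /= distrC.
have [G [GF tG GE]] := vitali_theorem_corollary B0 Efin cov e0.
exists (finmap.enum_fset G); split.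
- exact: finmap.fset_uniq.
- by move=> i iG; exact: GF.
- move=> i j iG jG ij.
  have [|h1] := ltP (cc i + rr i) (cc j - rr j); first by left.
  have [|h2] := ltP (cc j + rr j) (cc i - rr i); first by right.
  exfalso; move/eqP: ij; apply; apply: tG => //=.
  have ri := rat_radius_gt0 i; have rj := rat_radius_gt0 j.
  exists (Num.max (cc i - rr i) (cc j - rr j)); split; rewrite /= cB /cball /= in_itv /=;
    rewrite le_max ge_max ?lexx ?orbT /=; apply/andP; split => //; lra.
- by under eq_bigr do rewrite -cB.
Qed.

Section Monotone.
Variable f : R -> R.
Hypothesis f_nd : {homo f : x y / x <= y}.
Let incr i := f (cc i + rr i) - f (cc i - rr i).

Let incr_ge0 i : 0 <= incr i.
Proof. rewrite subr_ge0; apply: f_nd; have := rat_radius_gt0 i; lra. Qed.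

(** [steep u x] bounds the upper derivate of [f] at [x] from below, [flat v x] the lower derivate
    from above. The point may lie anywhere inside the small interval, which is the form that Vitali
    covers need. *)
Definition steep (u x : R) := forall d, 0 < d -> exists i,
  [/\ rr i < d, `|x - cc i| < rr i & u * (2 * rr i) < incr i].
Definition flat (v x : R) := forall d, 0 < d -> exists i,
  [/\ rr i < d, `|x - cc i| < rr i & incr i < v * (2 * rr i)].

(** A monotone [f] turns separated intervals into non-overlapping intervals of [[f a, f b]], whose
    lengths are the increments. *)
Let sum_incr (s : seq nat) a b : uniq s -> a <= b ->
  (forall i j, i \in s -> j \in s -> i != j ->
       cc i + rr i < cc j - rr j \/ cc j + rr j < cc i - rr i) ->
  (forall i, i \in s -> a <= cc i - rr i /\ cc i + rr i <= b) ->
  \sum_(i <- s) incr i <= f b - f a.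
Proof.
move=> us ab dis sub; rewrite -lee_fin.
have -> : ((f b - f a)%:E = mu `[f a, f b])%E.
  by rewrite lebesgue_measure_cc// f_nd.
apply: (@sum_disjoint_itv s (fun i => f (cc i - rr i)) (fun i => f (cc i + rr i))) => //.
- by move=> i _; rewrite -subr_ge0; exact: incr_ge0.
- move=> i /sub[h1 h2] x; rewrite /= !in_itv /= => /andP[/ltW h3 /ltW h4].
  by rewrite (le_trans (f_nd h1) h3) (le_trans h4 (f_nd h2)).
- by move=> i j iS jS ij; have [/ltW h|/ltW h] := dis i j iS jS ij; [left|right]; exact: f_nd.
Qed.

Let sum_len (s : seq nat) (O : set R) : uniq s -> measurable O ->
  (forall i j, i \in s -> j \in s -> i != j ->
       cc i + rr i < cc j - rr j \/ cc j + rr j < cc i - rr i) ->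
  (forall i, i \in s -> `]cc i - rr i, cc i + rr i[ `<=` O) ->
  ((\sum_(i <- s) 2 * rr i)%:E <= mu O)%E.
Proof.
move=> us mO dis sub.
rewrite (_ : \sum_(i <- s) 2 * rr i = \sum_(i <- s) ((cc i + rr i) - (cc i - rr i))).
  apply: (@sum_disjoint_itv s (fun i => cc i - rr i) (fun i => cc i + rr i)) => //.
  - by move=> i _; have := rat_radius_gt0 i; lra.
  - by move=> i j iS jS ij; have [/ltW h|/ltW h] := dis i j iS jS ij; [left|right].
by apply: eq_bigr => i _; ring.
Qed.

Let mus_bigU (s : seq nat) :
  (mus (\big[setU/set0]_(i <- s) cball i) <= (\sum_(i <- s) 2 * rr i)%:E)%E.
Proof.
elim: s => [|i s IH]; first by rewrite !big_nil outer_measure0.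
rewrite !big_cons EFinD; apply: (le_trans (outer_measureU2 _ _ _)).
apply: leeD => //.
have ri := rat_radius_gt0 i.
have h : (mu (cball i) <= (2 * rr i)%:E)%E.
  by rewrite /cball lebesgue_measure_cc ?lee_fin; lra.
exact: h.
Qed.

(** A disjoint family of intervals of slope above [u] has total length at most [C / u], where [C] is
    the rise of [f]; [u] is taken large. *)
Lemma negligible_steep (n : nat) :
  mus [set x | -n%:R < x < n%:R /\ forall u : nat, steep u%:R x] = 0%E.
Proof.
set E := [set x | _].
pose C := f (n%:R) - f (- n%:R).
have C0 : 0 <= C by rewrite subr_ge0; apply: f_nd; have := ler0n R n; lra.
have Efin : (mus E < +oo)%E.
  apply: (@le_lt_trans _ _ (mu `[-n%:R, n%:R])).
    apply: le_outer_measure => x [/andP[/ltW h1 /ltW h2] _].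
    by rewrite /= in_itv /= h1 h2.
  by rewrite lebesgue_measure_cc ?ltry//; have := ler0n R n; lra.
apply/eqP; rewrite eq_le outer_measure_ge0 andbT.
apply/lee_addgt0Pr => e e0; rewrite add0e.
have e2 : 0 < e / 2 by rewrite divr_gt0.
pose u := (Num.truncn (C / (e / 2))).+1.
have uC : C / u%:R < e / 2.
  by rewrite ltr_pdivrMr ?ltr0Sn// mulrC -ltr_pdivrMr// truncnS_gt.
pose Pr (c r : R) := [/\ - n%:R <= c - r, c + r <= n%:R & u%:R * (2 * r) < f (c + r) - f (c - r)].
have cov x d : E x -> 0 < d ->
    exists i, [/\ rr i < d, `|x - cc i| < rr i & Pr (cc i) (rr i)].
  move=> [/andP[x1 x2] xs] d0.
  have [|i [h1 h2 h3]] := xs u (Num.min d (Num.min ((x + n%:R) / 2) ((n%:R - x) / 2))).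
    by rewrite !lt_min d0 !divr_gt0//; lra.
  exists i; move: h1 h2; rewrite !lt_min => /and3P[g1 g2 g3] g4; split => //.
  by move: (g4); rewrite ltr_norml => /andP[k1 k2]; split => //; lra.
have [s [us sPr sdis sE]] := vitali_rat Efin cov e2.
apply: (@le_trans _ _ (mus (E `\` \big[setU/set0]_(i <- s) cball i) +
   mus (\big[setU/set0]_(i <- s) cball i))%E).
  apply: le_trans (outer_measureU2 _ _ _); apply: le_outer_measure => x Ex.
  by have [h|h] := pselect ((\big[setU/set0]_(i <- s) cball i) x); [right|left].
have -> : e%:E = ((e / 2)%:E + (e / 2)%:E)%E by rewrite -EFinD; congr EFin; lra.
apply: leeD; first exact: ltW.
apply: (le_trans (mus_bigU s)); rewrite lee_fin.
apply: le_trans (ltW uC); rewrite ler_pdivlMr ?ltr0Sn//.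
apply: (@le_trans _ _ (\sum_(i <- s) incr i)).
  rewrite mulrC mulr_sumr big_seq [leRHS]big_seq; apply: ler_sum => i /sPr[_ _ h].
  exact: ltW.
apply: sum_incr => //; first by have := ler0n R n; lra.
by move=> i /sPr[].
Qed.

(** Two nested Vitali covers. Flat intervals inside an open set of measure at most [m + e] cover [E]
    up to [e]; steep intervals inside these cover the part of [E] found there up to [e] again. The
    rise on the steep family is at most the rise on the flat one, so
    [u * (m - 2 * e) <= v * (m + e)], which forces [m = 0]. *)
Lemma negligible_steep_flat (n : nat) (u v : R) : 0 <= v -> v < u ->
  mus [set x | [/\ -n%:R < x < n%:R, steep u x & flat v x]] = 0%E.
Proof.
move=> v0 vu; set E := [set x | _].
have Efin : (mus E < +oo)%E.
  apply: (@le_lt_trans _ _ (mu `[-n%:R, n%:R])).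
    apply: le_outer_measure => x [/andP[/ltW h1 /ltW h2] _ _].
    by rewrite /= in_itv /= h1 h2.
  by rewrite lebesgue_measure_cc ?ltry//; have := ler0n R n; lra.
have Efn : mus E \is a fin_num by rewrite ge0_fin_numE// outer_measure_ge0.
set m := fine (mus E).
have mE : mus E = m%:E by rewrite fineK.
have m0 : 0 <= m by rewrite fine_ge0// outer_measure_ge0.
rewrite mE; congr EFin; apply/eqP; rewrite eq_le m0 andbT.
(* u (m - 2e) <= v (m + e) for every e > 0 *)
have key (e : R) : 0 < e -> u * (m - 2 * e) <= v * (m + e).
  move=> e0.
  have [W [oW EW We]] := outer_measure_open_le E e0.
  have mW : measurable W by exact: measurable_realfun.open_measurable.
  have Wle : (mu W <= (m + e)%:E)%E by rewrite EFinD -mE.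
  pose Pr1 (c r : R) := `]c - r, c + r[ `<=` W /\ f (c + r) - f (c - r) < v * (2 * r).
  have cov1 x d : E x -> 0 < d ->
      exists i, [/\ rr i < d, `|x - cc i| < rr i & Pr1 (cc i) (rr i)].
    move=> Ex d0.
    have /nbhs_ballP[r /= r0 rW] : nbhs x W by apply: open_nbhs_nbhs; split => //; exact: EW.
    have [_ _ fl] := Ex.
    have [|i [h1 h2 h3]] := fl (Num.min d (r / 2)).
      by rewrite lt_min d0 divr_gt0.
    move: h1; rewrite lt_min => /andP[g1 g2]; exists i; split => //; split => //.
    move=> y; rewrite /= in_itv /= => /andP[y1 y2]; apply: rW.
    rewrite -ball_normE /=; move: h2; rewrite !ltr_norml => /andP[k1 k2].
    by apply/andP; split; lra.
  have [s1 [us1 sPr1 sdis1 sE1]] := vitali_rat Efin cov1 e0.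
  (* The second cover must fit inside the first, so the closed balls are replaced by their
     interiors; only finitely many end points are lost. *)
  pose U := \big[setU/set0]_(i <- s1) `]cc i - rr i, cc i + rr i[%classic.
  pose K := \big[setU/set0]_(i <- s1) cball i.
  have K0 : mus (K `\` U) = 0%E.
    apply/eqP; rewrite eq_le outer_measure_ge0 andbT.
    pose Z := [set cc i - rr i | i in [set i | i \in s1]] `|`
              [set cc i + rr i | i in [set i | i \in s1]].
    have cZ : countable Z by apply: finite_set_countable; rewrite finite_setU; split; exact: finite_image (finite_seq s1).
    have Z0 : mus Z = 0%E by exact: countable_lebesgue_measure0.
    rewrite -Z0; apply: le_outer_measure => x.
    rewrite /K /U -!bigcup_seq => -[[i /= iS]]; rewrite /cball /= in_itv /= => /andP[h1 h2] h3.
    move: h1; rewrite le_eqVlt => /predU1P[h1|h1]; first by left; exists i.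
    move: h2; rewrite le_eqVlt => /predU1P[h2|h2]; first by right; exists i.
    by exfalso; apply: h3; exists i => //=; rewrite in_itv /= h1 h2.
  pose E' := E `&` U.
  have E'fin : (mus E' < +oo)%E by apply: le_lt_trans Efin; apply: le_outer_measure => x [].
  have E'm : ((m - e)%:E <= mus E')%E.
    rewrite EFinB leeBlDr// -mE.
    apply: (@le_trans _ _ (mus (E' `|` ((E `\` K) `|` (K `\` U))))).
      apply: le_outer_measure => x Ex.
      have [h|h] := pselect (U x); first by left.
      by right; have [h'|h'] := pselect (K x); [right|left].
    apply: (le_trans (outer_measureU2 _ _ _)); apply: leeD => //.
    apply: (le_trans (outer_measureU2 _ _ _)); rewrite -[leRHS]adde0.
    by apply: leeD; [exact: ltW|rewrite -K0; exact: lexx].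
  pose sub i j := (cc j - rr j <= cc i - rr i) && (cc i + rr i <= cc j + rr j).
  pose Pr2 (c r : R) := (exists2 j, j \in s1 & (cc j - rr j <= c - r) && (c + r <= cc j + rr j)) /\
    u * (2 * r) < f (c + r) - f (c - r).
  have cov2 x d : E' x -> 0 < d ->
      exists i, [/\ rr i < d, `|x - cc i| < rr i & Pr2 (cc i) (rr i)].
    move=> [Ex Ux] d0; move: Ux; rewrite /U -bigcup_seq => -[j /= js]; rewrite in_itv /= => /andP[x1 x2].
    have [_ st _] := Ex.
    have [|i [h1 h2 h3]] := st (Num.min d (Num.min ((x - (cc j - rr j)) / 2) ((cc j + rr j - x) / 2))).
      by rewrite !lt_min d0 !divr_gt0//; lra.
    exists i; move: h1 h2; rewrite !lt_min => /and3P[g1 g2 g3] g4; split => //.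
    split => //; exists j => //.
    by move: (g4); rewrite ltr_norml => /andP[k1 k2]; apply/andP; split; lra.
  have [s2 [us2 sPr2 sdis2 sE2]] := vitali_rat E'fin cov2 e0.
  have len2 : m - 2 * e <= \sum_(i <- s2) 2 * rr i.
    rewrite -lee_fin; apply: le_trans (mus_bigU s2).
    have -> : m - 2 * e = (m - e) - e by ring.
    rewrite EFinB leeBlDr//; apply: (le_trans E'm).
    apply: (@le_trans _ _ (mus ((\big[setU/set0]_(i <- s2) cball i) `|`
        (E' `\` \big[setU/set0]_(i <- s2) cball i)))).
      apply: le_outer_measure => x Ex.
      by have [h|h] := pselect ((\big[setU/set0]_(i <- s2) cball i) x); [left|right].
    by apply: (le_trans (outer_measureU2 _ _ _)); apply: leeD => //; exact: ltW.
  have incr21 : \sum_(i <- s2) incr i <= \sum_(j <- s1) incr j.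
    (* Every steep interval lies in some flat one. Grouping by container may count it more than
       once, which only increases a sum of nonnegative terms. *)
    apply: (@le_trans _ _ (\sum_(j <- s1) \sum_(i <- s2 | sub i j) incr i)).
      under [leRHS]eq_bigr do rewrite big_mkcond.
      rewrite exchange_big /= big_seq [leRHS]big_seq; apply: ler_sum => i /sPr2[[j js1 ij] _].
      have [us1' ss1'] := (us1, js1); elim: (s1) us1' ss1' => // k t IH /=.
      move=> /andP[kt ut]; rewrite inE big_cons => /predU1P[<-|jt].
        by rewrite /sub ij lerDl; apply: sumr_ge0 => l _; case: ifP.
      by apply: (le_trans (IH ut jt)); rewrite lerDr; case: ifP.
    rewrite big_seq [leRHS]big_seq; apply: ler_sum => j js1.
    rewrite -big_filter; apply: sum_incr.
    - exact: filter_uniq.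
    - by have := rat_radius_gt0 j; lra.
    - by move=> i k; rewrite !mem_filter => /andP[_ h1] /andP[_ h2]; exact: sdis2.
    - by move=> i; rewrite mem_filter => /andP[/andP[]].
  have len1 : \sum_(j <- s1) 2 * rr j <= m + e.
    rewrite -lee_fin; apply: le_trans Wle; apply: sum_len => // i /sPr1[]//.
  apply: (@le_trans _ _ (u * \sum_(i <- s2) 2 * rr i)).
    by rewrite ler_wpM2l//; lra.
  apply: (@le_trans _ _ (\sum_(i <- s2) incr i)).
    rewrite mulr_sumr big_seq [leRHS]big_seq; apply: ler_sum => i /sPr2[_ h]; exact: ltW.
  apply: (le_trans incr21); apply: (@le_trans _ _ (v * \sum_(i <- s1) 2 * rr i)).
    rewrite mulr_sumr big_seq [leRHS]big_seq; apply: ler_sum => i /sPr1[_ h]; exact: ltW.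
  by rewrite ler_wpM2l.
rewrite leNgt; apply/negP => mgt0.
have uv : 0 < (u - v) * m by rewrite mulr_gt0// subr_gt0.
have u0 : 0 < 2 * u + v + 1 by lra.
(* Chosen so that [(2 * u + v + 1) * e] is half of the gap [(u - v) * m], which contradicts
   [key]. *)
pose e := (u - v) * m / (2 * u + v + 1) / 2.
have e0 : 0 < e by rewrite !divr_gt0.
have := key _ e0.
have : (2 * u + v + 1) * e = (u - v) * m / 2 by rewrite /e; field; rewrite gt_eqF.
nra.
Qed.

End Monotone.
End MonotoneDerivative.

Section MonotoneDerivable.
Context {R : realType}.
Notation mu := (@lebesgue_measure R).
Variable f : R -> R.
Hypothesis f_nd : {homo f : x y / x <= y}.

Lemma rat_itvP (s t : R) : s < t -> exists2 q : rat, s < ratr q & ratr q < t.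
Proof.
by move=> /rat_in_itvoo[q]; rewrite in_itv /= => /andP[h1 h2]; exists q.
Qed.

Lemma ratr_half (a b : rat) : ratr ((b - a) / 2) = (ratr b - ratr a) / 2 :> R.
Proof. by rewrite fmorph_div rmorphB rmorph_nat. Qed.

Lemma ratr_mid (a b : rat) : ratr ((a + b) / 2) = (ratr a + ratr b) / 2 :> R.
Proof. by rewrite fmorph_div rmorphD rmorph_nat. Qed.

Lemma not_steepP (u x : R) : ~ steep f u x -> exists2 d : R, 0 < d &
  forall a b : rat, ratr a < x < ratr b -> ratr b - ratr a < d ->
    f (ratr b) - f (ratr a) <= u * (ratr b - ratr a).
Proof.
move=> /existsNP[d /not_implyP[d0 /forallNP h]]; exists d => // a b /andP[ax xb] abd.
rewrite leNgt; apply/negP => hlt.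
have r0 : 0 < (ratr ((b - a) / 2) : R).
  by rewrite ratr_half divr_gt0// subr_gt0 (lt_trans ax).
have [i [ci ri]] := rat_ballP ((a + b) / 2) r0.
apply: (h i); rewrite ci ri ratr_half ratr_mid.
have -> : (ratr a + ratr b) / 2 + (ratr b - ratr a) / 2 = ratr b :> R by field.
have -> : (ratr a + ratr b) / 2 - (ratr b - ratr a) / 2 = ratr a :> R by field.
have e2 : 2 * ((ratr b - ratr a) / 2) = ratr b - ratr a :> R by field.
split; [lra| |by rewrite e2].
by rewrite ltr_norml; apply/andP; split; lra.
Qed.

Lemma not_flatP (v x : R) : ~ flat f v x -> exists2 d : R, 0 < d &
  forall a b : rat, ratr a < x < ratr b -> ratr b - ratr a < d ->
    v * (ratr b - ratr a) <= f (ratr b) - f (ratr a).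
Proof.
move=> /existsNP[d /not_implyP[d0 /forallNP h]]; exists d => // a b /andP[ax xb] abd.
rewrite leNgt; apply/negP => hlt.
have r0 : 0 < (ratr ((b - a) / 2) : R).
  by rewrite ratr_half divr_gt0// subr_gt0 (lt_trans ax).
have [i [ci ri]] := rat_ballP ((a + b) / 2) r0.
apply: (h i); rewrite ci ri ratr_half ratr_mid.
have -> : (ratr a + ratr b) / 2 + (ratr b - ratr a) / 2 = ratr b :> R by field.
have -> : (ratr a + ratr b) / 2 - (ratr b - ratr a) / 2 = ratr a :> R by field.
have e2 : 2 * ((ratr b - ratr a) / 2) = ratr b - ratr a :> R by field.
split; [lra| |by rewrite e2].
by rewrite ltr_norml; apply/andP; split; lra.
Qed.

Lemma steep_le (u v x : R) : u <= v -> steep f v x -> steep f u x.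
Proof.
move=> uv h d d0; have [i [h1 h2 h3]] := h d d0; exists i; split => //.
apply: le_lt_trans h3; rewrite ler_wpM2r//; have := rat_radius_gt0 (R := R) i; lra.
Qed.

Lemma flat_le (u v x : R) : u <= v -> flat f u x -> flat f v x.
Proof.
move=> uv h d d0; have [i [h1 h2 h3]] := h d d0; exists i; split => //.
apply: (lt_le_trans h3); rewrite ler_wpM2r//; have := rat_radius_gt0 (R := R) i; lra.
Qed.

(** [L] is the infimum of the nonnegative slopes that are not steep at [x]. If [L - e] were flat,
    two rationals [q < p] between [L - e] and [L] would be flat and steep respectively, which is
    excluded. *)
Lemma not_steep_flat_slope (x : R) : (exists u : nat, ~ steep f u%:R x) ->
  (forall p q : rat, 0 <= (ratr q : R) -> (ratr q : R) < ratr p ->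
     steep f (ratr p) x -> ~ flat f (ratr q) x) ->
  exists2 L : R, 0 <= L & forall e : R, 0 < e -> ~ steep f (L + e) x /\ ~ flat f (L - e) x.
Proof.
move=> [u0 su0] sf.
pose S := [set u : R | 0 <= u /\ ~ steep f u x].
have S0 : S !=set0 by exists u0%:R; split => //; exact: ler0n.
have lS : lbound S 0 by move=> u [].
exists (inf S) => [|e e0]; first exact: lb_le_inf.
split.
  move=> st; have [|u [u1 u2] ue] := @inf_adherent _ S e e0.
    by split => //; exists 0.
  by apply: u2; apply: steep_le st; exact: ltW.
move=> fl.
have Le0 : 0 <= inf S - e.
  rewrite leNgt; apply/negP => Lneg.
  have [i [_ _]] := fl 1 ltr01.
  apply/negP; rewrite -leNgt; apply: (@le_trans _ _ 0).
    rewrite mulr_le0_ge0 ?(ltW Lneg)//; have := rat_radius_gt0 (R := R) i; lra.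
  by rewrite subr_ge0; apply: f_nd; have := rat_radius_gt0 (R := R) i; lra.
have [q q1 q2] := @rat_itvP (inf S - e) (inf S) (ltac:(lra)).
have [p p1 p2] := rat_itvP q2.
have q0 : 0 <= (ratr q : R) by apply: le_trans Le0 _; exact: ltW.
apply: (sf p q) => //; last by apply: flat_le fl; exact: ltW.
apply: contrapT => sp; move: p2; rewrite ltNge; move/negP; apply.
by apply: ge_inf; [exists 0|split => //; apply: le_trans q0 _; exact: ltW].
Qed.

(** Passage from rational intervals around [x] to arbitrary ones, which may have [x] as an end
    point. By monotonicity the upper bound follows by enlarging the interval and the lower one by
    shrinking it. When [x] is an end point, the interval is first extended by [g] past [x], and the
    rise on the extension is controlled by the upper bound. *)
Lemma slope_itv_bound (x L e : R) : 0 <= L -> 0 < e ->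
  (forall e : R, 0 < e -> ~ steep f (L + e) x /\ ~ flat f (L - e) x) ->
  exists2 d : R, 0 < d & forall s t, s <= x <= t -> s < t -> t - s < d ->
    (L - e) * (t - s) <= f t - f s <= (L + e) * (t - s).
Proof.
move=> L0 e0 h; have [/not_steepP[d1 d10 h1] /not_flatP[d2 d20 h2]] := h e e0.
pose d := Num.min d1 d2; have d0 : 0 < d by rewrite lt_min d10.
have Le0 : 0 < L + e by lra.
have ub s t : s <= x <= t -> s < t -> t - s < d -> f t - f s <= (L + e) * (t - s).
  move=> /andP[sx xt] st std; apply/ler_addgt0Pr => r r0.
  have [g g0 [gd gr]] : exists2 g, 0 < g & (t - s) + 2 * g < d /\ (L + e) * (2 * g) < r.
    exists (Num.min ((d - (t - s)) / 4) (r / (L + e) / 4)).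
      by rewrite lt_min !divr_gt0// subr_gt0.
    split.
      have : Num.min ((d - (t - s)) / 4) (r / (L + e) / 4) <= (d - (t - s)) / 4.
        by rewrite ge_min lexx.
      lra.
    apply: (@le_lt_trans _ _ ((L + e) * (2 * (r / (L + e) / 4)))).
      rewrite ler_wpM2l//; first exact: ltW.
      by rewrite ler_wpM2l// ge_min lexx orbT.
    have -> : (L + e) * (2 * (r / (L + e) / 4)) = r / 2 by field; rewrite gt_eqF.
    lra.
  have [a a1 a2] := @rat_itvP (s - g) s (ltac:(lra)).
  have [b b1 b2] := @rat_itvP t (t + g) (ltac:(lra)).
  have fa : f (ratr a) <= f s by apply: f_nd; exact: ltW.
  have fb : f t <= f (ratr b) by apply: f_nd; exact: ltW.
  have hh : f (ratr b) - f (ratr a) <= (L + e) * (ratr b - ratr a).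
    apply: h1; first by apply/andP; split; lra.
    by move: gd; rewrite /d lt_min => /andP[gd _]; lra.
  have : (L + e) * (ratr b - ratr a) <= (L + e) * (t - s + 2 * g).
    by rewrite ler_wpM2l//; lra.
  rewrite mulrDr; lra.
have lbs s t : s < x < t -> t - s < d -> (L - e) * (t - s) <= f t - f s.
  move=> /andP[sx xt] std; apply/ler_addgt0Pr => r r0.
  pose c := `|L - e| + 1; have c0 : 0 < c by rewrite ltr_wpDl.
  pose g := Num.min (r / c / 2) (Num.min (x - s) (t - x)).
  have g0 : 0 < g by rewrite !lt_min !subr_gt0 sx xt !divr_gt0.
  have g1 : g <= x - s by rewrite /g !ge_min lexx orbT.
  have g2 : g <= t - x by rewrite /g !ge_min lexx !orbT.
  have g3 : g <= r / c / 2 by rewrite /g ge_min lexx.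
  have [a a1 a2] := @rat_itvP s (s + g) (ltac:(lra)).
  have [b b1 b2] := @rat_itvP (t - g) t (ltac:(lra)).
  have fa : f s <= f (ratr a) by apply: f_nd; exact: ltW.
  have fb : f (ratr b) <= f t by apply: f_nd; exact: ltW.
  have hh : (L - e) * (ratr b - ratr a) <= f (ratr b) - f (ratr a).
    apply: h2; first by apply/andP; split; lra.
    by move: std; rewrite /d lt_min => /andP[_ gd]; lra.
  have : (L - e) * ((t - s) - (ratr b - ratr a)) <= r.
    apply: (le_trans (ler_norm _)); rewrite normrM.
    have -> : `|t - s - (ratr b - ratr a)| = t - s - (ratr b - ratr a).
      by rewrite ger0_norm//; lra.
    apply: (@le_trans _ _ (c * (r / c))); last by rewrite mulrC divfK// gt_eqF.
    apply: ler_pM => //; [lra|by rewrite /c; lra|lra].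
  rewrite mulrBr; lra.
exists (d / 2); first by rewrite divr_gt0.
move=> s t sxt st std; rewrite ub//; last by lra.
rewrite andbT.
apply/ler_addgt0Pr => r r0.
pose c := `|L - e| * 2 + (L + e) * 2 + 1.
have c0 : 0 < c by rewrite /c; have := normr_ge0 (L - e); lra.
pose g := Num.min (r / c) (d / 8).
have g0 : 0 < g by rewrite lt_min !divr_gt0.
have g1 : g <= r / c by rewrite /g ge_min lexx.
have g2 : g <= d / 8 by rewrite /g ge_min lexx orbT.
have /andP[sx xt] := sxt.
have l1 : (L - e) * (t + g - (s - g)) <= f (t + g) - f (s - g).
  by apply: lbs; [apply/andP; split; lra|lra].
have u1 : f s - f (s - g) <= (L + e) * (2 * g) \/ s < x.
  have [sx'|sx'] := ltP s x; [by right|left].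
  have -> : s = x by lra.
  have := ub (x - g) x; rewrite (_ : x - (x - g) = g); last by ring.
  move=> /(_ _ _ _) H; apply: (le_trans (H _ _ _)); [apply/andP; split; lra|lra|lra|].
  rewrite ler_wpM2l; lra.
have u2 : f (t + g) - f t <= (L + e) * (2 * g) \/ x < t.
  have [sx'|sx'] := ltP x t; [by right|left].
  have -> : t = x by lra.
  have := ub x (x + g); rewrite (_ : x + g - x = g); last by ring.
  move=> /(_ _ _ _) H; apply: (le_trans (H _ _ _)); [apply/andP; split; lra|lra|lra|].
  rewrite ler_wpM2l; lra.
have cg : c * g <= r by rewrite mulrC -ler_pdivlMr.
have ng : - `|L - e| * (2 * g) <= (L - e) * (2 * g).
  by rewrite ler_wpM2r//; [lra|have := ler_norm (- (L - e)); rewrite normrN; lra].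
have Leg : 0 <= (L + e) * g by rewrite mulr_ge0// ltW.
have nLeg : 0 <= `|L - e| * g by rewrite mulr_ge0// ltW.
have cge : c * g = `|L - e| * (2 * g) + (L + e) * (2 * g) + g by rewrite /c; ring.
have e1 : (L - e) * (t + g - (s - g)) = (L - e) * (t - s) + (L - e) * (2 * g) by ring.
have e2 : (L - e) * (t + g - s) = (L - e) * (t - s) + (L - e) * g by ring.
have e3 : (L - e) * (t - (s - g)) = (L - e) * (t - s) + (L - e) * g by ring.
have e4 : (L - e) * (2 * g) = (L - e) * g + (L - e) * g by ring.
have e5 : - `|L - e| * (2 * g) = - (`|L - e| * (2 * g)) by ring.
rewrite {}e5 in ng.
case: (boolP (s < x)) => [sx'|]; [|rewrite -leNgt => sx'];
  (case: (boolP (x < t)) => [xt'|]; [|rewrite -leNgt => xt']).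
- have std' : t - s < d by lra.
  have sxt' : s < x < t by rewrite sx' xt'.
  by have := lbs s t sxt' std' => H; clear - H r0; lra.
- have xtg : s < x < t + g by apply/andP; split; lra.
  have std' : t + g - s < d by lra.
  have := lbs s (t + g) xtg std'.
  case: u2 => [u2|]; last by lra.
  move: cg ng u2 nLeg; rewrite cge e2 e4; clear -g0; lra.
- have xtg : s - g < x < t by apply/andP; split; lra.
  have std' : t - (s - g) < d by lra.
  have := lbs (s - g) t xtg std'.
  case: u1 => [u1|]; last by lra.
  move: cg ng u1 nLeg; rewrite cge e3 e4; clear -g0; lra.
- lra.
Qed.

(** Lebesgue's theorem: at an exceptional point [f] is steep for every [u], or steep and flat for
    some rationals [q < p]; this leaves countably many null sets. *)
Lemma nondecreasing_ae_derivable : {ae mu, forall x, derivable f x 1}.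
Proof.
pose N1 n := [set x : R | -n%:R < x < n%:R /\ forall u : nat, steep f u%:R x].
pose N2 n (p q : rat) : set R := if (0 <= (ratr q : R)) && ((ratr q : R) < ratr p) then
   [set x | [/\ -n%:R < x < n%:R, steep f (ratr p) x & flat f (ratr q) x]] else set0.
pose N := (\bigcup_n N1 n) `|` (\bigcup_n \bigcup_p \bigcup_q N2 n p q).
have negN2 n p q : mu.-negligible (N2 n p q).
  rewrite /N2; case: ifPn => [/andP[q0 qp]|_]; last exact: negligible_set0.
  by apply/negligible_outer_measure; exact: negligible_steep_flat.
have negN : mu.-negligible N.
  apply: negligibleU; apply: negligible_bigcup => n.
    by apply/negligible_outer_measure; exact: negligible_steep.
  have -> : \bigcup_p \bigcup_q N2 n p q =
      \bigcup_k (if (unpickle k : option (rat * rat)) is Some (p, q) then N2 n p q else set0).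
    apply/seteqP; split => x.
      by move=> [p _ [q _ h]]; exists (pickle (p, q)); [exact: Logic.I|rewrite pickleK].
    by move=> [k _]; case: unpickle => [[p q]|//] h; exists p => //; exists q.
  by apply: negligible_bigcup => k; case: unpickle => [[p q]|]; [exact: negN2|exact: negligible_set0].
apply: negligibleS negN => x /= nd; apply: contrapT => xN; apply: nd.
have [n xn] : exists n : nat, -n%:R < x < n%:R.
  exists (Num.truncn `|x|).+1; rewrite -ltr_norml; exact: truncnS_gt.
have [||L L0 hL] := @not_steep_flat_slope x.
- apply: contrapT => /forallNP h; apply: xN; left; exists n => //; split => // u.
  exact: contrapT.
- move=> p q q0 qp sp fq; apply: xN; right; exists n => //; exists p => //; exists q => //.
  by rewrite /N2 q0 qp.
apply/cvg_ex; exists L; apply/cvgrPdist_le => e e0.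
have [d d0 dP] := slope_itv_bound L0 e0 hL.
near=> h.
have h0 : h != 0 by near: h; exact: nbhs_dnbhs_neq.
have hd : `|h| < d.
  near: h; apply: dnbhs0_lt d0.
rewrite /= /GRing.scale /= mulr1.
have [hgt|hlt|] := ltgtP 0 h; last by move=> hh; rewrite -hh eqxx in h0.
- have := dP x (h + x); rewrite lexx lerDr (ltW hgt) addrK => /(_ isT).
  rewrite ltrDr hgt => /(_ isT); rewrite -(gtr0_norm hgt) hd => /(_ isT).
  rewrite (gtr0_norm hgt) => /andP[h1 h2].
  rewrite ler_norml; apply/andP; split.
    by rewrite lerBrDl -lerBrDr opprK ler_pdivrMl// mulrC.
  by rewrite lerBlDl -lerBlDr ler_pdivlMl// mulrC.
- have := dP (h + x) x; rewrite lexx andbT gerDr (ltW hlt) => /(_ isT).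
  rewrite gtrDr hlt => /(_ isT); rewrite (_ : x - (h + x) = - h); last by ring.
  rewrite -(ltr0_norm hlt) hd => /(_ isT); rewrite (ltr0_norm hlt) => /andP[h1 h2].
  have -> : h^-1 * (f (h + x) - f x) = (- h)^-1 * (f x - f (h + x)).
    by rewrite invrN mulNr -mulrN opprB.
  have nh : 0 < - h by rewrite oppr_gt0.
  rewrite ler_norml; apply/andP; split.
    by rewrite lerBrDl -lerBrDr opprK ler_pdivrMl// mulrC.
  by rewrite lerBlDl -lerBlDr ler_pdivlMl// mulrC.
Unshelve. all: by end_near. Qed.

End MonotoneDerivable.

(** * Integral inequalities for monotone functions *)

Section AlmostEverywhere.
Context d (T : measurableType d) (R : realType) (mu : {measure set T -> \bar R}).

Lemma aeS (P Q : T -> Prop) : (forall x, P x -> Q x) ->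
  {ae mu, forall x, P x} -> {ae mu, forall x, Q x}.
Proof. by move=> PQ; apply: negligibleS => x /= nQ Px; apply: nQ; exact: PQ. Qed.

Lemma aeS2 (P Q W : T -> Prop) : (forall x, P x -> Q x -> W x) ->
  {ae mu, forall x, P x} -> {ae mu, forall x, Q x} -> {ae mu, forall x, W x}.
Proof.
move=> PQW aP aQ; apply: negligibleS (negligibleU aP aQ) => x /= nW.
by apply/not_andP => -[Px Qx]; apply: nW; exact: PQW.
Qed.

Lemma ae_forall (P : nat -> T -> Prop) : (forall n, {ae mu, forall x, P n x}) ->
  {ae mu, forall x, forall n, P n x}.
Proof.
move=> aP; apply: negligibleS (negligible_bigcup aP) => x /= /existsNP[n nP].
by exists n.
Qed.

End AlmostEverywhere.

Section Einf.
Context {R : realType}.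
Local Open Scope ereal_scope.
Implicit Types (u : nat -> \bar R) (c : \bar R).

Lemma limn_einf_sup_einfs u : limn_einf u = ereal_sup (range (einfs u)).
Proof.
rewrite limn_einf_lim; apply/cvg_lim => //.
exact/ereal_nondecreasing_cvgn/nondecreasing_einfs.
Qed.

Lemma limn_einf_ge u c : (\forall n \near \oo, c <= u n) -> c <= limn_einf u.
Proof.
move=> [N _ h]; rewrite limn_einf_sup_einfs.
apply: (@le_trans _ _ (einfs u N)); last by apply: ereal_sup_ubound; exists N.
by apply: le_ereal_inf_tmp => _ [n /= Nn <-]; exact: h.
Qed.

Lemma limn_einf_le u c : (forall N, exists2 n, (N <= n)%N & u n <= c) ->
  limn_einf u <= c.
Proof.
move=> h; rewrite limn_einf_sup_einfs; apply: ge_ereal_sup => _ [N _ <-].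
by have [n Nn uc] := h N; apply: ereal_inf_le; exists (u n) => //; exists n.
Qed.

End Einf.

Section Quotients.
Context {R : realType}.
Notation mu := (@lebesgue_measure R).
Local Open Scope ereal_scope.

(** Lebesgue measure and its image under the translation agree on half-open intervals, hence on all
    Borel sets. *)
Lemma integral_translation (g : R -> R) (a b h : R) :
  (forall x, `[(a + h)%R, (b + h)%R]%classic x -> 0 <= g x)%R ->
  measurable_fun setT g ->
  \int[mu]_(x in `[a, b]) (g (x + h)%R)%:E = \int[mu]_(x in `[(a + h)%R, (b + h)%R]) (g x)%:E.
Proof.
move=> g0 mg; pose phi (x : measurableTypeR R) : measurableTypeR R := (x + h)%R.
have mphi : measurable_fun setT phi by exact: measurable_funD.
have eqm (A : set (measurableTypeR R)) : measurable A -> mu A = pushforward mu phi A.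
  pose m : {measure set (measurableTypeR R) -> \bar R} := pushforward mu phi.
  move=> mA.
  apply: (@lebesgue_measure_unique _ (m mphi) _ A mA) => _ [[u v] _ <-] /=.
  rewrite /m /pushforward /=.
  have -> : phi @^-1` `]u, v] = (`](u - h)%R, (v - h)%R]%classic : set R).
    by apply/seteqP; split => x /=; rewrite !in_itv /= /phi ltrBlDr lerBrDr.
  rewrite !lebesgue_measure_itv /= !lte_fin ltrD2r; case: ifP => // _.
  by rewrite -!EFinB; congr EFin; ring.
rewrite [RHS](eq_measure_integral (pushforward mu phi)); last by move=> A mA _; exact: eqm.
rewrite ge0_integral_pushforward//.
- congr (integral mu _ _); apply/seteqP; split => x /=.
    by rewrite !in_itv /= /phi !lerD2r.
  by rewrite !in_itv /= /phi !lerD2r.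
- by apply/measurable_EFinP; exact: measurable_funTS.
- by move=> x; rewrite inE => /g0; rewrite lee_fin.
Qed.

(** After a translation the integral of [f (x + h) - f x] over [[a, b]] is at most that of
    [g = f - f a] over [[b, b + h]], hence at most [h * g (b + h)]. Subtracting [f a] makes every
    integrand nonnegative. *)
Lemma nondecreasing_quotient_integral (f : R -> R) (a b h : R) :
  {homo f : x y / (x <= y)%R} -> (a <= b)%R -> (0 < h)%R ->
  \int[mu]_(x in `[a, b]) ((f (x + h) - f x) / h)%R%:E <= (f (b + h) - f a)%R%:E.
Proof.
move=> f_nd ab h0; pose g x := (f x - f a)%R.
have mf : measurable_fun setT f by exact: nondecreasing_measurable.
have mg : measurable_fun setT g by exact: measurable_funB.
have mgh : measurable_fun (setT : set R) (fun x : R => g (x + h)%R).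
  by apply: (measurableT_comp mg); exact: measurable_funD.
have mEg (D : set R) : measurable_fun D (fun x => (g x)%:E).
  by apply/measurable_EFinP; exact: measurable_funTS.
have g0 x : (a <= x)%R -> (0 <= g x)%R by move=> ax; rewrite subr_ge0 f_nd.
have mI : measurable (`[a, b]%classic : set R) by exact: measurable_itv.
have gI x : `[a, b]%classic x -> (0 <= g x)%R.
  by rewrite /= in_itv /= => /andP[ax _]; exact: g0.
have dI x : (0 <= g (x + h) - g x)%R.
  by rewrite subr_ge0 lerD2r; apply: f_nd; rewrite lerDl ltW.
have A_fin : \int[mu]_(x in `[a, b]) (g x)%:E < +oo.
  apply: (@le_lt_trans _ _ (\int[mu]_(x in `[a, b]) (cst (g b)%:E) x)).
    apply: ge0_le_integral; [exact: mI| |exact: mEg|exact: measurable_cst|].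
    - by move=> x Dx; rewrite lee_fin; exact: gI.
    - move=> x /=; rewrite in_itv /= => /andP[_ xb]; rewrite lee_fin lerD2r.
      exact: f_nd.
  by rewrite integral_cst//= lebesgue_measure_cc// -EFinM ltry.
have A0 : 0 <= \int[mu]_(x in `[a, b]) (g x)%:E.
  by apply: integral_ge0 => x Dx; rewrite lee_fin; exact: gI.
have Q_le : \int[mu]_(x in `[a, b]) (g (x + h) - g x)%R%:E <= (h * g (b + h))%R%:E.
  rewrite -(@leeD2lE _ (\int[mu]_(x in `[a, b]) (g x)%:E)); last by rewrite ge0_fin_numE.
  have H1 x : `[a, b]%classic x -> 0 <= (g x)%:E by move=> Dx; rewrite lee_fin; exact: gI.
  have H2 x : `[a, b]%classic x -> 0 <= (g (x + h) - g x)%R%:E by rewrite lee_fin.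
  have mq : measurable_fun `[a, b] (fun x => (g (x + h) - g x)%R%:E).
    by apply/measurable_EFinP; apply: measurable_funTS; exact: measurable_funB.
  rewrite -(ge0_integralD mu mI H1 (mEg _) H2 mq).
  under eq_integral do rewrite -EFinD addrC subrK.
  rewrite integral_translation//; last first.
    by move=> x /=; rewrite in_itv /= => /andP[ax _]; apply: g0; apply: le_trans ax; rewrite lerDl ltW.
  have abh : (a <= b + h)%R by rewrite (le_trans ab)// lerDl ltW.
  apply: (@le_trans _ _ (\int[mu]_(x in `[a, (b + h)%R]) (g x)%:E)).
    apply: ge0_subset_integral; [by []|by []|exact: mEg| |].
    - by move=> x /=; rewrite in_itv /= => /andP[ax _]; rewrite lee_fin g0.
    - move=> x /=; rewrite !in_itv /= => /andP[ax ->]; rewrite andbT.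
      by apply: le_trans ax; rewrite lerDl ltW.
  have -> : `[a, (b + h)%R]%classic = (`[a, b] `|` `]b, (b + h)%R])%classic :> set R.
    apply/seteqP; split => x /=; rewrite !in_itv /=.
      by move=> /andP[-> ->]; rewrite andbT /=; case: (leP x b) => _; [left|right].
    move=> [/andP[-> xb]|/andP[xb ->]]; first by rewrite (le_trans xb)// lerDl ltW.
    by rewrite andbT (le_trans ab)// ltW.
  rewrite ge0_integral_setU; [|by []|by []|exact: mEg| |]; last 2 first.
  - move=> x /= [|]; rewrite in_itv /= => /andP[h1 h2]; rewrite lee_fin g0//.
    by rewrite (le_trans ab)// ltW.
  - apply/disj_setPS => x [/=]; rewrite !in_itv /= => /andP[_ h1] /andP[h2 _].
    by rewrite ltNge h1 in h2.
  rewrite leeD2l//.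
  apply: (@le_trans _ _ (\int[mu]_(x in `]b, (b + h)%R]) (cst (g (b + h)%R)%:E) x)).
    apply: ge0_le_integral; [by []| |exact: mEg|exact: measurable_cst|].
    - move=> x /=; rewrite in_itv /= => /andP[h1 _]; rewrite lee_fin g0//.
      by rewrite (le_trans ab)// ltW.
    - move=> x /=; rewrite in_itv /= => /andP[_ xb]; rewrite lee_fin lerD2r.
      exact: f_nd.
  rewrite integral_cst//= lebesgue_measure_itv /= lte_fin ltrDl h0 -EFinB addrAC subrr add0r.
  by rewrite -EFinM lee_fin mulrC.
have -> : (fun x => ((f (x + h) - f x) / h)%R%:E) =
    (fun x => (h^-1)%:E * (g (x + h) - g x)%R%:E).
  by apply/funext => x; rewrite -EFinM /g; congr EFin; ring.
rewrite ge0_integralZl_EFin//; last 3 first.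
- by move=> x _; rewrite lee_fin.
- by apply/measurable_EFinP; apply: measurable_funTS; exact: measurable_funB.
- by rewrite invr_ge0 ltW.
apply: (@le_trans _ _ ((h^-1)%:E * (h * g (b + h))%R%:E)).
  by apply: lee_wpmul2l => //; rewrite lee_fin invr_ge0 ltW.
by rewrite -EFinM mulrA mulVf ?mul1r// gt_eqF.
Qed.

Definition clamp (a b : R) (x : R) : R := Num.min b (Num.max a x).

Lemma clamp_id a b x : (a <= x <= b)%R -> clamp a b x = x.
Proof. by move=> /andP[ax xb]; rewrite /clamp max_r// min_r. Qed.

Lemma clamp_itv a b x : (a <= b)%R -> (a <= clamp a b x <= b)%R.
Proof. by move=> ab; rewrite /clamp le_min ab le_max lexx ge_min lexx. Qed.

Lemma clamp_le a b x : (x <= a)%R -> (a <= b)%R -> clamp a b x = a.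
Proof. by move=> xa ab; rewrite /clamp max_l// min_r. Qed.

Lemma clamp_ge a b x : (b <= x)%R -> (a <= b)%R -> clamp a b x = b.
Proof. by move=> xa ab; rewrite /clamp max_r ?min_l// (le_trans ab). Qed.

Lemma clamp_homo a b : {homo clamp a b : x y / (x <= y)%R}.
Proof.
move=> x y xy; rewrite /clamp le_min ge_min lexx /= ge_min; apply/orP; right.
by rewrite ge_max !le_max lexx xy orbT.
Qed.

Lemma clamp_nd (f : R -> R) a b : (a <= b)%R ->
  (forall x y, a <= x -> x <= y -> y <= b -> f x <= f y)%R ->
  {homo (f \o clamp a b) : x y / (x <= y)%R}.
Proof.
move=> ab h x y xy /=; have /andP[h1 h2] := clamp_itv x ab.
have /andP[h3 h4] := clamp_itv y ab.
by apply: h => //; exact: clamp_homo.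
Qed.

Lemma fatou_le (D : set R) (q : nat -> R -> \bar R) (g : R -> \bar R) (C : \bar R) :
  measurable D -> (forall n, measurable_fun D (q n)) ->
  (forall n x, D x -> 0 <= q n x) ->
  measurable_fun D g -> (forall x, D x -> 0 <= g x) ->
  {ae mu, forall x, D x -> g x <= limn_einf (q^~ x)} ->
  (forall n, \int[mu]_(x in D) q n x <= C) ->
  \int[mu]_(x in D) g x <= C.
Proof.
move=> mD mq q0 mg g0 gq qC.
apply: (@le_trans _ _ (\int[mu]_(x in D) limn_einf (q^~ x))).
  apply: ae_ge0_le_integral => //.
    by move=> x Dx; apply: limn_einf_ge; apply: nearW => n; exact: q0.
  rewrite (_ : (fun x => _) = (fun x => - limn_esup (fun n => - q n x))).
    apply: measurableT_comp => //; apply: measurable_fun_limn_esup => n.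
    by apply: (@measurableT_comp _ _ _ _ _ _ (-%E)) => //; exact: mq.
  by apply/funext => x; rewrite -limn_einfN /=; congr limn_einf; apply/funext => n /=; rewrite oppeK.
apply: (le_trans (fatou mu mD mq q0)).
by apply: limn_einf_le => N; exists N.
Qed.

Lemma derive_seq_quotient (f : R -> R) (x : R) : derivable f x 1%R ->
  (fun n : nat => (f (x + n.+1%:R^-1) - f x) / n.+1%:R^-1)%R @ \oo --> ('D_1 f x)%R.
Proof.
move=> df.
have h : ((h^-1 *: (f (h *: 1 + x) - f x)) @[h --> (0 : R)^'] --> 'D_1 f x)%R by exact: df.
have hs : ((fun n : nat => n.+1%:R^-1 : R) @ \oo --> (0 : R)^')%R.
  move=> A [e /= e0 eA].
  have := near_infty_natSinv_lt (PosNum e0); apply: filterS => n ne /=.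
  apply: eA; last by rewrite gt_eqF// invr_gt0.
  by rewrite /= sub0r normrN gtr0_norm// invr_gt0.
have := cvg_comp _ _ hs h; apply: cvg_trans; apply: near_eq_cvg; apply: nearW => n /=.
rewrite /GRing.scale /= mulr1 [RHS]mulrC; congr (_ * (f _ - _))%R; exact: addrC.
Qed.

(** Fatou's lemma on the difference quotients of [f] frozen outside [[a, b]]: with this extension
    [nondecreasing_quotient_integral] gives exactly [f b - f a]. *)
Lemma nondecreasing_integral_derive (f : R -> R) (a b : R) (df : R -> R) :
  (a <= b)%R ->
  (forall x y, a <= x -> x <= y -> y <= b -> f x <= f y)%R ->
  measurable_fun `[a, b] df -> (forall x, `[a, b]%classic x -> 0 <= df x)%R ->
  {ae mu, forall x, `]a, b[%classic x -> derivable f x (1%R : R) /\ df x = 'D_1 f x} ->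
  \int[mu]_(x in `[a, b]) (df x)%:E <= (f b - f a)%R%:E.
Proof.
move=> ab f_nd mdf df0 dfE.
pose F := f \o clamp a b.
have F_nd : {homo F : x y / (x <= y)%R} by exact: clamp_nd.
have mF : measurable_fun setT F by exact: nondecreasing_measurable.
pose q (n : nat) (x : R) : \bar R := ((F (x + n.+1%:R^-1) - F x) / n.+1%:R^-1)%R%:E.
have ab_ae : {ae mu, forall x : R, x != a /\ x != b}.
  exists [set a; b]; split => //.
  - exact: measurableU.
  - apply: countable_lebesgue_measure0; exact/finite_set_countable/finite_set2.
  - move=> x /= /not_andP[/negP|/negP]; rewrite negbK => /eqP ->; [by left|by right].
apply: (@fatou_le _ q) => //.
- move=> n; apply/measurable_EFinP; apply: measurable_funTS.
  apply: measurable_funM => //; apply: measurable_funB => //.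
  by apply: (measurableT_comp mF); exact: measurable_funD.
- move=> n x _; rewrite lee_fin divr_ge0//.
  by rewrite subr_ge0; apply: F_nd; rewrite lerDl.
- exact/measurable_EFinP.
- apply: aeS2 dfE ab_ae => x dfx [xa xb]; rewrite /= in_itv /= => /andP[ax xb'].
  have abx : `]a, b[%classic x.
    by rewrite /= in_itv /= !lt_neqAle eq_sym xa ax xb xb'.
  have [dx ->] := dfx abx.
  have := derive_seq_quotient dx => cv.
  have : (q^~ x) @ \oo --> ('D_1 f x)%:E.
    apply/fine_cvgP; split; first exact: nearW.
    apply: cvg_trans cv; apply: near_eq_cvg.
    have bx : (0 < b - x)%R by rewrite subr_gt0; move: abx; rewrite /= in_itv /= => /andP[].
    have := near_infty_natSinv_lt (PosNum bx); apply: filterS => n /= nb.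
    rewrite /F /= !clamp_id ?ax ?xb'//=.
    by rewrite (le_trans ax) ?lerDl//= addrC -lerBrDr ltW.
  by move=> /cvg_limn_einf_sup[-> _].
- move=> n; apply: (le_trans (nondecreasing_quotient_integral F_nd ab _)); first by rewrite invr_gt0.
  by rewrite /F /= clamp_ge// ?lerDl// clamp_le.
Qed.

End Quotients.

(** * Subgradients and conjugates *)

Section Convex.
Context {R : realType} {X : completeNormedModType R}.
Variable f : X -> R.
Hypothesis f_cvx : convex_fun f.
Hypothesis f_lsc : lower_semicontinuous (fun V => (f V)%:E).

(** Baire's theorem: the space is the union of the closed sets where [f <= n], so [f] is bounded on
    some ball around a point [x0]. Every point near [V] is the midpoint of the fixed point
    [2 V - x0] and of a point of that ball; convexity transports the bound. *)
Lemma convex_locally_bounded (V : X) :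
  exists2 r : R, 0 < r & exists C : R, forall w, `|w| < r -> f (V + w) <= C.
Proof.
have op n : open [set x : X | n%:R < f x].
  exact: (lower_semicontinuousP _).1 f_lsc n%:R.
have [n nd] : exists n : nat, ~ dense [set x : X | n%:R < f x].
  apply: contrapT => /forallNP h.
  have /Baire d : forall n : nat, open [set x : X | n%:R < f x] /\ dense [set x : X | n%:R < f x].
    by move=> n; split => //; exact: contrapT.
  have [x [_ xP]] := d setT (ex_intro _ (0 : X) I) openT.
  have := xP (Num.truncn `|f x|).+1 I => /=.
  by rewrite ltNge (le_trans (ler_norm _))// ltW// truncnS_gt.
move: nd => /existsNP[B /not_implyP[[x0 Bx0] /not_implyP[oB]]] /set0P/negP; rewrite negbK => /eqP B0.
have /nbhs_ballP[r /= r0 rB] : nbhs x0 B by exact: open_nbhs_nbhs.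
have fb x : `|x0 - x| < r -> f x <= n%:R.
  move=> xr; rewrite leNgt; apply/negP => fx.
  have : (B `&` [set x : X | n%:R < f x]) x.
    by split => //; apply: rB; rewrite -ball_normE.
  by rewrite B0.
exists (r / 2); first by rewrite divr_gt0.
exists (2^-1 * f (2 *: V - x0) + (1 - 2^-1) * n%:R) => w wr.
have -> : V + w = 2^-1 *: (2 *: V - x0) + (1 - 2^-1) *: (x0 + 2 *: w).
  have -> : 1 - 2^-1 = 2^-1 :> R by field.
  rewrite -scalerDr (addrC x0) addrA addrAC subrK -scalerDr scalerA mulVf ?scale1r//.
apply: (le_trans (f_cvx _ _ _)); first by apply/andP; split; lra.
rewrite lerD2l ler_wpM2l//; first by lra.
apply: fb; rewrite opprD addrA subrr sub0r normrN normrZ ger0_norm//; lra.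
Qed.

Definition dir_quot (V d : X) (t : R) := (f (V + t *: d) - f V) / t.
Definition dir_deriv (V d : X) := inf [set dir_quot V d t | t in [set t | 0 < t]].

Lemma dir_quot_nd V d s t : 0 < s -> s <= t -> dir_quot V d s <= dir_quot V d t.
Proof.
move=> s0 st; have t0 : 0 < t by exact: lt_le_trans st.
have l01 : 0 <= s / t <= 1 by apply/andP; split; [rewrite divr_ge0// ltW|rewrite ler_pdivrMr// mul1r].
have := f_cvx (V + t *: d) V l01.
have -> : (s / t) *: (V + t *: d) + (1 - s / t) *: V = V + s *: d.
  by rewrite scalerDr scalerA divfK ?gt_eqF// addrAC -scalerDl [s / t + _]addrC subrK scale1r.
move=> h; rewrite /dir_quot ler_pdivrMr//.
have -> : (f (V + t *: d) - f V) / t * s = (s / t) * f (V + t *: d) - (s / t) * f V.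
  by field; rewrite gt_eqF.
by move: h; rewrite mulrBl mul1r; lra.
Qed.

(** [V] is a convex combination of [V + t d] and [V - d], which bounds the quotients from below
    uniformly in [t]. *)
Lemma dir_quot_lb V d : lbound [set dir_quot V d t | t in [set t | 0 < t]]
  (- (f (V - d) - f V)).
Proof.
move=> _ [t /= t0 <-].
pose l := (1 + t)^-1.
have l0 : 0 < l by rewrite invr_gt0 addr_gt0.
have t1 : 1 + t != 0 by rewrite gt_eqF// addr_gt0.
have l01 : 0 <= l <= 1 by apply/andP; split; [exact: ltW|rewrite invf_le1 ?addr_gt0// lerDl ltW].
have := f_cvx (V + t *: d) (V - d) l01.
have -> : l *: (V + t *: d) + (1 - l) *: (V - d) = V.
  have -> : 1 - l = l * t by rewrite /l; field.
  rewrite -scalerA -scalerDr scalerBr addrACA subrr addr0 -[X in X + _]scale1r.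
  by rewrite -scalerDl scalerA mulVf// scale1r.
have -> : 1 - l = l * t by rewrite /l; field.
rewrite -mulrA -mulrDr ler_pdivlMl ?addr_gt0// => h.
by rewrite /dir_quot ler_pdivlMr//; lra.
Qed.

Lemma dir_deriv_le V d t : 0 < t -> dir_deriv V d <= dir_quot V d t.
Proof.
move=> t0; apply: ge_inf; last by exists t.
by exists (- (f (V - d) - f V)); exact: dir_quot_lb.
Qed.

Lemma dir_deriv_glb V d c : (forall t, 0 < t -> c <= dir_quot V d t) -> c <= dir_deriv V d.
Proof.
move=> h; apply: lb_le_inf; first by exists (dir_quot V d 1); exists 1 => //=.
by move=> _ [t /= t0 <-]; exact: h.
Qed.

Lemma dir_deriv_sublinear V : sublinear_on setT (dir_deriv V).
Proof.
split => [x y _ _|a x a0 _].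
- rewrite -lerBlDr; apply: dir_deriv_glb => s s0.
  rewrite lerBlDr -lerBlDl; apply: dir_deriv_glb => t t0; rewrite lerBlDl.
  have st0 : 0 < s + t by rewrite addr_gt0.
  have st : s + t != 0 by rewrite gt_eqF.
  (* With this step [V + e (x + y)] is the combination of [V + s x] and [V + t y] with weights
     [t / (s + t)] and [s / (s + t)]. *)
  pose e := s * t / (s + t).
  have e0 : 0 < e by rewrite divr_gt0// mulr_gt0.
  apply: (le_trans (dir_deriv_le _ _ e0)).
  pose l := t / (s + t).
  have l01 : 0 <= l <= 1.
    by apply/andP; split; [rewrite divr_ge0// ltW|rewrite ler_pdivrMr// mul1r lerDr ltW].
  have := f_cvx (V + s *: x) (V + t *: y) l01.
  have -> : l *: (V + s *: x) + (1 - l) *: (V + t *: y) = V + e *: (x + y).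
    rewrite !scalerDr addrACA -scalerDl (addrC l) subrK scale1r !scalerA.
    have -> : l * s = e by rewrite /l /e; field.
    have -> : (1 - l) * t = e by rewrite /l /e; field.
    by [].
  move=> h; rewrite /dir_quot ler_pdivrMr//.
  have -> : ((f (V + s *: x) - f V) / s + (f (V + t *: y) - f V) / t) * e =
     l * f (V + s *: x) + (1 - l) * f (V + t *: y) - f V.
    by rewrite /l /e; field; rewrite !gt_eqF.
  lra.
- rewrite -ler_pdivrMl//; apply: dir_deriv_glb => t t0; rewrite ler_pdivrMl//.
  have ta : 0 < t / a by rewrite divr_gt0.
  apply: (le_trans (dir_deriv_le _ _ ta)).
  rewrite /dir_quot scalerA divfK ?gt_eqF//.
  rewrite le_eqVlt; apply/orP; left; apply/eqP; by field; rewrite !gt_eqF.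
Qed.

(** Hahn-Banach below the directional derivative, with equality in the direction [d]: this
    subgradient controls the quotients along [d] from above as well. Its continuity comes from the
    local bound on [f]. *)
Lemma subdiff_dir V d : exists2 xi, subdiff f V xi &
  forall e : R, 0 < e -> exists2 t0 : R, 0 < t0 &
    forall t, 0 < t -> t <= t0 -> dir_quot V d t <= xi d + e.
Proof.
have [//|//|//|L [Llin Lle Ld]] := @HahnBanach R X setT _ _ _ d (dir_deriv_sublinear V) _.
have Lf w : L w <= f (V + w) - f V.
  apply: (le_trans (Lle w I)); apply: (le_trans (dir_deriv_le _ _ ltr01)).
  by rewrite /dir_quot scale1r divr1.
exists L.
  have [r r0 [C CP]] := convex_locally_bounded V.
  split.
    apply: (@linear_bounded_dual _ _ _ r (C - f V) r0) => [a u v|u ur]; first exact: Llin.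
    by apply: (le_trans (Lf u)); rewrite lerD2r; exact: CP.
  by move=> W; have := Lf (W - V); rewrite [V + _]addrC subrK; lra.
move=> e e0.
have [|_ [t /= t0 <-] te] := @inf_adherent _ [set dir_quot V d t | t in [set t | 0 < t]] e e0.
  split; first by exists (dir_quot V d 1); exists 1 => //=.
  by exists (- (f (V - d) - f V)); exact: dir_quot_lb.
exists t => // s s0 st; rewrite Ld; apply/ltW/(le_lt_trans _ te).
exact: dir_quot_nd.
Qed.

End Convex.

Section Conjugate.
Context {R : realType} {X : normedModType R}.
Implicit Types (f : X -> R) (V : X) (xi : X -> R).

Lemma fconj_subdiff f V xi : subdiff f V xi -> fconj f xi = (xi V - f V)%:E.
Proof.
move=> [dxi h]; apply/eqP; rewrite eq_le; apply/andP; split.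
  apply: ge_ereal_sup => _ [W _ <-]; rewrite lee_fin.
  by have := h W; rewrite (dualB _ _ dxi); lra.
by apply: ereal_sup_ubound; exists V.
Qed.

Lemma fconj_ge f V xi : ((xi V - f V)%:E <= fconj f xi)%E.
Proof. by apply: ereal_sup_ubound; exists V. Qed.

Lemma fconj_le f xi (c : \bar R) : (forall V, ((xi V - f V)%:E <= c)%E) -> (fconj f xi <= c)%E.
Proof. by move=> h; apply: ge_ereal_sup => _ [W _ <-]. Qed.

Lemma fconj_ge0 f xi : is_dual xi -> f 0 = 0 -> (0 <= fconj f xi)%E.
Proof. by move=> dxi f0; have := fconj_ge f 0 xi; rewrite f0 (dual0 dxi) subrr. Qed.

(** The perspective [s * f (V / s)] of a convex function vanishing at 0 is nonincreasing in [s]: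
    lengthening the step does not increase the dissipation term of the incremental problem. *)
Lemma convex_fun_ray f V s t : convex_fun f -> f 0 = 0 -> 0 < s -> s <= t ->
  t * f (t^-1 *: V) <= s * f (s^-1 *: V).
Proof.
move=> cf f0 s0 st; have t0 : 0 < t by exact: lt_le_trans st.
have l01 : 0 <= s / t <= 1 by apply/andP; split; [rewrite divr_ge0// ltW|rewrite ler_pdivrMr// mul1r].
have := cf _ (s^-1 *: V) 0 l01; rewrite scaler0 addr0 scalerA f0 mulr0 addr0.
have -> : s / t / s = t^-1 by field; rewrite !gt_eqF.
by move=> h; rewrite -ler_pdivlMl// (le_trans h)// mulrA [s / t]mulrC.
Qed.

End Conjugate.

(** * Differentiability of absolutely continuous curves *)

Section Slope.
Context {R : realType}.
Notation mu := (@lebesgue_measure R).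

(** A total and measurable substitute for the derivative, equal to it wherever the derivative
    exists. *)
Definition slope (g : R -> R) (t : R) : R :=
  fine (limn_esup (fun n => ((g (t + n.+1%:R^-1) - g t) / n.+1%:R^-1)%:E)).

Lemma measurable_slope (g : R -> R) : measurable_fun setT g -> measurable_fun setT (slope g).
Proof.
move=> mg; apply: (measurableT_comp (fine_measurable measurableT)).
apply: measurable_fun_limn_esup => n; apply/measurable_EFinP.
apply: measurable_funM => //; apply: measurable_funB => //.
by apply: (measurableT_comp mg); exact: measurable_funD.
Qed.

Lemma slope_derive (g : R -> R) t : derivable g t 1 -> slope g t = 'D_1 g t.
Proof.
move=> /derive_seq_quotient cv; rewrite /slope.
suff /cvg_limn_einf_sup[_ ->] :
    (fun n => ((g (t + n.+1%:R^-1) - g t) / n.+1%:R^-1)%:E) @ \oo --> ('D_1 g t)%:E by [].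
by apply/fine_cvgP; split; first exact: nearW.
Qed.

Lemma nondecreasing_derive_ge0 (g : R -> R) t : {homo g : x y / x <= y} ->
  derivable g t 1 -> 0 <= 'D_1 g t.
Proof.
move=> g_nd /derive_seq_quotient cv; apply: (cvg_lim_ge cv); apply: nearW => n.
by rewrite divr_ge0// subr_ge0; apply: g_nd; rewrite lerDl.
Qed.

End Slope.

Section StrongDerivative.
Context {R : realType} {X : normedModType R}.
Notation mu := (@lebesgue_measure R).
Hypothesis Xsep : separable_space (X := X).
Hypothesis Xrefl : reflexive_space (X := X).
Variables (P : R -> X) (F : R -> R).
Hypothesis F_nd : {homo F : x y / x <= y}.
Hypothesis PF : forall e : R, 0 < e -> exists2 r : R, 0 <= r &
  forall s t, s <= t -> `|P t - P s| <= e * (F t - F s) + r * (t - s).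

(** The term [e F + r t] compensates the variation of [xi (P t)], so that the theory of monotone
    functions applies to the scalar components of [P]. The freedom in [e] later removes the possibly
    singular part of [F]. *)
Lemma compensated_nd (xi : X -> R) (e r : R) : is_dual xi -> dnorm xi <= 1 ->
  (forall s t, s <= t -> `|P t - P s| <= e * (F t - F s) + r * (t - s)) ->
  {homo (fun t => xi (P t) + e * F t + r * t) : x y / x <= y} /\
  {homo (fun t => - xi (P t) + e * F t + r * t) : x y / x <= y}.
Proof.
move=> dxi xi1 h.
have key s t : s <= t -> `|xi (P t) - xi (P s)| <= e * (F t - F s) + r * (t - s).
  move=> st; rewrite -dualB//; apply: (le_trans (dual_le _ dxi)).
  by apply: le_trans (h _ _ st); rewrite ler_piMl.
by split => s t /key; rewrite ler_norml => /andP[]; lra.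
Qed.

Lemma derivable_dual_comp (xi : X -> R) : is_dual xi -> dnorm xi <= 1 ->
  {ae mu, forall t, derivable (fun t => xi (P t)) t 1}.
Proof.
move=> dxi xi1; have [r r0 h] := PF ltr01.
have [h1 _] := compensated_nd dxi xi1 h.
apply: aeS2 (nondecreasing_ae_derivable h1) (nondecreasing_ae_derivable F_nd).
move=> t d1 d2.
have -> : (fun t => xi (P t)) =
    (fun t => xi (P t) + 1 * F t + r * t) - F - (fun t => r * t).
  by apply/funext => x; rewrite !fctE; ring.
apply: derivableB; first exact: derivableB.
have -> : (fun t => r * t) = r *: (@id R) by [].
by apply: derivableZ; exact: derivable_id.
Qed.

Lemma measurable_dual_comp (xi : X -> R) : is_dual xi -> dnorm xi <= 1 ->
  measurable_fun setT (fun t => xi (P t)).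
Proof.
move=> dxi xi1; have [r r0 h] := PF ltr01.
have [h1 _] := compensated_nd dxi xi1 h.
have -> : (fun t => xi (P t)) =
    (fun t => (xi (P t) + 1 * F t + r * t) - (F t + r * t)).
  by apply/funext => x; ring.
apply: measurable_funB; first exact: nondecreasing_measurable.
by apply: measurable_funD; [exact: nondecreasing_measurable|exact: measurable_funM].
Qed.

Variable z : nat -> X -> R.
Hypothesis dz : forall n, is_dual (z n).
Hypothesis z1 : forall n, dnorm (z n) <= 1.
Hypothesis znorm : forall u (e : R), 0 < e -> exists n, `|u| - e <= z n u.

Let z_le n u : z n u <= `|u|.
Proof.
apply: (le_trans (ler_norm _)); apply: (le_trans (dual_le u (dz n))).
by rewrite ler_piMl.
Qed.

(** Where [F] is differentiable the quotients of [P] are bounded; a weak limit of them along the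
    ultrafilter represents the derivatives of all [z j (P t)] at once. *)
Lemma weak_derivative : exists V : R -> X, {ae mu, forall t,
  [/\ derivable F t 1, forall j, derivable (fun t => z j (P t)) t 1 &
      forall j, 'D_1 (fun t => z j (P t)) t = z j (V t)]}.
Proof.
have [U UU Uoo] := exists_ultra_oo.
have [r r0 h] := PF ltr01.
pose good t := derivable F t 1 /\ forall j, derivable (fun t => z j (P t)) t 1.
have ex t : exists v : X, good t -> forall j, 'D_1 (fun t => z j (P t)) t = z j v.
  have [[dF dzj]|ng] := pselect (good t); last by exists 0 => /ng.
  pose Q n := n.+1%:R *: (P (t + n.+1%:R^-1) - P t).
  have QF n : `|Q n| <= (F (t + n.+1%:R^-1) - F t) / n.+1%:R^-1 + r.
    rewrite /Q normrZ ger0_norm// invrK.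
    apply: (@le_trans _ _ (n.+1%:R * (1 * (F (t + n.+1%:R^-1) - F t) + r * (t + n.+1%:R^-1 - t)))).
      by rewrite ler_wpM2l// h// lerDl.
    rewrite (_ : t + n.+1%:R^-1 - t = n.+1%:R^-1); last by ring.
    rewrite mul1r mulrDr mulrC lerD2l mulrCA divff ?mulr1// pnatr_eq0//.
  have [C CP] : exists C, forall n, `|(F (t + n.+1%:R^-1) - F t) / n.+1%:R^-1| <= C.
    have /cvg_seq_bounded[M [_ MP]] := cvgP _ (derive_seq_quotient dF).
    by exists (M + 1) => n; apply: MP => //; rewrite ltrDl.
  have [v vP] := @weak_ultra R X U UU Q (C + r) Xrefl (fun n =>
     le_trans (QF n) (lerD (le_trans (ler_norm _) (CP n)) (lexx r))).
  exists v => _ j.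
  have c1 := vP _ (dz j).
  have c2 : z j (Q n) @[n --> U] --> 'D_1 (fun t => z j (P t)) t.
    have := derive_seq_quotient (dzj j) => cv.
    have oU : (fun n : nat => n) @ U --> \oo.
      by move=> A [k _ kA]; apply: filterS (Uoo k) => n /=; exact: kA.
    have := cvg_comp _ _ oU cv; apply: cvg_trans; apply: near_eq_cvg; apply: nearW => n /=.
    by rewrite /Q dualZ// dualB// invrK mulrC.
  exact: (cvg_unique (@Rhausdorff R) c2 c1).
have [V VP] := choice ex; exists V.
have aF := nondecreasing_ae_derivable F_nd.
have az := ae_forall (fun j => derivable_dual_comp (dz j) (z1 j)).
by apply: aeS2 aF az => t d1 d2; split => //; exact: VP.
Qed.

Let f j t := z j (P t).

(* Measurable version of the norm of the weak derivative minus [x]. *)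
Definition dist_slope (x : X) (t : R) : R :=
  fine (maxe 0%E (esups (fun j => (slope (f j) t - z j x)%:E) 0%N)).

Lemma measurable_dist_slope x : measurable_fun setT (dist_slope x).
Proof.
apply: (measurableT_comp (fine_measurable measurableT)).
apply: measurable_maxe => //; apply: measurable_fun_esups => j.
apply/measurable_EFinP; apply: measurable_funB => //.
apply: measurable_slope; exact: (measurable_dual_comp (dz j) (z1 j)).
Qed.

Lemma dist_slope_ge0 x t : 0 <= dist_slope x t.
Proof. by apply: fine_ge0; rewrite le_max lexx. Qed.

Lemma dist_slopeE x t v :
  (forall j, derivable (f j) t 1) -> (forall j, 'D_1 (f j) t = z j v) ->
  dist_slope x t = `|v - x|.
Proof.
move=> d1 d2; rewrite /dist_slope.
have -> : esups (fun j => (slope (f j) t - z j x)%:E) 0%N = `|v - x|%:E.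
  apply/eqP; rewrite eq_le; apply/andP; split.
    apply: ge_ereal_sup => _ [j _ <-]; rewrite lee_fin slope_derive// d2 -dualB//.
  apply/lee_addgt0Pr => e e0; have [j zj] := znorm (v - x) e0.
  rewrite -leeBlDr// -EFinB; apply: (@le_trans _ _ (z j (v - x))%:E) => //.
  by apply: ereal_sup_ubound; exists j => //; rewrite slope_derive// d2 dualB.
by rewrite max_r.
Qed.

Lemma slope_F_integral a b : a <= b ->
  (\int[mu]_(t in `[a, b]) (Num.max 0 (slope F t))%:E <= (F b - F a)%:E)%E.
Proof.
move=> ab; apply: nondecreasing_integral_derive => //.
- by move=> x y _ xy _; exact: F_nd.
- apply: measurable_maxr => //; apply: measurable_funTS; apply: measurable_slope.
  exact: nondecreasing_measurable.
- by move=> x _; rewrite le_max lexx.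
- apply: aeS (nondecreasing_ae_derivable F_nd) => x dx _; split => //.
  by rewrite slope_derive// max_r// nondecreasing_derive_ge0.
Qed.

Lemma dist_slope_le (r : R) (V : R -> X) : 0 <= r ->
  (forall s t, s <= t -> `|P t - P s| <= 1 * (F t - F s) + r * (t - s)) ->
  {ae mu, forall t, forall x, dist_slope x t <= Num.max 0 (slope F t) + (r + `|x|)}.
Proof.
move=> r0 h; have [W aW] := weak_derivative.
apply: aeS aW => t [dF dzj Wz] x.
rewrite (dist_slopeE _ dzj Wz) slope_derive//.
have -> : Num.max 0 ('D_1 F t) = 'D_1 F t by rewrite max_r// nondecreasing_derive_ge0.
apply: (@le_trans _ _ (`|W t| + `|x|)); first exact: ler_normB.
rewrite addrA lerD2r; apply/ler_addgt0Pr => e e0.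
have [j zj] := znorm (W t) e0.
suff : z j (W t) <= 'D_1 F t + r by lra.
rewrite -Wz; have c1 := derive_seq_quotient (dzj j).
have c2 := derive_seq_quotient dF.
have c3 := rcvgB (FF := eventually_filter) c1 c2.
suff : 'D_1 (f j) t - 'D_1 F t <= r by rewrite /f; lra.
apply: (cvg_lim_le c3); apply: nearW => n /=.
have n0 : 0 < n.+1%:R^-1 :> R by rewrite invr_gt0.
move: (n.+1%:R^-1) n0 => q q0.
rewrite -mulrBl ler_pdivrMr//.
have := h t (t + q); rewrite lerDl => /(_ (ltW q0)).
have := z_le j (P (t + q) - P t); rewrite /f (dualB _ _ (dz j)).
rewrite (_ : t + q - t = q); [lra|ring].
Qed.

(** For [z j] nearly norming the increment, [w = - z j P + e' F + r t] is nondecreasing, so the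
    integral of its derivative is at most its increment, while that derivative is a.e. at least
    [r - z j (P')]. The singular part of [F] thus costs only [e' (F t - F s)]. *)
Lemma dist_slope_increment x s t : s <= t ->
  (`|P t - P s - (t - s) *: x|%:E <= \int[mu]_(u in `[s, t]) (dist_slope x u)%:E)%E.
Proof.
move=> st; have [W aW] := weak_derivative.
apply/lee_addgt0Pr => e e0.
have Fst : 0 <= F t - F s by rewrite subr_ge0; exact: F_nd.
(* Keeps [e' (F t - F s)] below [e / 2]; the other half of [e] pays for [z j] being only almost
   norming. *)
pose e' : R := e / 2 / (F t - F s + 1).
have e'0 : 0 < e' by rewrite !divr_gt0// ltr_wpDl.
have e2 : 0 < e / 2 by rewrite divr_gt0.
have [r r0 h] := PF e'0.
have [j zj] := znorm (P t - P s - (t - s) *: x) e2.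
have [_ w_nd] := compensated_nd (dz j) (z1 j) h.
set w := (fun t => _) in w_nd.
have mw : measurable_fun setT w by exact: nondecreasing_measurable.
pose dw u : R := Num.max 0 (slope w u).
have mdw : measurable_fun setT dw by apply: measurable_maxr => //; exact: measurable_slope.
have I1 : (\int[mu]_(u in `[s, t]) (dw u)%:E <= (w t - w s)%:E)%E.
  apply: nondecreasing_integral_derive => //.
  - by move=> a b _ ab _; exact: w_nd.
  - exact: measurable_funTS.
  - by move=> a _; rewrite le_max lexx.
  - apply: aeS (nondecreasing_ae_derivable w_nd) => a da _; split => //.
    by rewrite /dw slope_derive// max_r// nondecreasing_derive_ge0.
pose c := r - z j x.
have mG (D : set R) : measurable_fun D (fun u => (dist_slope x u)%:E).
  by apply/measurable_EFinP; apply: measurable_funTS; exact: measurable_dist_slope.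
have mW (D : set R) : measurable_fun D (fun u => (dw u)%:E).
  by apply/measurable_EFinP; exact: measurable_funTS.
have mI : measurable (`[s, t]%classic : set R) by exact: measurable_itv.
have dw0 u : (0 <= (dw u)%:E)%E by rewrite lee_fin le_max lexx.
have G0 u : (0 <= (dist_slope x u)%:E)%E by rewrite lee_fin dist_slope_ge0.
have I2 : ((c * (t - s))%:E <= \int[mu]_(u in `[s, t]) ((dw u)%:E + (dist_slope x u)%:E))%E.
  have [c0|c0] := leP c 0.
    apply: (@le_trans _ _ 0%E).
      by rewrite lee_fin mulr_le0_ge0// subr_ge0.
    by apply: integral_ge0 => u _; apply: adde_ge0.
  apply: (@le_trans _ _ (\int[mu]_(u in `[s, t]) (cst c%:E) u)%E).
    by rewrite integral_cst//= lebesgue_measure_cc// -EFinM.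
  apply: ae_ge0_le_integral; [exact: mI| |exact: measurable_cst| | |].
  - by move=> u _; rewrite lee_fin ltW.
  - by move=> u _; apply: adde_ge0.
  - by apply: emeasurable_funD; [exact: mW|exact: mG].
  - apply: aeS2 aW (nondecreasing_ae_derivable w_nd) => u [dF dzj Wz] dwu _.
    rewrite (dist_slopeE _ dzj Wz) -EFinD lee_fin.
    have sw : slope w u = - 'D_1 (f j) u + e' * 'D_1 F u + r.
      rewrite slope_derive//.
      have c1 := derive_seq_quotient (dzj j).
      have c2 := derive_seq_quotient dF.
      have c3 := derive_seq_quotient dwu.
      have c4 := rcvgD (FF := eventually_filter) (rcvgD (FF := eventually_filter)
        (rcvgN (FF := eventually_filter) c1) (rcvgZ (FF := eventually_filter) (c := e') c2)) (cvg_cst r).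
      have c5 : (w (u + n.+1%:R^-1) - w u) / n.+1%:R^-1 @[n --> \oo] -->
          - 'D_1 (f j) u + e' * 'D_1 F u + r.
        have E : (fun n : nat => (w (u + n.+1%:R^-1) - w u) / n.+1%:R^-1) =
            (fun n : nat => - ((z j (P (u + n.+1%:R^-1)) - z j (P u)) / n.+1%:R^-1) +
              e' * ((F (u + n.+1%:R^-1) - F u) / n.+1%:R^-1) + r).
          apply/funext => n; rewrite /w.
          have : n.+1%:R^-1 != 0 :> R by rewrite invr_eq0 pnatr_eq0.
          by move: (n.+1%:R^-1) => q q0; field.
        by rewrite E; exact: c4.
      exact: (cvg_unique (@Rhausdorff R) c3 c5).
    have F0 : 0 <= 'D_1 F u by exact: nondecreasing_derive_ge0.
    have wle : slope w u <= dw u by rewrite le_max lexx orbT.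
    have zle := z_le j (W u - x); rewrite (dualB _ _ (dz j)) -Wz -/(f j) in zle.
    have eF0 : 0 <= e' * 'D_1 F u by rewrite mulr_ge0// ltW.
    move: wle; rewrite sw /c; lra.
have I3 : ((c * (t - s))%:E <= (w t - w s)%:E + \int[mu]_(u in `[s, t]) (dist_slope x u)%:E)%E.
  apply: (le_trans I2).
  rewrite (ge0_integralD mu mI (fun u _ => dw0 u) (mW _) (fun u _ => G0 u) (mG _)).
  exact: leeD2r.
have key : `|P t - P s - (t - s) *: x| - e <= c * (t - s) - (w t - w s).
  have e'F : e' * (F t - F s) <= e / 2.
    rewrite /e' mulrAC ler_pdivrMr; last by lra.
    by rewrite ler_wpM2l//; lra.
  move: zj; rewrite !(dualB _ _ (dz j)) (dualZ _ _ (dz j)) /c /w; lra.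
have : (`|P t - P s - (t - s) *: x|%:E <=
    (e + (c * (t - s) - (w t - w s)))%:E)%E by rewrite lee_fin; lra.
move=> /le_trans; apply.
rewrite EFinD addeC leeD2r// EFinB leeBlDl//.
Qed.

Lemma integral_dist_slope_fin x a b : a <= b ->
  (\int[mu]_(u in `[a, b]) (dist_slope x u)%:E < +oo)%E.
Proof.
move=> ab; have [r r0 h] := PF ltr01; have [V _] := weak_derivative.
have mI : measurable (`[a, b]%classic : set R) by exact: measurable_itv.
have mF : measurable_fun setT (fun t => Num.max 0 (slope F t)).
  apply: measurable_maxr => //; apply: measurable_slope; exact: nondecreasing_measurable.
have F0 t : (0 <= (Num.max 0 (slope F t))%:E)%E by rewrite lee_fin le_max lexx.
have c0 : (0 <= (r + `|x|)%:E)%E by rewrite lee_fin addr_ge0.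
apply: (@le_lt_trans _ _ (\int[mu]_(u in `[a, b])
    ((Num.max 0 (slope F u))%:E + (cst (r + `|x|)%:E) u))%E).
  apply: ae_ge0_le_integral; [exact: mI| | | | |].
  - by move=> u _; rewrite lee_fin dist_slope_ge0.
  - by apply/measurable_EFinP; apply: measurable_funTS; exact: measurable_dist_slope.
  - by move=> u _; apply: adde_ge0.
  - by apply: emeasurable_funD => //; apply/measurable_EFinP; exact: measurable_funTS.
  - apply: aeS (dist_slope_le V r0 h) => u hu _ /=.
    by rewrite -EFinD lee_fin; exact: hu.
have mFI : measurable_fun `[a, b] (fun t => (Num.max 0 (slope F t))%:E).
  by apply/measurable_EFinP; exact: measurable_funTS.
rewrite (ge0_integralD mu mI (fun u _ => F0 u) mFI (fun u _ => c0) (measurable_cst _)).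
apply: lte_add_pinfty; first by apply: (le_lt_trans (slope_F_integral ab)); rewrite ltry.
by rewrite integral_cst//= lebesgue_measure_cc// -EFinM ltry.
Qed.

Lemma lebesgue_pt_dist_slope x : {ae mu, forall t, lebesgue_pt (dist_slope x) t}.
Proof.
apply: lebesgue_differentiation; split; [exact: measurable_dist_slope|exact: openT|].
move=> K _ cK.
have [M [_ MK]] := compact_bounded cK.
have mK : measurable K by exact: compact_measurable.
have M0 : - (`|M| + 1) <= `|M| + 1 by have := normr_ge0 M; lra.
apply: le_lt_trans (integral_dist_slope_fin x M0).
under eq_integral do rewrite ger0_norm ?dist_slope_ge0//.
apply: ge0_subset_integral; [exact: mK|exact: measurable_itv| | |].
- by apply/measurable_EFinP; apply: measurable_funTS; exact: measurable_dist_slope.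
- by move=> u _; rewrite lee_fin dist_slope_ge0.
- move=> u Ku; rewrite /= in_itv /= -ler_norml; apply: MK => //.
  by rewrite (le_lt_trans (ler_norm _))// ltrDl.
Qed.

(** At a common Lebesgue point of [|P' - w k|] for all [k], take [w k] within [e / 4] of the weak
    derivative [V t]. The increment of [P] minus [h w k] is bounded by the integral of [|P' - w k|],
    which is close to [|h| |V t - w k|]. *)
Lemma ae_strong_derivable : {ae mu, forall t, derivable P t 1}.
Proof.
have [V aV] := weak_derivative.
have [w wd] := separable_dense_seq Xsep.
apply: aeS2 aV (ae_forall (fun k => lebesgue_pt_dist_slope (w k))).
move=> t [dF dzj Vz] lp.
suff : h^-1 *: (P (h *: 1 + t) - P t) @[h --> (0 : R)^'] --> V t by move=> ?; apply/cvg_ex; exists (V t).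
apply/cvgrPdist_le => e e0.
have e4 : 0 < e / 4 by rewrite divr_gt0.
have [k kP] := wd (V t) _ e4.
have Gt := dist_slopeE (w k) dzj Vz.
pose G := dist_slope (w k).
have e8 : 0 < e / 8 by rewrite divr_gt0.
(* The interval of length [|h|] sits in the ball of radius [2 |h|], so the oscillation of [G]
   contributes [e / 8 * (2 * (2 |h|)) = |h| * e / 2]. With [e / 4] from [G t] and [e / 4] from
   [V t - w k], the total per unit of [h] is [e]. *)
have [d d0 dP] : exists2 d : R, 0 < d & forall h, 0 < h -> h < d ->
    (\int[mu]_(u in ball t h) `|(G u - G t)%:E| <= (e / 8 * (2 * h))%:E)%E.
  have /fine_cvgP[l1 /cvgrPdist_lt/(_ _ e8) l2] := lp k.
  have [d /= d0 dP] := filterI l1 l2; exists d => // h h0 hd.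
  have [|f1] := dP h _ h0; first by rewrite /= sub0r normrN gtr0_norm.
  rewrite /= sub0r normrN.
  have mb : mu (ball t h) = (2 * h)%:E.
    by rewrite lebesgue_measure_ball ?ltW// mulr2n; congr EFin; ring.
  have I0 : (0 <= \int[mu]_(u in ball t h) `|(G u - G t)%:E|)%E by exact: integral_ge0.
  have h2 : 2 * h != 0 by rewrite gt_eqF// mulr_gt0.
  move: f1; rewrite /davg /iavg mb inver (negbTE h2) /=.
  move: I0; case: (\int[mu]_(u in ball t h) _)%E => [i i0 _|_|//].
    rewrite /= ger0_norm; last by rewrite mulr_ge0 ?invr_ge0// ?mulr_ge0// ltW.
    by rewrite ltr_pdivrMl ?mulr_gt0// => hi; rewrite lee_fin ltW// mulrC.
  by rewrite gt0_muley// lte_fin invr_gt0 mulr_gt0.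
have mG (D : set R) : measurable_fun D (fun u => (G u)%:E).
  by apply/measurable_EFinP; apply: measurable_funTS; exact: measurable_dist_slope.
have mGt (D : set R) : measurable_fun D (fun u => `|(G u - G t)%:E|%E).
  apply: measurableT_comp => //; apply/measurable_EFinP; apply: measurable_funTS.
  by apply: measurable_funB => //; exact: measurable_dist_slope.
near=> h.
have h0 : h != 0 by near: h; exact: nbhs_dnbhs_neq.
have hd : `|h| < d / 2.
  by near: h; apply: dnbhs0_lt; rewrite divr_gt0.
have nh0 : 0 < `|h| by rewrite normr_gt0.
have bound a b : a <= b -> b - a = `|h| -> (forall u, a <= u <= b -> `|t - u| < 2 * `|h|) ->
    `|P b - P a - (b - a) *: w k| <= `|h| * (3 / 4 * e).
  move=> ab bah sub; rewrite -lee_fin.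
  have mI : measurable (`[a, b]%classic : set R) by exact: measurable_itv.
  have Gt0 : (0 <= (G t)%:E)%E by rewrite lee_fin dist_slope_ge0.
  apply: (le_trans (dist_slope_increment _ ab)).
  apply: (@le_trans _ _ (\int[mu]_(u in `[a, b]) (cst (G t)%:E u + `|(G u - G t)%:E|))%E).
    apply: ge0_le_integral; [exact: mI| |exact: mG| |].
    - by move=> u _; rewrite lee_fin dist_slope_ge0.
    - by apply: emeasurable_funD; [exact: measurable_cst|exact: mGt].
    - move=> u _; rewrite /cst /= -EFinD lee_fin -lerBlDl; exact: ler_norm.
  rewrite (ge0_integralD mu mI (fun u _ => Gt0) (measurable_cst _) (fun u _ => abse_ge0 _) (mGt _)).
  have -> : `|h| * (3 / 4 * e) = `|h| * (e / 4) + e / 8 * (2 * (2 * `|h|)) by field.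
  rewrite EFinD; apply: leeD.
    rewrite integral_cst//= lebesgue_measure_cc// -EFinM lee_fin bah mulrC ler_wpM2l//.
    by rewrite /G Gt ltW.
  apply: (@le_trans _ _ (\int[mu]_(u in ball t (2 * `|h|)) `|(G u - G t)%:E|)%E).
    apply: ge0_subset_integral; [exact: mI|exact: measurable_ball|exact: mGt|by []|].
    by move=> u /=; rewrite in_itv /= => /sub; rewrite -ball_normE.
  by apply: dP; [rewrite mulr_gt0|lra].
have main : `|P (h + t) - P t - h *: w k| <= `|h| * (3 / 4 * e).
  have [hgt|hlt|hh] := ltgtP 0 h; last by rewrite -hh eqxx in h0.
  - have := bound t (h + t); rewrite addrK gtr0_norm// lerDr => /(_ (ltW hgt) erefl); apply.
    move=> u /andP[u1 u2]; rewrite ltr_norml; apply/andP; split; lra.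
  - have := bound (h + t) t; rewrite (_ : t - (h + t) = - h); last by ring.
    rewrite ltr0_norm// gerDr => /(_ (ltW hlt) erefl) hb.
    have -> : P (h + t) - P t - h *: w k = - (P t - P (h + t) - (- h) *: w k).
      by rewrite scaleNr opprK opprD opprB.
    rewrite normrN; apply: hb => u /andP[u1 u2].
    rewrite ltr_norml; apply/andP; split; lra.
have -> : h *: (1 : R) = h by rewrite /GRing.scale /= mulr1.
have -> : V t - h^-1 *: (P (h + t) - P t) = (V t - w k) - h^-1 *: (P (h + t) - P t - h *: w k).
  by rewrite [in RHS]scalerBr scalerA mulVf// scale1r opprB addrA subrK.
apply: (le_trans (ler_normB _ _)); rewrite normrZ normfV.
have : `|h|^-1 * `|P (h + t) - P t - h *: w k| <= 3 / 4 * e by rewrite ler_pdivrMl.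
lra.
Unshelve. all: by end_near. Qed.

End StrongDerivative.

(** * Analytic sets and measurable selection *)

Section OuterLebesgue.
Context {R : realType}.
Notation mu := (@lebesgue_measure R).
Notation mus := ((wlength (@idfun R))^*)%mu.
Local Open Scope ereal_scope.

Lemma measurable_hull (A : set R) :
  exists G : set R, [/\ measurable G, A `<=` G & mu G = mus A].
Proof.
have [G [oG AG mG]] := outer_measure_Gdelta A.
exists (\bigcap_i G i); split => //.
by apply: bigcapT_measurable => i; exact: open_measurable.
Qed.

(** Continuity from below for sets that need not be measurable: [A n] is replaced by the
    intersection of measurable hulls of the [A k] with [k >= n], which increases with [n] and has
    the same outer measure. *)
Lemma outer_measure_increasing (A : nat -> set R) (c : \bar R) :
  (forall n, A n `<=` A n.+1) -> c < mus (\bigcup_n A n) -> exists n, c < mus (A n).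
Proof.
move=> nA cA; apply: contrapT => /forallNP h.
have {}h n : mus (A n) <= c by rewrite leNgt; apply/negP/h.
have [G GP] := choice (fun n => measurable_hull (A n)).
pose H n := \bigcap_(k in [set k | (n <= k)%N]) G k.
have mG n : measurable (G n) by have [] := GP n.
have mH n : measurable (H n) by apply: bigcap_measurable => //; exists n => //=.
have AH n : A n `<=` H n.
  move=> x Ax k /= nk; have [_ AG _] := GP k; apply: AG.
  elim: k nk => [|k IH]; first by rewrite leqn0 => /eqP <-.
  by rewrite leq_eqVlt => /predU1P[nk|/IH Ak]; [rewrite -nk|exact: (nA k x Ak)].
have cvgH : mu \o H @ \oo --> mu (\bigcup_n H n).
  apply: nondecreasing_cvg_mu; [exact: mH|apply: bigcup_measurable => k _; exact: mH|].
  move=> n m nm; apply/subsetPset => x Hx k /= mk.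
  by apply: Hx => /=; exact: leq_trans mk.
have : mu (\bigcup_n H n) <= c.
  apply: cvge_le cvgH; apply: nearW => n /=.
  apply: le_trans (h n); have [mGn AGn <-] := GP n.
  by apply: le_outer_measure => x; apply => /=.
rewrite leNgt => /negP; apply; apply: (lt_le_trans cA).
by apply: le_outer_measure => x [n _ Ax]; exists n => //; exact: AH.
Qed.

End OuterLebesgue.

Section Analytic.
Context {R : realType} {X : normedModType R}.
Notation mu := (@lebesgue_measure R).
Notation mus := ((wlength (@idfun R))^*)%mu.
Hypothesis Xsep : separable_space (X := X).
Variable T : R.

(** Sequential closedness for the product of time, weak-* topology and the product topology of
    [nat -> nat]. Only norm-bounded sequences are tested, since projections are taken ball by
    ball. *)
Definition weak_closed (C : R -> (X -> R) -> (nat -> nat) -> Prop) : Prop :=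
  forall (M : R) (rn : nat -> R) (xn : nat -> X -> R) (sn : nat -> nat -> nat) r xi s,
  (forall n, [/\ 0 <= rn n <= T, is_dual (xn n), dnorm (xn n) <= M & C (rn n) (xn n) (sn n)]) ->
  rn n @[n --> \oo] --> r -> 0 <= r <= T -> is_dual xi ->
  (forall u, xn n u @[n --> \oo] --> xi u) ->
  (forall i, \forall n \near \oo, sn n i = s i) ->
  C r xi s.

(* Projections of weakly closed sets along the Baire space. *)
Definition analytic (A : R -> (X -> R) -> Prop) : Prop :=
  exists2 C, weak_closed C & forall r xi, 0 <= r <= T -> is_dual xi ->
    (A r xi <-> exists s, C r xi s).

Lemma analytic_closed (A : R -> (X -> R) -> Prop) :
  weak_closed (fun r xi _ => A r xi) -> analytic A.
Proof. by move=> cA; exists (fun r xi _ => A r xi) => // r xi _ _; split=> [Ar|[]//]; exists (fun i => i). Qed.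

Lemma analytic_ext (A B : R -> (X -> R) -> Prop) :
  (forall r xi, 0 <= r <= T -> is_dual xi -> (A r xi <-> B r xi)) ->
  analytic A -> analytic B.
Proof.
by move=> AB [C cC CA]; exists C => // r xi rT dxi; rewrite -AB//; exact: CA.
Qed.

(** The first entry of [s] names the index. It is eventually constant along a convergent sequence,
    which is why the first [N] terms are dropped. *)
Lemma analytic_exists (A : nat -> R -> (X -> R) -> Prop) :
  (forall n, analytic (A n)) -> analytic (fun r xi => exists n, A n r xi).
Proof.
move=> aA.
have /choice[C CP] n : exists C, weak_closed C /\ forall r xi, 0 <= r <= T -> is_dual xi ->
    (A n r xi <-> exists s, C r xi s) by have [C] := aA n; exists C.
exists (fun r xi s => C (s 0%N) r xi (fun i => s i.+1)).
  move=> M rn xn sn r xi s h rnr rT dxi xnxi sns.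
  have [N _ NP] := sns 0%N.
  have shift i : (N <= i + N)%N by rewrite leq_addl.
  have [cC _] := CP (s 0%N).
  apply: (cC M (fun n => rn (n + N)%N) (fun n => xn (n + N)%N)
      (fun n i => sn (n + N)%N i.+1)) => //.
  - move=> n; have [h1 h2 h3 h4] := h (n + N)%N; split => //.
    by rewrite -(NP (n + N)%N (shift n)).
  - by rewrite (cvg_shiftn N rn).
  - by move=> u; rewrite (cvg_shiftn N (fun n => xn n u)); exact: xnxi.
  - move=> i; have [K _ KP] := sns i.+1; exists K => // n /= Kn; apply: KP => /=.
    exact: leq_trans Kn (leq_addr _ _).
move=> r xi rT dxi; split=> [[n]|[s Cs]].
  by have [_ /(_ r xi rT dxi) ->] := CP n => -[s Cs]; exists (fun i => if i is j.+1 then s j else n).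
by exists (s 0%N); have [_ /(_ r xi rT dxi) ->] := CP (s 0%N); exists (fun i => s i.+1).
Qed.

(** One sequence codes countably many witnesses through a pairing of the indices. *)
Lemma analytic_forall (A : nat -> R -> (X -> R) -> Prop) :
  (forall n, analytic (A n)) -> analytic (fun r xi => forall n, A n r xi).
Proof.
move=> aA.
have /choice[C CP] n : exists C, weak_closed C /\ forall r xi, 0 <= r <= T -> is_dual xi ->
    (A n r xi <-> exists s, C r xi s) by have [C] := aA n; exists C.
exists (fun r xi s => forall n, C n r xi (fun i => s (pickle (n, i)))).
  move=> M rn xn sn r xi s h rnr rT dxi xnxi sns n.
  have [cC _] := CP n.
  apply: (cC M rn xn (fun k i => sn k (pickle (n, i)))) => //.
  by move=> k; have [h1 h2 h3 h4] := h k; split.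
move=> r xi rT dxi; split=> [h|[s Cs] n].
  have /choice[s sP] n : exists s, C n r xi s by have [_ /(_ r xi rT dxi) <-] := CP n.
  exists (fun k => if (unpickle k : option (nat * nat)) is Some (n, i) then s n i else 0%N) => n.
  have -> : (fun i => if (unpickle (pickle (n, i)) : option (nat * nat)) is Some (m, j) then s m j else 0%N) = s n.
    by apply/funext => i; rewrite pickleK.
  exact: sP.
by have [_ /(_ r xi rT dxi) ->] := CP n; exists (fun i => s (pickle (n, i))).
Qed.

Lemma analytic_or (A B : R -> (X -> R) -> Prop) :
  analytic A -> analytic B -> analytic (fun r xi => A r xi \/ B r xi).
Proof.
move=> aA aB; have h n : analytic (if n is 0%N then A else B) by case: n.
apply: analytic_ext (analytic_exists h) => r xi _ _; split.
  by move=> [[|n] hn]; [left|right].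
by move=> [hA|hB]; [exists 0%N|exists 1%N].
Qed.

Lemma analytic_and (A B : R -> (X -> R) -> Prop) :
  analytic A -> analytic B -> analytic (fun r xi => A r xi /\ B r xi).
Proof.
move=> aA aB; have h n : analytic (if n is 0%N then A else B) by case: n.
apply: analytic_ext (analytic_forall h) => r xi _ _; split.
  by move=> h'; split; [exact: (h' 0%N)|exact: (h' 1%N)].
by move=> [hA hB] [|n].
Qed.

(** Sets analytic together with their complements are stable under complement and countable union,
    which makes an induction over Borel sets possible. *)
Definition bianalytic (A : R -> (X -> R) -> Prop) :=
  analytic A /\ analytic (fun r xi => ~ A r xi).

Lemma bianalytic_not A : bianalytic A -> bianalytic (fun r xi => ~ A r xi).
Proof.
move=> [a1 a2]; split => //; apply: analytic_ext a1 => r xi _ _.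
by split => [h nh|/contrapT].
Qed.

Lemma bianalytic_exists (A : nat -> R -> (X -> R) -> Prop) :
  (forall n, bianalytic (A n)) -> bianalytic (fun r xi => exists n, A n r xi).
Proof.
move=> h; split; first by apply: analytic_exists => n; have [] := h n.
apply: analytic_ext (analytic_forall (fun n => (h n).2)) => r xi _ _.
by split => [h1 [n]|/forallNP//]; exact: h1.
Qed.

(** Compactness of times, weak-* balls and sequences bounded by [b]. The bound on entry [i] is
    required only from rank [i + 1] on, because the construction bounds one more entry at each
    step. *)
Lemma triple_compact (U : set_system nat) (UU : UltraFilter U)
  (Uoo : forall k, U [set n | (k <= n)%N]) (M : R)
  (rn : nat -> R) (xn : nat -> X -> R) (sn : nat -> nat -> nat) (b : nat -> nat) :
  (forall n, [/\ 0 <= rn n <= T, is_dual (xn n) & dnorm (xn n) <= M]) ->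
  (forall n i, (i < n)%N -> (sn n i <= b i)%N) ->
  exists (g : nat -> nat) r xi s, [/\ 0 <= r <= T /\ (forall n, (g n < g n.+1)%N),
    is_dual xi /\ dnorm xi <= M, rn (g n) @[n --> \oo] --> r /\ (forall u, xn (g n) u @[n --> \oo] --> xi u) &
    forall i, (s i <= b i)%N /\ \forall n \near \oo, sn (g n) i = s i].
Proof.
move=> h sb.
have dx n : is_dual (xn n) by have [] := h n.
have xM n : dnorm (xn n) <= M by have [] := h n.
have [r rT rnr] : exists2 r : R, `[0, T]%classic r & rn n @[n --> U] --> r.
  apply: (ultra_compact (K := `[0, T]%classic)); first exact: segment_compact.
  by move=> n; have [+ _ _] := h n; rewrite /= in_itv.
have [xi [dxi xiM xnxi]] := weak_star_ultra (U := U) dx xM.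
(* A bounded integer sequence is constant on a set of the ultrafilter: otherwise finitely many
   complements, all in [U], would exclude every admissible value. *)
have ex i : exists v : nat, (v <= b i)%N /\ U [set n | sn n i = v].
  apply: contrapT => /forallNP nex.
  have : U (\bigcap_(v in [set v | (v <= b i)%N]) [set n | sn n i <> v]).
    have key k : U (\bigcap_(v in [set v | (v < k)%N /\ (v <= b i)%N]) [set n | sn n i <> v]).
      elim: k => [|k IH]; first by apply: filterS filterT => n _ v [].
      have [kb|kb] := leqP k (b i); last first.
        apply: filterS IH => n IHn v [/= vk vb]; apply: IHn; split => //.
        by rewrite (leq_ltn_trans vb).
      have Uk : U [set n | sn n i <> k].
        have [Uk|//] := in_ultra_setVsetC [set n | sn n i = k] UU.
        by exfalso; apply: (nex k).
      apply: filterS (filterI IH Uk) => n [IHn nk] v [/=]; rewrite ltnS leq_eqVlt.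
      by move=> /predU1P[->//|vk] vb; exact: IHn.
    by apply: filterS (key (b i).+1) => n hn v /= vb; apply: hn.
  move=> /(filterI (Uoo i.+1))/filter_ex[n [/= ni nv]].
  by apply: (nv (sn n i)) => //=; exact: sb.
have [s sP] := choice ex.
have [|g [gi [[g1 g2] g3]]] := along_subsequence Uoo
  (Q := fun g => (rn (g n) @[n --> \oo] --> r /\ (forall u, xn (g n) u @[n --> \oo] --> xi u)) /\
    forall i, \forall n \near \oo, sn (g n) i = s i).
  apply: along_and; first apply: along_and.
  - exact: along_cvg.
  - exact: (weak_star_along Xsep dx xM dxi).
  - apply: along_forall => i; exact: (along_near (sP i).2).
by exists g, r, xi, s; split => // i; split => //; have [] := sP i.
Qed.

Section Projection.
Variables (A : R -> (X -> R) -> Prop) (M : R).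
Hypothesis aA : analytic A.

Definition proj_ball : set R :=
  [set r | 0 <= r <= T /\ exists xi, [/\ is_dual xi, dnorm xi <= M & A r xi]].

(* Choquet capacitability of analytic sets. *)
Lemma proj_ball_inner (c : \bar R) : (c < mus proj_ball)%E ->
  exists K : set R, [/\ measurable K, K `<=` proj_ball & (c <= mu K)%E].
Proof.
have [C cC CA] := aA => cQ.
pose Q (l : seq nat) := [set r | 0 <= r <= T /\ exists xi s,
  [/\ is_dual xi, dnorm xi <= M, (forall i, (i < size l)%N -> (s i <= nth 0 l i)%N) & C r xi s]].
have Q0 : proj_ball `<=` Q [::].
  move=> r [rT [xi [dxi xiM Ar]]]; split => //.
  by have [s Cs] := (CA r xi rT dxi).1 Ar; exists xi, s.
(* Bounding one more entry of [s]: the sets increase to a superset of [Q l] as the bound [v] grows,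
   so the outer measure stays above [c] for some [v]. *)
have step l : exists v, (c < mus (Q l))%E -> (c < mus (Q (rcons l v)))%E.
  have [h|h] := pselect (c < mus (Q l))%E; last by exists 0%N.
  have [||v cv] := @outer_measure_increasing R (fun v => Q (rcons l v)) c; last by exists v.
    move=> v r [rT [xi [s [dxi xiM sl Cs]]]]; split => //; exists xi, s; split => // i.
    rewrite size_rcons => il; have := sl i; rewrite size_rcons => /(_ il).
    by rewrite !nth_rcons; case: ltnP => // _; case: eqP => // _ /leq_trans; apply.
  apply: (lt_le_trans h); apply: le_outer_measure => r [rT [xi [s [dxi xiM sl Cs]]]].
  exists (s (size l)) => //; split => //; exists xi, s; split => // i.
  rewrite size_rcons ltnS leq_eqVlt nth_rcons => /predU1P[->|il].
    by rewrite ltnn eqxx.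
  by rewrite il; exact: sl.
have [g gP] := choice step.
pose l := fix l n := if n is k.+1 then rcons (l k) (g (l k)) else [::].
have lsz n : size (l n) = n by elim: n => //= n IH; rewrite size_rcons IH.
have lQ n : (c < mus (Q (l n)))%E.
  elim: n => [|n IH] /=; last exact: gP.
  by apply: (lt_le_trans cQ); exact: le_outer_measure.
pose b i := g (l i).
have lb n i : (i < n)%N -> nth 0%N (l n) i = b i.
  elim: n => // n IH; rewrite ltnS leq_eqVlt /= nth_rcons lsz => /predU1P[->|il].
    by rewrite ltnn eqxx.
  by rewrite il IH.
pose K := [set r | 0 <= r <= T /\ exists xi s,
  [/\ is_dual xi, dnorm xi <= M, (forall i, (s i <= b i)%N) & C r xi s]].
have KQ : K `<=` proj_ball.
  move=> r [rT [xi [s [dxi xiM sb Cs]]]]; split => //; exists xi; split => //.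
  by apply/(CA r xi rT dxi); exists s.
have [U UU Uoo] := exists_ultra_oo.
(* a closed set meeting every Q (l n) meets K *)
have lim (rn : nat -> R) : (forall n, Q (l n) (rn n)) ->
    exists2 r, K r & exists2 g : nat -> nat, (forall n, (g n < g n.+1)%N) & rn (g n) @[n --> \oo] --> r.
  move=> rnQ.
  have /choice[xs xsP] n : exists p : (X -> R) * (nat -> nat),
      [/\ is_dual p.1, dnorm p.1 <= M, (forall i, (i < n)%N -> (p.2 i <= b i)%N) & C (rn n) p.1 p.2].
    have [_ [xi [s [dxi xiM sl Cs]]]] := rnQ n; exists (xi, s); split => // i il.
    by rewrite -(lb n i il); apply: sl; rewrite lsz.
  have [||h [r [xi [s [[rT hi] [dxi xiM] [rnr xnxi] sb]]]]] := @triple_compact U UU Uoo M rn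
      (fun n => (xs n).1) (fun n => (xs n).2) b.
  - by move=> n; have [? ? _ _] := xsP n; have [? _] := rnQ n.
  - by move=> n i il; have [_ _ h _] := xsP n; exact: h.
  exists r; last by exists h.
  split => //; exists xi, s; split => //; first by move=> i; have [] := sb i.
  apply: (cC M (fun n => rn (h n)) (fun n => (xs (h n)).1) (fun n => (xs (h n)).2)) => //.
    by move=> n; have [? ? _ ?] := xsP (h n); have [? _] := rnQ (h n).
  by move=> i; have [] := sb i.
have clK : closed K.
  move=> r clr.
  have /choice[rn rnP] n : exists x, K x /\ `|r - x| < n.+1%:R^-1.
    have [|x [Kx xr]] := clr (ball r n.+1%:R^-1).
      by apply: nbhsx_ballx; rewrite invr_gt0.
    by exists x; rewrite -ball_normE in xr.
  have [|r' Kr' [h hi rnr']] := lim rn.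
    move=> n; have [[rT [xi [s [dxi xiM sb Cs]]]] _] := rnP n; split => //.
    by exists xi, s; split => // i; rewrite lsz => il; rewrite lb.
  have hn n : (n <= h n)%N by elim: n => // n IH; exact: leq_ltn_trans (hi n).
  suff rnr : rn (h n) @[n --> \oo] --> r by rewrite (cvg_unique (@Rhausdorff R) rnr rnr').
  apply/cvgrPdist_lt => e e0; have := near_infty_natSinv_lt (PosNum e0).
  apply: filterS => n /=; apply: le_lt_trans.
  have [_ /ltW/le_trans] := rnP (h n); apply.
  by rewrite lef_pV2 ?posrE// ler_nat ltnS.
have mK : measurable K by exact: closed_measurable.
exists K; split => //.
apply/lee_addgt0Pr => e e0.
have [W [oW KW We]] := outer_measure_open_le K e0.
apply: le_trans We; rewrite leNgt; apply/negP => Wc.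
(* Were the open [W] of measure below [c], each [Q (l n)] would have a point outside [W]; but a
   limit of such points lies in [K], hence in the open set [W]. *)
have /choice[rn rnP] n : exists x, Q (l n) x /\ ~ W x.
  apply: contrapT => /forallNP nex.
  have : (mus (Q (l n)) <= mus W)%E.
    apply: le_outer_measure => x Qx; apply: contrapT => Wx; exact: (nex x).
  by rewrite leNgt (lt_trans Wc (lQ n)).
have [|r Kr [h _ rnr]] := lim rn; first by move=> n; have [] := rnP n.
have /rnr[k _ kW] : nbhs r W by apply: open_nbhs_nbhs; split => //; exact: KW.
by have [_ nW] := rnP (h k); apply: nW; apply: kW => /=.
Qed.

(** The union of inner approximations has the same finite measure as a measurable hull of the
    projection, so what lies between them is null. *)
Lemma proj_ball_measurable : exists B : set R,
  [/\ measurable B, B `<=` proj_ball & mu.-negligible (proj_ball `\` B)].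
Proof.
have fin : (mus proj_ball < +oo)%E.
  apply: (@le_lt_trans _ _ (mu (`[0, Num.max 0 T]%classic : set R))).
    apply: le_outer_measure => r [/andP[r0 rT] _]; rewrite /= in_itv /= r0 le_max rT orbT//.
  by rewrite lebesgue_measure_itv /=; case: ifP => _; rewrite -?EFinB ltry.
have fn : mus proj_ball \is a fin_num by rewrite ge0_fin_numE// outer_measure_ge0.
have /choice[K KP] n : exists K : set R, [/\ measurable K, K `<=` proj_ball &
    (mus proj_ball - (n.+1%:R^-1)%:E <= mu K)%E].
  apply: proj_ball_inner.
  by rewrite lteBlDr// lteDl// lte_fin invr_gt0.
exists (\bigcup_n K n); split.
- by apply: bigcup_measurable => n _; have [] := KP n.
- by move=> r [n _]; have [_ + _] := KP n; apply.
have mB : measurable (\bigcup_n K n) by apply: bigcup_measurable => n _; have [] := KP n.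
have Bsub : \bigcup_n K n `<=` proj_ball by move=> r [n _]; have [_ + _] := KP n; apply.
have [G [mG QG GQ]] := measurable_hull proj_ball.
have BG : \bigcup_n K n `<=` G by exact: subset_trans QG.
have muB : mu (\bigcup_n K n) = mus proj_ball.
  apply/eqP; rewrite eq_le; apply/andP; split.
    by rewrite -GQ; exact: le_outer_measure.
  apply/lee_addgt0Pr => e e0.
  have [k _ /(_ k (leqnn k)) ke] := near_infty_natSinv_lt (PosNum e0).
  have [mKn _ h] := KP k.
  rewrite -leeBlDr//; apply: (@le_trans _ _ (mus proj_ball - (k.+1%:R^-1)%:E)%E).
    by rewrite leeB// lee_fin ltW.
  by apply: (le_trans h); apply: le_outer_measure; exact: bigcup_sup.
exists (G `\` \bigcup_n K n); split; first exact: measurableD.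
  have Gfin : (mu G < +oo)%E by rewrite GQ.
  have e : mu (G `\` \bigcup_n K n) = (mu G - mu (G `&` \bigcup_n K n))%E by exact: measureD.
  by rewrite e setIidr// muB GQ subee.
by move=> r [Qr nB]; split => //; exact: QG.
Qed.

End Projection.
End Analytic.

Section FirstIndex.

Definition first_index (P : nat -> Prop) : nat :=
  if pselect (exists j, `[< P j >]) is left h then ex_minn h else 0%N.

Lemma first_indexP (P : nat -> Prop) : (exists j, P j) -> P (first_index P).
Proof.
move=> [j Pj]; rewrite /first_index; case: pselect => [h|[]]; last by exists j; apply/asboolP.
by case: ex_minnP => m /asboolP.
Qed.

Lemma first_indexE (P : nat -> Prop) j : first_index P = j <->
  (P j /\ forall i, (i < j)%N -> ~ P i) \/ (j = 0%N /\ forall i, ~ P i).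
Proof.
rewrite /first_index; case: pselect => [h|nh].
  case: ex_minnP => m /asboolP Pm mmin; split=> [<-|[[Pj jmin]|[_ nP]]].
  - by left; split => // i im Pi; have := mmin i (asboolT Pi); rewrite leqNgt im.
  - apply/eqP; rewrite eqn_leq mmin ?asboolT//= leqNgt; apply/negP => mj.
    exact: jmin mj Pm.
  - by have := nP m.
split=> [<-|[[Pj _]|[-> //]]]; last by exfalso; apply: nh; exists j; apply/asboolP.
by right; split => // i Pi; apply: nh; exists i; apply/asboolP.
Qed.

Lemma measurable_first_index d (T : measurableType d) (B : nat -> set T) j :
  (forall n, measurable (B n)) -> measurable [set r | first_index (fun i => B i r) = j].
Proof.
move=> mB.
have -> : [set r | first_index (fun i => B i r) = j] =
    (B j `\` \bigcup_(i in [set i | (i < j)%N]) B i) `|`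
    (if j is 0%N then ~` \bigcup_i B i else set0).
  apply/seteqP; split => r /=.
    move=> /first_indexE[[Bj h]|[-> h]]; [left; split => // -[i ij]|right => -[i _]]; exact: h.
  move=> [[Bj h]|h]; apply/first_indexE.
    by left; split => // i ij Bi; apply: h; exists i.
  by case: j h => // h; right; split => // i Bi; apply: h; exists i.
apply: measurableU; first by apply: measurableD => //; exact: bigcup_measurable.
by case: j => //; apply: measurableC; exact: bigcup_measurable.
Qed.

End FirstIndex.

Section Selection.
Context {R : realType} {X : normedModType R}.
Notation mu := (@lebesgue_measure R).
Hypothesis Xsep : separable_space (X := X).
Variables (T : R) (y : nat -> X -> R).
Hypothesis dy : forall n, is_dual (y n).
Hypothesis y_dense : forall xi (e : R), is_dual xi -> 0 < e ->
  exists n, dnorm (fun u => xi u - y n u) < e.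

(** Weak-* lower semicontinuity of the dual norm, tested vector by vector. *)
Lemma weak_limit_dist (xn : nat -> X -> R) (xi z : X -> R) (c : R)
    (F : set_system nat) {FF : ProperFilter F} : 0 <= c ->
  (forall n, is_dual (xn n)) -> is_dual z ->
  (\forall n \near F, dnorm (fun u => xn n u - z u) <= c) ->
  (forall u, xn n u @[n --> F] --> xi u) -> dnorm (fun u => xi u - z u) <= c.
Proof.
move=> c0 dx dz h xnxi; apply: dual_norm_le => // u.
have lim : (xn n u - z u) @[n --> F] --> xi u - z u by apply: rcvgB => //; exact: cvg_cst.
rewrite ler_norml; apply/andP; split.
  apply: (cvg_lim_ge lim); apply: filterS h => n hn.
  have := dual_le u (is_dualB (dx n) dz); rewrite ler_norml => /andP[h1 _].
  by apply: le_trans h1; rewrite lerN2 ler_wpM2r.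
apply: (cvg_lim_le lim); apply: filterS h => n hn.
have := dual_le u (is_dualB (dx n) dz); rewrite ler_norml => /andP[_ h1].
by apply: (le_trans h1); rewrite ler_wpM2r.
Qed.

Lemma weak_closed_ball (z : X -> R) (c : R) : is_dual z -> 0 <= c ->
  weak_closed T (fun r xi _ => dnorm (fun u => xi u - z u) <= c).
Proof.
move=> dz c0 M rn xn sn r xi s h _ _ _ xnxi _.
by apply: (weak_limit_dist (F := \oo) c0 _ dz _ xnxi);
  [move=> n; have [] := h n|apply: nearW => n; have [] := h n].
Qed.

Variable A : R -> (X -> R) -> Prop.
Hypothesis aA : analytic T A.
Hypothesis A_closed : forall r (xn : nat -> X -> R) xi, 0 <= r <= T ->
  (forall n, is_dual (xn n) /\ A r (xn n)) -> is_dual xi ->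
  dnorm (fun u => xn n u - xi u) @[n --> \oo] --> (0 : R) -> A r xi.

Let e_ (n : nat) : R := n.+1%:R^-1.
Let e0 n : 0 < e_ n. Proof. by rewrite invr_gt0. Qed.

(** The indices in [s] localize the force in norm balls of radii [1 / (i + 1)]. There are countably
    many lists [s], and the projection of each cell is measurable up to a null set. *)
Let cell (s : seq nat) (r : R) (xi : X -> R) := A r xi /\
  forall i, (i < size s)%N -> dnorm (fun u => xi u - y (nth 0%N s i) u) <= e_ i.

Let analytic_cell s : analytic T (cell s).
Proof.
apply: analytic_and => //; apply: analytic_forall => i; apply: analytic_closed.
have [il|il] := ltnP i (size s); last by move=> M rn xn sn r xi s' *; lia.
move=> M rn xn sn r xi s' h rnr rT dxi xnxi sns _.
apply: (@weak_closed_ball (y (nth 0%N s i)) (e_ i) (dy _) (ltW (e0 i)) M rn xn sn r xi s') => //.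
by move=> n; have [h1 h2 h3 h4] := h n; split => //; exact: h4.
Qed.

(** At each time the list of indices is extended by the first one whose cell still contains an
    element of [A]; this depends measurably on [r] because the projections of the cells are
    measurable up to null sets. Elements of the successive cells converge in norm, and the limit
    stays in [A] by closedness. *)
Lemma measurable_selection (N0 : set R) : mu.-negligible N0 ->
  (forall r, 0 <= r <= T -> ~ N0 r -> exists xi, is_dual xi /\ A r xi) ->
  exists (Xi : R -> X -> R) (J : nat -> R -> nat) (N : set R),
    [/\ mu.-negligible N, forall r, is_dual (Xi r),
        forall n j, measurable [set r : R | J n r = j],
        forall n r, dnorm (fun u => Xi r u - y (J n r) u) <= n.+1%:R^-1 &
        forall r, 0 <= r <= T -> ~ N r -> A r (Xi r)].
Proof.
move=> negN0 exA.
have /choice[Bf BfP] (sm : seq nat * nat) : exists B : set R, [/\ measurable B,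
    B `<=` proj_ball T (cell sm.1) sm.2%:R & mu.-negligible (proj_ball T (cell sm.1) sm.2%:R `\` B)].
  exact: proj_ball_measurable (analytic_cell sm.1).
pose B s := \bigcup_m Bf (s, m).
have mB s : measurable (B s) by apply: bigcup_measurable => m _; have [] := BfP (s, m).
(* Collects the null defects of all cells and all radii: outside this set, lying in a projection is
   the same as lying in its measurable part. *)
pose Nb := N0 `|` \bigcup_k (if (unpickle k : option (seq nat * nat)) is Some sm then
  proj_ball T (cell sm.1) sm.2%:R `\` Bf sm else set0).
have negNb : mu.-negligible Nb.
  apply: negligibleU => //; apply: negligible_bigcup => k.
  by case: unpickle => [sm|]; [have [] := BfP sm|exact: negligible_set0].
have [Nm [mNm Nm0 NbNm]] := negNb.
have inB s r xi : ~ Nm r -> 0 <= r <= T -> is_dual xi -> cell s r xi -> B s r.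
  move=> nN rT dxi cxi; exists (Num.truncn (dnorm xi)).+1 => //.
  set m := _.+1; apply: contrapT => nB; apply: nN; apply: NbNm; right.
  exists (pickle (s, m)); [exact: Logic.I|rewrite pickleK; split => //=].
  by split => //; exists xi; split => //; exact/ltW/truncnS_gt.
have ofB s r : B s r -> exists xi, is_dual xi /\ cell s r xi.
  by move=> [m _]; have [_ sub _] := BfP (s, m) => /sub[_ [xi [dxi _ cxi]]]; exists xi.
pose Gd : set R := `[0, T]%classic `\` Nm.
have mGd : measurable Gd by apply: measurableD => //; exact: measurable_itv.
pose nx s r := first_index (fun j => (Gd `&` B (rcons s j)) r).
pose L := fix L n r := if n is k.+1 then rcons (L k r) (nx (L k r) r) else [::].
pose J n r := nx (L n r) r.
have Lsz n r : size (L n r) = n by elim: n => //= n IH; rewrite size_rcons IH.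
have mnx s j : measurable [set r | nx s r = j].
  by apply: measurable_first_index => n; apply: measurableI.
have mL n s : measurable [set r | L n r = s].
  elim: n s => [|n IH] s /=.
    have [->|s0] := eqVneq s [::]; first by rewrite (_ : [set _ | _] = setT)//; exact/seteqP.
    by rewrite (_ : [set _ | _] = set0)//; apply/seteqP; split => // r /esym/eqP; rewrite (negbTE s0).
  case/lastP: s => [|s j].
    rewrite (_ : [set _ | _] = set0)//; apply/seteqP; split => // r /= /(congr1 size).
    by rewrite size_rcons.
  rewrite (_ : [set _ | _] = [set r | L n r = s] `&` [set r | nx s r = j]).
    exact: measurableI.
  apply/seteqP; split => r /=; first by move=> /rcons_inj[-> ->].
  by move=> [-> ->].
have [dec decP] : exists dec : nat -> seq nat, forall s, exists k, dec k = s.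
  exists (fun k => odflt [::] (unpickle k)) => s; exists (pickle s).
  by rewrite (pickleK s).
have mJ n j : measurable [set r | J n r = j].
  rewrite (_ : [set _ | _] = \bigcup_k ([set r | L n r = dec k] `&` [set r | nx (dec k) r = j])).
    by apply: bigcup_measurable => k _; exact: measurableI.
  apply/seteqP; split => r /=; last by move=> [k _] /= [<-].
  by move=> h; have [k kL] := decP (L n r); exists k => //=; rewrite kL.
have LB n r : Gd r -> B (L n r) r.
  move=> Gr; have [rT nN] := Gr; have {}rT : 0 <= r <= T by move: rT; rewrite /= in_itv.
  elim: n => [|n IH] /=.
    have [|xi [dxi Axi]] := exA r rT; first by move=> N0r; apply: nN; apply: NbNm; left.
    exact: (inB _ _ _ nN rT dxi).
  suff [] : (Gd `&` B (rcons (L n r) (nx (L n r) r))) r by [].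
  apply: (first_indexP (P := fun j => (Gd `&` B (rcons (L n r) j)) r)).
  have [xi [dxi [Axi cxi]]] := ofB _ _ IH.
  have [j xij] := y_dense dxi (e0 n); exists j; split => //.
  apply: (inB _ _ _ nN rT dxi); split => // i; rewrite size_rcons Lsz ltnS leq_eqVlt nth_rcons Lsz.
  move=> /predU1P[->|il]; first by rewrite ltnn eqxx; exact: ltW.
  by rewrite il; apply: cxi; rewrite Lsz.
have nthL n r i : (i < n)%N -> nth 0%N (L n r) i = J i r.
  elim: n => // n IH; rewrite ltnS leq_eqVlt /= nth_rcons Lsz => /predU1P[->|il].
    by rewrite ltnn eqxx.
  by rewrite il IH.
have [U UU Uoo] := exists_ultra_oo.
have ex r : exists xi, [/\ is_dual xi,
    forall n, dnorm (fun u => xi u - y (J n r) u) <= e_ n & Gd r -> A r xi].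
  (* Off [Gd] no index is admissible, so every [J n r] takes the default value 0 and [y 0] is
     selected. *)
  have [Gr|nG] := pselect (Gd r); last first.
    exists (y 0%N); split => // n.
    have -> : J n r = 0%N by apply/first_indexE; right; split => // i [].
    by rewrite dual_normBB; exact: ltW.
  have /choice[x xP] n := ofB _ _ (LB n r Gr).
  have dx n : is_dual (x n) by have [] := xP n.
  have xJ n i : (i < n)%N -> dnorm (fun u => x n u - y (J i r) u) <= e_ i.
    by move=> il; have [_ [_ h]] := xP n; rewrite -(nthL n r i il); apply: h; rewrite Lsz.
  have [||xi [dxi _ xxi]] := @weak_star_ultra R X U UU (fun n => x n.+1) (dnorm (y (J 0%N r)) + e_ 0%N).
  - by [].
  - move=> n; have -> : x n.+1 = (fun u => (x n.+1 u - y (J 0%N r) u) + y (J 0%N r) u).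
      by apply/funext => u; rewrite subrK.
    apply: (le_trans (dual_normD (is_dualB (dx _) (dy _)) (dy _))).
    by rewrite addrC lerD2l xJ.
  have xiJ n : dnorm (fun u => xi u - y (J n r) u) <= e_ n.
    apply: (weak_limit_dist (F := U) (ltW (e0 n)) (fun n => dx n.+1) (dy _) _ xxi).
    by apply: filterS (Uoo n) => k /= nk; apply: xJ.
  exists xi; split => // _.
  have [rT _] := Gr; have {}rT : 0 <= r <= T by move: rT; rewrite /= in_itv.
  apply: (A_closed (xn := x)) => //.
    by move=> n; have [? [? _]] := xP n.
  apply/cvgrPdist_le => e egt0.
  have e2 : 0 < e / 2 by rewrite divr_gt0.
  have [k _ kP] := near_infty_natSinv_lt (PosNum e2).
  exists k.+1 => // n /= kn; rewrite sub0r normrN ger0_norm; last exact/dual_norm_ge0/is_dualB.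
  apply: (le_trans (dual_norm_triangle (xi2 := y (J k r)) _ _ _)) => //.
  have h1 := xJ n k kn; have h2 := xiJ k; have h3 := kP k (leqnn k).
  rewrite (dual_normBC (dy _) dxi); move: h3; rewrite /= -/(e_ k); lra.
have /choice[Xi XiP] := ex.
exists Xi, J, Nm; split => //.
- by exists Nm; split.
- by move=> r; have [] := XiP r.
- by move=> n r; have [_ + _] := XiP r; apply.
- by move=> r rT nN; have [_ _] := XiP r; apply; split => //; rewrite /= in_itv.
Qed.

End Selection.

(** * Minimizing movements *)

(* The hypotheses of the theorem for the real-valued energy [e = fine E] and
   the bound [g = fine G] on the common domain [D]. *)
Record real_ggs {R : realType} {X : completeNormedModType R} (T K1 K2 : R)
    (e : R -> X -> R) (g : X -> R) (D : set X) (Psi : X -> X -> R)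
    (F : R -> X -> set (X -> R)) (Pw : R -> X -> (X -> R) -> R) : Prop := RealGGS {
  ggs_T : 0 < T;
  ggs_K1 : 0 < K1;
  ggs_K2 : 0 < K2;
  ggs_dual : forall t P Xi, 0 <= t <= T -> D P -> F t P Xi -> is_dual Xi;
  ggs_g : forall t P, 0 <= t <= T -> D P -> 0 <= g P <= e t P;
  ggs_lip : forall s t P, 0 <= s <= T -> 0 <= t <= T -> D P ->
    `|e t P - e s P| <= K1 * g P * `|t - s|;
  ggs_compact : forall t c, 0 <= t <= T -> compact [set P | D P /\ e t P <= c];
  ggs_min : forall Ps tau t Pb, D Ps -> 0 < tau -> 0 <= t <= T -> D Pb ->
    (forall P, D P -> e t Pb + tau * Psi Ps (tau^-1 *: (Pb - Ps))
                   <= e t P + tau * Psi Ps (tau^-1 *: (P - Ps))) ->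
    exists2 Xi, F t Pb Xi & subdiff (Psi Ps) (tau^-1 *: (Pb - Ps)) (fun V => - Xi V);
  ggs_power : forall t P Xi, 0 < t < T -> D P -> F t P Xi ->
    forall d eps : R, 0 < d -> 0 < eps -> exists h, [/\ 0 < h, h < d &
      (e (t + h) P - e t P) / h <= Pw t P Xi + eps];
  ggs_power_le : forall t P Xi, 0 <= t <= T -> D P -> F t P Xi -> Pw t P Xi <= K2 * g P;
  ggs_closed : forall t (Pn : nat -> X) P (Xin : nat -> X -> R) Xi cE cP, 0 <= t <= T ->
    (forall n, D (Pn n) /\ F t (Pn n) (Xin n)) -> D P ->
    Pn n @[n --> \oo] --> P -> weak_cvg_dual Xin Xi ->
    e t (Pn n) @[n --> \oo] --> cE -> Pw t (Pn n) (Xin n) @[n --> \oo] --> cP ->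
    [/\ F t P Xi, cP <= Pw t P Xi & cE = e t P];
  ggs_Psi_lsc : forall P, D P -> lower_semicontinuous (fun V => (Psi P V)%:E);
  ggs_Psi_cvx : forall P, D P -> convex_fun (Psi P);
  ggs_Psi0 : forall P, D P -> Psi P 0 = 0;
  ggs_Psi_ge0 : forall P V, D P -> 0 <= Psi P V;
  ggs_Psi_coercive : forall S M : R, exists2 C : R, 0 <= C &
    forall P V, D P -> g P <= S -> M * `|V| <= Psi P V + C;
  ggs_conj_coercive : forall S M : R, exists2 C : R, 0 <= C &
    forall P Xi c, D P -> g P <= S -> is_dual Xi -> (fconj (Psi P) Xi <= c%:E)%E ->
      M * dnorm Xi <= c + C;
  ggs_Psi_liminf : forall (S c : R) (Pn : nat -> X) P (Vn : nat -> X) V,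
    Pn n @[n --> \oo] --> P -> (forall n, D (Pn n) /\ g (Pn n) <= S) -> weak_cvg Vn V ->
    (forall n, Psi (Pn n) (Vn n) <= c) -> Psi P V <= c;
  ggs_conj_liminf : forall (S c : R) (Pn : nat -> X) P (Xin : nat -> X -> R) Xi,
    Pn n @[n --> \oo] --> P -> (forall n, D (Pn n) /\ g (Pn n) <= S) ->
    weak_cvg_dual Xin Xi ->
    (forall n, (fconj (Psi (Pn n)) (Xin n) <= c%:E)%E) -> (fconj (Psi P) Xi <= c%:E)%E;
  ggs_conj_eq : forall P V Xi1 Xi2, D P ->
    subdiff (Psi P) V Xi1 -> subdiff (Psi P) V Xi2 ->
    fconj (Psi P) Xi1 = fconj (Psi P) Xi2 }.

Section Scheme.
Context {R : realType} {X : completeNormedModType R} (T K1 K2 : R).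
Context (e : R -> X -> R) (g : X -> R) (D : set X) (Psi : X -> X -> R).
Context (F : R -> X -> set (X -> R)) (Pw : R -> X -> (X -> R) -> R).
Hypothesis G : real_ggs T K1 K2 e g D Psi F Pw.

Lemma sublevel_closed t c : 0 <= t <= T -> closed [set P | D P /\ e t P <= c].
Proof. by move=> tT; apply: compact_closed; [exact: norm_hausdorff|exact: (ggs_compact G)]. Qed.

Lemma energy_filter_lim (I : Type) (U : set_system I) {FU : ProperFilter U}
    (Pn : I -> X) P t c : 0 <= t <= T ->
  Pn n @[n --> U] --> P -> (\forall n \near U, D (Pn n) /\ e t (Pn n) <= c) ->
  D P /\ e t P <= c.
Proof.
move=> tT PnP h.
by apply: (@closed_cvg _ _ U _ Pn _ (@sublevel_closed t c tT) _ P PnP).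
Qed.

Lemma Psi_sublevel_closed P c : D P -> closed [set V | Psi P V <= c].
Proof.
move=> DP; rewrite -openC; have := (lower_semicontinuousP _).1 (ggs_Psi_lsc G DP) c.
congr open; apply/seteqP; split => V /=; rewrite lte_fin ltNge; first by move/negP.
by move=> h; apply/negP.
Qed.

Definition step_energy t tau Ps P := e t P + tau * Psi Ps (tau^-1 *: (P - Ps)).

(** Direct method. Along the ultrafilter the energies and the dissipations of a minimizing sequence
    converge separately, compactness of the energy sublevels gives a limit point, and the sublevels
    of each term are closed. *)
Lemma step_minimizer t tau Ps : 0 <= t <= T -> 0 < tau -> D Ps ->
  exists Pb, D Pb /\ forall P, D P -> step_energy t tau Ps Pb <= step_energy t tau Ps P.
Proof.
move=> tT tau0 DPs.
pose A := [set step_energy t tau Ps P | P in D].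
have A0 : has_inf A.
  split; first by exists (step_energy t tau Ps Ps); exists Ps.
  exists 0 => _ [P DP <-]; have /andP[g0 ge] := ggs_g G tT DP.
  apply: addr_ge0; first exact: le_trans ge.
  by apply: mulr_ge0; [exact: ltW|exact: (ggs_Psi_ge0 G)].
set m := inf A.
have /choice[Pn PnP] (n : nat) : exists P, D P /\ step_energy t tau Ps P < m + n.+1%:R^-1.
  have [|_ [P DP <-] Pm] := inf_adherent (_ : 0 < n.+1%:R^-1 :> R) A0.
    by rewrite invr_gt0.
  by exists P.
have [U UU Uoo] := exists_ultra_oo.
have inv1 n : n.+1%:R^-1 <= 1 :> R by rewrite invf_le1// ler1n.
have e0 n : 0 <= e t (Pn n).
  by have [/(ggs_g G tT)/andP[h1 h2] _] := PnP n; exact: le_trans h2.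
have p0 n : 0 <= tau * Psi Ps (tau^-1 *: (Pn n - Ps)).
  by apply: mulr_ge0; [exact: ltW|exact: (ggs_Psi_ge0 G)].
have en n : e t (Pn n) <= m + 1.
  have [_ h] := PnP n; have := p0 n; move: h (inv1 n); rewrite /step_energy; move: (n.+1%:R^-1) => q; lra.
have pn n : Psi Ps (tau^-1 *: (Pn n - Ps)) <= (m + 1) / tau.
  rewrite ler_pdivlMr// [leLHS]mulrC.
  have [_ h] := PnP n; have := e0 n; move: h (inv1 n); rewrite /step_energy; move: (n.+1%:R^-1) => q; lra.
have [|Pb [DPb _] PnPb] := @ultra_compact U UU _ _ Pn (@ggs_compact _ _ _ _ _ _ _ _ _ _ _ G t (m + 1) tT).
  by move=> n; split => //; have [] := PnP n.
have [a _ ena] := @ultra_bounded R U UU (fun n => e t (Pn n)) (m + 1)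
  (fun n => ltac:(by rewrite ger0_norm)).
have [b _ pnb] := @ultra_bounded R U UU (fun n => Psi Ps (tau^-1 *: (Pn n - Ps))) ((m + 1) / tau)
  (fun n => ltac:(by rewrite ger0_norm// (ggs_Psi_ge0 G))).
have Ea : e t Pb <= a.
  apply/ler_addgt0Pr => d d0.
  have [|_ //] := @energy_filter_lim _ U _ Pn Pb t (a + d) tT PnPb.
  have ad : a < a + d by rewrite ltrDl.
  apply: filterS (cvgr_lt _ ena _ ad) => n /ltW h; split => //; by have [] := PnP n.
have Pb_b : Psi Ps (tau^-1 *: (Pb - Ps)) <= b.
  apply/ler_addgt0Pr => d d0.
  have bd : b < b + d by rewrite ltrDl.
  have VV : tau^-1 *: (Pn n - Ps) @[n --> U] --> tau^-1 *: (Pb - Ps).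
    by apply: cvgZr; apply: cvgB => //; exact: cvg_cst.
  apply: (closed_cvg _ (@Psi_sublevel_closed Ps (b + d) DPs) _ _ VV).
  by apply: filterS (cvgr_lt _ pnb _ bd) => n /ltW.
have abm : a + tau * b <= m.
  have lim : (e t (Pn n) + tau * Psi Ps (tau^-1 *: (Pn n - Ps))) @[n --> U] --> a + tau * b.
    by apply: rcvgD => //; exact: rcvgZ.
  apply/ler_addgt0Pr => d d0; apply: (cvg_lim_le lim).
  have [k _ kd] := near_infty_natSinv_lt (PosNum d0).
  apply: filterS (Uoo k) => n /kd /= nd; have [_ h] := PnP n.
  by move: h nd; rewrite /step_energy; move: (n.+1%:R^-1) => q; lra.
exists Pb; split => // P DP.
apply: (@le_trans _ _ m); last by apply: ge_inf; [exact: A0.2|exists P].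
have : tau * Psi Ps (tau^-1 *: (Pb - Ps)) <= tau * b by rewrite ler_pM2l.
rewrite /step_energy; lra.
Qed.

Lemma exists_argmin : exists mn : R -> R -> X -> X, forall t tau Ps,
  0 <= t <= T -> 0 < tau -> D Ps ->
  D (mn t tau Ps) /\ forall P, D P ->
    step_energy t tau Ps (mn t tau Ps) <= step_energy t tau Ps P.
Proof.
have ex (q : R * R * X) : exists Pb, 0 <= q.1.1 <= T -> 0 < q.1.2 -> D q.2 ->
    D Pb /\ forall P, D P -> step_energy q.1.1 q.1.2 q.2 Pb <= step_energy q.1.1 q.1.2 q.2 P.
  have [[h1 [h2 h3]]|nh] := pselect (0 <= q.1.1 <= T /\ 0 < q.1.2 /\ D q.2).
    by have [Pb h] := step_minimizer h1 h2 h3; exists Pb.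
  by exists 0 => h1 h2 h3; exfalso; apply: nh.
have [f fP] := choice ex.
by exists (fun t tau Ps => f (t, tau, Ps)) => t tau Ps; exact: (fP (t, tau, Ps)).
Qed.

Variables (mn : R -> R -> X -> X) (P0 : X).
Hypothesis mnP : forall t tau Ps, 0 <= t <= T -> 0 < tau -> D Ps ->
  D (mn t tau Ps) /\ forall P, D P ->
    step_energy t tau Ps (mn t tau Ps) <= step_energy t tau Ps P.
Hypothesis DP0 : D P0.

Variable N : nat.
Definition tau : R := T / N.+1%:R.
Definition node (k : nat) : R := k%:R * tau.
Fixpoint pk (k : nat) : X := if k is j.+1 then mn (node j.+1) tau (pk j) else P0.
Definition dissk (k : nat) : R := tau * Psi (pk k) (tau^-1 *: (pk k.+1 - pk k)).

Lemma tau_gt0 : 0 < tau.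
Proof. by rewrite divr_gt0// (ggs_T G). Qed.

Lemma node_itv k : (k <= N.+1)%N -> 0 <= node k <= T.
Proof.
move=> kN; rewrite mulr_ge0 ?(ltW tau_gt0)//=.
rewrite /node /tau mulrCA ger_pMr ?(ggs_T G)// ler_pdivrMr// mul1r ler_nat//.
Qed.

Lemma nodeS k : node k.+1 = node k + tau.
Proof. by rewrite /node -natr1 mulrDl mul1r. Qed.

Lemma node_lt j k : (j <= k)%N -> node j <= node k.
Proof. by move=> jk; rewrite ler_wpM2r ?(ltW tau_gt0)// ler_nat. Qed.

Lemma pk_D k : (k <= N.+1)%N -> D (pk k).
Proof.
elim: k => // k IH kN /=; have [] // := mnP (node_itv kN) tau_gt0 (IH (ltnW kN)).
Qed.

Lemma step_energy_ge0 t s Ps P : 0 <= t <= T -> 0 <= s -> D Ps -> D P ->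
  0 <= s * Psi Ps (s^-1 *: (P - Ps)) /\ 0 <= step_energy t s Ps P.
Proof.
move=> tT s0 DPs DP; have h : 0 <= s * Psi Ps (s^-1 *: (P - Ps)).
  by rewrite mulr_ge0// (ggs_Psi_ge0 G).
split => //; apply: addr_ge0 => //.
by have /andP[h1] := ggs_g G tT DP; exact: le_trans.
Qed.

Lemma step_energy_self t s Ps : D Ps -> step_energy t s Ps Ps = e t Ps.
Proof. by move=> DPs; rewrite /step_energy subrr scaler0 (ggs_Psi0 G)// mulr0 addr0. Qed.

Lemma dissk_ge0 k : (k <= N.+1)%N -> 0 <= dissk k.
Proof. by move=> kN; rewrite mulr_ge0 ?(ltW tau_gt0)// (ggs_Psi_ge0 G)//; exact: pk_D. Qed.

Lemma energy_step_le k : (k < N.+1)%N ->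
  e (node k.+1) (pk k.+1) + dissk k <= (1 + K1 * tau) * e (node k) (pk k).
Proof.
move=> kN; have DPk := pk_D (ltnW kN).
have [_ /(_ _ DPk)] := mnP (node_itv kN) tau_gt0 DPk.
rewrite step_energy_self// => /le_trans; apply.
have := ggs_lip G (node_itv (ltnW kN)) (node_itv kN) DPk.
rewrite nodeS [node k + _]addrC addrK (gtr0_norm tau_gt0) ler_norml => /andP[_ h].
have /andP[_ gle] := ggs_g G (node_itv (ltnW kN)) DPk.
have h2 : K1 * g (pk k) * tau <= K1 * e (node k) (pk k) * tau.
  by rewrite ler_wpM2r ?(ltW tau_gt0)// ler_wpM2l// ltW// (ggs_K1 G).
by move: h h2; rewrite [tau + _]addrC; lra.
Qed.

(** Discrete Gronwall bound: each step multiplies the energy by at most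
    [1 + K1 * tau <= expR (K1 * tau)]. *)
Definition bound1 : R := expR (K1 * T) * e 0 P0.

Lemma energy_node_le k : (k <= N.+1)%N -> e (node k) (pk k) <= bound1.
Proof.
move=> kN; have e0 : 0 <= e 0 P0.
  have T0 : 0 <= (0 : R) <= T by rewrite lexx ltW// (ggs_T G).
  by have /andP[h1] := ggs_g G T0 DP0; exact: le_trans.
have K1t : 0 <= 1 + K1 * tau by rewrite addr_ge0// mulr_ge0 ?(ltW tau_gt0)// ltW// (ggs_K1 G).
have : e (node k) (pk k) <= (1 + K1 * tau) ^+ k * e 0 P0.
  elim: k kN => [|k IH] kN; first by rewrite /node mul0r expr0 mul1r.
  have h := energy_step_le kN; have h2 := dissk_ge0 (ltnW kN).
  apply: (@le_trans _ _ ((1 + K1 * tau) * e (node k) (pk k))); first by lra.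
  by rewrite exprS -mulrA ler_wpM2l// IH// ltnW.
move=> /le_trans; apply; rewrite ler_wpM2r//.
apply: (@le_trans _ _ (expR (K1 * tau) ^+ k)).
  by apply: lerXn2r; rewrite ?nnegrE ?expR_ge0// ?expR_ge1Dx//.
rewrite -expRM_natl ler_expR mulrCA ler_wpM2l//; first by rewrite ltW// (ggs_K1 G).
by have /andP[] := node_itv kN.
Qed.

(** The extra factor pays for evaluating the energy of a node at any other time of [[0, T]]; [rate]
    is then a Lipschitz constant in time for the energy of states with [g <= bound]. *)
Definition bound : R := (1 + K1 * T) * bound1.
Definition rate : R := K1 * bound.
Definition cumul (k : nat) : R := \sum_(0 <= l < k) dissk l.
Definition kap (t : R) : nat := Num.truncn (t / tau).
(** De Giorgi's interpolant. At the node the step has length 0 and [pk k] is kept; the incremental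
    energy is then the bare energy. *)
Definition interp (k : nat) (t : R) : X :=
  if t == node k then pk k else mn t (t - node k) (pk k).
Definition vfun (k : nat) (t : R) : R := step_energy t (t - node k) (pk k) (interp k t).
Definition lyap (t : R) : R := vfun (kap t) t + cumul (kap t).

Lemma bound1_ge0 : 0 <= bound1.
Proof.
apply: le_trans (energy_node_le (leq0n _)).
have /andP[h1] := ggs_g G (node_itv (leq0n N.+1)) DP0; exact: le_trans.
Qed.

Lemma bound1_le : bound1 <= bound.
Proof.
rewrite /bound ler_peMl ?bound1_ge0// lerDl mulr_ge0// ltW//.
  exact: (ggs_K1 G).
exact: (ggs_T G).
Qed.

Lemma bound_ge0 : 0 <= bound.
Proof. exact: le_trans bound1_ge0 bound1_le. Qed.

Lemma rate_ge0 : 0 <= rate.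
Proof. by rewrite mulr_ge0 ?bound_ge0// ltW// (ggs_K1 G). Qed.

Lemma kapP t : 0 <= t <= T ->
  [/\ (kap t <= N.+1)%N, node (kap t) <= t & t < node (kap t) + tau].
Proof.
move=> /andP[t0 tT]; have tt : 0 <= t / tau by rewrite divr_ge0// ltW// tau_gt0.
have /andP[h1 h2] := truncn_itv tt; split.
- rewrite truncn_le_nat (@le_lt_trans _ _ N.+1%:R) ?ltr_nat//.
  rewrite ler_pdivrMr ?tau_gt0// /tau mulrC divfK ?pnatr_eq0//.
- by rewrite /node -ler_pdivlMr ?tau_gt0.
- by rewrite -nodeS /node -ltr_pdivrMr ?tau_gt0.
Qed.

Lemma kap_eq t k : node k <= t -> t < node k + tau -> kap t = k.
Proof.
move=> h1 h2; apply: truncn_def; rewrite ler_pdivlMr ?tau_gt0// ltr_pdivrMr ?tau_gt0//.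
by rewrite h1 -nodeS in h2 *.
Qed.

Lemma kap_le s t : s <= t -> (kap s <= kap t)%N.
Proof. by move=> st; apply: le_truncn; rewrite ler_wpM2r// invr_ge0 ltW// tau_gt0. Qed.

Lemma energy_pk_le k t : (k <= N.+1)%N -> 0 <= t <= T -> e t (pk k) <= bound.
Proof.
move=> kN tT; have DPk := pk_D kN; have nk := node_itv kN.
have := ggs_lip G nk tT DPk; rewrite ler_norml => /andP[_ h].
have /andP[g0 ge] := ggs_g G nk DPk.
have en := energy_node_le kN.
have tn : `|t - node k| <= T.
  by rewrite ler_norml; apply/andP; split; move: tT nk => /andP[? ?] /andP[? ?]; lra.
have h1 : K1 * g (pk k) * `|t - node k| <= K1 * bound1 * T.
  apply: ler_pM => //; first by rewrite mulr_ge0// ltW// (ggs_K1 G).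
  by rewrite ler_wpM2l ?(ltW (ggs_K1 G))//; exact: le_trans en.
rewrite /bound mulrDl mul1r -mulrA [T * _]mulrC mulrA; lra.
Qed.

Lemma g_pk_le k : (k <= N.+1)%N -> g (pk k) <= bound.
Proof.
move=> kN; have /andP[_ ge] := ggs_g G (node_itv kN) (pk_D kN).
exact: (le_trans ge (energy_pk_le kN (node_itv kN))).
Qed.

Lemma interp_D k t : (k <= N.+1)%N -> 0 <= t <= T -> node k <= t -> D (interp k t).
Proof.
move=> kN tT kt; rewrite /interp; case: eqVneq => [_|tk]; first exact: pk_D.
have [] // := @mnP t (t - node k) (pk k) tT _ (pk_D kN).
by rewrite subr_gt0 lt_neqAle eq_sym tk.
Qed.

Lemma vfun_le k t P : (k <= N.+1)%N -> 0 <= t <= T -> node k < t -> D P ->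
  vfun k t <= step_energy t (t - node k) (pk k) P.
Proof.
move=> kN tT kt DP; rewrite /vfun /interp gt_eqF//.
have s0 : 0 < t - node k by rewrite subr_gt0.
by have [_ h] := mnP tT s0 (pk_D kN); exact: h.
Qed.

Lemma vfun_at_node k : (k <= N.+1)%N -> vfun k (node k) = e (node k) (pk k).
Proof.
by move=> kN; rewrite /vfun /interp eqxx step_energy_self//; exact: pk_D.
Qed.

Lemma vfun_le_pk k t : (k <= N.+1)%N -> 0 <= t <= T -> node k <= t ->
  vfun k t <= e t (pk k).
Proof.
move=> kN tT; rewrite le_eqVlt => /predU1P[<-|kt]; first by rewrite vfun_at_node.
by apply: (le_trans (vfun_le kN tT kt (pk_D kN))); rewrite step_energy_self//; exact: pk_D.
Qed.

Lemma interp_bounds k t : (k <= N.+1)%N -> 0 <= t <= T -> node k <= t ->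
  [/\ 0 <= g (interp k t), g (interp k t) <= e t (interp k t),
      e t (interp k t) <= vfun k t & vfun k t <= bound].
Proof.
move=> kN tT kt; have DI := interp_D kN tT kt.
have /andP[g0 ge] := ggs_g G tT DI; split => //; last first.
  exact: (le_trans (vfun_le_pk kN tT kt) (energy_pk_le kN tT)).
have s0 : 0 <= t - node k by rewrite subr_ge0.
have [h _] := step_energy_ge0 tT s0 (pk_D kN) DI.
by rewrite /vfun /step_energy lerDl.
Qed.

(** The minimizer at time [t] is tested at time [t']: its energy grows at most at speed [rate], and
    its dissipation term does not increase because the step is longer ([convex_fun_ray]). *)
Lemma vfun_mono k t t' : (k <= N.+1)%N -> 0 <= t -> t' <= T -> node k <= t -> t <= t' ->
  vfun k t' <= vfun k t + rate * (t' - t).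
Proof.
move=> kN t0 t'T kt; rewrite le_eqVlt => /predU1P[<-|tt']; first by rewrite subrr mulr0 addr0.
have tT : 0 <= t <= T by rewrite t0 (le_trans (ltW tt')).
have tT' : 0 <= t' <= T by rewrite t'T (le_trans t0 (ltW tt')).
have DI := interp_D kN tT kt; have Dk := pk_D kN.
have [g0 ge ev vb] := interp_bounds kN tT kt.
apply: (le_trans (vfun_le kN tT' (le_lt_trans kt tt') DI)).
have := ggs_lip G tT tT' DI; rewrite ler_norml => /andP[_ h].
have h1 : K1 * g (interp k t) * `|t' - t| <= rate * (t' - t).
  rewrite gtr0_norm ?subr_gt0//; apply: ler_wpM2r; first by rewrite subr_ge0 ltW.
  rewrite /rate; apply: ler_wpM2l; first exact: ltW (ggs_K1 G).
  exact: le_trans (le_trans ge ev) vb.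
suff : (t' - node k) * Psi (pk k) ((t' - node k)^-1 *: (interp k t - pk k)) <=
    (t - node k) * Psi (pk k) ((t - node k)^-1 *: (interp k t - pk k)).
  by rewrite /vfun /step_energy; lra.
move: kt; rewrite le_eqVlt => /predU1P[kt|kt].
  by rewrite -kt /interp eqxx subrr !scaler0 (ggs_Psi0 G)// !mulr0.
apply: convex_fun_ray; [exact: (ggs_Psi_cvx G)|exact: (ggs_Psi0 G)|by rewrite subr_gt0|].
by rewrite lerD2r ltW.
Qed.

Lemma vfun_next k : (k < N.+1)%N -> vfun k (node k.+1) = e (node k.+1) (pk k.+1) + dissk k.
Proof.
move=> kN; have sE : node k.+1 - node k = tau by rewrite nodeS addrC addKr.
have ne : (node k.+1 == node k) = false by rewrite gt_eqF// -subr_gt0 sE tau_gt0.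
by rewrite /vfun /interp ne sE.
Qed.

Lemma cumulS k : cumul k.+1 = cumul k + dissk k.
Proof. by rewrite /cumul big_nat_recr. Qed.

(** Nothing is lost across a node: by [vfun_next] the dissipation [dissk] leaves [vfun] and enters
    [cumul]. *)
Lemma lyap_node t k : 0 <= t <= T -> (kap t < k)%N -> (k <= N.+1)%N ->
  vfun k (node k) + cumul k <= lyap t + rate * (node k - t).
Proof.
move=> tT tk kN; have /andP[t0 tT'] := tT; have [ktN kt1 kt2] := kapP tT.
elim: k tk kN => // k IH; rewrite ltnS leq_eqVlt => /predU1P[kk|tk] kN.
  rewrite vfun_at_node// cumulS addrCA -vfun_next//.
  rewrite /lyap; move: kN; rewrite -kk => kN.
  have := @vfun_mono (kap t) t (node (kap t).+1) ktN t0.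
  have /andP[_ h] := node_itv kN; rewrite nodeS => /(_ _ kt1 (ltW kt2)).
  by rewrite -nodeS => /(_ h); lra.
have {}IH := IH tk (ltnW kN).
rewrite vfun_at_node// cumulS addrCA -vfun_next//.
have /andP[n0 _] := node_itv (ltnW kN); have /andP[_ nT] := node_itv kN.
have := vfun_mono (ltnW kN) n0 nT (lexx _) (node_lt (leqnSn k)).
lra.
Qed.

Lemma lyap_mono t t' : 0 <= t -> t <= t' -> t' <= T ->
  lyap t' <= lyap t + rate * (t' - t).
Proof.
move=> t0 tt' t'T; have tT : 0 <= t <= T by rewrite t0 (le_trans tt').
have tT' : 0 <= t' <= T by rewrite t'T (le_trans t0).
have [kN k1 k2] := kapP tT; have [kN' k1' k2'] := kapP tT'.
have := kap_le tt'; rewrite leq_eqVlt => /predU1P[kk|kk].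
  by have := vfun_mono kN t0 t'T k1 tt'; rewrite /lyap -kk; lra.
have h1 := lyap_node tT kk kN'.
have /andP[n0 _] := node_itv kN'.
have h2 := vfun_mono kN' n0 t'T (lexx _) k1'.
by rewrite {1}/lyap; lra.
Qed.

Lemma cumul_nd j k : (j <= k)%N -> (k <= N.+1)%N -> cumul j <= cumul k.
Proof.
move=> jk; elim: k jk => [|k IH]; first by rewrite leqn0 => /eqP ->.
rewrite leq_eqVlt => /predU1P[-> //|jk] kN.
apply: (le_trans (IH jk (ltnW kN))); rewrite cumulS lerDl dissk_ge0//.
exact: ltnW.
Qed.

Lemma lyap0 : lyap 0 = e 0 P0.
Proof.
have k0 : kap 0 = 0%N by rewrite /kap mul0r truncn0.
have n0 : node 0 = 0 by rewrite /node mul0r.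
by rewrite /lyap k0 -[X in vfun 0 X]n0 vfun_at_node// n0 /cumul big_geq// addr0.
Qed.

Lemma pk_increment (M C : R) j k : 0 <= M ->
  (forall P V, D P -> g P <= bound -> M * `|V| <= Psi P V + C) ->
  (j <= k)%N -> (k <= N.+1)%N ->
  M * `|pk k - pk j| <= cumul k - cumul j + C * (node k - node j).
Proof.
move=> M0 h jk; elim: k jk => [|k IH].
  by rewrite leqn0 => /eqP ->; rewrite !subrr normr0 !mulr0 addr0.
rewrite leq_eqVlt => /predU1P[->|jk] kN; first by rewrite !subrr normr0 !mulr0 addr0.
have {}IH := IH jk (ltnW kN).
have := h (pk k) (tau^-1 *: (pk k.+1 - pk k)) (pk_D (ltnW kN)) (g_pk_le (ltnW kN)).
rewrite normrZ gtr0_norm ?invr_gt0 ?tau_gt0// mulrCA -(ler_pM2l tau_gt0) mulVKf; last exact: lt0r_neq0 tau_gt0.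
rewrite mulrDr -/(dissk k) => h1.
have : M * `|pk k.+1 - pk j| <= M * `|pk k.+1 - pk k| + M * `|pk k - pk j|.
  by rewrite -mulrDr ler_wpM2l// (le_trans _ (ler_normD _ _))// addrA subrK.
by rewrite cumulS nodeS; lra.
Qed.

Lemma kap_increment (M C : R) s t : 0 <= M -> 0 <= C ->
  (forall P V, D P -> g P <= bound -> M * `|V| <= Psi P V + C) ->
  0 <= s -> s <= t -> t <= T ->
  M * `|pk (kap t) - pk (kap s)| <=
    cumul (kap t) - cumul (kap s) + C * (t - s + tau).
Proof.
move=> M0 C0 h s0 st tT.
have sT : 0 <= s <= T by rewrite s0 (le_trans st).
have tT' : 0 <= t <= T by rewrite tT (le_trans s0).
have [ks s1 s2] := kapP sT; have [kt t1 t2] := kapP tT'.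
apply: (le_trans (pk_increment M0 h (kap_le st) kt)).
by rewrite lerD2l ler_wpM2l//; lra.
Qed.

Lemma interp_dist (M C : R) t : 0 <= C ->
  (forall P V, D P -> g P <= bound -> M * `|V| <= Psi P V + C) ->
  0 <= t <= T -> M * `|interp (kap t) t - pk (kap t)| <= bound + C * tau.
Proof.
move=> C0 h tT; have [kN k1 k2] := kapP tT; set k := kap t in kN k1 k2 *.
have [g0 ge ev vb] := interp_bounds kN tT k1.
move: (k1); rewrite le_eqVlt => /predU1P[kt|kt].
  rewrite -{1}kt /interp eqxx subrr normr0 mulr0 addr_ge0 ?bound_ge0//.
  by rewrite mulr_ge0// ltW// tau_gt0.
have s0 : 0 < t - node k by rewrite subr_gt0.
have := h (pk k) ((t - node k)^-1 *: (interp k t - pk k)) (pk_D kN) (g_pk_le kN).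
rewrite normrZ gtr0_norm ?invr_gt0// mulrCA -(ler_pM2l s0) mulVKf; last exact: lt0r_neq0 s0.
rewrite mulrDr => h1.
have h2 : C * (t - node k) <= C * tau by rewrite ler_wpM2l//; lra.
have h3 : 0 <= e t (interp k t) by exact: le_trans ge.
by move: vb; rewrite /vfun /step_energy; lra.
Qed.

(** The Fenchel-Young inequality with one fixed covector at every step; the increments telescope. *)
Lemma cumul_minorant (xi : X -> R) (c : R) j k : is_dual xi -> (j <= k)%N -> (k <= N.+1)%N ->
  (forall l, (j <= l < k)%N -> (fconj (Psi (pk l)) xi <= c%:E)%E) ->
  xi (pk k - pk j) - c * (node k - node j) <= cumul k - cumul j.
Proof.
move=> dxi jk; elim: k jk => [|k IH].
  by rewrite leqn0 => /eqP -> _ _; rewrite !subrr (dual0 dxi) mulr0 subrr.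
rewrite leq_eqVlt => /predU1P[-> _ _|jk kN h].
  by rewrite !subrr (dual0 dxi) mulr0 subrr.
have {}IH : xi (pk k - pk j) - c * (node k - node j) <= cumul k - cumul j.
  by apply: IH (ltnW kN) _ => // l /andP[jl lk]; apply: h; rewrite jl ltnW.
have := le_trans (fconj_ge (Psi (pk k)) (tau^-1 *: (pk k.+1 - pk k)) xi) (h k _).
have jk' : (j <= k < k.+1)%N by rewrite ltnSn andbT -ltnS.
move=> /(_ jk'); rewrite lee_fin (dualZ _ _ dxi) -(ler_pM2l tau_gt0).
rewrite mulrBr mulVKf ?(lt0r_neq0 tau_gt0)// -/(dissk k) (dualB _ _ dxi) => h1.
by move: IH; rewrite !(dualB _ _ dxi) cumulS nodeS; lra.
Qed.

(** The minimizer [P] at time [t] competes at time [t + h]. Its energy moves at a rate controlled by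
    the power, for the small [h] that (E4) supplies. The longer step replaces [V] by [V - eta V], so
    the dissipation term moves at rate at most [Psi V - xi0 V] up to a small error, where the
    subgradient [xi0] is extremal in the direction [- V]. By (Psi4) this rate is [- Psi*(- Xi)] for
    the force [Xi] of (E2). *)
Lemma lyap_derive t : 0 < t < T -> node (kap t) < t -> derivable lyap t 1 ->
  exists Xi c, [/\ F t (interp (kap t) t) Xi,
    subdiff (Psi (pk (kap t))) ((t - node (kap t))^-1 *: (interp (kap t) t - pk (kap t)))
      (fun V => - Xi V),
    fconj (Psi (pk (kap t))) (fun V => - Xi V) = c%:E &
    'D_1 lyap t <= Pw t (interp (kap t) t) Xi - c].
Proof.
move=> /andP[t0 tT] nt dl.
have tT' : 0 <= t <= T by rewrite !ltW.
have [kN k1 k2] := kapP tT'; set k := kap t in kN k1 k2 nt *.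
set s := t - node k; have s0 : 0 < s by rewrite subr_gt0.
set P := interp k t; set V := s^-1 *: (P - pk k).
have DP : D P by exact: interp_D.
have Dk : D (pk k) by exact: pk_D.
have [Xi FXi sXi] : exists2 Xi, F t P Xi & subdiff (Psi (pk k)) V (fun V => - Xi V).
  apply: (ggs_min G) => //; move=> Q DQ.
  by have := vfun_le kN tT' nt DQ.
exists Xi, (- Xi V - Psi (pk k) V); split => //; first exact: fconj_subdiff.
have [xi0 sxi0 dq] := subdiff_dir (ggs_Psi_cvx G Dk) (ggs_Psi_lsc G Dk) V (- V).
have xi0V : xi0 V - Psi (pk k) V = - Xi V - Psi (pk k) V.
  have := ggs_conj_eq G Dk sxi0 sXi.
  by rewrite (fconj_subdiff sxi0) (fconj_subdiff sXi) => -[].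
have dxi0 : is_dual xi0 by have [] := sxi0.
apply/ler_addgt0Pr => eps' eps'0.
(* One third each for the derivative of [lyap], the power and the subgradient. *)
pose eps := eps' / 3; have eps0 : 0 < eps by rewrite divr_gt0.
have [eta0 eta00 etaP] := dq eps eps0.
have [d1 d10 d1P] : exists2 d : R, 0 < d & forall h, 0 < h -> h < d ->
    'D_1 lyap t - eps <= (lyap (t + h) - lyap t) / h.
  have dlim : (h^-1 *: (lyap (h *: 1 + t) - lyap t)) @[h --> (0 : R)^'] --> 'D_1 lyap t by exact: dl.
  have /cvgrPdist_le/(_ _ eps0)[d /= d0 dP] := dlim.
  exists d => // h h0 hd.
  have := dP h; rewrite /= sub0r normrN gtr0_norm// gt_eqF// => /(_ hd isT).
  by rewrite /GRing.scale /= mulr1 ler_norml [h + t]addrC [h^-1 * _]mulrC => /andP[_]; lra.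
(* Keeps [h] in the range of the derivative estimate and inside the current step, ensures
   [eta <= eta0], and keeps [t + h] below [T]. *)
pose d := Num.min (Num.min d1 (node k + tau - t)) (Num.min (s * eta0) (T - t)).
have d0 : 0 < d by rewrite !lt_min d10 !subr_gt0 k2 tT mulr_gt0.
have tT2 : 0 < t < T by rewrite t0.
have [h [h0 hd hP]] := ggs_power G tT2 DP FXi d0 eps0.
move: hd; rewrite !lt_min => /andP[/andP[hd1 hd2] /andP[hd3 hd4]].
have kE : kap (t + h) = k by apply: kap_eq; lra.
have t'T : 0 <= t + h <= T by apply/andP; split; lra.
have nt' : node k < t + h by lra.
have := d1P h h0 hd1; rewrite /lyap kE -/k opprD addrACA subrr addr0 => h1.
have v1 := vfun_le kN t'T nt' DP.
have sh0 : 0 < s + h by rewrite addr_gt0.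
have shE : t + h - node k = s + h by rewrite /s addrAC.
rewrite /step_energy shE in v1.
pose eta := h / (s + h).
have eta_gt0 : 0 < eta by rewrite divr_gt0.
have eta_le : eta <= eta0.
  rewrite ler_pdivrMr//; apply: (le_trans (ltW hd3)); rewrite mulrC ler_wpM2l ?(ltW eta00)//.
  by rewrite lerDl ltW.
have VE : (s + h)^-1 *: (P - pk k) = V + eta *: (- V).
  rewrite /V scalerN scalerA -scalerBl; congr (_ *: _).
  by rewrite /eta; field; rewrite !gt_eqF.
have := etaP eta eta_gt0 eta_le; rewrite /dir_quot -VE ler_pdivrMr// => h2.
set p := Psi (pk k) ((s + h)^-1 *: (P - pk k)) in v1 h2.
rewrite (dualN _ dxi0) in h2.
have h3 : (s + h) * p <= (s + h) * Psi (pk k) V + h * (- xi0 V + eps).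
  have -> : h * (- xi0 V + eps) = (s + h) * ((- xi0 V + eps) * eta).
    by rewrite /eta; field; rewrite gt_eqF.
  by rewrite -mulrDr ler_wpM2l ?(ltW sh0)//; lra.
move: h1; rewrite ler_pdivlMr// => h1.
move: hP; rewrite ler_pdivrMr// => hP.
rewrite -(ler_pM2r h0).
have vE : vfun k t = e t P + s * Psi (pk k) V by [].
have := congr1 (fun q => q * h) xi0V; rewrite /= => xi0Vh.
rewrite vE in h1; rewrite /eps in h1 h3 hP *.
have : (xi0 V - Psi (pk k) V) * h = (- Xi V - Psi (pk k) V) * h by rewrite xi0V.
lra.
Qed.

End Scheme.

Section DiscreteScheme.
Context {R : realType} {X : completeNormedModType R}.
Variables (T : R) (e : R -> X -> R) (g : X -> R) (D : set X) (Psi : X -> X -> R).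
Variables (F : R -> X -> set (X -> R)) (Pw : R -> X -> (X -> R) -> R) (P0 : X).

(* What the limit passage uses of the minimizing-movement scheme of step [tau]:
   the piecewise constant interpolant [p], the variational (De Giorgi)
   interpolant [I], the energy [v] of the incremental problems, and the
   accumulated dissipation [w]. *)
Record discrete_scheme (B rt tau : R) (p I : R -> X) (v w : R -> R) : Prop := DiscreteScheme {
  scheme_p : forall t, 0 <= t <= T -> [/\ D (p t), g (p t) <= B & e t (p t) <= B];
  scheme_I : forall t, 0 <= t <= T ->
    [/\ D (I t), g (I t) <= B, 0 <= e t (I t), e t (I t) <= v t & v t <= B];
  scheme_p0 : p 0 = P0;
  scheme_v0 : v 0 = e 0 P0;
  scheme_w0 : w 0 = 0;
  scheme_vw : forall s t, 0 <= s -> s <= t -> t <= T ->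
    v t + w t <= v s + w s + rt * (t - s);
  scheme_w : forall s t, 0 <= s -> s <= t -> t <= T -> w s <= w t;
  scheme_incr : forall M C, 0 <= M -> 0 <= C ->
    (forall P V, D P -> g P <= B -> M * `|V| <= Psi P V + C) ->
    forall s t, 0 <= s -> s <= t -> t <= T ->
      M * `|p t - p s| <= w t - w s + C * (t - s + tau);
  scheme_dist : forall M C, 0 <= C ->
    (forall P V, D P -> g P <= B -> M * `|V| <= Psi P V + C) ->
    forall t, 0 <= t <= T -> M * `|I t - p t| <= B + C * tau;
  scheme_minorant : forall xi c s t, is_dual xi -> 0 <= c -> 0 <= s -> s <= t -> t <= T ->
    (forall r, 0 <= r -> s - tau <= r -> r <= t -> (fconj (Psi (p r)) xi <= c%:E)%E) ->
    xi (p t - p s) - c * (t - s + tau) <= w t - w s;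
  scheme_derive : {ae (@lebesgue_measure R), forall t, 0 < t < T ->
    derivable (fun t => v t + w t) t 1 -> exists Xi c, [/\ F t (I t) Xi,
      fconj (Psi (p t)) (fun V => - Xi V) = c%:E,
      v t <= e t (I t) - Xi (I t - p t) &
      'D_1 (fun t => v t + w t) t <= Pw t (I t) Xi - c]} }.

(** The derivative clause holds off the countably many nodes, where the interpolant is a genuine
    minimizer. The inequality on [v] is the equality case of Fenchel-Young together with
    [Psi* >= 0]. *)
Lemma discrete_scheme_exists (K1 K2 : R) (G : real_ggs T K1 K2 e g D Psi F Pw) : D P0 ->
  exists B rt (p I : nat -> R -> X) (v w : nat -> R -> R),
    [/\ 0 <= B, 0 <= rt &
      forall n, discrete_scheme B rt (T / n.+1%:R) (p n) (I n) (v n) (w n)].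
Proof.
move=> DP0; have [mn mnP] := exists_argmin G.
exists (bound T K1 e P0), (rate T K1 e P0).
pose kp n := kap T n.
exists (fun n t => pk T mn P0 n (kap T n t)), (fun n t => interp T mn P0 n (kap T n t) t).
exists (fun n t => vfun T e Psi mn P0 n (kap T n t) t).
exists (fun n t => cumul T Psi mn P0 n (kap T n t)).
split; [exact: (bound_ge0 G mnP DP0 0)|exact: (rate_ge0 G mnP DP0 0)|move=> n].
have k0 : kap T n 0 = 0%N by rewrite /kap mul0r truncn0.
split.
- move=> t tT; have [kN k1 k2] := kapP G n tT; split.
  + exact: (pk_D G mnP DP0 kN).
  + exact: (g_pk_le G mnP DP0 kN).
  + exact: (energy_pk_le G mnP DP0 kN tT).
- move=> t tT; have [kN k1 k2] := kapP G n tT.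
  have [g0 ge ev vb] := interp_bounds G mnP DP0 kN tT k1; split => //.
  + exact: (interp_D G mnP DP0 kN tT k1).
  + exact: le_trans ge (le_trans ev vb).
  + exact: le_trans ge.
- by rewrite k0.
- by have := lyap0 G mnP DP0 n; rewrite /lyap k0 /cumul big_geq// addr0.
- by rewrite k0 /cumul big_geq.
- move=> s t s0 st tT; exact: (lyap_mono G mnP DP0 n s0 st tT).
- move=> s t s0 st tT; apply: (cumul_nd G mnP DP0); first exact: (kap_le G n st).
  by have [] := kapP G n (ltac:(by rewrite tT (le_trans s0 st)) : 0 <= t <= T).
- move=> M C M0 C0 h s t s0 st tT; exact: (kap_increment G mnP DP0 n M0 C0 h s0 st tT).
- move=> M C C0 h t tT; exact: (interp_dist G mnP DP0 n C0 h tT).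
- move=> xi c s t dxi c0 s0 st tT h.
  have sT : 0 <= s <= T by rewrite s0 (le_trans st).
  have tT' : 0 <= t <= T by rewrite tT (le_trans s0).
  have [ks s1 s2] := kapP G n sT; have [kt t1 t2] := kapP G n tT'.
  have := @cumul_minorant _ _ _ _ _ _ _ _ _ _ _ G mn P0 n xi c _ _ dxi (kap_le G n st) kt.
  (* The node at or before [s] may precede it by up to [tau], which explains the window
     [[s - tau, t]] and the slack [tau] in [scheme_minorant]. *)
  move=> h1; apply: le_trans (h1 _); last first.
    move=> l /andP[jl lk]; have ln := nodeS T n l.
    have t0 := tau_gt0 G n.
    have kl : kap T n (node T n l) = l by apply: (kap_eq G); rewrite ?ltrDl.
    have := h (node T n l); rewrite kl => h'; apply: h'.
    + by rewrite mulr_ge0// ltW.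
    + have := node_lt G n jl; rewrite -/(tau T n); lra.
    + have := node_lt G n (ltnW lk); lra.
  rewrite lerD2l lerN2; apply: ler_wpM2l => //; rewrite -/(tau T n); lra.
pose Z := range (node T n).
have Z0 : (@lebesgue_measure R).-negligible Z.
  have cZ : countable Z by exact: card_image_le.
  by apply/negligibleP; [exact: countable_measurable|exact: countable_lebesgue_measure0].
apply: negligibleS Z0 => t /= /not_implyP[t0T] /not_implyP[dl nex].
have tT : 0 <= t <= T by case/andP: t0T => ? ?; rewrite !ltW.
have [kN k1 k2] := kapP G n tT.
apply: contrapT => nZ.
have nt : node T n (kap T n t) < t.
  by rewrite lt_neqAle k1 andbT; apply/eqP => E; apply: nZ; exists (kap T n t).
apply: nex; have [Xi [c [FXi sXi cE dc]]] := lyap_derive G mnP DP0 t0T nt dl.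
exists Xi, c; split => //.
have [dXi _] := sXi; have := fconj_subdiff sXi; rewrite cE => -[cE'].
have s0 : 0 < t - node T n (kap T n t) by rewrite subr_gt0.
have c0 : 0 <= c.
  by rewrite -lee_fin -cE; apply: (fconj_ge0 dXi); rewrite (ggs_Psi0 G (pk_D G mnP DP0 kN)).
rewrite /vfun /step_energy lerD2l.
set s := t - _ in s0 cE' *; set P := Psi _ _ in cE' *.
have -> : P = - Xi (s^-1 *: (interp T mn P0 n (kap T n t) t - pk T mn P0 n (kap T n t))) - c by rewrite cE'; ring.
have := dualZ s^-1 (interp T mn P0 n (kap T n t) t - pk T mn P0 n (kap T n t)) dXi => /= ->.
rewrite mulrBr mulVKf ?gt_eqF// lerBlDr lerDl mulr_ge0// ltW//.
Qed.

End DiscreteScheme.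

(** * Passage to the limit *)

Lemma cvg_comp_ge {Z : topologicalType} (u : nat -> Z) (l : Z) (s : nat -> nat) :
  (forall n, (n <= s n)%N) -> u n @[n --> \oo] --> l -> u (s n) @[n --> \oo] --> l.
Proof.
move=> ns ul A /ul [N _ NA]; exists N => // n /= Nn; apply: NA; exact: leq_trans (ns n).
Qed.

Lemma increasing_ge (s : nat -> nat) : (forall n, (s n < s n.+1)%N) -> forall n, (n <= s n)%N.
Proof. by move=> h; elim=> // n IH; exact: leq_ltn_trans (h n). Qed.

Lemma not_near_oo (A : nat -> Prop) : ~ (\forall n \near \oo, A n) ->
  exists s : nat -> nat, forall n, (n <= s n)%N /\ ~ A (s n).
Proof.
move=> nA; suff /choice[s sP] : forall n, exists m, (n <= m)%N /\ ~ A m by exists s.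
move=> n; apply: contrapT => h; apply: nA; exists n => // m /= nm.
by apply: contrapT => nAm; apply: h; exists m.
Qed.

(** Helly's argument: the values at [t] are squeezed between those at nearby dense points, where
    convergence is known. *)
Lemma monotone_cvg {R : realType} (f_ : nat -> R -> R) (f : R -> R) (d : nat -> R) (a b t : R) :
  (forall n x y, a <= x -> x <= y -> y <= b -> f_ n x <= f_ n y) ->
  f x @[x --> t] --> f t -> a < t < b ->
  (forall x y, a <= x -> x < y -> y <= b -> exists i, x < d i < y) ->
  (forall i, f_ n (d i) @[n --> \oo] --> f (d i)) ->
  f_ n t @[n --> \oo] --> f t.
Proof.
move=> f_nd ft /andP[at_ tb] dd fd; apply/cvgrPdist_le => e e0.
have e2 : 0 < e / 2 by rewrite divr_gt0.
have /cvgrPdist_le/(_ _ e2)[r /= r0 rP] := ft.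
have [i /andP[i1 i2]] : exists i, Num.max a (t - r) < d i < t.
  by apply: dd; rewrite ?le_max ?lexx// ?(ltW tb)// gt_max at_ gtrBl.
have [j /andP[j1 j2]] : exists j, t < d j < Num.min b (t + r).
  by apply: dd; rewrite ?ge_min ?lexx ?(ltW at_)// lt_min tb ltrDl.
move: i1 j2; rewrite gt_max lt_min => /andP[ai ri] /andP[jb rj].
have hi : `|f t - f (d i)| <= e / 2 by apply: rP; rewrite /ball_/= ltr_norml; apply/andP; split; lra.
have hj : `|f t - f (d j)| <= e / 2 by apply: rP; rewrite /ball_/= ltr_norml; apply/andP; split; lra.
have /cvgrPdist_le/(_ _ e2) ci := fd i; have /cvgrPdist_le/(_ _ e2) cj := fd j.
near=> n.
have h1 : `|f (d i) - f_ n (d i)| <= e / 2 by near: n; exact: ci.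
have h2 : `|f (d j) - f_ n (d j)| <= e / 2 by near: n; exact: cj.
have h3 := f_nd n (d i) t (ltW ai) (ltW i2) (ltW tb).
have h4 := f_nd n t (d j) (ltW at_) (ltW j1) (ltW jb).
move: hi hj h1 h2; rewrite !ler_norml => /andP[? ?] /andP[? ?] /andP[? ?] /andP[? ?].
by apply/andP; split; lra.
Unshelve. all: by end_near. Qed.

Lemma dense_itv {R : realType} (T : R) : 0 < T -> exists d : nat -> R,
  (forall i, 0 <= d i <= T) /\
  forall x y, 0 <= x -> x < y -> y <= T -> exists i, x < d i < y.
Proof.
move=> T0; exists (fun i => clamp 0 T (ratr (odflt (0 : rat) (unpickle i)))); split.
  by move=> i; apply: clamp_itv; exact: ltW.
move=> x y x0 xy yT; have [q] := rat_in_itvoo xy; rewrite in_itv /= => /andP[xq qy].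
exists (pickle q); rewrite pickleK /= clamp_id ?xq//.
by rewrite (le_trans x0 (ltW xq)) (le_trans (ltW qy)).
Qed.

Section ConjUpper.
Context {R : realType} {X : completeNormedModType R} (T K1 K2 : R).
Context (e : R -> X -> R) (g : X -> R) (D : set X) (Psi : X -> X -> R).
Context (F : R -> X -> set (X -> R)) (Pw : R -> X -> (X -> R) -> R).
Hypothesis Xsep : separable_space (X := X).
Hypothesis Xrefl : reflexive_space (X := X).
Hypothesis G : real_ggs T K1 K2 e g D Psi F Pw.

(** For a fixed covector the conjugate is upper semicontinuous in the state. Otherwise there are
    vectors [V n] with [xi (V n) - Psi (V n) >= c]; coercivity bounds them, and (Psi3) at a weak
    limit shows that the conjugate at [Q] is at least [c]. *)
Lemma fconj_upper (S c : R) (Qn : nat -> X) (Q : X) (xi : X -> R) : is_dual xi ->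
  Qn n @[n --> \oo] --> Q -> (forall n, D (Qn n) /\ g (Qn n) <= S) ->
  (fconj (Psi Q) xi < c%:E)%E ->
  \forall n \near \oo, (fconj (Psi (Qn n)) xi <= c%:E)%E.
Proof.
move=> dxi QnQ Qg fc; apply: contrapT => /not_near_oo[s sP].
have /choice[V VP] n : exists V, c <= xi V - Psi (Qn (s n)) V.
  apply: contrapT => /forallNP h; have [_] := sP n; apply; apply: fconj_le => V.
  by rewrite lee_fin leNgt; apply/negP => /ltW; exact: h.
(* The additional 1 in the slope is what bounds [|V n|] once the linear term [xi (V n)] is
   absorbed. *)
have [C C0 CP] := ggs_Psi_coercive G S (dnorm xi + 1).
have VC n : `|V n| <= C - c.
  have [DQ gQ] := Qg (s n); have := CP _ (V n) DQ gQ; have := VP n.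
  have := le_trans (ler_norm _) (dual_le (V n) dxi); rewrite mulrDl mul1r; lra.
have [U UU Uoo] := exists_ultra_oo.
have [V0 V0P] := weak_ultra (U := U) Xrefl VC.
have [s' [s'i s'V]] := along_subsequence Uoo (weak_along Xsep Xrefl VC V0P).
have s'n := increasing_ge s'i.
have Qs' : Qn (s (s' n)) @[n --> \oo] --> Q.
  by apply: (cvg_comp_ge (s := s \o s')) => //= n; apply: leq_trans (s'n n) (sP _).1.
have c_le : (c%:E <= fconj (Psi Q) xi)%E.
  apply: le_trans (fconj_ge _ V0 _); rewrite lee_fin.
  apply/ler_addgt0Pr => eps eps0.
  have /cvgrPdist_le/(_ _ eps0)[m _ mP] := s'V xi dxi.
  have := @ggs_Psi_liminf _ _ _ _ _ _ _ _ _ _ _ G S (xi V0 - c + eps)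
    (fun n => Qn (s (s' (n + m)%N))) Q (fun n => V (s' (n + m)%N)) V0.
  have h1 : Qn (s (s' (n + m)%N)) @[n --> \oo] --> Q.
    by apply: (cvg_comp_ge (s := fun n => (n + m)%N) _ Qs') => n; exact: leq_addr.
  have h2 : weak_cvg (fun n => V (s' (n + m)%N)) V0.
    move=> z dz; apply: (cvg_comp_ge (s := fun n => (n + m)%N) _ (s'V z dz)) => n; exact: leq_addr.
  have h3 n : Psi (Qn (s (s' (n + m)%N))) (V (s' (n + m)%N)) <= xi V0 - c + eps.
    have := mP (n + m)%N (leq_addl _ _); rewrite /= ler_norml => /andP[? ?].
    by have := VP (s' (n + m)%N); lra.
  by move=> /(_ h1 (fun n => Qg _) h2 h3); lra.
by move: (le_lt_trans c_le fc); rewrite ltxx.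
Qed.

End ConjUpper.

Lemma cvg_ext {A : Type} {Z : topologicalType} (V : set_system A) (f h : A -> Z) (l : Z) :
  (forall x, f x = h x) -> f x @[x --> V] --> l -> h x @[x --> V] --> l.
Proof. by move=> /funext ->. Qed.

Lemma derive_seq_vector {R : realType} {X : normedModType R} (f : R -> X) (x : R) :
  derivable f x 1 ->
  n.+1%:R^-1^-1 *: (f (x + n.+1%:R^-1) - f x) @[n --> \oo] --> 'D_1 f x.
Proof.
move=> df.
have h : (h^-1 *: (f (h *: 1 + x) - f x)) @[h --> (0 : R)^'] --> 'D_1 f x by exact: df.
have hs : ((fun n : nat => n.+1%:R^-1 : R) @ \oo --> (0 : R)^').
  move=> A [e /= e0 eA].
  have := near_infty_natSinv_lt (PosNum e0); apply: filterS => n ne /=.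
  apply: eA; last by rewrite gt_eqF// invr_gt0.
  by rewrite /= sub0r normrN gtr0_norm// invr_gt0.
apply: (cvg_ext _ (cvg_comp _ _ hs h)) => n /=.
by congr (_ *: (f _ - _)); rewrite /GRing.scale /= mulr1 addrC.
Qed.

Lemma clamp_lipschitz {R : realType} (a b s t : R) : a <= b -> s <= t ->
  clamp a b t - clamp a b s <= t - s.
Proof.
move=> ab st; have [ta|at_] := leP t a.
  by rewrite !clamp_le ?(le_trans st)// subrr subr_ge0.
have [bs|sb] := leP b s.
  by rewrite !clamp_ge ?(le_trans bs)// subrr subr_ge0.
apply: lerB; first by rewrite /clamp max_r ?(ltW at_)// ge_min lexx orbT.
by rewrite /clamp le_min le_max lexx orbT (ltW sb).
Qed.

Section Limit.
Context {R : realType} {X : completeNormedModType R} (T K1 K2 : R).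
Context (e : R -> X -> R) (g : X -> R) (D : set X) (Psi : X -> X -> R).
Context (F : R -> X -> set (X -> R)) (Pw : R -> X -> (X -> R) -> R).
Hypothesis Xsep : separable_space (X := X).
Hypothesis Xrefl : reflexive_space (X := X).
Hypothesis G : real_ggs T K1 K2 e g D Psi F Pw.
Notation mu := (@lebesgue_measure R).

Variables (P0 : X) (B rt : R) (tau : nat -> R) (p I : nat -> R -> X) (v w : nat -> R -> R).
Hypothesis B_ge0 : 0 <= B.
Hypothesis rt_ge0 : 0 <= rt.
Hypothesis tau_ge0 : forall n, 0 <= tau n.
Hypothesis tau_cvg : tau n @[n --> \oo] --> (0 : R).
Hypothesis S : forall n,
  discrete_scheme T e g D Psi F Pw P0 B rt (tau n) (p n) (I n) (v n) (w n).

Let T_gt0 : 0 < T := ggs_T G.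
Let wmax := B + rt * T.
Let wmax_ge0 : 0 <= wmax.
Proof. by rewrite addr_ge0// mulr_ge0// ltW. Qed.

Lemma scheme_w_bounds n t : 0 <= t <= T -> 0 <= w n t <= wmax.
Proof.
move=> tT; have /andP[t0 tT'] := tT.
have := scheme_w (S n) (lexx 0) t0 tT'; rewrite (scheme_w0 (S n)) => -> /=.
have := scheme_vw (S n) (lexx 0) t0 tT'; rewrite (scheme_w0 (S n)).
have [_ _ e0 ev _] := scheme_I (S n) tT.
have T00 : 0 <= (0 : R) <= T by rewrite lexx ltW.
have [_ _ _ _ vB] := scheme_I (S n) T00.
have : rt * (t - 0) <= rt * T by rewrite subr0 ler_wpM2l.
rewrite /wmax; lra.
Qed.

Lemma scheme_v_bounds n t : 0 <= t <= T -> 0 <= v n t <= B.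
Proof.
by move=> tT; have [_ _ e0 ev vB] := scheme_I (S n) tT; rewrite vB (le_trans e0).
Qed.

Lemma scheme_incr_sym (M C : R) n s t : 0 <= M -> 0 <= C ->
  (forall P V, D P -> g P <= B -> M * `|V| <= Psi P V + C) ->
  0 <= s <= T -> 0 <= t <= T -> M * `|p n t - p n s| <= wmax + C * (`|t - s| + tau n).
Proof.
move=> M0 C0 h; wlog st : s t / s <= t => [hw sT tT|sT tT].
  have [st|/ltW ts] := leP s t; first exact: hw.
  by rewrite distrC [`|t - s|]distrC; exact: hw.
have /andP[s0 _] := sT; have /andP[_ tT'] := tT.
apply: (le_trans (scheme_incr (S n) M0 C0 h s0 st tT')).
have /andP[_ w1] := scheme_w_bounds n tT; have /andP[w2 _] := scheme_w_bounds n sT.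
by rewrite ger0_norm ?subr_ge0//; lra.
Qed.

(** With slope [M = (wmax + 2) / eps] the whole dissipation is absorbed; the two added units pay for
    [C |t - s|] and [C tau]. *)
Lemma scheme_equicontinuous (eps : R) : 0 < eps -> exists2 eta : R, 0 < eta &
  \forall n \near \oo, forall s t, 0 <= s <= T -> 0 <= t <= T -> `|t - s| <= eta ->
    `|p n t - p n s| <= eps.
Proof.
move=> eps0; pose M := (wmax + 2) / eps.
have M0 : 0 < M by rewrite divr_gt0//; have := wmax_ge0; lra.
have [C C0 CP] := ggs_Psi_coercive G B M.
have C1 : 0 < C + 1 by lra.
have eta0 : 0 < (C + 1)^-1 by rewrite invr_gt0.
exists (C + 1)^-1 => //.
have Ce : C * (C + 1)^-1 <= 1 by rewrite ler_pdivrMr//; lra.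
apply: filterS (cvgr_lt _ tau_cvg _ eta0) => n tn s t sT tT ts.
have := scheme_incr_sym n (ltW M0) C0 (fun P V DP gP => CP P V DP gP) sT tT.
have h1 : C * `|t - s| <= C * (C + 1)^-1 by rewrite ler_wpM2l.
have h2 : C * tau n <= C * (C + 1)^-1 by rewrite ler_wpM2l// ltW.
rewrite mulrDr => h3.
have {}h3 : M * `|p n t - p n s| <= wmax + 2 by lra.
rewrite -(ler_pM2l M0); apply: (le_trans h3).
by rewrite /M mulfVK ?gt_eqF.
Qed.

Lemma interp_cvg_diff t : 0 <= t <= T -> `|I n t - p n t| @[n --> \oo] --> (0 : R).
Proof.
move=> tT; apply/cvgrPdist_le => eps eps0; pose M := (B + 1) / eps.
have M0 : 0 < M by rewrite divr_gt0//; have := B_ge0; lra.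
have [C C0 CP] := ggs_Psi_coercive G B M.
have C1 : 0 < C + 1 by lra.
have eta0 : 0 < (C + 1)^-1 by rewrite invr_gt0.
apply: filterS (cvgr_lt _ tau_cvg _ eta0) => n tn.
rewrite sub0r normrN normr_id -(ler_pM2l M0).
apply: (le_trans (scheme_dist (S n) C0 (fun P V DP gP => CP P V DP gP) tT)).
have Ce : C * (C + 1)^-1 <= 1 by rewrite ler_pdivrMr//; lra.
have h2 : C * tau n <= C * (C + 1)^-1 by rewrite ler_wpM2l// ltW.
by rewrite /M mulfVK ?gt_eqF//; lra.
Qed.

Variable d : nat -> R.
Hypothesis d_itv : forall i, 0 <= d i <= T.
Hypothesis d_dense : forall x y, 0 <= x -> x < y -> y <= T -> exists i, x < d i < y.
Hypothesis p_d : forall i, exists l : X, p n (d i) @[n --> \oo] --> l.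
Hypothesis vw_d : forall i, exists l : R, v n (d i) + w n (d i) @[n --> \oo] --> l.
Hypothesis w_d : forall i, exists l : R, w n (d i) @[n --> \oo] --> l.

Context (U : set_system nat) {UU : UltraFilter U}.
Hypothesis Uoo : forall k, U [set n | (k <= n)%N].

Lemma cvg_oo_U {Z : topologicalType} (u : nat -> Z) (l : Z) :
  u n @[n --> \oo] --> l -> u n @[n --> U] --> l.
Proof.
move=> ul A /ul[N _ NA]; have h : U (u @^-1` A) by apply: filterS (Uoo N) => n nN; exact: NA.
exact: h.
Qed.

Lemma near_oo_U (A : nat -> Prop) : (\forall n \near \oo, A n) -> U [set n | A n].
Proof. by move=> [N _ NA]; apply: filterS (Uoo N) => n /NA. Qed.

Let c := clamp 0 T.
Let c_itv t : 0 <= c t <= T.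
Proof. by apply: clamp_itv; exact: ltW. Qed.

(** The ultrafilter provides limits at all times at once; the clamp makes the limit curves total and
    constant on each side of [[0, T]]. *)
Lemma limit_curves : exists (P : R -> X) (L W : R -> R), forall t,
  [/\ p n (c t) @[n --> U] --> P t, v n (c t) + w n (c t) @[n --> U] --> L t &
      w n (c t) @[n --> U] --> W t].
Proof.
have h1 t : exists l : X, p n (c t) @[n --> U] --> l.
  have [|l _ hl] := @ultra_compact U UU _ _ (fun n => p n (c t)) (@ggs_compact _ _ _ _ _ _ _ _ _ _ _ G (c t) B (c_itv t)).
    by move=> n; have [] := scheme_p (S n) (c_itv t).
  by exists l.
have h2 t : exists l : R, w n (c t) @[n --> U] --> l.
  have [|l _ hl] := @ultra_bounded R U UU (fun n => w n (c t)) wmax.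
    by move=> n; have /andP[? ?] := scheme_w_bounds n (c_itv t); rewrite ger0_norm.
  by exists l.
have h3 t : exists l : R, v n (c t) @[n --> U] --> l.
  have [|l _ hl] := @ultra_bounded R U UU (fun n => v n (c t)) B.
    by move=> n; have /andP[? ?] := scheme_v_bounds n (c_itv t); rewrite ger0_norm.
  by exists l.
have [P PP] := choice h1; have [W WP] := choice h2; have [V VP] := choice h3.
by exists P, (fun t => V t + W t), W => t; split => //; exact: rcvgD.
Qed.

Variables (P : R -> X) (L W : R -> R).
Hypothesis PLW : forall t,
  [/\ p n (c t) @[n --> U] --> P t, v n (c t) + w n (c t) @[n --> U] --> L t &
      w n (c t) @[n --> U] --> W t].
Let pP t : p n (c t) @[n --> U] --> P t. Proof. by have [] := PLW t. Qed.
Let vwL t : v n (c t) + w n (c t) @[n --> U] --> L t. Proof. by have [] := PLW t. Qed.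
Let wW t : w n (c t) @[n --> U] --> W t. Proof. by have [] := PLW t. Qed.

Let c_id t : 0 <= t <= T -> c t = t.
Proof. exact: clamp_id. Qed.

(** Convergence at the dense times and asymptotic equicontinuity upgrade the limit along [U] to a
    limit of the whole sequence. *)
Lemma scheme_cvg t : 0 <= t <= T -> p n t @[n --> \oo] --> P t.
Proof.
move=> tT; apply/cvgrPdist_le => eps eps0.
have e4 : 0 < eps / 4 by rewrite divr_gt0.
have [eta eta0 etaP] := scheme_equicontinuous e4.
have [i di] : exists i, `|t - d i| <= eta.
  have /andP[t0 tT'] := tT; move: (tT'); rewrite le_eqVlt => /predU1P[tE|tlT].
    have [i /andP[i1 i2]] : exists i, Num.max 0 (T - eta) < d i < T.
      by apply: d_dense; rewrite ?le_max ?lexx// gt_max T_gt0 gtrBl.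
    exists i; move: i1; rewrite gt_max => /andP[i0 i1].
    by rewrite tE ler_norml; apply/andP; split; lra.
  have [i /andP[i1 i2]] : exists i, t < d i < Num.min T (t + eta).
    by apply: d_dense; rewrite ?ge_min ?lexx// lt_min tlT ltrDl.
  exists i; move: i2; rewrite lt_min => /andP[i0 i2].
  by rewrite ler_norml; apply/andP; split; lra.
have [l pdi] := p_d i.
have hP : `|P t - l| <= eps / 4.
  have lim : `|p n t - p n (d i)| @[n --> U] --> `|P t - l|.
    apply: cvg_norm; apply: cvgB; last exact: cvg_oo_U.
    by have := @pP t; rewrite c_id.
  apply: (cvg_lim_le lim); apply: near_oo_U.
  by apply: filterS etaP => n; apply.
have /cvgrPdist_le/(_ _ e4) hd := pdi.
apply: filterS2 etaP hd => n h1 h2.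
have {}h1 := h1 (d i) t (d_itv i) tT di.
have -> : P t - p n t = (P t - l) + ((l - p n (d i)) - (p n t - p n (d i))).
  by rewrite opprB [l - p n (d i) + _]addrA subrK [RHS]addrA subrK.
apply: (le_trans (ler_normD _ _)); have := ler_normB (l - p n (d i)) (p n t - p n (d i)).
move: hP h1 h2; lra.
Qed.

Lemma limit_d i : v n (d i) + w n (d i) @[n --> \oo] --> L (d i) /\
  w n (d i) @[n --> \oo] --> W (d i).
Proof.
have := @vwL (d i); have := @wW (d i); rewrite c_id// => h1 h2.
have [l1 h3] := w_d i; have [l2 h4] := vw_d i.
have -> : L (d i) = l2 by apply: (cvg_unique _ h2 (cvg_oo_U h4)).
by have -> : W (d i) = l1 by apply: (cvg_unique _ h1 (cvg_oo_U h3)).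
Qed.

Lemma limit_W_nd : {homo W : x y / x <= y}.
Proof.
move=> x y xy; apply: (ler_cvg_to (@wW x) (@wW y)); apply: nearW => n.
have /andP[x0 _] := c_itv x; have /andP[_ yT] := c_itv y.
by apply: (scheme_w (S n)) => //; exact: clamp_homo.
Qed.

Lemma limit_L_mono s t : 0 <= s -> s <= t -> t <= T -> L t <= L s + rt * (t - s).
Proof.
move=> s0 st tT; have sT : 0 <= s <= T by rewrite s0 (le_trans st).
have tT' : 0 <= t <= T by rewrite tT (le_trans s0).
have := @vwL t; have := @vwL s; rewrite !c_id// => h1 h2.
apply: (ler_cvg_to h2 (rcvgD h1 (cvg_cst _))); apply: nearW => n.
exact: (scheme_vw (S n)).
Qed.

Lemma limit_incr (M : R) : 0 <= M -> exists2 C, 0 <= C &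
  forall s t, s <= t -> M * `|P t - P s| <= W t - W s + C * (t - s).
Proof.
move=> M0; have [C C0 CP] := ggs_Psi_coercive G B M; exists C => // s t st.
have l1 : M * `|p n (c t) - p n (c s)| @[n --> U] --> M * `|P t - P s|.
  by apply: rcvgZ; apply: cvg_norm; apply: cvgB.
have l2 : w n (c t) - w n (c s) + C * (t - s + tau n) @[n --> U] -->
    W t - W s + C * (t - s + 0).
  apply: rcvgD; first exact: rcvgB.
  by apply: rcvgZ; apply: rcvgD; [exact: cvg_cst|exact: cvg_oo_U].
rewrite -[t - s in leRHS]addr0; apply: (ler_cvg_to l1 l2); apply: nearW => n.
have /andP[s0 _] := c_itv s; have /andP[_ tT] := c_itv t.
have cst : c s <= c t by exact: clamp_homo.
apply: (le_trans (scheme_incr (S n) M0 C0 (fun P V DP gP => CP P V DP gP) s0 cst tT)).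
by rewrite lerD2l ler_wpM2l// lerD2r clamp_lipschitz// ltW.
Qed.

Lemma limit_0 : [/\ P 0 = P0, L 0 = e 0 P0 & W 0 = 0].
Proof.
have T00 : 0 <= (0 : R) <= T by rewrite lexx ltW.
have := PLW 0; rewrite c_id// => -[h1 h2 h3]; split.
- have h : p n 0 @[n --> U] --> P0.
    by apply: (cvg_ext (f := fun=> P0)) => [n|]; [rewrite (scheme_p0 (S n))|exact: cvg_cst].
  by apply: (cvg_unique _ h1 h); exact: norm_hausdorff.
- have h : v n 0 + w n 0 @[n --> U] --> e 0 P0.
    by apply: (cvg_ext (f := fun=> e 0 P0)) => [n|]; [rewrite (scheme_v0 (S n)) (scheme_w0 (S n)) addr0|exact: cvg_cst].
  exact: (cvg_unique _ h2 h).
- have h : w n 0 @[n --> U] --> (0 : R).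
    by apply: (cvg_ext (f := fun=> 0)) => [n|]; [rewrite (scheme_w0 (S n))|exact: cvg_cst].
  exact: (cvg_unique _ h3 h).
Qed.

Lemma interp_cvg t : 0 <= t <= T -> I n t @[n --> \oo] --> P t.
Proof.
move=> tT; have h : I n t - p n t @[n --> \oo] --> (0 : X) by apply/norm_cvg0P/interp_cvg_diff.
apply: (cvg_ext (f := fun n => (I n t - p n t) + p n t)) => [n|]; first by rewrite subrK.
by have h2 := cvgD h (scheme_cvg tT); rewrite add0r in h2; exact: h2.
Qed.

Lemma limit_D t : 0 <= t <= T -> [/\ D (P t), e t (P t) <= B & e t (P t) <= L t - W t].
Proof.
move=> tT; have IP := cvg_oo_U (interp_cvg tT).
have [|DP eB] := energy_filter_lim G (c := B) tT IP.
  apply: nearW => n; have [? _ _ h1 h2] := scheme_I (S n) tT; split => //; exact: le_trans h1 h2.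
split => //; apply/ler_addgt0Pr => eps eps0.
have lim : v n t @[n --> U] --> L t - W t.
  have := @vwL t; have := @wW t; rewrite c_id// => h1 h2.
  by apply: (cvg_ext (f := fun n => (v n t + w n t) - w n t)) => [n|]; [rewrite addrK|exact: rcvgB].
have [|_ //] := energy_filter_lim G (c := L t - W t + eps) tT IP.
have lt : L t - W t < L t - W t + eps by rewrite ltrDl.
apply: filterS (cvgr_lt _ lim _ lt) => n h; have [? _ _ h1 h2] := scheme_I (S n) tT.
by split => //; exact: le_trans h1 (ltW h).
Qed.

(** The local uniform version of [fconj_upper]: indices and times violating it would give states
    converging to [P t]. *)
Lemma fconj_local t (xi : X -> R) (k : R) : is_dual xi -> 0 <= t <= T ->
  (fconj (Psi (P t)) xi < k%:E)%E ->
  exists2 delta : R, 0 < delta & \forall n \near \oo, forall r, 0 <= r <= T ->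
    `|r - t| <= delta -> (fconj (Psi (p n r)) xi <= k%:E)%E.
Proof.
move=> dxi tT fk; apply: contrapT => nex.
have /choice[nr nrP] (m : nat) : exists q : nat * R, (m <= q.1)%N /\
    [/\ 0 <= q.2 <= T, `|q.2 - t| <= m.+1%:R^-1 & ~ (fconj (Psi (p q.1 q.2)) xi <= k%:E)%E].
  apply: contrapT => nq; apply: nex; exists m.+1%:R^-1; first by rewrite invr_gt0.
  exists m => // n /= mn r rT rt'; apply: contrapT => nf; apply: nq.
  by exists (n, r).
have cv : p (nr m).1 (nr m).2 @[m --> \oo] --> P t.
  apply/cvgrPdist_le => eps eps0; have e2 : 0 < eps / 2 by rewrite divr_gt0.
  have [eta eta0 [N _ etaP]] := scheme_equicontinuous e2.
  have /cvgrPdist_le/(_ _ e2)[N' _ N'P] := scheme_cvg tT.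
  have etas := near_infty_natSinv_lt (PosNum eta0).
  near=> m; have [m1 [rT rm _]] := nrP m.
  have Nm : (maxn N N' <= m)%N by near: m; exists (maxn N N').
  have em : m.+1%:R^-1 < eta by near: m; exact: etas.
  have h1 : `|p (nr m).1 (nr m).2 - p (nr m).1 t| <= eps / 2.
    apply: etaP => //=; last exact: le_trans rm (ltW em).
    exact: leq_trans (leq_maxl _ _) (leq_trans Nm m1).
  have h2 : `|P t - p (nr m).1 t| <= eps / 2.
    by apply: N'P => /=; exact: leq_trans (leq_maxr _ _) (leq_trans Nm m1).
  have -> : P t - p (nr m).1 (nr m).2 =
      (P t - p (nr m).1 t) - (p (nr m).1 (nr m).2 - p (nr m).1 t).
    by rewrite opprB addrA subrK.
  by apply: (le_trans (ler_normB _ _)); lra.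
have Qg m : D (p (nr m).1 (nr m).2) /\ g (p (nr m).1 (nr m).2) <= B.
  by have [_ [rT _ _]] := nrP m; have [] := scheme_p (S (nr m).1) rT.
have [N _ NP] := fconj_upper Xsep Xrefl G dxi cv Qg fk.
by have [_ [_ _]] := nrP N; apply; apply: NP => /=.
Unshelve. all: by end_near. Qed.

(** The test covector is a subgradient [xi] of [Psi (P t)] at the velocity, for which Fenchel-Young
    is an equality. Taking [k] slightly above its conjugate makes the bound valid at the nearby
    states of the scheme, so the minorants pass to the limit and can be divided by [h]. *)
Lemma Psi_le_slope t : 0 < t < T -> derivable P t 1 -> derivable W t 1 ->
  Psi (P t) ('D_1 P t) <= 'D_1 W t.
Proof.
move=> /andP[t0 tT] dP dW; have tT' : 0 <= t <= T by rewrite !ltW.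
have [DP _ _] := limit_D tT'.
set V := 'D_1 P t.
have [xi sxi _] := subdiff_dir (ggs_Psi_cvx G DP) (ggs_Psi_lsc G DP) V 0.
have dxi : is_dual xi by have [] := sxi.
have fE := fconj_subdiff sxi.
have f0 := fconj_ge0 dxi (ggs_Psi0 G DP); rewrite fE lee_fin in f0.
apply/ler_addgt0Pr => eps eps0.
pose k := xi V - Psi (P t) V + eps.
have k0 : 0 <= k by rewrite addr_ge0// ltW.
have fk : (fconj (Psi (P t)) xi < k%:E)%E by rewrite fE lte_fin ltrDl.
have [delta delta0 dlP] := fconj_local dxi tT' fk.
have key h : 0 < h -> h <= delta -> t + h <= T ->
    xi (P (t + h) - P t) - k * h <= W (t + h) - W t.
  move=> h0 hd thT; have thT' : 0 <= t + h <= T by rewrite thT andbT addr_ge0// ltW.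
  have ch : c (t + h) = t + h by exact: c_id.
  have ct : c t = t by exact: c_id.
  have l1 : xi (p n (t + h) - p n t) - k * (h + tau n) @[n --> U] -->
      xi (P (t + h) - P t) - k * (h + 0).
    apply: rcvgB.
      have h1 : p n (t + h) - p n t @[n --> U] --> P (t + h) - P t.
        by apply: cvgB; [have := @pP (t + h); rewrite ch|have := @pP t; rewrite ct].
      exact: (continuous_cvg _ (dxi.2 _) h1).
    by apply: rcvgZ; apply: rcvgD; [exact: cvg_cst|exact: cvg_oo_U].
  have l2 : w n (t + h) - w n t @[n --> U] --> W (t + h) - W t.
    by apply: rcvgB; [have := @wW (t + h); rewrite ch|have := @wW t; rewrite ct].
  rewrite -[h in k * h]addr0; apply: (ler_cvg_to l1 l2).
  have ntau : \forall n \near \oo, tau n < delta by exact: (cvgr_lt _ tau_cvg _ delta0).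
  apply: (near_oo_U (A := fun n => xi (p n (t + h) - p n t) - k * (h + tau n) <=
    w n (t + h) - w n t)).
  apply: filterS2 dlP ntau => n hn tn.
  have tth : t <= t + h by rewrite lerDl ltW.
  have := scheme_minorant (S n) (xi := xi) (c := k) dxi k0 (ltW t0) tth thT.
  rewrite [t + h - t]addrAC subrr add0r; apply => r r0 r1 r2; apply: hn.
    by rewrite r0 (le_trans r2).
  by rewrite ler_norml; apply/andP; split; lra.
have lP : xi (n.+1%:R^-1^-1 *: (P (t + n.+1%:R^-1) - P t)) - k @[n --> \oo] --> xi V - k.
  apply: rcvgB; last exact: cvg_cst.
  exact: (continuous_cvg _ (dxi.2 _) (derive_seq_vector dP)).
have lW := derive_seq_quotient dW.
suff : xi V - k <= 'D_1 W t by rewrite /k; lra.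
apply: (ler_cvg_to lP lW).
have m0 : 0 < Num.min delta (T - t) by rewrite lt_min delta0 subr_gt0.
apply: filterS (near_infty_natSinv_lt (PosNum m0)) => n /=.
rewrite lt_min => /andP[nd nT].
have h0 : 0 < n.+1%:R^-1 :> R by rewrite invr_gt0.
move: (n.+1%:R^-1 : R) h0 nd nT => h h0 hd hT.
have thT : t + h <= T by lra.
rewrite (dualZ _ _ dxi) ler_pdivlMr// mulrBl mulrAC mulVf ?gt_eqF// mul1r.
exact: (key h h0 (ltW hd) thT).
Qed.

(** The sign and the linear term make this nondecreasing. Its derivative [rt - (v + w)'] is then
    nonnegative, so Fatou's lemma applies; [limit_rate] becomes the function [b] of the limit
    curve. *)
Definition lyap_defect (n : nat) (t : R) : R := rt * c t - (v n (c t) + w n (c t)).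
Definition defect_rate (n : nat) (t : R) : R := Num.max 0 (slope (lyap_defect n) t).
Definition limit_rate (t : R) : \bar R := limn_einf (fun n => (defect_rate n t)%:E).

Lemma lyap_defect_nd n : {homo lyap_defect n : x y / x <= y}.
Proof.
move=> x y xy; have /andP[x0 _] := c_itv x; have /andP[_ yT] := c_itv y.
have cxy : c x <= c y by exact: clamp_homo.
have := scheme_vw (S n) x0 cxy yT.
rewrite /lyap_defect mulrBr; lra.
Qed.

Lemma measurable_defect_rate n : measurable_fun setT (defect_rate n).
Proof.
apply: measurable_maxr => //; apply: measurable_slope.
by apply: nondecreasing_measurable => //; exact: lyap_defect_nd.
Qed.

Lemma measurable_limit_rate : measurable_fun setT limit_rate.
Proof.
have mo : measurable_fun setT (@oppe R) by exact: oppe_measurable.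
have h : measurable_fun setT (fun t => limn_esup (fun n => - (defect_rate n t)%:E)%E).
  apply: measurable_fun_limn_esup => n; apply: (measurableT_comp mo).
  by apply/measurable_EFinP; exact: measurable_defect_rate.
exact: (measurableT_comp mo h).
Qed.

Lemma limit_rate_ge0 t : (0 <= limit_rate t)%E.
Proof. by apply: limn_einf_ge; apply: nearW => n; rewrite lee_fin le_max lexx. Qed.

(** For the lower limit of the integrals it is enough that infinitely many increments come close to
    their limit along [U]. *)
Lemma limit_rate_integral s t : 0 <= s -> s <= t -> t <= T ->
  (\int[mu]_(r in `[s, t]) limit_rate r <= (rt * (t - s) - (L t - L s))%:E)%E.
Proof.
move=> s0 st tT; have sT : 0 <= s <= T by rewrite s0 (le_trans st).
have tT' : 0 <= t <= T by rewrite tT (le_trans s0).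
have lim : lyap_defect n t - lyap_defect n s @[n --> U] --> rt * (t - s) - (L t - L s).
  apply: (cvg_ext (f := fun n => rt * (t - s) - ((v n (c t) + w n (c t)) - (v n (c s) + w n (c s))))).
    by move=> n; rewrite /lyap_defect !c_id//; ring.
  by apply: rcvgB; [exact: cvg_cst|apply: rcvgB; [exact: vwL|exact: vwL]].
have mr n : measurable_fun `[s, t] (EFin \o defect_rate n).
  by apply/measurable_EFinP; apply: measurable_funTS; exact: measurable_defect_rate.
have r0 n x : `[s, t]%classic x -> (0 <= (defect_rate n x)%:E)%E.
  by rewrite lee_fin le_max lexx.
apply: (le_trans (fatou mu _ mr r0)) => //.
apply/lee_addgt0Pr => eps eps0; rewrite -EFinD; apply: limn_einf_le => N.
have lt_eps : rt * (t - s) - (L t - L s) < rt * (t - s) - (L t - L s) + eps by rewrite ltrDl.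
have [n [Nn ln]] := filter_ex (filterI (Uoo N) (cvgr_lt _ lim _ lt_eps)).
exists n => //; apply: (@le_trans _ _ (lyap_defect n t - lyap_defect n s)%:E); last first.
  by rewrite lee_fin; exact: ltW.
apply: nondecreasing_integral_derive => //.
- by move=> x y _ xy _; exact: lyap_defect_nd.
- by apply: measurable_funTS; exact: measurable_defect_rate.
- by move=> x _; rewrite le_max lexx.
apply: aeS (nondecreasing_ae_derivable (@lyap_defect_nd n)) => x dx _; split => //.
by rewrite /defect_rate slope_derive// max_r// nondecreasing_derive_ge0//; exact: lyap_defect_nd.
Qed.

(** Along indices that realize the lower limit, the power bound [K2 * B] bounds the conjugates,
    coercivity of [Psi*] then bounds the forces, and (E5) applies to a subsequence with converging
    powers and energies. As the forces are bounded and [I - p] tends to 0, the estimate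
    [v <= e - Xi (I - p)] yields the missing inequality between [L - W] and the energy. *)
Lemma limit_force r (beta : R) : 0 < r < T -> v n r @[n --> \oo] --> L r - W r ->
  limit_rate r = beta%:E ->
  (forall n, exists (Xi : X -> R) (k : R), [/\ F r (I n r) Xi, fconj (Psi (p n r)) (fun V => - Xi V) = k%:E,
      v n r <= e r (I n r) - Xi (I n r - p n r) &
      rt - defect_rate n r <= Pw r (I n r) Xi - k]) ->
  L r - W r = e r (P r) /\ exists Xi : X -> R, [/\ is_dual Xi, F r (P r) Xi &
    (fconj (Psi (P r)) (fun V => (- Xi V)%R) <= (Pw r (P r) Xi + beta - rt)%:E)%E].
Proof.
move=> /andP[r0 rT] vcv bE hX; have rT' : 0 <= r <= T by rewrite !ltW.
have [DP _ eLW] := limit_D rT'.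
have /choice[s sP] k : exists n, (k <= n)%N /\ defect_rate n r <= beta + k.+1%:R^-1.
  apply: contrapT => nex; have : ((beta + k.+1%:R^-1)%:E <= limit_rate r)%E.
    apply: limn_einf_ge; exists k => // n /= kn; rewrite lee_fin leNgt; apply/negP => /ltW h.
    by apply: nex; exists n.
  by rewrite bE lee_fin; apply/negP; rewrite -ltNge ltrDl invr_gt0.
have sn n : (n <= s n)%N by have [] := sP n.
have /choice[Xi XiP] n := hX (s n).
have /choice[k kP] n : exists k, [/\ F r (I (s n) r) (Xi n),
    fconj (Psi (p (s n) r)) (fun V => - Xi n V) = k%:E,
    v (s n) r <= e r (I (s n) r) - Xi n (I (s n) r - p (s n) r) &
    rt - defect_rate (s n) r <= Pw r (I (s n) r) (Xi n) - k] by exact: XiP.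
have DI n : D (I (s n) r) by have [] := scheme_I (S (s n)) rT'.
have gI n : g (I (s n) r) <= B by have [] := scheme_I (S (s n)) rT'.
have Dp n : D (p (s n) r) /\ g (p (s n) r) <= B by have [] := scheme_p (S (s n)) rT'.
have dX n : is_dual (Xi n) by have [FX _ _ _] := kP n; exact: (ggs_dual G rT' (DI n) FX).
have dNX n : is_dual (fun V => - Xi n V) by exact: is_dualN.
have k0 n : 0 <= k n.
  by have [_ kE _ _] := kP n; rewrite -lee_fin -kE; apply: (fconj_ge0 (dNX n)); rewrite (ggs_Psi0 G (Dp n).1).
have inv1 n : n.+1%:R^-1 <= 1 :> R by rewrite invf_le1// ler1n.
have PwU n : Pw r (I (s n) r) (Xi n) <= K2 * B.
  have [FX _ _ _] := kP n; apply: (le_trans (ggs_power_le G rT' (DI n) FX)).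
  by rewrite ler_wpM2l// ltW// (ggs_K2 G).
have kPw n : rt - beta - n.+1%:R^-1 + k n <= Pw r (I (s n) r) (Xi n).
  by have [_ _ _ h] := kP n; have [_ h2] := sP n; move: h h2; move: (n.+1%:R^-1) => q; lra.
(* The worst case of [kPw] and [PwU], the term [n.+1%:R^-1] being at most 1. *)
pose kmax := K2 * B - rt + beta + 1.
have kU n : k n <= kmax.
  by have := kPw n; have := PwU n; have := inv1 n; rewrite /kmax; move: (n.+1%:R^-1) => q; lra.
have [C C0 CP] := ggs_conj_coercive G B 1.
have XC n : dnorm (Xi n) <= kmax + C.
  rewrite -(dual_normN (dX n)) -[dnorm _]mul1r.
  apply: (CP _ _ _ (Dp n).1 (Dp n).2 (dNX n)).
  by have [_ -> _ _] := kP n; rewrite lee_fin.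
have [V UV Voo] := exists_ultra_oo.
have [Xi0 [dXi0 _ XiU]] := weak_star_ultra (U := V) dX XC.
have [Pl _ PwV] : exists2 l, `|l| <= Num.max (K2 * B) (- (rt - beta - 1)) &
    Pw r (I (s n) r) (Xi n) @[n --> V] --> l.
  apply: ultra_bounded => n; rewrite ler_norml; apply/andP; split.
    rewrite lerNl le_max; apply/orP; right; rewrite lerN2.
    by have := kPw n; have := k0 n; have := inv1 n; move: (n.+1%:R^-1) => q; lra.
  by rewrite le_max PwU.
have [kl _ kV] : exists2 l, `|l| <= kmax & k n @[n --> V] --> l.
  by apply: ultra_bounded => n; rewrite ger0_norm.
have [el _ eV] : exists2 l, `|l| <= B & e r (I (s n) r) @[n --> V] --> l.
  apply: ultra_bounded => n; have [_ _ e0 ev vB] := scheme_I (S (s n)) rT'.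
  by rewrite ger0_norm//; exact: le_trans vB.
have [s' [s'i [[Xs Ps] [ks es]]]] := along_subsequence Voo
  (along_and (along_and (weak_star_along Xsep dX XC dXi0 XiU) (along_cvg PwV))
     (along_and (along_cvg kV) (along_cvg eV))).
have s'n := increasing_ge s'i.
have ss n : (n <= s (s' n))%N by apply: leq_trans (s'n n) (sn _).
have Ics : I (s (s' n)) r @[n --> \oo] --> P r.
  exact: (cvg_comp_ge (s := s \o s') ss (interp_cvg rT')).
have pcs : p (s (s' n)) r @[n --> \oo] --> P r.
  exact: (cvg_comp_ge (s := s \o s') ss (scheme_cvg rT')).
have dXs n : is_dual (Xi (s' n)) by exact: dX.
have wX : weak_cvg_dual (fun n => Xi (s' n)) Xi0 by exact: weak_cvg_dualP.
have DF n : D (I (s (s' n)) r) /\ F r (I (s (s' n)) r) (Xi (s' n)).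
  by split => //; have [] := kP (s' n).
have [FXi PwXi eE] := ggs_closed G (Pn := fun n => I (s (s' n)) r)
  (Xin := fun n => Xi (s' n)) rT' DF DP Ics wX es Ps.
split.
  apply/eqP; rewrite eq_le eLW andbT -eE.
  have l1 : v (s (s' n)) r @[n --> \oo] --> L r - W r by exact: (cvg_comp_ge (s := s \o s') ss vcv).
  have l2 : e r (I (s (s' n)) r) + (kmax + C) * `|I (s (s' n)) r - p (s (s' n)) r| @[n --> \oo]
      --> el + (kmax + C) * 0.
    apply: rcvgD => //; apply: rcvgZ.
    exact: (cvg_comp_ge (s := s \o s') ss (interp_cvg_diff rT')).
  rewrite mulr0 addr0 in l2; apply: (ler_cvg_to l1 l2); apply: nearW => n.
  have [_ _ h _] := kP (s' n); apply: (le_trans h); rewrite lerD2l.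
  set x := _ - p _ _; apply: (le_trans (ler_norm _)); rewrite normrN.
  by apply: (le_trans (dual_le x (dX _))); rewrite ler_wpM2r.
exists Xi0; split => //.
have wNX : weak_cvg_dual (fun n V => - Xi (s' n) V) (fun V => - Xi0 V).
  apply: weak_cvg_dualP => // [|u]; first exact: is_dualN.
  by apply: rcvgN; exact: Xs.
have le_kl : (fconj (Psi (P r)) (fun V => (- Xi0 V)%R) <= kl%:E)%E.
  apply/lee_addgt0Pr => eps eps0; rewrite -EFinD.
  have lt_eps : kl < kl + eps by rewrite ltrDl.
  have [m _ mP] := cvgr_lt _ ks _ lt_eps.
  have shift n : (n <= n + m)%N by exact: leq_addr.
  apply: (ggs_conj_liminf G (S := B) (Pn := fun n => p (s (s' (n + m)%N)) r)
    (Xin := fun n V => - Xi (s' (n + m)%N) V)).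
  - exact: (cvg_comp_ge shift pcs).
  - by move=> n; exact: Dp.
  - apply: weak_cvg_dualP => // [|u]; first exact: is_dualN.
    by apply: rcvgN; exact: (cvg_comp_ge shift (Xs u)).
  - move=> n; have [_ -> _ _] := kP (s' (n + m)%N).
    by rewrite lee_fin ltW//; apply: mP => /=; exact: leq_addl.
apply: (le_trans le_kl); rewrite lee_fin.
have l1 : rt - beta - n.+1%:R^-1 + k (s' n) @[n --> \oo] --> rt - beta - 0 + kl.
  apply: rcvgD => //; apply: rcvgB; first exact: cvg_cst.
  exact: cvg_harmonic.
have := ler_cvg_to l1 Ps (nearW _ (fun n => le_trans _ (kPw (s' n)))).
rewrite subr0 => h; suff : rt - beta + kl <= Pl by move: PwXi; lra.
apply: h => n; rewrite lerD2r lerD2l lerN2 lef_pV2 ?posrE// ler_nat ltnS.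
exact: s'n.
Qed.

End Limit.

Lemma derive_linear_sub {R : realType} (k : R) (f : R -> R) (r : R) : derivable f r 1 ->
  derivable (fun t => k * t - f t) r 1 /\ 'D_1 (fun t => k * t - f t) r = k - 'D_1 f r.
Proof.
move=> df.
have h : is_derive r 1 (fun t => k * t - f t) (k - 'D_1 f r).
  have h1 : is_derive r 1 f ('D_1 f r) by exact: DeriveDef.
  have h2 : is_derive r 1 (fun t => k *: t) (k *: (1 : R)) by exact: is_deriveZ.
  by have := is_deriveB h2 h1; rewrite /GRing.scale /= mulr1.
by split; [exact: ex_derive|exact: derive_val].
Qed.

Section LimitCurve.
Context {R : realType} {X : completeNormedModType R} (T K1 K2 : R).
Context (e : R -> X -> R) (g : X -> R) (D : set X) (Psi : X -> X -> R).
Context (F : R -> X -> set (X -> R)) (Pw : R -> X -> (X -> R) -> R) (P0 : X).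
Notation mu := (@lebesgue_measure R).

(* [L] is the limit of energy plus accumulated dissipation, [W] that of the
   dissipation, and [rt - b] bounds the derivative of [L]. *)
Record limit_curve (B rt : R) (P : R -> X) (L W : R -> R) (b : R -> \bar R) : Prop := LimitCurve {
  limit_rt : 0 <= rt;
  limit_init : [/\ P 0 = P0, L 0 = e 0 P0 & W 0 = 0];
  limit_energy : forall t, 0 <= t <= T -> [/\ D (P t), e t (P t) <= B & e t (P t) <= L t - W t];
  limit_W : {homo W : x y / x <= y};
  limit_L : forall s t, 0 <= s -> s <= t -> t <= T -> L t <= L s + rt * (t - s);
  limit_modulus : forall M, 0 <= M -> exists2 C, 0 <= C &
    forall s t, s <= t -> M * `|P t - P s| <= W t - W s + C * (t - s);
  limit_b : measurable_fun setT b;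
  limit_b0 : forall t, (0 <= b t)%E;
  limit_L_b : forall s t, 0 <= s -> s <= t -> t <= T ->
    (\int[mu]_(r in `[s, t]) b r <= (rt * (t - s) - (L t - L s))%:E)%E;
  limit_ae : {ae mu, forall r, 0 < r < T -> [/\ derivable P r 1, derivable W r 1,
    Psi (P r) ('D_1 P r) <= 'D_1 W r &
    forall beta, b r = beta%:E -> L r - W r = e r (P r) /\
      exists Xi : X -> R, [/\ is_dual Xi, F r (P r) Xi &
        (fconj (Psi (P r)) (fun V => (- Xi V)%R) <= (Pw r (P r) Xi + beta - rt)%:E)%E]]} }.

(** Limits are taken twice. A first passage along [U] finds a subsequence converging at the dense
    times; the curves are rebuilt for it, so that the monotone quantities converge in the ordinary
    sense at continuity points. A further subsequence depending on the time then cannot change their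
    limits. *)
Lemma limit_curve_exists (Xsep : separable_space (X := X)) (Xrefl : reflexive_space (X := X))
    (G : real_ggs T K1 K2 e g D Psi F Pw) : D P0 ->
  exists B rt P L W b, limit_curve B rt P L W b.
Proof.
move=> DP0; have T0 := ggs_T G.
have [B [rt [p [I [v [w [B0 rt0 S]]]]]]] := discrete_scheme_exists G DP0.
have [d [d_itv d_dense]] := dense_itv T0.
have [U UU Uoo] := exists_ultra_oo.
have [Pc [Lc [Wc PLW]]] := limit_curves (U := U) G rt0 S.
have cd i : clamp 0 T (d i) = d i by exact: clamp_id.
have Q1 : along U (fun s => forall i, p (s n) (d i) @[n --> \oo] --> Pc (d i)).
  apply: along_forall => i; have [h _ _] := PLW (d i); rewrite cd in h.
  exact: (along_cvg (u := fun n => p n (d i)) h).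
have Q2 : along U (fun s => forall i, v (s n) (d i) + w (s n) (d i) @[n --> \oo] --> Lc (d i)).
  apply: along_forall => i; have [_ h _] := PLW (d i); rewrite cd in h.
  exact: (along_cvg (u := fun n => v n (d i) + w n (d i)) h).
have Q3 : along U (fun s => forall i, w (s n) (d i) @[n --> \oo] --> Wc (d i)).
  apply: along_forall => i; have [_ _ h] := PLW (d i); rewrite cd in h.
  exact: (along_cvg (u := fun n => w n (d i)) h).
have [s [si [sP [sL sW]]]] := along_subsequence Uoo (along_and Q1 (along_and Q2 Q3)).
have sn := increasing_ge si.
have S' n := S (s n).
have tau_cvg : T / (s n).+1%:R @[n --> \oo] --> (0 : R).
  have h : T * n.+1%:R^-1 @[n --> \oo] --> T * 0 by apply: rcvgZ; exact: cvg_harmonic.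
  by rewrite mulr0 in h; exact: (cvg_comp_ge sn h).
have p_d i : exists l : X, p (s n) (d i) @[n --> \oo] --> l by exists (Pc (d i)).
have vw_d i : exists l : R, v (s n) (d i) + w (s n) (d i) @[n --> \oo] --> l by exists (Lc (d i)).
have w_d i : exists l : R, w (s n) (d i) @[n --> \oo] --> l by exists (Wc (d i)).
have [Pl [Ll [Wl PLW']]] := limit_curves (U := U) G rt0 S'.
have W_nd : {homo Wl : x y / x <= y}.
  by move=> x y; exact: (limit_W_nd (UU := UU) G S' PLW').
have L_mono := limit_L_mono (UU := UU) S' PLW'.
have incr M M0 := limit_incr (UU := UU) G tau_cvg S' Uoo PLW' (M := M) M0.
pose v' n := v (s n); pose w' n := w (s n).
exists B, rt, Pl, Ll, Wl, (limit_rate T rt v' w'); split => //.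
- exact: (limit_0 (UU := UU) G S' PLW').
- by move=> t tT; exact: (limit_D (UU := UU) G B0 rt0 tau_cvg S' d_itv d_dense p_d Uoo PLW' tT).
- exact: (measurable_limit_rate G S').
- by move=> t; exact: (limit_rate_ge0 T rt v' w' t).
- by move=> x y x0 xy yT; exact: (limit_rate_integral (UU := UU) G S' Uoo PLW' x0 xy yT).
have [z [dz z1 znorm]] := norming_sequence Xsep.
have aeP : {ae mu, forall t, derivable Pl t 1}.
  have PF eps : 0 < eps -> exists2 k : R, 0 <= k &
      forall x y, x <= y -> `|Pl y - Pl x| <= eps * (Wl y - Wl x) + k * (y - x).
  move=> eps0.
  have [C C0 CP] := incr eps^-1 (ltac:(by rewrite invr_ge0 ltW)).
  exists (eps * C) => [|x y xy]; first by rewrite mulr_ge0// ltW.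
  have := CP _ _ xy; rewrite -(ler_pM2l eps0) mulVKf ?gt_eqF// mulrDr.
  by rewrite mulrA.
  exact: (ae_strong_derivable Xsep Xrefl W_nd PF dz z1 znorm).
have aeW := nondecreasing_ae_derivable W_nd.
(* [Ll] itself need not be monotone; this combination is nondecreasing, hence differentiable and so
   continuous a.e. *)
pose hL t := rt * clamp 0 T t - Ll t.
have hL_nd : {homo hL : x y / x <= y}.
  move=> x y xy; have /andP[x0 _] := clamp_itv x (ltW T0).
  have /andP[_ yT] := clamp_itv y (ltW T0).
  have cxy : clamp 0 T x <= clamp 0 T y by exact: clamp_homo.
  have LcE t : Ll (clamp 0 T t) = Ll t.
    have [_ h _] := PLW' (clamp 0 T t); rewrite clamp_id ?clamp_itv ?(ltW T0)// in h.
    have [_ h' _] := PLW' t; exact: (cvg_unique _ h h').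
  have := L_mono _ _ x0 cxy yT; rewrite /hL !LcE mulrBr; lra.
have aeL := nondecreasing_ae_derivable hL_nd.
have aeS' := ae_forall (fun n => scheme_derive (S' n)).
have aeD := ae_forall (fun n => nondecreasing_ae_derivable (lyap_defect_nd G S' n)).

pose c := clamp 0 T.
have near_c r : 0 < r < T -> \forall t \near r, c t = t.
  move=> rT.
  have : nbhs r `]0, T[%classic by apply: open_nbhs_nbhs; split; [exact: interval_open|rewrite /= in_itv].
  by apply: filterS => t /=; rewrite in_itv /= => /andP[t0 tT]; rewrite /c clamp_id// !ltW.
have aePW : {ae mu, forall r, derivable Pl r 1 /\ derivable Wl r 1}.
  by apply: aeS2 aeP aeW => r.
have aeLD : {ae mu, forall r, derivable hL r 1 /\ forall n, derivable
    (lyap_defect T rt (fun n => v (s n)) (fun n => w (s n)) n) r 1}.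
  by apply: aeS2 aeL aeD => r.
have aeLDP : {ae mu, forall r, (derivable hL r 1 /\ forall n, derivable
    (lyap_defect T rt (fun n => v (s n)) (fun n => w (s n)) n) r 1) /\
    (derivable Pl r 1 /\ derivable Wl r 1)}.
  by apply: aeS2 aeLD aePW => r.
apply: aeS2 aeLDP aeS' => r [[dL dD] [dP dW]] hS rT.
have rT' : 0 <= r <= T by have /andP[? ?] := rT; rewrite !ltW.
split => //; first exact: (Psi_le_slope (UU := UU) Xsep Xrefl G B0 rt0 tau_cvg S' d_itv d_dense p_d Uoo PLW' rT dP dW).
move=> beta bE.
have limd := limit_d (UU := UU) (p := fun n => p (s n)) (v := fun n => v (s n))
  (w := fun n => w (s n)) d_itv vw_d w_d Uoo PLW'.
have w_cvg : w (s n) r @[n --> \oo] --> Wl r.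
  apply: (monotone_cvg (f_ := fun n => w (s n)) _ _ rT d_dense) => [n x y||i].
  - exact: (scheme_w (S' n)).
  - exact/differentiable_continuous/derivable1_diffP.
  - exact: (limd i).2.
have L_cvg : rt * r - (v (s n) r + w (s n) r) @[n --> \oo] --> rt * r - Ll r.
  apply: (monotone_cvg (f_ := fun n t => rt * t - (v (s n) t + w (s n) t))
    (f := fun t => rt * t - Ll t) _ _ rT d_dense) => [n x y x0 xy yT||i].
  - by have := scheme_vw (S' n) x0 xy yT; rewrite mulrBr; lra.
  - have /derivable1_diffP/differentiable_continuous := dL.
    rewrite /prop_for /continuous_at /hL clamp_id//; apply: cvg_trans; apply: near_eq_cvg.
    by apply: filterS (near_c r rT) => t ct; rewrite -/c ct.
  - by apply: rcvgB; [exact: cvg_cst|exact: (limd i).1].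
have v_cvg : v (s n) r @[n --> \oo] --> Ll r - Wl r.
  apply: (cvg_ext (f := fun n => rt * r - (rt * r - (v (s n) r + w (s n) r)) - w (s n) r)).
    by move=> n; ring.
  rewrite -[Ll r](subKr (rt * r)); apply: rcvgB => //; apply: rcvgB => //; exact: cvg_cst.
apply: (limit_force (UU := UU) Xsep Xrefl G B0 rt0 tau_cvg S' d_itv d_dense p_d Uoo PLW' rT v_cvg bE).
move=> n; have rE : {near r, lyap_defect T rt (fun n => v (s n)) (fun n => w (s n)) n =1
    (fun t => rt * t - (v (s n) t + w (s n) t))}.
  by apply: filterS (near_c r rT) => t ct; rewrite /lyap_defect -/c ct.
have dn := dD n; have dvw0 := near_eq_derivable rE dn.
have vwE : (fun t => rt * t - (rt * t - (v (s n) t + w (s n) t))) =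
    (fun t => v (s n) t + w (s n) t) by apply/funext => t; rewrite subKr.
have [dvw dvwE] := derive_linear_sub rt dvw0; rewrite vwE in dvw dvwE.
have [Xi [k [h1 h2 h3 h4]]] := hS n rT dvw.
exists Xi, k; split => //; apply: le_trans h4; rewrite dvwE.
rewrite -(near_eq_derive _ rE)// lerD2l lerN2 /defect_rate (slope_derive dn).
by rewrite le_max lexx orbT.
Qed.

End LimitCurve.

(** * Borel subsets of the phase space *)

Section OpenCells.
Context {R : realType} {Y : Type} (T : R) (dom : Y -> Prop) (dist : Y -> Y -> R) (y : nat -> Y).
Hypothesis dist_sym : forall a b, dom a -> dom b -> dist a b = dist b a.
Hypothesis dist_tri : forall a b c, dom a -> dom b -> dom c -> dist a c <= dist a b + dist b c.
Hypothesis dom_y : forall n, dom (y n).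
Hypothesis y_dense : forall x e, dom x -> 0 < e -> exists n, dist x (y n) < e.

(** Stated for a type with a predicate and a distance, so that it applies both to the dual, whose
    points are functions satisfying [is_dual], and to [X]. *)
Definition open_on (O : R -> Y -> Prop) : Prop := forall r x, 0 <= r <= T -> dom x -> O r x ->
  exists2 e : R, 0 < e & forall r' x', 0 <= r' <= T -> dom x' ->
    `|r - r'| < e -> dist x x' < e -> O r' x'.

Definition cell_code (m : nat) : rat * nat * nat := odflt (0, 0%N, 0%N) (unpickle m).
Definition cell_time (m : nat) : R := ratr (cell_code m).1.1.
Definition cell_radius (m : nat) : R := (cell_code m).1.2.+1%:R^-1.
Definition cell_center (m : nat) : nat := (cell_code m).2.

Lemma cell_radius_ge0 m : 0 <= cell_radius m.
Proof. by rewrite invr_ge0. Qed.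

Definition in_cell (m : nat) (r : R) (x : Y) : Prop :=
  `|r - cell_time m| <= cell_radius m /\ dist x (y (cell_center m)) <= cell_radius m.

(** Lindelof property: the cells contained in [O] exhaust it, as centers run through a dense set and
    radii through the numbers [1 / (k + 1)]. *)
Lemma open_on_cells (O : R -> Y -> Prop) : open_on O ->
  exists good : nat -> Prop, forall r x, 0 <= r <= T -> dom x ->
    (O r x <-> exists m, good m /\ in_cell m r x).
Proof.
move=> oO.
exists (fun m => forall r x, 0 <= r <= T -> dom x -> in_cell m r x -> O r x).
move=> r x rT dx; split=> [Orx|[m [h c]]]; last exact: h.
have [e e0 eP] := oO r x rT dx Orx.
have e2 : 0 < e / 2 by rewrite divr_gt0.
have [k _ /(_ k (leqnn k)) /= ke] := near_infty_natSinv_lt (PosNum e2).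
have k0 : 0 < k.+1%:R^-1 :> R by rewrite invr_gt0.
have [j jx] := y_dense dx k0.
have [q] := rat_in_itvoo (ltac:(by rewrite ltrDl) : r < r + k.+1%:R^-1).
rewrite in_itv /= => /andP[rq qr].
exists (pickle (q, k, j)); rewrite /in_cell /cell_time /cell_radius /cell_center /cell_code !pickleK /=.
split; last by split; [rewrite ler_norml; apply/andP; split; move: rq qr; move: (k.+1%:R^-1) => ?; lra|exact: ltW].
move=> r' x' rT' dx' [h1 h2]; apply: eP => //.
  move: h1 ke rq qr; rewrite ltr_norml ler_norml; move: (k.+1%:R^-1) (ratr q) => ? ?.
  by move=> /andP[? ?] ? ? ?; apply/andP; split; lra.
apply: (le_lt_trans (dist_tri dx (dom_y j) dx')); rewrite (dist_sym (dom_y j) dx').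
by move: h2 jx ke; move: (k.+1%:R^-1) => ?; lra.
Qed.

Lemma open_on_measurable d (Tm : measurableType d) (time : Tm -> R) (Z : Tm -> Y)
    (O : R -> Y -> Prop) :
  (forall z, dom (Z z)) ->
  (forall q c, measurable [set z | `|time z - q| <= c]) ->
  (forall j c, measurable [set z | 0 <= time z <= T /\ dist (Z z) (y j) <= c]) ->
  open_on O -> measurable [set z | 0 <= time z <= T /\ O (time z) (Z z)].
Proof.
move=> dZ mt mZ /open_on_cells[good gP].
pose C m := [set z | `|time z - cell_time m| <= cell_radius m] `&`
  [set z | 0 <= time z <= T /\ dist (Z z) (y (cell_center m)) <= cell_radius m].
have -> : [set z | 0 <= time z <= T /\ O (time z) (Z z)] = \bigcup_(m in good) C m.
  apply/seteqP; split => z /=.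
    by move=> [zT Oz]; have /(gP _ _ zT (dZ z))[m [gm [h1 h2]]] := Oz; exists m.
  move=> [m gm [h1 [zT h2]]]; split => //; apply/(gP _ _ zT (dZ z)).
  by exists m.
by apply: bigcup_measurable => m _; apply: measurableI; [exact: mt|exact: mZ].
Qed.

End OpenCells.

(** * Borel sets are bianalytic *)

Section Bianalytic.
Context {R : realType} {X : normedModType R} (T : R).
Hypothesis Xsep : separable_space (X := X).
Variable y : nat -> X -> R.
Hypothesis dy : forall n, is_dual (y n).
Hypothesis y_dense : forall xi (e : R), is_dual xi -> 0 < e ->
  exists n, dnorm (fun u => xi u - y n u) < e.

Definition dual_dist (xi z : X -> R) : R := dnorm (fun u => xi u - z u).

Lemma dual_dist_sym xi z : is_dual xi -> is_dual z -> dual_dist xi z = dual_dist z xi.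
Proof. by move=> h1 h2; rewrite /dual_dist dual_normBC. Qed.

Lemma dual_dist_tri a b c : is_dual a -> is_dual b -> is_dual c ->
  dual_dist a c <= dual_dist a b + dual_dist b c.
Proof. by move=> h1 h2 h3; exact: dual_norm_triangle. Qed.

Definition open_cells := open_on_cells (T := T) (dom := is_dual) (dist := dual_dist) (y := y)
  dual_dist_sym dual_dist_tri dy y_dense.

(** Distance greater than [c] is witnessed at one vector of a dense sequence with a definite margin,
    and each such condition is weak-* closed. *)
Lemma analytic_dual_far (z : X -> R) (c : R) : is_dual z -> 0 <= c ->
  analytic T (fun _ xi => ~ dual_dist xi z <= c).
Proof.
move=> dz c0; have [w wd] := separable_dense_seq Xsep.
have h i k : analytic T (fun (_ : R) xi => c * `|w i| + k.+1%:R^-1 <= `|xi (w i) - z (w i)|).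
  apply: analytic_closed => M rn xn sn r xi s hn _ _ _ xnxi _.
  have lim : `|xn n (w i) - z (w i)| @[n --> \oo] --> `|xi (w i) - z (w i)|.
    by apply: cvg_norm; apply: cvgB; [exact: xnxi|exact: cvg_cst].
  by apply: (cvg_lim_ge lim); apply: nearW => n; have [] := hn n.
apply: analytic_ext (analytic_exists (fun i => analytic_exists (h i))) => r xi _ dxi; split.
  move=> [i [k hk]] le_c.
  have h1 := le_trans hk (dual_le (w i) (is_dualB dxi dz)).
  have h2 := le_trans h1 (ler_wpM2r (normr_ge0 _) le_c).
  have k0 : 0 < k.+1%:R^-1 :> R by rewrite invr_gt0.
  by move: h2 k0; move: (k.+1%:R^-1) => q; lra.
move=> nle; apply: contrapT => nex; apply: nle; apply: dual_norm_le => // u.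
have [C C0 zC] := dual_bounded (is_dualB dxi dz).
rewrite leNgt; apply/negP => lt_u.
pose gap := `|xi u - z u| - c * `|u|.
have gap0 : 0 < gap by rewrite subr_gt0.
(* Replacing [u] by some [w i] within this distance [d] costs at most [(C + c) d], hence at most
   half of the gap. *)
have s0 : 0 < gap / (2 * (C + c + 1)) by rewrite divr_gt0// mulr_gt0//; lra.
have [i iu] := wd u _ s0; set d := `|u - w i| in iu.
have d0 : 0 <= d by exact: normr_ge0.
have Cc0 : 0 < C + c + 1 by lra.
have dgap : (C + c) * d <= gap / 2.
  have -> : gap / 2 = (C + c + 1) * (gap / (2 * (C + c + 1))) by field; rewrite gt_eqF.
  by apply: ler_pM; rewrite ?(ltW iu)//; lra.
have g2 : 0 < gap / 2 by rewrite divr_gt0.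
have [k _ /(_ k (leqnn k)) /= kg] := near_infty_natSinv_lt (PosNum g2).
apply: nex; exists i, k.
have h1 : `|w i| <= `|u| + d.
  by rewrite -[w i](subKr u); apply: (le_trans (ler_normB _ _)).
have h2 : `|xi u - z u| <= `|xi (w i) - z (w i)| + C * d.
  have := zC (u - w i); rewrite (dualB _ _ dxi) (dualB _ _ dz) -/d.
  have -> : xi u - z u = (xi (w i) - z (w i)) + (xi u - xi (w i) - (z u - z (w i))) by ring.
  by move=> hu; apply: (le_trans (ler_normD _ _)); rewrite lerD2l.
have h3 : c * `|w i| <= c * `|u| + c * d by rewrite -mulrDr ler_wpM2l.
move: kg dgap h2 h3; rewrite /gap; move: (k.+1%:R^-1) => q; lra.
Qed.

Lemma bianalytic_time (q c : R) : bianalytic T (fun r (_ : X -> R) => `|r - q| <= c).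
Proof.
split.
  apply: analytic_closed => M rn xn sn r xi s hn rnr _ _ _ _.
  have lim : `|rn n - q| @[n --> \oo] --> `|r - q|.
    by apply: cvg_norm; apply: rcvgB; [exact: rnr|exact: cvg_cst].
  by apply: (cvg_lim_le lim); apply: nearW => n; have [] := hn n.
have h k : analytic T (fun r (_ : X -> R) => c + k.+1%:R^-1 <= `|r - q|).
  apply: analytic_closed => M rn xn sn r xi s hn rnr _ _ _ _.
  have lim : `|rn n - q| @[n --> \oo] --> `|r - q|.
    by apply: cvg_norm; apply: rcvgB; [exact: rnr|exact: cvg_cst].
  by apply: (cvg_lim_ge lim); apply: nearW => n; have [] := hn n.
apply: analytic_ext (analytic_exists h) => r xi _ _; split.
  move=> [k hk] /(le_trans hk); apply/negP; rewrite -ltNge ltrDl invr_gt0//.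
move=> /negP; rewrite -ltNge => gap; have g0 : 0 < `|r - q| - c by rewrite subr_gt0.
have [k _ /(_ k (leqnn k)) /= kg] := near_infty_natSinv_lt (PosNum g0).
by exists k; move: kg; move: (k.+1%:R^-1) => ?; lra.
Qed.

Lemma bianalytic_and (A B : R -> (X -> R) -> Prop) :
  bianalytic T A -> bianalytic T B -> bianalytic T (fun r xi => A r xi /\ B r xi).
Proof.
move=> [a1 a2] [b1 b2]; split; first exact: analytic_and.
apply: analytic_ext (analytic_or a2 b2) => r xi _ _; split; first by move=> [h [h' _]|h [_ h']].
by move=> h; have [ha|] := pselect (A r xi); [right => hb; exact: h|left].
Qed.

Lemma bianalytic_dual (z : X -> R) (c : R) : is_dual z -> 0 <= c ->
  bianalytic T (fun _ xi => dual_dist xi z <= c).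
Proof.
by move=> dz c0; split; [apply: analytic_closed; exact: weak_closed_ball|exact: analytic_dual_far].
Qed.

Lemma bianalytic_const (Q : Prop) : bianalytic T (fun _ (_ : X -> R) => Q).
Proof.
have h (Q' : Prop) : analytic T (fun _ (_ : X -> R) => Q').
  by apply: analytic_closed => M rn xn sn r xi s hn _ _ _ _ _; have [] := hn 0%N.
by split; exact: h.
Qed.

Lemma bianalytic_ext (A B : R -> (X -> R) -> Prop) :
  (forall r xi, 0 <= r <= T -> is_dual xi -> (A r xi <-> B r xi)) ->
  bianalytic T A -> bianalytic T B.
Proof.
move=> AB [a1 a2]; split; first exact: (analytic_ext AB a1).
apply: (analytic_ext _ a2).
by move=> r xi rT dxi; rewrite AB.
Qed.

Lemma bianalytic_open (O : R -> (X -> R) -> Prop) :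
  open_on T is_dual dual_dist O -> bianalytic T O.
Proof.
move=> /open_cells[good gP].
apply: (@bianalytic_ext (fun r xi => exists m, good m /\
  in_cell dual_dist y m r xi)).
  by move=> r xi rT dxi; rewrite gP.
apply: bianalytic_exists => m; apply: bianalytic_and; first exact: bianalytic_const.
apply: bianalytic_and; first exact: bianalytic_time.
by apply: bianalytic_dual => //; exact: cell_radius_ge0.
Qed.

Lemma rel_open_on (P : R -> X) (U : set (R * X * (X -> R))) :
  (forall (e r : R), 0 <= r <= T -> 0 < e -> exists2 del : R, 0 < del &
     forall r', 0 <= r' <= T -> `|r - r'| < del -> `|P r - P r'| < e) ->
  rel_open T U -> open_on T is_dual dual_dist (fun r xi => U (r, P r, xi)).
Proof.
move=> cP [Usub oU] r xi rT dxi Uz.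
have [e e0 eP] := oU _ Uz; have [del del0 dP] := cP e r rT e0.
exists (Num.min e del) => [|r' xi' rT' dxi']; first by rewrite lt_min e0.
rewrite !lt_min => /andP[h1 h2] /andP[h3 _]; apply: eP; first by split => //=; rewrite in_itv.
by rewrite /pdist /= !gt_max h1 h3 (dP _ rT' h2).
Qed.

(** The sets whose trace along the continuous curve [P] is bianalytic form a sigma-algebra
    containing the relatively open sets. *)
Lemma bianalytic_borel (P : R -> X) (A : set (R * X * (X -> R))) :
  (forall (e r : R), 0 <= r <= T -> 0 < e -> exists2 del : R, 0 < del &
     forall r', 0 <= r' <= T -> `|r - r'| < del -> `|P r - P r'| < e) ->
  borel_set T A -> bianalytic T (fun r xi => A (r, P r, xi)).
Proof.
move=> cP; move: A.
suff : borel_set (X := X) T `<=` [set A | bianalytic T (fun r xi => A (r, P r, xi))] by exact.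
apply: smallest_sub; first split.
- exact: bianalytic_const.
- move=> A bA; apply: bianalytic_ext (bianalytic_not bA) => r xi rT dxi; split.
    by move=> nA; split => //; split => //=; rewrite in_itv.
  by move=> [].
- move=> A bA; apply: bianalytic_ext (bianalytic_exists bA) => r xi _ _.
  by split=> [[n h]|[n _ h]]; exists n.
by move=> U oU; apply: bianalytic_open; exact: rel_open_on.
Qed.

Lemma bianalytic_measurable (A : set R) : measurable A -> bianalytic T (fun r (_ : X -> R) => A r).
Proof.
have -> : measurable A = (<<s @RGenCInfty.G R >> A) :> Prop.
  by rewrite -[RHS]/((@RGenCInfty.G R).-sigma.-measurable A) -RGenCInfty.measurableE.
move: A.
suff : <<s @RGenCInfty.G R >> `<=` [set A | bianalytic T (fun r (_ : X -> R) => A r)] by exact.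
apply: smallest_sub; first split.
- exact: bianalytic_const.
- move=> A bA; apply: bianalytic_ext (bianalytic_not bA) => r xi _ _.
  by split=> [|[]].
- move=> A bA; apply: bianalytic_ext (bianalytic_exists bA) => r xi _ _.
  by split=> [[n h]|[n _ h]]; exists n.
move=> _ [x ->].
(* On [[0, T]] the ray [r >= x] coincides with this bounded interval, so that [bianalytic_time]
   applies. *)
apply: (@bianalytic_ext (fun r _ => `|r - (x + Num.max 0 (T - x))| <= Num.max 0 (T - x))).
  move=> r xi /andP[r0 rT] _ /=; rewrite in_itv /= andbT.
  have m1 : 0 <= Num.max 0 (T - x) by rewrite le_max lexx.
  have m2 : T - x <= Num.max 0 (T - x) by rewrite le_max lexx orbT.
  move: (Num.max 0 (T - x)) m1 m2 => m m1 m2; rewrite ler_norml; split.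
    by move=> /andP[h _]; lra.
  by move=> h; apply/andP; split; lra.
exact: bianalytic_time.
Qed.

End Bianalytic.

(** * Analyticity and closedness of the admissible forces *)

Section ForceSelection.
Context {R : realType} {X : completeNormedModType R} (T K1 K2 : R).
Context (e : R -> X -> R) (g : X -> R) (D : set X) (Psi : X -> X -> R).
Context (F : R -> X -> set (X -> R)) (Pw : R -> X -> (X -> R) -> R).
Hypothesis Xsep : separable_space (X := X).
Hypothesis Xrefl : reflexive_space (X := X).
Hypothesis G : real_ggs T K1 K2 e g D Psi F Pw.
Notation mu := (@lebesgue_measure R).
Hypothesis graph_borel : borel_set T (graphF T D F).
Hypothesis Pw_borel : forall O : set R, open O ->
  borel_set T (graphF T D F `&` [set z | O (Pw z.1.1 z.1.2 z.2)]).

Variables (P : R -> X) (S : R).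
Hypothesis P_D : forall r, 0 <= r <= T -> D (P r) /\ g (P r) <= S.
Hypothesis P_cont : forall (eps r : R), 0 <= r <= T -> 0 < eps -> exists2 del : R, 0 < del &
  forall r', 0 <= r' <= T -> `|r - r'| < del -> `|P r - P r'| < eps.

Lemma curve_cvg (rn : nat -> R) r : (forall n, 0 <= rn n <= T) -> 0 <= r <= T ->
  rn n @[n --> \oo] --> r -> P (rn n) @[n --> \oo] --> P r.
Proof.
move=> rnT rT rnr; apply/cvgrPdist_lt => eps eps0.
have [del del0 delP] := P_cont rT eps0.
by move/cvgrPdist_lt: rnr => /(_ _ del0); apply: filterS => n h; exact: delP.
Qed.

Lemma conj_curve_liminf (rn : nat -> R) r (xn : nat -> X -> R) xi (c : R) :
  (forall n, 0 <= rn n <= T) -> 0 <= r <= T -> rn n @[n --> \oo] --> r ->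
  (forall n, is_dual (xn n)) -> is_dual xi -> (forall u, xn n u @[n --> \oo] --> xi u) ->
  (forall n, (fconj (Psi (P (rn n))) (fun V => - xn n V)%R <= c%:E)%E) ->
  (fconj (Psi (P r)) (fun V => - xi V)%R <= c%:E)%E.
Proof.
move=> rnT rT rnr dx dxi xnxi h.
apply: (ggs_conj_liminf G (S := S) (curve_cvg rnT rT rnr) _ _ h).
  by move=> n; exact: P_D.
apply: weak_cvg_dualP => // [n||u]; [exact: is_dualN|exact: is_dualN|].
by apply: rcvgN.
Qed.

Lemma open_conj (c : R) : open_on T (is_dual (X := X)) dual_dist
  (fun r xi => ~ (fconj (Psi (P r)) (fun V => - xi V)%R <= c%:E)%E).
Proof.
move=> r xi rT dxi hxi; apply: contrapT => nex; apply: hxi.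
have /choice[z zP] (m : nat) : exists q : R * (X -> R), [/\ 0 <= q.1 <= T, is_dual q.2,
    `|r - q.1| < m.+1%:R^-1, dual_dist xi q.2 < m.+1%:R^-1 &
    (fconj (Psi (P q.1)) (fun V => - q.2 V)%R <= c%:E)%E].
  apply: contrapT => nq; apply: nex; exists m.+1%:R^-1; first by rewrite invr_gt0.
  by move=> r' x' rT' dx' h1 h2 h3; apply: nq; exists (r', x').
apply: (@conj_curve_liminf (fun m => (z m).1) r (fun m => (z m).2) xi c).
- by move=> m; have [] := zP m.
- by [].
- apply/cvgrPdist_lt => eps eps0.
  apply: filterS (near_infty_natSinv_lt (PosNum eps0)) => m /= mE.
  by have [_ _ h _ _] := zP m; exact: lt_trans h mE.
- by move=> m; have [] := zP m.
- by [].
- move=> u; apply/cvgrPdist_le => eps eps0.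
  have e1 : 0 < eps / (`|u| + 1) by rewrite divr_gt0// ltr_wpDl.
  apply: filterS (near_infty_natSinv_lt (PosNum e1)) => m /= mE.
  have [_ dz _ h _] := zP m.
  apply: (le_trans (dual_le u (is_dualB dxi dz))).
  rewrite -(@divfK _ (`|u| + 1) _ eps) ?gt_eqF ?ltr_wpDl//.
  apply: ler_pM => //; [exact/dual_norm_ge0/is_dualB|exact/ltW/(lt_trans h)|by rewrite lerDl].
- by move=> m; have [] := zP m.
Qed.

Variables (bb : R -> R) (rt : R).
Hypothesis mbb : measurable_fun setT bb.

(** The pointwise relation left by the limit passage; together with the bound on the integral of [b]
    it controls the dissipation of the force. *)
Definition force_rel (r : R) (xi : X -> R) : Prop := F r (P r) xi /\
  (fconj (Psi (P r)) (fun V => - xi V)%R <= (Pw r (P r) xi + bb r - rt)%:E)%E.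

Let q_ (i : nat) : R := ratr (odflt (0 : rat) (unpickle i)).

Let q_dense (x y : R) : x < y -> exists i, x < q_ i < y.
Proof.
by move=> xy; have [q] := rat_in_itvoo xy; rewrite in_itv /= => h; exists (pickle q); rewrite /q_ pickleK.
Qed.

Lemma force_graphE r xi : 0 <= r <= T -> is_dual xi ->
  (graphF T D F (r, P r, xi) <-> F r (P r) xi).
Proof.
move=> rT dxi; split=> [[_ []]//|h]; split; first by rewrite /= in_itv.
by split => //; have [] := P_D rT.
Qed.

(** The conjugate is lower semicontinuous and the power only Borel, so their comparison is cut at
    rationals: for every [q_ i], either the right-hand side is at least [q_ i], a bianalytic
    condition on the graph, or the conjugate is at most [q_ i], a weakly closed one. *)
Lemma force_analytic (y : nat -> X -> R) : (forall n, is_dual (y n)) ->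
  (forall xi (eps : R), is_dual xi -> 0 < eps ->
     exists n, dnorm (fun u => xi u - y n u) < eps) ->
  analytic T force_rel.
Proof.
move=> dy y_dense.
(* The inequality [Pw + bb - rt < q_ i] is split at a rational [q_ j] between [Pw] and
   [q_ i + rt - bb]. *)
pose Q i j r xi := (graphF T D F `&` [set z | z.2 = z.2 /\ Pw z.1.1 z.1.2 z.2 < q_ j]) (r, P r, xi)
  /\ bb r < q_ i + rt - q_ j.
have bQ i j : bianalytic T (Q i j).
  apply: bianalytic_and; last first.
    apply: (bianalytic_measurable T (A := [set r | bb r < q_ i + rt - q_ j])).
    rewrite -[X in measurable X]setTI.
    rewrite (_ : [set r | _] = bb @^-1` `]-oo, (q_ i + rt - q_ j)[%classic).
      exact: mbb.
    by apply/seteqP; split => r /=; rewrite in_itv.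
  apply: (bianalytic_borel Xsep dy y_dense P_cont).
  have := Pw_borel (open_lt (y := q_ j)); congr borel_set.
  by congr setI; apply/seteqP; split => z /=; [split|case].
have clq i : analytic T (fun r xi => (fconj (Psi (P r)) (fun V => - xi V)%R <= (q_ i)%:E)%E).
  apply: analytic_closed => M rn xn sn r xi s hn rnr rT dxi xnxi _.
  by apply: (conj_curve_liminf _ rT rnr _ dxi xnxi) => n; have [] := hn n.
have aF := (bianalytic_borel Xsep dy y_dense P_cont graph_borel).1.
have aall := analytic_forall (fun i => analytic_or (bianalytic_not (bianalytic_exists (bQ i))).1 (clq i)).
apply: analytic_ext (analytic_and aF aall) => r xi rT dxi.
have QE i : (exists j, Q i j r xi) <-> F r (P r) xi /\ Pw r (P r) xi + bb r - rt < q_ i.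
  split=> [[j [[/(force_graphE rT dxi) h1 [_ /= h2]] h3]]|[h1 h2]]; first by split => //; lra.
  have [j /andP[j1 j2]] := q_dense (ltac:(lra) : Pw r (P r) xi < q_ i + rt - bb r).
  exists j; split; last by lra.
  by split => //; exact/force_graphE.
split.
  move=> [/(force_graphE rT dxi) h1 h2]; split => //; apply/lee_addgt0Pr => eps eps0.
  have [i /andP[i1 i2]] := q_dense (ltac:(by rewrite ltrDl) :
    Pw r (P r) xi + bb r - rt < Pw r (P r) xi + bb r - rt + eps).
  have [/QE h|h] := h2 i; first by exfalso; apply: h.
  by apply: (le_trans h); rewrite lee_fin ltW.
move=> [h1 h2]; split; first exact/force_graphE.
move=> i; have [le_i|lt_i] := leP (q_ i) (Pw r (P r) xi + bb r - rt).
  by left => /QE[_]; rewrite ltNge le_i.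
by right; apply: (le_trans h2); rewrite lee_fin ltW.
Qed.

(** (E5) with a constant sequence of states. The powers have a convergent subsequence: they are
    bounded above by (E4), and below by the relation itself since [Psi* >= 0]. *)
Lemma force_closed r (xn : nat -> X -> R) xi : 0 <= r <= T ->
  (forall n, is_dual (xn n) /\ force_rel r (xn n)) -> is_dual xi ->
  dnorm (fun u => xn n u - xi u) @[n --> \oo] --> (0 : R) -> force_rel r xi.
Proof.
move=> rT hn dxi cv; have [DP gP] := P_D rT.
have dx n : is_dual (xn n) by have [] := hn n.
have xnxi u : xn n u @[n --> \oo] --> xi u.
  apply/cvgrPdist_le => eps eps0.
  have e1 : 0 < eps / (`|u| + 1) by rewrite divr_gt0// ltr_wpDl.
  move/cvgrPdist_lt: cv => /(_ _ e1); apply: filterS => n h.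
  rewrite distrC; apply: (le_trans (dual_le u (is_dualB (dx n) dxi))).
  rewrite -(@divfK _ (`|u| + 1) _ eps) ?gt_eqF ?ltr_wpDl//.
  move: h; rewrite sub0r normrN ger0_norm; last exact/dual_norm_ge0/is_dualB.
  by move=> h; apply: ler_pM => //; [exact/dual_norm_ge0/is_dualB|exact/ltW|rewrite lerDl].
have Pw_bnd n : `|Pw r (P r) (xn n)| <= Num.max (K2 * g (P r)) (bb r - rt).
  have [_ [FX fX]] := hn n; rewrite ler_norml; apply/andP; split.
    rewrite lerNl le_max; apply/orP; right.
    have := le_trans (fconj_ge0 (is_dualN (dx n)) (ggs_Psi0 G DP)) fX.
    by rewrite lee_fin; lra.
  by rewrite le_max (ggs_power_le G rT DP FX).
have [U UU Uoo] := exists_ultra_oo.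
have [l _ lU] := ultra_bounded (U := U) Pw_bnd.
have [s [si sl]] := along_subsequence Uoo (along_cvg (u := fun n => Pw r (P r) (xn n)) lU).
have sn := increasing_ge si.
have xs u : xn (s n) u @[n --> \oo] --> xi u by exact: (cvg_comp_ge sn (xnxi u)).
have dxs n : is_dual (xn (s n)) by exact: dx.
have DF n : D (P r) /\ F r (P r) (xn (s n)) by split => //; have [_ []] := hn (s n).
have cP : (fun=> P r) @ \oo --> P r by exact: cvg_cst.
have ce : (fun=> e r (P r)) @ \oo --> e r (P r) by exact: cvg_cst.
have [FX lP _] := ggs_closed G (Pn := fun=> P r) (Xin := fun n => xn (s n)) rT DF DP cP
  (weak_cvg_dualP Xrefl dxs dxi xs) ce sl.
split => //; apply: (@le_trans _ _ (l + bb r - rt)%:E); last by rewrite lee_fin; lra.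
apply/lee_addgt0Pr => eps eps0; rewrite -EFinD.
have lt_eps : l < l + eps by rewrite ltrDl.
have [m _ mP] := cvgr_lt _ sl _ lt_eps.
have shift n : (n <= n + m)%N by exact: leq_addr.
apply: (@conj_curve_liminf (fun=> r) r (fun n => xn (s (n + m)%N))) => //.
- exact: cvg_cst.
- by move=> u; exact: (cvg_comp_ge shift (xs u)).
move=> n; have [_ [_ fX]] := hn (s (n + m)%N); apply: (le_trans fX); rewrite lee_fin.
by have := mP (n + m)%N (leq_addl _ _); rewrite /=; lra.
Qed.

End ForceSelection.

(** * The completed Lebesgue measure *)

(* [mc] is a complete measure extending the Lebesgue measure along [io]. It is
   kept abstract because the carrier of [completed_lebesgue_measure] is only
   convertible to [R]. *)
Definition completes_lebesgue {R : realType} d (Tc : measurableType d)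
    (mc : {measure set Tc -> \bar R}) (io : Tc -> R) : Prop :=
  [/\ forall A : set R, measurable A -> measurable (io @^-1` A),
      forall A : set R, measurable A -> mc (io @^-1` A) = (@lebesgue_measure R) A &
      measure_is_complete mc].

Lemma completed_lebesgue_completes {R : realType} :
  completes_lebesgue (@completed_lebesgue_measure R) (fun x => x).
Proof.
split; [|by []|exact: completed_lebesgue_measure_is_complete].
by move=> A mA; exact: sub_caratheodory.
Qed.

Section Completion.
Context {R : realType} d (Tc : measurableType d) (mc : {measure set Tc -> \bar R}) (io : Tc -> R).
Hypothesis mcP : completes_lebesgue mc io.
Notation mu := (@lebesgue_measure R).

Lemma measurable_completion A : measurable A -> measurable (io @^-1` A).
Proof. by have [h _ _] := mcP; exact: h. Qed.

Lemma measurable_fun_completion : measurable_fun setT io.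
Proof. by move=> _ A mA; rewrite setTI; exact: measurable_completion. Qed.

Lemma negligible_completion N : mu.-negligible N -> mc.-negligible (io @^-1` N).
Proof.
move=> [A [mA A0 NA]]; have [h1 h2 _] := mcP.
by exists (io @^-1` A); split; [exact: h1|rewrite -A0; exact: h2|move=> x /NA].
Qed.

Lemma ae_completion (Q : R -> Prop) :
  {ae mu, forall r, Q r} -> {ae mc, forall x, Q (io x)}.
Proof. by move=> /negligible_completion. Qed.

Lemma measurable_ae_completion (A B : set Tc) : measurable A ->
  {ae mc, forall x, A x <-> B x} -> measurable B.
Proof.
move=> mA [N [mN N0 NP]]; have [_ _ cm] := mcP.
have -> : B = (A `\` N) `|` (B `&` N).
  apply/seteqP; split => x.
    move=> Bx; have [Nx|nNx] := pselect (N x); [by right|left; split => //].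
    by apply: contrapT => nA; apply: nNx; apply: NP => /= AB; apply: nA; exact/AB.
  move=> [[Ax nNx]|[]//]; apply: contrapT => nB; apply: nNx; apply: NP => /= AB.
  by apply: nB; exact/AB.
apply: measurableU; first exact: measurableD.
by apply: cm; exists N; split => // x [].
Qed.

(** Lebesgue measure is the image of [mc] under [io], so this is a change of variables. *)
Lemma integral_completion (D : set R) (f : R -> \bar R) : measurable D ->
  measurable_fun D f -> (forall x, D x -> (0 <= f x)%E) ->
  (\int[mc]_(x in io @^-1` D) f (io x) = \int[mu]_(r in D) f r)%E.
Proof.
move=> mD mf f0; pose phi : Tc -> measurableTypeR R := io.
have mphi : measurable_fun setT phi by exact: measurable_fun_completion.
have eqm (A : set (measurableTypeR R)) : measurable A -> mu A = pushforward mc phi A.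
  by move=> mA; have [_ h2 _] := mcP; rewrite /pushforward h2.
rewrite [RHS](eq_measure_integral (pushforward mc phi)); last by move=> A mA _; exact: eqm.
by rewrite [RHS]ge0_integral_pushforward// => r; rewrite inE => /f0.
Qed.

End Completion.

Section MonotoneSum.
Context {R : realType}.

(* Removing a degenerate interval, or else the rightmost one, leaves a family of
   non-overlapping intervals on the left of it. *)
Lemma sum_increments_le (W : R -> R) (I : finType) (a b : I -> R) (x y : R) :
  {homo W : s t / s <= t} -> forall A : {set I},
  (forall i, i \in A -> x <= a i /\ a i <= b i /\ b i <= y) ->
  (forall i j, i \in A -> j \in A -> i != j -> b i <= a j \/ b j <= a i) ->
  x <= y -> \sum_(i in A) (W (b i) - W (a i)) <= W y - W x.
Proof.
move=> W_nd A; move: {2}#|A| (erefl #|A|) => n.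
elim: n A y => [|n IH] A y cA hab hdis xy.
  by move/eqP: cA; rewrite cards_eq0 => /eqP ->; rewrite big_set0 subr_ge0 W_nd.
have [i0 i0A] : exists i, i \in A by apply/card_gt0P; rewrite cA.
have [i iA dis] : exists2 i, i \in A & a i = b i \/ forall j, j \in A -> j != i -> b j <= a i.
  have [[i [iA ab]]|nex] := pselect (exists i, i \in A /\ a i = b i); first by exists i => //; left.
  case: (arg_maxP a i0A) => i iA im; exists i => //; right => j jA ji.
  have [//|bi] := hdis j i jA iA ji.
  have ai_lt : a i < b i.
    rewrite lt_neqAle (hab i iA).2.1 andbT; apply/eqP => E; apply: nex; by exists i.
  by have := lt_le_trans ai_lt (le_trans bi (im j jA)); rewrite ltxx.
have cA' : #|A :\ i| = n by move: cA; rewrite (cardsD1 i A) iA => -[].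
have hab' j : j \in A :\ i -> j != i /\ j \in A by rewrite in_setD1 => /andP[].
rewrite (big_setD1 i iA) /=.
have hdis' j k : j \in A :\ i -> k \in A :\ i -> j != k -> b j <= a k \/ b k <= a j.
  by move=> /hab'[_ jA] /hab'[_ kA]; exact: hdis.
case: dis => [E|dis].
  rewrite E subrr add0r; apply: IH => // j /hab'[_ jA]; exact: hab.
have [xa [ab by_]] := hab i iA.
have := IH (A :\ i) (a i) cA' _ hdis' xa.
have h j : j \in A :\ i -> x <= a j /\ a j <= b j /\ b j <= a i.
  by move=> /hab'[ji jA]; have [? [? ?]] := hab j jA; do 2 split => //; exact: dis.
by move=> /(_ h); have := W_nd _ _ by_; lra.
Qed.

End MonotoneSum.

(** * The energy-dissipation inequality *)

Section EDI.
Context {R : realType} {X : completeNormedModType R} (T K1 K2 : R).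
Context (e : R -> X -> R) (g : X -> R) (D : set X) (Psi : X -> X -> R).
Context (F : R -> X -> set (X -> R)) (Pw : R -> X -> (X -> R) -> R).
Hypothesis Xsep : separable_space (X := X).
Hypothesis Xrefl : reflexive_space (X := X).
Hypothesis G : real_ggs T K1 K2 e g D Psi F Pw.
Notation mu := (@lebesgue_measure R).
Hypothesis graph_borel : borel_set T (graphF T D F).
Hypothesis Pw_borel : forall O : set R, open O ->
  borel_set T (graphF T D F `&` [set z | O (Pw z.1.1 z.1.2 z.2)]).
Variables (P0 : X) (B rt : R) (P : R -> X) (L W : R -> R) (b : R -> \bar R).
Hypothesis LC : limit_curve T e D Psi F Pw P0 B rt P L W b.

Let T_gt0 : 0 < T := ggs_T G.

Lemma curve_D r : 0 <= r <= T -> D (P r) /\ g (P r) <= B.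
Proof.
move=> rT; have [DP eB _] := limit_energy LC rT; split => //.
by have /andP[_] := ggs_g G rT DP; move/le_trans; apply.
Qed.

Lemma curve_bound_ge0 : 0 <= B.
Proof.
have T0 : 0 <= (0 : R) <= T by rewrite lexx ltW.
have [DP gB] := curve_D T0; have /andP[g0 _] := ggs_g G T0 DP; exact: le_trans gB.
Qed.

Lemma curve_modulus (M : R) : 0 < M -> exists2 C, 0 <= C & forall s t, s <= t ->
  `|P t - P s| <= (W t - W s) / M + C / M * (t - s).
Proof.
move=> M0; have [C C0 CP] := limit_modulus LC (ltW M0); exists C => // s t st.
rewrite -(ler_pM2l M0); apply: (le_trans (CP _ _ st)).
suff -> : M * ((W t - W s) / M + C / M * (t - s)) = W t - W s + C * (t - s) by [].
by field; rewrite gt_eqF.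
Qed.

(** [W] may jump, but its increment is divided by an arbitrary [M]: its share is kept below
    [eps / 2], and the rest is linear in the elapsed time. *)
Lemma curve_cont (eps r : R) : 0 <= r <= T -> 0 < eps -> exists2 del : R, 0 < del &
  forall r', 0 <= r' <= T -> `|r - r'| < del -> `|P r - P r'| < eps.
Proof.
move=> rT eps0; have W_nd := limit_W LC.
have w0 : 0 <= W T - W 0 by rewrite subr_ge0; apply: W_nd; exact: ltW.
pose M := 2 * (W T - W 0 + 1) / eps.
have M0 : 0 < M by rewrite divr_gt0// mulr_gt0//; lra.
have [C C0 CP] := curve_modulus M0.
have C1 : 0 < C / M + 1 by rewrite ltr_wpDl// divr_ge0// ltW.
pose del := eps / 2 / (C / M + 1).
have del0 : 0 < del by rewrite !divr_gt0.
have key s t : 0 <= s -> t <= T -> s <= t -> t - s < del -> `|P t - P s| < eps.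
  move=> s0 tT st tsd; apply: (le_lt_trans (CP _ _ st)).
  have h1 : (W t - W s) / M <= (W T - W 0) / M.
    by rewrite ler_wpM2r ?invr_ge0 ?(ltW M0)// lerB// W_nd.
  have h2 : (W T - W 0) / M < eps / 2.
    rewrite ltr_pdivrMr// /M.
    have -> : eps / 2 * (2 * (W T - W 0 + 1) / eps) = W T - W 0 + 1 by field; rewrite gt_eqF.
    by rewrite ltrDl.
  have h3 : C / M * (t - s) <= (C / M + 1) * del.
    by apply: ler_pM; [rewrite divr_ge0// ltW|rewrite subr_ge0|rewrite lerDl|exact: ltW].
  have h4 : (C / M + 1) * del = eps / 2 by rewrite /del mulrCA divff ?gt_eqF// mulr1.
  lra.
exists del => // r' rT'; have /andP[r0 rT1] := rT; have /andP[r0' rT1'] := rT'.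
have [rr|/ltW rr] := leP r r'.
  by rewrite distrC [`|P r - _|]distrC ger0_norm ?subr_ge0// => h; apply: key.
by rewrite ger0_norm ?subr_ge0// => h; apply: key.
Qed.

Let bb r := fine (b r).

Lemma limit_b_integrable : mu.-integrable `[0, T] b.
Proof.
apply/integrableP; split; first by apply: measurable_funTS; exact: (limit_b LC).
under eq_integral do rewrite gee0_abs ?(limit_b0 LC)//.
by apply: (le_lt_trans (limit_L_b LC (lexx 0) (ltW T_gt0) (lexx T))); rewrite ltry.
Qed.

Lemma limit_b_fin : {ae mu, forall r, 0 <= r <= T -> b r = (bb r)%:E}.
Proof.
have mD : measurable (`[0, T]%classic : set (measurableTypeR R)) by exact: measurable_itv.
have := integrable_ae mD limit_b_integrable.
by apply: aeS => r h rT; rewrite fineK// h//= in_itv.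
Qed.

Lemma measurable_bb : measurable_fun setT bb.
Proof. exact: (measurableT_comp (fine_measurable measurableT) (limit_b LC)). Qed.

Lemma force_selection (y : nat -> X -> R) : (forall n, is_dual (y n)) ->
  (forall xi (eps : R), is_dual xi -> 0 < eps ->
     exists n, dnorm (fun u => xi u - y n u) < eps) ->
  exists (Xi : R -> X -> R) (J : nat -> R -> nat) (N : set R),
    [/\ mu.-negligible N, forall r, is_dual (Xi r),
        forall n j, measurable [set r : R | J n r = j],
        forall n r, dual_dist (Xi r) (y (J n r)) <= n.+1%:R^-1 &
        forall r, 0 <= r <= T -> ~ N r -> force_rel Psi F Pw P bb rt r (Xi r)].
Proof.
move=> dy y_dense.
have [N0 [N00 N0P]] : exists N0 : set R, mu.-negligible N0 /\ forall r, ~ N0 r ->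
    0 <= r <= T -> exists xi, is_dual xi /\ force_rel Psi F Pw P bb rt r xi.
  have fin : {ae mu, forall r, 0 < r < T -> exists xi, is_dual xi /\ force_rel Psi F Pw P bb rt r xi}.
    apply: aeS2 limit_b_fin (limit_ae LC) => r hb hl r0T.
    have rT : 0 <= r <= T by have /andP[? ?] := r0T; rewrite !ltW.
    have [_ _ _ h] := hl r0T; have [_ [xi [dxi Fxi fxi]]] := h _ (hb rT).
    by exists xi.
  pose N1 := ~` [set r | 0 < r < T -> exists xi, is_dual xi /\ force_rel Psi F Pw P bb rt r xi].
  exists (N1 `|` [set 0; T]); split.
    apply: negligibleU; first exact: fin.
    apply/negligibleP; first by apply: measurableU; exact: measurable_set1.
    by apply: countable_lebesgue_measure0; apply: finite_set_countable; exact: finite_set2.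
  move=> r /not_orP[/contrapT h1 /not_orP[/eqP h2 /eqP h3]] /andP[r0 rT]; apply: h1.
  by rewrite !lt_neqAle r0 rT eq_sym h2 h3.
apply: (measurable_selection Xsep dy y_dense _ _ N00).
- exact: (force_analytic Xsep Xrefl G graph_borel Pw_borel curve_D curve_cont rt measurable_bb dy y_dense).
- by move=> r xn xi; exact: (force_closed Xrefl G curve_D curve_cont).
- by move=> r rT nN; exact: N0P.
Qed.

End EDI.

Lemma measurable_fun_superlevel {R : realType} d (Tc : measurableType d) (D : set Tc)
    (f : Tc -> \bar R) :
  (forall c : R, measurable (D `&` [set x | (c%:E < f x)%E])) -> measurable_fun D f.
Proof.
move=> h mD; apply: (measurability _ (ErealGenOInfty.measurableE R)) => // _ [_ [x ->] <-].
by rewrite (_ : f @^-1` _ = [set z | (x%:E < f z)%E])//; apply/seteqP; split => z /=; rewrite in_itv /= andbT.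
Qed.

Lemma derive_dual_comp {R : realType} {X : normedModType R} (P : R -> X) (xi : X -> R) (t : R) :
  is_dual xi -> derivable P t 1 ->
  derivable (fun t => xi (P t)) t 1 /\ 'D_1 (fun t => xi (P t)) t = xi ('D_1 P t).
Proof.
move=> dxi dP.
have h : (h^-1 *: (xi (P (h *: 1 + t)) - xi (P t))) @[h --> (0 : R)^'] --> xi ('D_1 P t).
  have h0 : (h^-1 *: (P (h *: 1 + t) - P t)) @[h --> (0 : R)^'] --> 'D_1 P t by exact: dP.
  apply: (cvg_ext (f := fun h : R => xi (h^-1 *: (P (h *: 1 + t) - P t)))).
    by move=> k; rewrite (dualZ _ _ dxi) (dualB _ _ dxi).
  exact: (continuous_cvg _ (dxi.2 _) h0).
split; first by apply/cvg_ex; exists (xi ('D_1 P t)).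
exact: (cvg_lim _ h).
Qed.

(** * Measurability and integrals along the limit curve *)

Section Integrals.
Context {R : realType} {X : completeNormedModType R} (T K1 K2 : R).
Context (e : R -> X -> R) (g : X -> R) (D : set X) (Psi : X -> X -> R).
Context (F : R -> X -> set (X -> R)) (Pw : R -> X -> (X -> R) -> R).
Hypothesis Xsep : separable_space (X := X).
Hypothesis Xrefl : reflexive_space (X := X).
Hypothesis G : real_ggs T K1 K2 e g D Psi F Pw.
Notation mu := (@lebesgue_measure R).
Hypothesis Pw_borel : forall O : set R, open O ->
  borel_set T (graphF T D F `&` [set z | O (Pw z.1.1 z.1.2 z.2)]).
Variables (P0 : X) (B rt : R) (P : R -> X) (L W : R -> R) (b : R -> \bar R).
Hypothesis LC : limit_curve T e D Psi F Pw P0 B rt P L W b.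
Context d (Tc : measurableType d) (mc : {measure set Tc -> \bar R}) (io : Tc -> R).
Hypothesis mcP : completes_lebesgue mc io.
Variables (y : nat -> X -> R) (Xi : R -> X -> R) (J : nat -> R -> nat) (N : set R).
Hypothesis dy : forall n, is_dual (y n).
Hypothesis y_dense : forall xi (eps : R), is_dual xi -> 0 < eps ->
  exists n, dnorm (fun u => xi u - y n u) < eps.
Hypothesis N_negl : mu.-negligible N.
Hypothesis dXi : forall r, is_dual (Xi r).
Hypothesis mJ : forall n j, measurable [set r : R | J n r = j].
Hypothesis XiJ : forall n r, dual_dist (Xi r) (y (J n r)) <= n.+1%:R^-1.
Hypothesis XiF : forall r, 0 <= r <= T -> ~ N r ->
  force_rel Psi F Pw P (fun r => fine (b r)) rt r (Xi r).

Let T_gt0 : 0 < T := ggs_T G.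
Let P_D r : 0 <= r <= T -> D (P r) /\ g (P r) <= B. Proof. exact: (curve_D G LC). Qed.
Let P_cont (eps r : R) : 0 <= r <= T -> 0 < eps -> exists2 del : R, 0 < del &
  forall r', 0 <= r' <= T -> `|r - r'| < del -> `|P r - P r'| < eps.
Proof. exact: (curve_cont G LC). Qed.

(** A limit of functions that take the value [dual_dist (y j) z] on the measurable set where [J m]
    equals [j]. *)
Lemma measurable_dual_dist z : is_dual z ->
  measurable_fun (setT : set R) (fun r => dual_dist (Xi r) z).
Proof.
move=> dz; apply: (@measurable_fun_cvg _ _ _ _ (fun m r => dual_dist (y (J m r)) z)).
  move=> m _ A mA; rewrite setTI.
  have -> : (fun r => dual_dist (y (J m r)) z) @^-1` A =
      \bigcup_(j in [set j | A (dual_dist (y j) z)]) [set r | J m r = j].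
    by apply/seteqP; split => r /=; [exists (J m r)|move=> [j Aj ->]].
  by apply: bigcup_measurable => j _; exact: mJ.
move=> r _; apply/cvgrPdist_le => eps eps0.
apply: filterS (near_infty_natSinv_lt (PosNum eps0)) => m /= me.
apply: (le_trans _ (ltW me)); apply: (le_trans _ (XiJ m r)).
have h1 := dual_dist_tri (dXi r) (dy (J m r)) dz.
have h2 := dual_dist_tri (dy (J m r)) (dXi r) dz.
rewrite (dual_dist_sym (dy (J m r)) (dXi r)) in h2.
by rewrite ler_norml; apply/andP; split; lra.
Qed.

Lemma selection_measurable (O : R -> (X -> R) -> Prop) : open_on T (is_dual (X := X)) dual_dist O ->
  measurable [set x : Tc | 0 <= io x <= T /\ O (io x) (Xi (io x))].
Proof.
apply: (open_on_measurable (y := y) (@dual_dist_sym _ _) (@dual_dist_tri _ _) dy y_dense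
  (Z := fun x => Xi (io x))).
- by move=> x; exact: dXi.
- move=> q c; rewrite (_ : [set z | _] = io @^-1` `[q - c, q + c]%classic).
    by apply: (measurable_completion mcP); exact: measurable_itv.
  by apply/seteqP; split => x /=; rewrite in_itv /= ler_distl.
- move=> j c; rewrite (_ : [set z | _] = io @^-1` (`[0, T]%classic `&`
      (fun r => dual_dist (Xi r) (y j)) @^-1` `]-oo, c]%classic)).
    apply: (measurable_completion mcP); apply: measurableI; first exact: measurable_itv.
    by rewrite -[X in measurable X]setTI; apply: measurable_dual_dist.
  by apply/seteqP; split => x /=; rewrite !in_itv.
Qed.

Lemma selection_borel (A : set (R * X * (X -> R))) : borel_set T A ->
  measurable [set x : Tc | 0 <= io x <= T /\ A (io x, P (io x), Xi (io x))].
Proof.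
have mI : measurable [set x : Tc | 0 <= io x <= T].
  rewrite (_ : [set x | _] = io @^-1` `[0, T]%classic).
    by apply: (measurable_completion mcP); exact: measurable_itv.
  by apply/seteqP; split => x /=; rewrite in_itv.
move: A; suff : borel_set (X := X) T `<=` [set A |
    measurable [set x : Tc | 0 <= io x <= T /\ A (io x, P (io x), Xi (io x))]] by exact.
apply: smallest_sub; first split.
- by rewrite /= (_ : [set x | _] = set0)//; apply/seteqP; split => x // [].
- move=> A /= mA; rewrite (_ : [set x | _] = [set x | 0 <= io x <= T] `\`
      [set x | 0 <= io x <= T /\ A (io x, P (io x), Xi (io x))]); first exact: measurableD.
  apply/seteqP; split => x /= [xT h]; first by split => // -[_]; exact: h.2.
  split => //; split; first by split => //=; rewrite in_itv.
  by move=> Ax; apply: h.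
- move=> A /= mA; rewrite (_ : [set x | _] = \bigcup_k
      [set x | 0 <= io x <= T /\ A k (io x, P (io x), Xi (io x))]); first exact: bigcupT_measurable.
  by apply/seteqP; split => x /=; [move=> [xT [k _ h]]; exists k|move=> [k _ [xT h]]; split => //; exists k].
move=> U oU /=; apply: (selection_measurable (O := fun r xi => U (r, P r, xi))).
exact: rel_open_on.
Qed.

Definition conj_int (x : Tc) : \bar R := fconj (Psi (P (io x))) (fun V => (- Xi (io x) V)%R).
Definition power_int (x : Tc) : R := Pw (io x) (P (io x)) (Xi (io x)).
Definition diss_int (x : Tc) : \bar R := (Psi (P (io x)) ('D_1 P (io x)))%:E.

Let I0 := [set x : Tc | 0 <= io x <= T].

Lemma measurable_conj_int : measurable_fun I0 conj_int.
Proof.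
apply: measurable_fun_superlevel => c.
have oc : open_on T (is_dual (X := X)) dual_dist
    (fun r xi => ~ (fconj (Psi (P r)) (fun V => - xi V)%R <= c%:E)%E).
  by apply: (open_conj Xrefl G P_D P_cont).
have := selection_measurable oc; congr measurable.
apply/seteqP; split => x /= [xT h]; split => //; first by rewrite ltNge; apply/negP.
by apply/negP; rewrite -ltNge.
Qed.

Lemma ae_not_negl : {ae mc, forall x, ~ N (io x)}.
Proof.
have := negligible_completion mcP N_negl; apply: negligibleS => x /=.
by move=> /contrapT.
Qed.

(** Outside the null set [N] the selected force lies in the graph, where (E4) gives Borel
    superlevels; completeness of [mc] takes care of the values elsewhere. *)
Lemma measurable_power_int : measurable_fun I0 (EFin \o power_int).
Proof.
apply: measurable_fun_superlevel => c.
have op : open [set x : R | c < x] by exact: open_gt.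
apply: (measurable_ae_completion mcP (selection_borel (Pw_borel op))).
apply: aeS ae_not_negl => x nN; split=> /= -[xT h]; split => //; first by case: h.
have [Fx _] := XiF xT nN; split; last by [].
by split; [rewrite /= in_itv|split => //; exact: (P_D xT).1].
Qed.

(** The velocity is seen through its distances to a dense sequence, which [dist_slope] makes
    measurable; the superlevels of [Psi (P r) V] are open in [(r, V)] by (Psi3). *)
Lemma measurable_diss_int : measurable_fun I0 diss_int.
Proof.
apply: measurable_fun_superlevel => c.
have [w wd] := separable_dense_seq Xsep.
have [z [dz z1 znorm]] := norming_sequence Xsep.
have W_nd := limit_W LC.
have PF (eps : R) : 0 < eps -> exists2 r : R, 0 <= r &
    forall s t, s <= t -> `|P t - P s| <= eps * (W t - W s) + r * (t - s).
  move=> eps0; have e1 : 0 < eps^-1 by rewrite invr_gt0.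
  have [C C0 CP] := curve_modulus LC e1; exists (C / eps^-1); first by rewrite divr_ge0// ltW.
  by move=> s t st; have := CP _ _ st; rewrite invrK [_ * eps]mulrC.
pose Z (x : Tc) : X := 'D_1 P (io x).
have dist_sym (u v : X) : True -> True -> `|u - v| = `|v - u| by move=> _ _; rewrite distrC.
have dist_tri (u v k : X) : True -> True -> True -> `|u - k| <= `|u - v| + `|v - k|.
  by move=> _ _ _; exact: ler_distD.
have w_dense (u : X) (eps : R) : True -> 0 < eps -> exists n, `|u - w n| < eps by move=> _; exact: wd.
have oO : open_on T (fun=> True) (fun u v : X => `|u - v|) (fun r V => ~ Psi (P r) V <= c).
  move=> r V rT _ hV; apply: contrapT => nex; apply: hV.
  have /choice[q qP] (m : nat) : exists q : R * X, [/\ 0 <= q.1 <= T,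
      `|r - q.1| < m.+1%:R^-1, `|V - q.2| < m.+1%:R^-1 & Psi (P q.1) q.2 <= c].
    apply: contrapT => nq; apply: nex; exists m.+1%:R^-1; first by rewrite invr_gt0.
    by move=> r' V' rT' _ h1 h2 h3; apply: nq; exists (r', V').
  have q1 : (q m).1 @[m --> \oo] --> r.
    apply/cvgrPdist_lt => eps eps0.
    apply: filterS (near_infty_natSinv_lt (PosNum eps0)) => m /= mE.
    by have [_ h _ _] := qP m; exact: lt_trans h mE.
  have q2 : (q m).2 @[m --> \oo] --> V.
    apply/cvgrPdist_lt => eps eps0.
    apply: filterS (near_infty_natSinv_lt (PosNum eps0)) => m /= mE.
    by have [_ _ h _] := qP m; exact: lt_trans h mE.
  have qT m : 0 <= (q m).1 <= T by have [] := qP m.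
  apply: (ggs_Psi_liminf G (S := B) (curve_cvg P_cont qT rT q1) (fun m => P_D (qT m)) (Vn := fun m => (q m).2)).
    by move=> xi dxi; exact: (continuous_cvg _ (dxi.2 _) q2).
  by move=> m; have [] := qP m.
have mq q k : measurable [set x : Tc | `|io x - q| <= k].
  rewrite (_ : [set x | _] = io @^-1` `[q - k, q + k]%classic).
    by apply: (measurable_completion mcP); exact: measurable_itv.
  by apply/seteqP; split => x /=; rewrite in_itv /= ler_distl.
have aeP : {ae mc, forall x, 0 < io x < T -> derivable P (io x) 1}.
  by apply: aeS (ae_completion mcP (limit_ae LC)) => x h xT; have [] := h xT.
have aeT : {ae mc, forall x, io x != 0 /\ io x != T}.
  have h : mu.-negligible [set 0; T].
    apply/negligibleP; first by apply: measurableU; exact: measurable_set1.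
    by apply: countable_lebesgue_measure0; apply: finite_set_countable; exact: finite_set2.
  apply: negligibleS (negligible_completion mcP h) => x /= /not_andP[] /negP; rewrite negbK => /eqP ->.
    by left.
  by right.
have mw j k : measurable [set x : Tc | 0 <= io x <= T /\ `|Z x - w j| <= k].
  pose A := io @^-1` (`[0, T]%classic `&` (dist_slope P z (w j)) @^-1` `]-oo, k]%classic).
  have mA : measurable A.
    apply: (measurable_completion mcP); apply: measurableI; first exact: measurable_itv.
    rewrite -[X in measurable X]setTI; apply: (measurable_dist_slope W_nd PF dz z1) => //.
  apply: (measurable_ae_completion mcP mA); apply: aeS2 aeP aeT => x hx [x0 xT].
  rewrite /A /= !in_itv /=.
  suff E : 0 <= io x <= T -> dist_slope P z (w j) (io x) = `|Z x - w j|.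
    by split=> -[h1 h2]; split => //; [rewrite -E|rewrite E].
  move=> /andP[i0 iT]; have dPx : derivable P (io x) 1.
    by apply: hx; rewrite !lt_neqAle i0 iT xT eq_sym x0.
  apply: (dist_slopeE dz z1 znorm) => i; by have [] := derive_dual_comp (dz i) dPx.
have := open_on_measurable dist_sym dist_tri (fun=> Logic.I) w_dense (Z := Z) (fun=> Logic.I) mq mw oO.
congr measurable; apply/seteqP; split => x /= [xT h]; split => //.
  by rewrite lte_fin ltNge; apply/negP.
by apply/negP; rewrite -ltNge -lte_fin.
Qed.

Let kappa := K2 * B.
Let kappa_ge0 : 0 <= kappa.
Proof. by rewrite mulr_ge0 ?(curve_bound_ge0 G LC)// ltW// (ggs_K2 G). Qed.
(** The power is bounded above a.e. by [kappa] but a priori not below. Integrals of this nonnegative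
    function make sense before the power is known to be integrable. *)
Let defect (x : Tc) : R := Num.max 0 (kappa - power_int x).

Lemma ae_force : {ae mc, forall x, 0 <= io x <= T ->
  [/\ (conj_int x <= (power_int x + fine (b (io x)) - rt)%:E)%E, power_int x <= kappa &
      b (io x) = (fine (b (io x)))%:E]}.
Proof.
apply: aeS2 ae_not_negl (ae_completion mcP (limit_b_fin G LC)) => x nN hb xT.
have [Fx fx] := XiF xT nN; have [DP gP] := P_D xT.
split => //; last exact: hb.
apply: (le_trans (ggs_power_le G xT DP Fx)).
by apply: ler_wpM2l => //; rewrite ltW// (ggs_K2 G).
Qed.

Lemma ae_interior : {ae mc, forall x, 0 <= io x <= T -> 0 < io x < T}.
Proof.
have h : mu.-negligible [set 0; T].
  apply/negligibleP; first by apply: measurableU; exact: measurable_set1.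
  by apply: countable_lebesgue_measure0; apply: finite_set_countable; exact: finite_set2.
apply: negligibleS (negligible_completion mcP h) => x /= /not_implyP[/andP[i0 iT] nx].
apply: contrapT => /not_orP[/eqP h0 /eqP hT]; apply: nx.
by rewrite !lt_neqAle i0 iT hT eq_sym h0.
Qed.

Lemma ae_diss : {ae mc, forall x, 0 <= io x <= T ->
  (diss_int x <= (Num.max 0 (slope W (io x)))%:E)%E}.
Proof.
apply: aeS2 ae_interior (ae_completion mcP (limit_ae LC)) => x hi hl xT.
have [_ dW PW _] := hl (hi xT).
by rewrite lee_fin (slope_derive dW) le_max PW orbT.
Qed.

Lemma conj_int_ge0 x : 0 <= io x <= T -> (0 <= conj_int x)%E.
Proof.
by move=> xT; apply: (fconj_ge0 (is_dualN (dXi _))); exact: (ggs_Psi0 G (P_D xT).1).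
Qed.

Lemma diss_int_ge0 x : 0 <= io x <= T -> (0 <= diss_int x)%E.
Proof. by move=> xT; rewrite lee_fin; exact: (ggs_Psi_ge0 G _ (P_D xT).1). Qed.

Section Interval.
Variables (s t : R).
Hypothesis s0 : 0 <= s.
Hypothesis st : s <= t.
Hypothesis tT : t <= T.
Let I1 := io @^-1` `[s, t]%classic.

Let I1T x : I1 x -> 0 <= io x <= T.
Proof. by rewrite /I1 /= in_itv /= => /andP[h1 h2]; rewrite (le_trans s0)//= (le_trans h2). Qed.

Let mI1 : measurable I1.
Proof. by apply: (measurable_completion mcP); exact: measurable_itv. Qed.

Let mu_I1 : mc I1 = (t - s)%:E.
Proof.
have [_ h _] := mcP; rewrite h; last exact: measurable_itv.
by rewrite lebesgue_measure_cc.
Qed.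

Let mI0 : measurable I0.
Proof.
rewrite (_ : I0 = io @^-1` `[0, T]%classic).
  by apply: (measurable_completion mcP); exact: measurable_itv.
by apply/seteqP; split => x /=; rewrite /I0 /= in_itv.
Qed.

Let restr (f : Tc -> \bar R) : measurable_fun I0 f -> measurable_fun I1 f.
Proof. by move=> mf; apply: (measurable_funS mI0 _ mf) => x; exact: I1T. Qed.

Let aeI1 (Q : Tc -> Prop) : {ae mc, forall x, 0 <= io x <= T -> Q x} -> {ae mc, forall x, I1 x -> Q x}.
Proof. by apply: aeS => x h /I1T. Qed.

Let mdefect : measurable_fun I1 (fun x => (defect x)%:E).
Proof.
apply/measurable_EFinP; apply: measurable_maxr => //; apply: measurable_funB => //.
by apply/measurable_EFinP; exact: (restr measurable_power_int).
Qed.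

Let mb : measurable_fun I1 (fun x => b (io x)).
Proof.
have h : measurable_fun setT (b \o io).
  by apply: (measurableT_comp (limit_b LC)); exact: (measurable_fun_completion mcP).
exact: measurable_funTS.
Qed.

Lemma diss_integral : (\int[mc]_(x in I1) diss_int x <= (W t - W s)%:E)%E.
Proof.
have W_nd := limit_W LC.
have msl : measurable_fun (setT : set R) (fun r => Num.max 0 (slope W r)).
  by apply: measurable_maxr => //; apply: measurable_slope; exact: nondecreasing_measurable.
have msl' : measurable_fun `[s, t] (fun r => (Num.max 0 (slope W r))%:E).
  by apply/measurable_EFinP; exact: measurable_funTS.
apply: (@le_trans _ _ (\int[mc]_(x in I1) (Num.max 0 (slope W (io x)))%:E)%E).
  apply: ae_ge0_le_integral => //.
  - by move=> x /I1T; exact: diss_int_ge0.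
  - exact: (restr measurable_diss_int).
  - by move=> x _; rewrite lee_fin le_max lexx.
  - apply/measurable_EFinP; apply: measurable_funTS.
    exact: (measurableT_comp msl (measurable_fun_completion mcP)).
  - exact: (aeI1 ae_diss).
rewrite (integral_completion mcP (f := fun r => (Num.max 0 (slope W r))%:E)) => //; first last.
  by move=> x _; rewrite lee_fin le_max lexx.
apply: nondecreasing_integral_derive => //.
- by move=> x z _ xz _; exact: W_nd.
- exact: measurable_funTS.
- by move=> x _; rewrite le_max lexx.
apply: aeS (nondecreasing_ae_derivable W_nd) => x dx _; split => //.
by rewrite (slope_derive dx) max_r// nondecreasing_derive_ge0.
Qed.

(** [force_rel] is integrated in the form [Psi* + defect + rt <= kappa + b], where every term is
    nonnegative; the bound on the integral of [b] then cancels [rt * (t - s)]. *)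
Lemma conj_defect_integral :
  (\int[mc]_(x in I1) conj_int x + \int[mc]_(x in I1) (defect x)%:E <=
   (kappa * (t - s) - (L t - L s))%:E)%E.
Proof.
have d0 x : (0 <= (defect x)%:E)%E by rewrite lee_fin le_max lexx.
have rt0 := limit_rt LC.
have c0 x : I1 x -> (0 <= conj_int x)%E by move/I1T; exact: conj_int_ge0.
have mconj := restr measurable_conj_int.
have h1 : (\int[mc]_(x in I1) ((conj_int x + (defect x)%:E) + (cst rt%:E) x) <=
    \int[mc]_(x in I1) ((cst kappa%:E) x + b (io x)))%E.
  apply: ae_ge0_le_integral => //.
  - by move=> x xI; rewrite !adde_ge0// ?c0// lee_fin.
  - by apply: emeasurable_funD => //; apply: emeasurable_funD.
  - by move=> x xI; rewrite adde_ge0// ?(limit_b0 LC)// lee_fin.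
  - by apply: emeasurable_funD.
  apply: (aeI1 (Q := fun x => (conj_int x + (defect x)%:E + cst rt%:E x <= cst kappa%:E x + b (io x))%E)).
  apply: aeS ae_force => x h /h[h1 h2 h3] /=.
  rewrite h3 -EFinD; apply: (le_trans (leeD (leeD h1 (lexx _)) (lexx _))).
  rewrite -!EFinD lee_fin /defect max_r ?subr_ge0//; lra.
rewrite ge0_integralD// in h1; [|by move=> x xI; rewrite adde_ge0// c0|by apply: emeasurable_funD].
rewrite ge0_integralD// in h1.
rewrite [X in (_ <= X)%E]ge0_integralD// in h1; last by move=> x _; exact: (limit_b0 LC).
rewrite !integral_cst// mu_I1 (integral_completion mcP (f := b)) in h1.
- have h2 := le_trans h1 (leeD (lexx _) (limit_L_b LC s0 st tT)).
  rewrite -!EFinM -EFinD in h2.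
  move: h2; rewrite -leeBrDr// -EFinB => /le_trans; apply.
  by rewrite lee_fin; lra.
- exact: measurable_itv.
- by apply: measurable_funTS; exact: (limit_b LC).
- by move=> x _; exact: (limit_b0 LC).
Qed.

Lemma integrals_fin : exists f c : R, [/\ (\int[mc]_(x in I1) conj_int x = f%:E)%E,
  (\int[mc]_(x in I1) (defect x)%:E = c%:E)%E & f + c <= kappa * (t - s) - (L t - L s)].
Proof.
have h := conj_defect_integral.
have c0 : (0 <= \int[mc]_(x in I1) conj_int x)%E.
  by apply: integral_ge0 => x /I1T; exact: conj_int_ge0.
have d0 : (0 <= \int[mc]_(x in I1) (defect x)%:E)%E.
  by apply: integral_ge0 => x _; rewrite lee_fin le_max lexx.
move: c0 d0 h; case: (integral mc I1 conj_int) => [f||] //; case: (integral _ _ _) => [c||] //.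
by move=> _ _; rewrite -EFinD lee_fin => h; exists f, c.
Qed.

Lemma defect_integrable : mc.-integrable I1 (fun x => (defect x)%:E).
Proof.
apply/integrableP; split => //.
have [f [c [_ hc _]]] := integrals_fin.
under eq_integral do rewrite gee0_abs ?lee_fin ?le_max ?lexx//.
by rewrite hc ltry.
Qed.

Let cst_integrable (k : R) : mc.-integrable I1 (cst k%:E).
Proof.
apply/integrableP; split => //.
rewrite (eq_integral (cst (`|k|%:E)))//; by rewrite integral_cst// mu_I1 -EFinM ltry.
Qed.

Lemma power_integrable : mc.-integrable I1 (EFin \o power_int).
Proof.
apply/integrableP; split; first exact: (restr measurable_power_int).
have [f [c [_ hc _]]] := integrals_fin.
apply: (@le_lt_trans _ _ (\int[mc]_(x in I1) ((cst kappa%:E) x + (defect x)%:E))%E).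
  apply: ae_ge0_le_integral => //.
  - by apply: measurableT_comp => //; exact: (restr measurable_power_int).
  - by move=> x _; rewrite adde_ge0// lee_fin ?le_max ?lexx.
  - by apply: emeasurable_funD.
  apply: (aeI1 (Q := fun x => (`|(EFin \o power_int) x| <= cst kappa%:E x + (defect x)%:E)%E)).
  apply: aeS ae_force => x h /h[_ h2 _] /=.
  rewrite -EFinD lee_fin /defect max_r ?subr_ge0// ler_norml.
  by have := kappa_ge0; move=> k0; apply/andP; split; lra.
rewrite ge0_integralD//; last by move=> x _; rewrite lee_fin le_max lexx.
by rewrite integral_cst// mu_I1 hc -EFinM -EFinD ltry.
Qed.

Lemma power_integral (c : R) : (\int[mc]_(x in I1) (defect x)%:E = c%:E)%E ->
  (\int[mc]_(x in I1) (power_int x)%:E = (kappa * (t - s) - c)%:E)%E.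
Proof.
move=> hc; rewrite (@ae_eq_integral _ _ _ _ I1 (fun x => (kappa%:E - (defect x)%:E)%E))//.
- rewrite (integralB_EFin mI1 (f1 := cst kappa) (cst_integrable kappa) defect_integrable).
  have hk : (\int[mc]_(x in I1) (cst kappa x)%:E = (kappa * (t - s))%:E)%E.
    by rewrite (eq_integral (cst kappa%:E))// integral_cst// mu_I1.
  by rewrite hc hk -EFinB.
- exact: (restr measurable_power_int).
- by apply: emeasurable_funB.
apply: (aeI1 (Q := fun x => ((power_int x)%:E = kappa%:E - (defect x)%:E)%E)).
apply: aeS ae_force => x h /h[_ h2 _].
by rewrite -EFinB /defect max_r ?subr_ge0//; congr EFin; lra.
Qed.

Lemma dissipation_integral (f : R) : (\int[mc]_(x in I1) conj_int x = f%:E)%E ->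
  (\int[mc]_(x in I1) (diss_int x + conj_int x) <= (W t - W s + f)%:E)%E.
Proof.
move=> hf; rewrite ge0_integralD//.
- by rewrite hf EFinD leeD2r//; exact: diss_integral.
- by move=> x /I1T; exact: diss_int_ge0.
- exact: (restr measurable_diss_int).
- by move=> x /I1T; exact: conj_int_ge0.
- exact: (restr measurable_conj_int).
Qed.

Lemma dissipation_integrable : mc.-integrable I1 (fun x => (diss_int x + conj_int x)%E).
Proof.
have [f [c [hf _ _]]] := integrals_fin.
apply/integrableP; split.
  apply: emeasurable_funD; [exact: (restr measurable_diss_int)|exact: (restr measurable_conj_int)].
rewrite (eq_integral (fun x => (diss_int x + conj_int x)%E)).
  by apply: (le_lt_trans (dissipation_integral hf)); rewrite ltry.
move=> x; rewrite inE => /I1T xT; rewrite gee0_abs// adde_ge0//.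
  exact: diss_int_ge0.
exact: conj_int_ge0.
Qed.

(** The increment of [W] cancels between [L - W] and the bound on the dissipation; what remains is
    the inequality of [integrals_fin]. *)
Lemma energy_dissipation_inequality :
  ((L t - W t)%:E + \int[mc]_(x in I1) (diss_int x + conj_int x) <=
   (L s - W s)%:E + \int[mc]_(x in I1) (power_int x)%:E)%E.
Proof.
have [f [c [hf hc fc]]] := integrals_fin.
rewrite (power_integral hc); apply: (le_trans (leeD (lexx _) (dissipation_integral hf))).
by rewrite -!EFinD lee_fin; lra.
Qed.

(** Coercivity of the conjugate with slope 1 bounds the dual norm by [Psi* + C]. *)
Lemma force_norm_integrable : mc.-integrable I1 (fun x => (dnorm (Xi (io x)))%:E).
Proof.
have E r : dnorm (Xi r) = dual_dist (Xi r) (fun=> 0).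
  by congr dnorm; apply/funext => u; rewrite subr0.
have mX : measurable_fun I1 (fun x => (dnorm (Xi (io x)))%:E).
  apply/measurable_EFinP; apply: measurable_funTS.
  rewrite (_ : (fun _ => _) = (fun r => dual_dist (Xi r) (fun=> 0)) \o io); last first.
    by apply/funext => x; rewrite /= E.
  apply: measurableT_comp; last exact: (measurable_fun_completion mcP).
  by apply: measurable_dual_dist; exact: is_dual0.
have [C C0 CP] := ggs_conj_coercive G B 1.
have [f [c [hf _ _]]] := integrals_fin.
apply/integrableP; split => //.
apply: (@le_lt_trans _ _ (\int[mc]_(x in I1) (conj_int x + (cst C%:E) x))%E).
  apply: ae_ge0_le_integral => //.
  - exact: measurableT_comp.
  - by move=> x /I1T xT; rewrite adde_ge0 ?conj_int_ge0// lee_fin.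
  - by apply: emeasurable_funD => //; exact: (restr measurable_conj_int).
  apply: (aeI1 (Q := fun x => (`|(dnorm (Xi (io x)))%:E| <= conj_int x + cst C%:E x)%E)).
  apply: aeS ae_force => x h xT; have [h1 _ _] := h xT; have [DP gP] := P_D xT.
  have cE := conj_int_ge0 xT.
  have [k kE] : exists k : R, conj_int x = k%:E.
    by move: h1 cE; case: (conj_int x) => [k||] // _ _; exists k.
  rewrite kE /= -EFinD lee_fin ger0_norm; last exact/dual_norm_ge0.
  rewrite -(dual_normN (dXi _)) -[dnorm _]mul1r.
  by apply: (CP _ _ _ DP gP (is_dualN (dXi _))); rewrite -kE.
rewrite ge0_integralD//; [|by move=> x /I1T; exact: conj_int_ge0|exact: (restr measurable_conj_int)].
by rewrite hf integral_cst// mu_I1 -EFinM -EFinD ltry.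
Qed.

End Interval.

(** Nearest-point approximation among [y 0, ..., y n]: finitely many values on measurable sets,
    hence the simple functions that Bochner measurability asks for. *)
Fixpoint closest (n : nat) (r : R) : nat := if n is m.+1 then
  if dual_dist (Xi r) (y m.+1) < dual_dist (Xi r) (y (closest m r)) then m.+1 else closest m r
  else 0%N.

Lemma closest_le n r : (closest n r <= n)%N.
Proof. by elim: n => //= n IH; case: ifP => // _; exact: leqW. Qed.

Lemma closest_min n i r : (i <= n)%N ->
  dual_dist (Xi r) (y (closest n r)) <= dual_dist (Xi r) (y i).
Proof.
elim: n => [|n IH]; first by rewrite leqn0 => /eqP ->.
rewrite leq_eqVlt => /predU1P[->|/IH h] /=; case: ifP => //; first by move=> /negbT; rewrite -leNgt.
by move=> /ltW h2; exact: le_trans h2 h.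
Qed.

Lemma measurable_closest n j : measurable [set r : R | closest n r = j].
Proof.
elim: n j => [|n IH] j /=.
  have [->|/eqP j0] := eqVneq j 0%N; first by rewrite (_ : [set _ | _] = setT)//; apply/seteqP; split.
  by rewrite (_ : [set _ | _] = set0)//; apply/seteqP; split => // r /= E; apply: j0.
pose A i := [set r : R | dual_dist (Xi r) (y n.+1) < dual_dist (Xi r) (y i)].
have mA i : measurable (A i).
  rewrite (_ : A i = setT `&` (fun r => dual_dist (Xi r) (y n.+1) - dual_dist (Xi r) (y i)) @^-1` `]-oo, 0[%classic).
    by apply: (measurable_funB (measurable_dual_dist (dy _)) (measurable_dual_dist (dy i))) => //.
  by rewrite setTI; apply/seteqP; split => r /=; rewrite in_itv /= subr_lt0.
have -> : [set r : R | (if dual_dist (Xi r) (y n.+1) < dual_dist (Xi r) (y (closest n r))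
      then n.+1 else closest n r) = j] =
    \bigcup_i ([set r | closest n r = i] `&` ((A i `&` [set r | n.+1 = j]) `|` (~` A i `&` [set r | i = j]))).
  apply/seteqP; split => r /=.
    move=> h; exists (closest n r) => //; split => //; move: h; case: ifP => h E; [left|right] => //.
    by split => //; rewrite /A /= h.
  by move=> [i _ [-> [[h E]|[h E]]]]; [rewrite h|case: ifP => // /h].
have mc' (Q : Prop) : measurable [set r : R | Q].
  have [q|nq] := pselect Q.
    by rewrite (_ : [set _ | _] = setT)//; apply/seteqP; split.
  by rewrite (_ : [set _ | _] = set0)//; apply/seteqP; split.
apply: bigcupT_measurable => i; apply: measurableI; first exact: IH.
by apply: measurableU; apply: measurableI => //; exact: measurableC.
Qed.

Lemma closest_cvg r : dnorm (fun V => y (closest n r) V - Xi r V) @[n --> \oo] --> (0 : R).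
Proof.
apply/cvgrPdist_lt => eps eps0; have [i hi] := y_dense (dXi r) eps0.
exists i => // n /= ni; rewrite sub0r normrN ger0_norm; last exact/dual_norm_ge0/is_dualB.
rewrite dual_normBC//; exact: le_lt_trans (closest_min r ni) hi.
Qed.

End Integrals.

Lemma limf_einf_ge {R : realType} (f : R -> \bar R) (Fl : set_system R) (A : set R) (c : \bar R) :
  Fl A -> (forall h, A h -> (c <= f h)%E) -> (c <= limf_einf f Fl)%E.
Proof.
move=> FA h; rewrite /limf_einf leeNr; apply: (@le_trans _ _ (ereal_sup ((fun x => - f x)%E @` A))).
  by apply: ereal_inf_lbound; exists A.
by apply: ge_ereal_sup => _ [x Ax <-]; rewrite leeN2; exact: h.
Qed.

(** Over non-overlapping intervals the increments of [W] add up to at most [W T - W 0], however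
    short the intervals. A large [M] brings their share below [eps / 2], and the total length
    controls the rest. *)
Lemma abs_cont_modulus {R : realType} {X : normedModType R} (T : R) (P : R -> X) (W : R -> R) :
  0 <= T -> {homo W : x y / x <= y} ->
  (forall M, 0 < M -> exists2 C, 0 <= C & forall s t, s <= t ->
     `|P t - P s| <= (W t - W s) / M + C / M * (t - s)) -> abs_cont T P.
Proof.
move=> T0 W_nd h eps eps0.
have w0 : 0 <= W T - W 0 by rewrite subr_ge0; exact: W_nd.
pose M := 2 * (W T - W 0 + 1) / eps.
have M0 : 0 < M by rewrite divr_gt0// mulr_gt0//; lra.
have [C C0 CP] := h M M0.
have CM0 : 0 <= C / M by rewrite divr_ge0// ltW.
have C1 : 0 < C / M + 1 by lra.
exists (eps / 2 / (C / M + 1)) => [|n a b ab dis len]; first by rewrite !divr_gt0.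
have sumW : \sum_(i < n) (W (b i) - W (a i)) <= W T - W 0.
  have -> : \sum_(i < n) (W (b i) - W (a i)) = \sum_(i in [set: 'I_n]%SET) (W (b i) - W (a i)).
    by apply: eq_bigl => i; rewrite finset.in_setT.
  exact: (sum_increments_le W_nd (fun i _ => ab i) (fun i j _ _ => dis i j) T0).
have h1 : \sum_(i < n) `|P (b i) - P (a i)| <=
    (W T - W 0) / M + C / M * \sum_(i < n) (b i - a i).
  apply: (@le_trans _ _ (\sum_(i < n) ((W (b i) - W (a i)) / M + C / M * (b i - a i)))).
    by apply: ler_sum => i _; apply: CP; have [_ []] := ab i.
  by rewrite big_split /= -mulr_suml -mulr_sumr lerD2r ler_wpM2r// invr_ge0 ltW.
apply: (le_lt_trans h1).
have h2 : (W T - W 0) / M < eps / 2.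
  rewrite ltr_pdivrMr// /M.
  have -> : eps / 2 * (2 * (W T - W 0 + 1) / eps) = W T - W 0 + 1 by field; rewrite gt_eqF.
  by rewrite ltrDl.
have h3 : C / M * \sum_(i < n) (b i - a i) <= C / M * (eps / 2 / (C / M + 1)).
  by apply: ler_wpM2l => //; exact: ltW.
have h4 : C / M * (eps / 2 / (C / M + 1)) <= eps / 2.
  by rewrite mulrA ler_pdivrMr// [leRHS]mulrC; apply: ler_wpM2r; [rewrite divr_ge0// ltW|rewrite lerDl].
lra.
Qed.

Theorem theorem2p7 (R : realType) (X : completeNormedModType R)
  (Xsep : @separable_space R X) (Xrefl : @reflexive_space R X)
  (T : R) (T_gt0 : 0 < T)
  (E : R -> X -> \bar R) (D : set X) (Psi : X -> X -> R)
  (F : R -> X -> set (X -> R)) (Pw : R -> X -> (X -> R) -> R)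
  (* standing assumptions of the setting *)
  (HD : forall t, `[0, T]%classic t -> forall P, (E t P < +oo)%E <-> D P)
  (HFdual : forall t P Xi, `[0, T]%classic t -> D P -> F t P Xi -> is_dual Xi)
  (HPsi_ge0 : forall P, D P -> forall V, 0 <= Psi P V)
  (* (E0) *)
  (E0_lsc : forall t, `[0, T]%classic t -> lower_semicontinuous (E t))
  (E0_bound : exists2 C0 : R, 0 < C0 & forall t P, `[0, T]%classic t -> D P ->
      (Ginf T E P <= E t P)%E /\ (C0%:E <= Ginf T E P)%E)
  (E0_graph : borel_set T (graphF T D F))
  (* (E1) *)
  (E1 : forall t, `[0, T]%classic t -> forall c : R,
      compact [set P : X | (E t P <= c%:E)%E])
  (* (E2) *)
  (E2 : forall (Ps : X), D Ps -> forall tau : R, 0 < tau ->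
      forall t, `[0, T]%classic t -> forall Pb : X,
      (forall P : X, (E t Pb + (tau * Psi Ps (tau^-1 *: (Pb - Ps)))%:E
                      <= E t P + (tau * Psi Ps (tau^-1 *: (P - Ps)))%:E)%E) ->
      exists2 Xi, F t Pb Xi &
        subdiff (Psi Ps) (tau^-1 *: (Pb - Ps)) (fun V => - Xi V))
  (* (E3) *)
  (E3 : exists2 K1 : R, 0 < K1 & forall P, D P -> forall s t,
      `[0, T]%classic s -> `[0, T]%classic t ->
      (`|E t P - E s P| <= (K1 * `|t - s|)%:E * Ginf T E P)%E)
  (* (E4) *)
  (E4_meas : forall O : set R, open O ->
      borel_set T (graphF T D F `&` [set z | O (Pw z.1.1 z.1.2 z.2)]))
  (E4 : exists2 K2 : R, 0 < K2 & forall t P Xi, graphF T D F (t, P, Xi) ->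
      [/\ t < T -> (limf_einf (fun h : R => ((E (t + h)%R P - E t P) * (h^-1)%:E)%E)
                     0^'+ <= (Pw t P Xi)%:E)%E,
          (0 < t -> exists L : \bar R,
             [/\ (fun h : R => ((E t P - E (t - h)%R P) * (h^-1)%:E)%E) @ 0^'+ --> L,
                 ((Pw t P Xi)%:E <= L)%E & (L <= K2%:E * Ginf T E P)%E]) &
          ((Pw t P Xi)%:E <= K2%:E * Ginf T E P)%E])
  (* (E5) *)
  (E5 : forall t, `[0, T]%classic t ->
      forall (Pn : nat -> X) (P : X) (Xin : nat -> X -> R) (Xi : X -> R)
             (cE cP : R),
      (forall n, D (Pn n) /\ F t (Pn n) (Xin n)) ->
      Pn n @[n --> \oo] --> P ->
      weak_cvg_dual Xin Xi ->
      E t (Pn n) @[n --> \oo] --> cE%:E ->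
      Pw t (Pn n) (Xin n) @[n --> \oo] --> cP ->
      [/\ F t P Xi, cP <= Pw t P Xi & cE%:E = E t P])
  (* (Psi1) *)
  (Psi1 : forall P, D P ->
      [/\ lower_semicontinuous (fun V => (Psi P V)%:E),
          convex_fun (Psi P) & Psi P 0 = 0])
  (* (Psi2) *)
  (Psi2 : forall S : R, 0 < S ->
      (forall M : R, exists r0 : R, forall V : X, r0 <= `|V| ->
         ((M * `|V|)%:E <=
          ereal_inf [set (Psi P V)%:E | P in [set P | (Ginf T E P <= S%:E)%E]])%E) /\
      (forall M : R, exists r0 : R, forall Xi : X -> R, is_dual Xi ->
         r0 <= dnorm Xi ->
         ((M * dnorm Xi)%:E <=
          ereal_inf [set fconj (Psi P) Xi | P in [set P | (Ginf T E P <= S%:E)%E]])%E))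
  (* (Psi3) *)
  (Psi3 : forall S : R, 0 < S ->
      forall (Pn : nat -> X) (P : X) (Vn : nat -> X) (V : X)
             (Xin : nat -> X -> R) (Xi : X -> R),
      Pn n @[n --> \oo] --> P ->
      (forall n, (Ginf T E (Pn n) <= S%:E)%E) ->
      weak_cvg Vn V -> weak_cvg_dual Xin Xi ->
      ((Psi P V)%:E <= limn_einf (fun n => (Psi (Pn n) (Vn n))%:E))%E /\
      (fconj (Psi P) Xi <= limn_einf (fun n => fconj (Psi (Pn n)) (Xin n)))%E)
  (* (Psi4) *)
  (Psi4 : forall P, D P -> forall V Xi1 Xi2,
      subdiff (Psi P) V Xi1 -> subdiff (Psi P) V Xi2 ->
      fconj (Psi P) Xi1 = fconj (Psi P) Xi2) :
  forall P0 : X, D P0 ->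
  exists P : R -> X,
    [/\ P 0 = P0, abs_cont T P &
    exists (cE : R -> R) (Xi : R -> X -> R),
      bounded_variation 0 T cE /\
      (forall t, `[0, T]%classic t -> (E t (P t) <= (cE t)%:E)%E) /\
      (cE 0)%:E = E 0 (P 0) /\
      {ae (@completed_lebesgue_measure R), forall s,
         `]0, T[%classic s -> (cE s)%:E = E s (P s)} /\
      bochner_L1_dual T Xi /\
      {ae (@completed_lebesgue_measure R), forall t,
         `]0, T[%classic t -> F t (P t) (Xi t)} /\
      (@completed_lebesgue_measure R).-integrable `[0, T]%classic
        (fun r => ((Psi (P r) ('D_1 P r))%:E
                   + fconj (Psi (P r)) (fun V => (- Xi r V)%R))%E) /\
      (@completed_lebesgue_measure R).-integrable `[0, T]%classic
        (fun r => (Pw r (P r) (Xi r))%:E) /\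
      (forall s t, 0 <= s -> s <= t -> t <= T ->
        ((cE t)%:E
         + \int[@completed_lebesgue_measure R]_(r in `[s, t]%classic)
             ((Psi (P r) ('D_1 P r))%:E
              + fconj (Psi (P r)) (fun V => (- Xi r V)%R))
         <= (cE s)%:E
         + \int[@completed_lebesgue_measure R]_(r in `[s, t]%classic)
             (Pw r (P r) (Xi r))%:E)%E)].
Proof.
have [C0 C00 E0b] := E0_bound.
have [K1 K10 E3b] := E3.
have [K2 K20 E4b] := E4.
pose e t P := fine (E t P); pose g P := fine (Ginf T E P).
have itvT t : 0 <= t <= T -> `[0, T]%classic t by rewrite /= in_itv.
have T00 : 0 <= (0 : R) <= T by rewrite lexx ltW.
have Gfin P : D P -> Ginf T E P = (g P)%:E.
  move=> DP; have [h1 h2] := E0b 0 P (itvT _ T00) DP.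
  have h3 := le_lt_trans h1 ((HD _ (itvT _ T00) P).2 DP).
  by rewrite /g fineK// ge0_fin_numE// (le_trans _ h2)// lee_fin ltW.
have Efin t P : 0 <= t <= T -> D P -> E t P = (e t P)%:E.
  move=> tT DP; have [h1 h2] := E0b t P (itvT _ tT) DP.
  rewrite /e fineK// ge0_fin_numE; first exact: (HD _ (itvT _ tT) P).2.
  by apply: le_trans h1; apply: le_trans h2; rewrite lee_fin ltW.
have Ege t P : 0 <= t <= T -> D P -> 0 <= g P <= e t P.
  move=> tT DP; have [h1 h2] := E0b t P (itvT _ tT) DP.
  rewrite (Gfin P DP) (Efin t P tT DP) !lee_fin in h1 h2.
  by rewrite h1 andbT (le_trans (ltW C00)).
have Dlt t P : 0 <= t <= T -> (E t P < +oo)%E -> D P by move=> tT; exact: (HD _ (itvT _ tT) P).1.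
have Ginf_le P S : D P -> g P <= S -> (Ginf T E P <= (Num.max 1 S)%:E)%E.
  by move=> DP gS; rewrite (Gfin P DP) lee_fin le_max gS orbT.
(* (Psi2) and (Psi3) are stated for positive levels, whereas the record allows any [S]. *)
have maxS S : 0 < Num.max 1 S :> R by rewrite lt_max ltr01.
have G : real_ggs T K1 K2 e g D Psi F Pw.
  split => //.
  - move=> s t P sT tT DP; have := E3b P DP s t (itvT _ sT) (itvT _ tT).
    rewrite (Gfin P DP) (Efin t P tT DP) (Efin s P sT DP) -EFinB lee_fin.
    by rewrite mulrAC.
  - move=> t c tT; have := E1 t (itvT _ tT) c; congr compact.
    apply/seteqP; split => P /=.
      move=> h; have DP : D P by apply: (Dlt t) => //; apply: (le_lt_trans h); rewrite ltry.
      by split => //; rewrite (Efin t P tT DP) lee_fin in h.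
    by move=> [DP h]; rewrite (Efin t P tT DP) lee_fin.
  - move=> Ps tau t Pb DPs tau0 tT DPb h; apply: (E2 Ps DPs tau tau0 t (itvT _ tT)) => P.
    have [DP|nDP] := pselect (D P).
      by rewrite (Efin t P tT DP) (Efin t Pb tT DPb) -!EFinD lee_fin; exact: h.
    (* Outside [D] the energy is infinite, so minimality over [D] is minimality over [X]. *)
    have -> : E t P = +oo%E by apply/eqP; rewrite -leye_eq leNgt; apply/negP => /(Dlt t P tT).
    by rewrite addye// leey.
  (* If no small [h] worked, all quotients on []0, m[] would be at least [Pw + eps], and so would
     the lower limit in (E4). *)
  - move=> t P Xi /andP[t0 tT] DP FXi dd eps dd0 eps0; apply: contrapT => nex.
    have tT' : 0 <= t <= T by rewrite !ltW.
    have gr : graphF T D F (t, P, Xi) by split; [exact: itvT|split].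
    have [h _ _] := E4b t P Xi gr; have {}h := h tT.
    pose m := Num.min dd (T - t); have m0 : 0 < m by rewrite lt_min dd0 subr_gt0.
    have : ((Pw t P Xi + eps)%:E <= limf_einf (fun h : R => ((E (t + h)%R P - E t P) * (h^-1)%:E)%E) 0^'+)%E.
      apply: (limf_einf_ge (A := [set h : R | 0 < h < m])).
        exists m => //= x; rewrite /= sub0r normrN => xm x0.
        by rewrite x0 /= -(gtr0_norm x0).
      move=> k /= /andP[k0]; rewrite lt_min => /andP[kd kT].
      have tkT : 0 <= t + k <= T by apply/andP; split; lra.
      rewrite (Efin _ P tkT DP) (Efin _ P tT' DP) -EFinB -EFinM lee_fin leNgt.
      by apply/negP => /ltW lt_k; apply: nex; exists k.
    by move=> /le_trans/(_ h); rewrite lee_fin => ?; lra.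
  - move=> t P Xi tT DP FXi; have gr : graphF T D F (t, P, Xi) by split; [exact: itvT|split].
    by have [_ _] := E4b t P Xi gr; rewrite (Gfin P DP) -EFinM lee_fin.
  - move=> t Pn P Xin Xi cE cP tT DF DP PnP wX ecE PcP.
    have lim : E t (Pn n) @[n --> \oo] --> cE%:E.
      apply: (cvg_ext (f := fun n => (e t (Pn n))%:E)).
        by move=> n; rewrite (Efin t _ tT (DF n).1).
      by apply/fine_cvgP; split; first exact: nearW.
    have [h1 h2 h3] := E5 t (itvT _ tT) Pn P Xin Xi cE cP DF PnP wX lim PcP.
    by split => //; rewrite /e -h3.
  - by move=> P DP; have [] := Psi1 P DP.
  - by move=> P DP; have [] := Psi1 P DP.
  - by move=> P DP; have [] := Psi1 P DP.
  - by move=> P V DP; exact: HPsi_ge0.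
  - move=> S M; have [h _] := Psi2 _ (maxS S); have [r0 r0P] := h M.
    (* From radius [r0] on, (Psi2) gives the growth; below it this constant dominates [M |V|]. *)
    exists (`|M| * `|r0|) => // P V DP gS; have [rV|Vr] := leP r0 `|V|.
      have h1 : (ereal_inf [set (Psi P V)%:E | P in [set P | (Ginf T E P <= (Num.max 1 S)%:E)%E]]
          <= (Psi P V)%:E)%E by apply: ereal_inf_lbound; exists P => //; exact: Ginf_le.
      have := le_trans (r0P V rV) h1; rewrite lee_fin => h2.
      by apply: (le_trans h2); rewrite lerDl mulr_ge0.
    apply: (le_trans (ler_norm _)); rewrite normrM normr_id.
    have h1 : `|M| * `|V| <= `|M| * `|r0|.
      by apply: ler_wpM2l => //; apply: (le_trans (ltW Vr)); exact: ler_norm.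
    by apply: (le_trans h1); rewrite lerDr HPsi_ge0.
  - move=> S M; have [_ h] := Psi2 _ (maxS S); have [r0 r0P] := h M.
    exists (`|M| * `|r0|) => // P Xi c DP gS dXi fc; have [_ _ Ps0] := Psi1 P DP.
    have c0 : 0 <= c by rewrite -lee_fin (le_trans _ fc)//; exact: fconj_ge0.
    have [rV|Vr] := leP r0 (dnorm Xi).
      have h1 : (ereal_inf [set fconj (Psi P) Xi | P in [set P | (Ginf T E P <= (Num.max 1 S)%:E)%E]]
          <= fconj (Psi P) Xi)%E by apply: ereal_inf_lbound; exists P => //; exact: Ginf_le.
      have := le_trans (le_trans (r0P Xi dXi rV) h1) fc; rewrite lee_fin => h2.
      by apply: (le_trans h2); rewrite lerDl mulr_ge0.
    have n0 := dual_norm_ge0 dXi.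
    apply: (le_trans (ler_norm _)); rewrite normrM (ger0_norm n0).
    have h1 : `|M| * dnorm Xi <= `|M| * `|r0|.
      by apply: ler_wpM2l => //; apply: (le_trans (ltW Vr)); exact: ler_norm.
    by apply: (le_trans h1); rewrite lerDr.
  - move=> S c Pn P Vn V PnP DPn wV h.
    (* (Psi3) treats vectors and covectors together: the covectors are taken to be zero here, the
       vectors in the next clause. *)
    have [h1 _] := Psi3 _ (maxS S) Pn P Vn V (fun=> fun=> 0) (fun=> 0) PnP
      (fun n => Ginf_le _ S (DPn n).1 (DPn n).2) wV (weak_cvg_dual_cst is_dual0).
    rewrite -lee_fin; apply: (le_trans h1); apply: limn_einf_le => m.
    by exists m => //; rewrite lee_fin.
  - move=> S c Pn P Xin Xi PnP DPn wX h.
    have w0 : weak_cvg (fun _ : nat => 0 : X) 0 by move=> xi _; exact: cvg_cst.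
    have [_ h1] := Psi3 _ (maxS S) Pn P (fun=> 0) 0 Xin Xi PnP
      (fun n => Ginf_le _ S (DPn n).1 (DPn n).2) w0 wX.
    by apply: (le_trans h1); apply: limn_einf_le => m; exists m.
  - by move=> P V Xi1 Xi2 DP; exact: Psi4.
move=> P0 DP0.
have [B [rt [P [L [W [b LC]]]]]] := limit_curve_exists Xsep Xrefl G DP0.
have [y [dy y_dense]] := dual_separable Xsep Xrefl.
have [Xi [J [N [N0 dXi mJ XiJ XiF]]]] := force_selection Xsep Xrefl G E0_graph E4_meas LC dy y_dense.
have mcP := @completed_lebesgue_completes R.
have [PP0 LL0 WW0] := limit_init LC.
have W_nd := limit_W LC.
have rt0 := limit_rt LC.
have I0T : `[0, T]%classic = [set r : R | 0 <= r <= T] by apply/seteqP; split => r /=; rewrite in_itv.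
exists P; split => //.
  exact: (abs_cont_modulus (ltW T_gt0) W_nd (curve_modulus LC)).
exists (fun t => L t - W t), Xi; split; [|split; [|split; [|split; [|split; [|split; [|split; [|split]]]]]]].
- have -> : (fun t => L t - W t) = (fun t => rt * t) \+ (\- (fun t => rt * t - L t + W t)).
    by apply/funext => t /=; ring.
  apply: bounded_variationD => //.
    apply: nondecreasing_bounded_variation => x z _ _ xz; exact: ler_wpM2l.
  apply: bounded_variationN; apply: nondecreasing_bounded_variation => x z.
  rewrite !in_itv /= => /andP[x0 _] /andP[_ zT] xz.
  by have := limit_L LC x0 xz zT; have := W_nd _ _ xz; rewrite mulrBr; lra.
- move=> t; rewrite /= in_itv /= => tT; have [DP _ h] := limit_energy LC tT.
  by rewrite (Efin t _ tT DP) lee_fin.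
- by rewrite PP0 LL0 WW0 subr0 (Efin 0 P0 T00 DP0).
- have h : {ae (@lebesgue_measure R), forall r, `]0, T[%classic r -> (L r - W r)%:E = E r (P r)}.
    apply: aeS2 (limit_b_fin G LC) (limit_ae LC) => r hb hl; rewrite /= in_itv /= => rT.
    have rT' : 0 <= r <= T by have /andP[? ?] := rT; rewrite !ltW.
    have [_ _ _ hf] := hl rT; have [-> _] := hf _ (hb rT').
    by have [DP _ _] := limit_energy LC rT'; rewrite (Efin r _ rT' DP).
  exact: (ae_completion mcP h).
- split; first by move=> r _; exact: dXi.
  split; last by apply: (force_norm_integrable Xrefl G E4_meas LC mcP dy y_dense N0 dXi mJ XiJ XiF (lexx 0) (ltW T_gt0) (lexx T)).
  exists (fun n r => y (closest y Xi n r)); split; last first.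
    by apply: aeW => r _; exact: (closest_cvg dy y_dense dXi).
  move=> n; split; [by move=> r; exact: dy|split].
    apply: (@sub_finite_set _ _ (y @` [set j | (j <= n)%N])).
      by move=> _ [r _ <-]; exists (closest y Xi n r) => //=; exact: closest_le.
    by apply: finite_image; apply: (@sub_finite_set _ _ `I_n.+1) => // j /=; rewrite ltnS.
  move=> z; apply: measurableI.
    exact: measurable_itv.
  have mz : measurable (\bigcup_(j in [set j | y j = z]) [set r : R | closest y Xi n r = j]).
    by apply: bigcup_measurable => j _; exact: (measurable_closest dy dXi mJ XiJ).
  move: mz; congr measurable.
  by apply/seteqP; split => r /=; [move=> [j <- <-]|exists (closest y Xi n r)].
- have h := ae_not_negl mcP N0; apply: aeS h => r nN; rewrite /= in_itv /= => /andP[r0 rT].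
  by have [] := XiF r (ltac:(by rewrite !ltW)) nN.
- exact: (dissipation_integrable Xsep Xrefl G E4_meas LC mcP dy y_dense N0 dXi mJ XiJ XiF (lexx 0) (ltW T_gt0) (lexx T)).
- exact: (power_integrable Xrefl G E4_meas LC mcP dy y_dense N0 dXi mJ XiJ XiF (lexx 0) (ltW T_gt0) (lexx T)).
- move=> s t s0 st tT.
  exact: (energy_dissipation_inequality Xsep Xrefl G E4_meas LC mcP dy y_dense N0 dXi mJ XiJ XiF s0 st tT).
Qed.
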